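(* Let $\rho_0\in L^\infty(\mathbb R_+,\mathbb R_+)\cap L^1(\mathbb R_+,\mathbb R_+)$ with $0<R(\rho_0)<\infty$, and let $\bar\rho(\cdot,t)$, $t\ge0$, be the generalized solution with initial datum $\rho_0$. Then $\bar\rho(\cdot,t)$ is equal to the separating element $S_t(\rho_0)$ for all $t>0$. Moreover there is $a_2<\infty$ (depending on $\rho_0$) such that $$R(\bar\rho(\cdot,t))<a_2\qquad\text{for all }t\ge0,$$ and if $\rho_0$ is strictly positive in a neighborhood of the origin then there exists $a_1>0$ such that $$R(\bar\rho(\cdot,t))>a_1\qquad\text{for all }t\ge0.$$
   Context: Fix a parameter $j>0$; $\mathbb R_+=[0,\infty)$. Quasi-solutions. Let $\rho_0$ be as in the claim, $T>0$, $\epsilon>0$. A triple $(X_t,u(\cdot,t),\epsilon)$, $t\in[0,T)$, is a quasi-solution in $[0,T)$ with initial datum $\rho_0$ and accuracy parameter $\epsilon$ if: (1) $X_t$ is strictly positive, Lipschitz continuous and piecewise $C^1$ in $t$ (finitely many discontinuities of the derivative); (2) $u(r,t)\ge0$, $t\in[0,T)$, $r\in[0,X_t]$, is such that for each $t\in[0,T)$, $u(\cdot,t)\in C^2((0,X_t),\mathbb R_+)$ has limits together with its derivatives at $0$ and $X_t$, and for each $r\in[0,X_t]$, $u(r,t)$ is differentiable in $t$; (3) for all $t\in(0,T)$: $\frac{\partial u}{\partial t}=\frac12\frac{\partial^2u}{\partial r^2}$ for $r\in(0,X_t)$, $\frac{\partial u}{\partial r}(0,t)=-2j$, $u(X_t,t)=0$;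 (4) $\int|u(r,0)-\rho_0(r)|\,dr\le\epsilon$; (5) $\sup_{0\le t<T}|\int_0^{X_t}u(r,t)\,dr-\int_0^{X_0}u(r,0)\,dr|\le\epsilon$. Functions $u(\cdot,t)$ are extended by $0$ to $r>X_t$. A sequence of quasi-solutions $(X^{(n)}_t,\rho^{(n)}(\cdot,t),\epsilon_n)$ in $[0,T)$ with initial datum $\rho_0$ is optimal if $\epsilon_n\to0$. Generalized solution. $\rho(r,t)$, $r\in\mathbb R_+$, $t\in[0,T)$, is a generalized solution in $[0,T)$ with initial datum $\rho_0$ if there is an optimal sequence of quasi-solutions in $[0,T)$ with initial datum $\rho_0$ such that $\rho^{(n)}(\cdot,t)\to\rho(\cdot,t)$ weakly (as measures $\rho^{(n)}(r,t)\,dr$ on $\mathbb R_+$) for all $t\in[0,T)$. ''The generalized solution'' $\bar\rho(r,t)$, $r,t\in\mathbb R_+$, is the function whose restriction to $[0,T)$ is, for every $T>0$, the unique generalized solution in $[0,T)$ with initial datum $\rho_0$ (equality of functions of $r$ being understood a.e.). Measures and order. $\mathcal U$ is the space of positive Borel measures on $\mathbb R_+$ of the form $u=c_uD_0+\rho_u\,dr$, $c_u\ge0$, $D_0$ the Dirac delta at $0$, $\rho_u\in L^\infty(\mathbb R_+,\mathbb R_+)\cap L^1(\mathbb R_+,\mathbb R_+)$ (functions are identified with elements having $c_u=0$). $F(r;u)=c_u\mathbf 1_{\{0\}}(r)+\int_r^\infty\rho_u(r')\,dr'$; $R(u):=\inf\{r:F(r;u)=0\}$; $\mathcal U_\delta:=\{u\in\mathcal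 U:F(0;\rho_u)>j\delta\}$. Barriers. $K^{(\delta)}:\mathcal U_\delta\to\mathcal U$, $K^{(\delta)}u=j\delta D_0+\mathbf 1_{[0,R_\delta(u)]}u$, $R_\delta(u):=\inf\{r:F(r;u)=j\delta\}$. $G_t^{\rm neum}(r,r')=G_t(r,r')+G_t(r,-r')$, $G_t(r,r')=\frac{e^{-(r-r')^2/(2t)}}{\sqrt{2\pi t}}$, $G_t^{\rm neum}*u(r)=\int_{\mathbb R_+}G_t^{\rm neum}(r,r')\,u(dr')$. For $u\in L^\infty\cap L^1$ nonnegative and $\delta>0$ with $j\delta<F(0;u)$: $S_0^{(\delta,\pm)}(u)=u$ and, for $k\ge1$, $S^{(\delta,-)}_{k\delta}(u)=K^{(\delta)}(G_\delta^{\rm neum}*S^{(\delta,-)}_{(k-1)\delta}(u))$, $S^{(\delta,+)}_{k\delta}(u)=G_\delta^{\rm neum}*(K^{(\delta)}S^{(\delta,+)}_{(k-1)\delta}(u))$. Separating element. $S_t(\rho_0)(r)$ is the unique function, continuous in $(r,t)$ for $t>0$, such that for all $t>0$, $r\in\mathbb R_+$: $F(r;S_t(\rho_0))=\lim_{\ell\to\infty}F(r;S_t^{(2^{-\ell}t,\pm)}(\rho_0))$ and $F(r;S_t(\rho_0))=\inf_{\delta}F(r;S_t^{(\delta,+)}(\rho_0))=\sup_\delta F(r;S_t^{(\delta,-)}(\rho_0))$, the infimum and supremum being over $\delta>0$ with $t=k\delta$ for some $k\in\mathbb N$ and $j\delta<F(0;\rho_0)$. *)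

(* Defs.v *)
From HB Require Import structures.
From mathcomp Require Import all_boot all_order all_algebra.
From mathcomp Require Import all_classical all_reals all_analysis.

Set Implicit Arguments.
Unset Strict Implicit.
Unset Printing Implicit Defensive.

Import Order.TTheory GRing.Theory Num.Theory.
Import numFieldNormedType.Exports.

Local Open Scope ring_scope.
Local Open Scope classical_set_scope.

(* Space-time functions take the time first: u t r is the value written u(r, t)
   in the usual notation, so that u t is the profile at time t. Functions on
   R_+ are represented by functions on R whose values at negative arguments
   are never used. *)

Definition halfline (R : realType) : set R := `[0, +oo[%classic.
Arguments halfline R : clear implicits.

(* An element of L^oo(R_+, R_+) `&` L^1(R_+, R_+); as usual for such classes,
   the pointwise conditions are only required almost everywhere. *)
Definition Linfty_L1_nonneg (R : realType) (f : R -> R) : Prop :=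
  (@lebesgue_measure R).-integrable (halfline R) (EFin \o f) /\
  exists M : R, {ae (@lebesgue_measure R), forall r : R, 0 <= r -> 0 <= f r <= M}.

Definition eq_ae_halfline (R : realType) (f g : R -> R) : Prop :=
  {ae @lebesgue_measure R, forall r : R, 0 <= r -> f r = g r}.

Definition pos_near_origin (R : realType) (f : R -> R) : Prop :=
  exists2 e : R, 0 < e &
    {ae (@lebesgue_measure R), forall r : R, 0 <= r <= e -> 0 < f r}.

(* The measure c D_0 + rho dr on R_+, given by its atom c at the origin and its
   density rho. *)
Record U (R : realType) := mkU { atom : R ; dens : R -> R }.

Definition of_fun (R : realType) (f : R -> R) : U R := mkU 0 f.

(* Extended-real valued, so that F r u is finite only if the density of u is
   integrable on [r, +oo). *)
Definition F (R : realType) (r : R) (u : U R) : \bar R :=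
  ((if r == 0 then atom u else 0)%:E +
   \int[@lebesgue_measure R]_(x in `[r, +oo[) (dens u x)%:E)%E.

(* inf {r >= 0 | F r u = a}, equal to +oo if there is no such r. *)
Definition level_inf (R : realType) (a : \bar R) (u : U R) : \bar R :=
  ereal_inf [set r%:E | r in [set r : R | 0 <= r /\ F r u = a]].

Definition edge (R : realType) (u : U R) : \bar R := level_inf 0%E u.

(* K^(delta); it is meaningful when F 0 (of_fun (dens u)) > j delta. The atom
   of u is kept since the origin always belongs to [0, R_delta u]. *)
Definition barrier_cut (R : realType) (j delta : R) (u : U R) : U R :=
  mkU (j * delta + atom u)
      (fun r => if (r%:E <= level_inf (j * delta)%:E u)%E
                then dens u r else 0).

Definition gauss (R : realType) (t r r' : R) : R :=
  expR (- (r - r') ^+ 2 / (2 * t)) / Num.sqrt (2 * pi * t).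

Definition gauss_neum (R : realType) (t r r' : R) : R :=
  gauss t r r' + gauss t r (- r').

(* G_t^neum * u: the integral of G_t^neum(r, .) against c D_0 + rho dr. *)
Definition heat_neum (R : realType) (t : R) (u : U R) : U R :=
  of_fun (fun r =>
    atom u * gauss_neum t r 0 +
    \int[@lebesgue_measure R]_(x in halfline R) (gauss_neum t r x * dens u x)).

(* S_minus j delta k u and S_plus j delta k u are S_(k delta)^(delta, -) u and
   S_(k delta)^(delta, +) u. *)
Definition S_minus (R : realType) (j delta : R) (k : nat) (u : R -> R) : U R :=
  iter k (fun v => barrier_cut j delta (heat_neum delta v)) (of_fun u).

Definition S_plus (R : realType) (j delta : R) (k : nat) (u : R -> R) : U R :=
  iter k (fun v => heat_neum delta (barrier_cut j delta v)) (of_fun u).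

Definition step_index (R : realType) (j : R) (rho0 : R -> R) (t : R) :
    set (R * nat) :=
  [set dk : R * nat | [/\ 0 < dk.1, t = dk.2%:R * dk.1 &
     ((j * dk.1)%:E < F 0 (of_fun rho0))%E]].

Definition separating_element (R : realType) (j : R) (rho0 : R -> R)
    (S : R -> R -> R) : Prop :=
  {within [set p : R * R | 0 < p.1 /\ 0 <= p.2],
     continuous (fun p : R * R => S p.1 p.2)} /\
  forall t r : R, 0 < t -> 0 <= r ->
    [/\ F r (S_minus j (t / 2 ^+ l) (2 ^ l)%N rho0) @[l --> \oo]
          --> F r (of_fun (S t)),
        F r (S_plus j (t / 2 ^+ l) (2 ^ l)%N rho0) @[l --> \oo]
          --> F r (of_fun (S t)),
        F r (of_fun (S t)) =
          ereal_inf [set F r (S_plus j dk.1 dk.2 rho0)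
                    | dk in step_index j rho0 t] &
        F r (of_fun (S t)) =
          ereal_sup [set F r (S_minus j dk.1 dk.2 rho0)
                    | dk in step_index j rho0 t]].

(* C^1 on [0, T) except at finitely many times, with a derivative that has
   finite one-sided limits everywhere in [0, T). *)
Definition piecewise_C1 (R : realType) (T : R) (X : R -> R) : Prop :=
  (exists2 D : set R, finite_set D & forall t : R, 0 < t < T -> ~ D t ->
     derivable X t 1 /\ {for t, continuous X^`()}) /\
  (forall t : R, 0 <= t < T -> exists l : R, X^`() s @[s --> t^'+] --> l) /\
  (forall t : R, 0 < t < T -> exists l : R, X^`() s @[s --> t^'-] --> l).

(* v is C^2 on (0, a), and v, v', v'' have finite limits at 0 and a; the limits
   of v are its values there. *)
Definition C2_with_limits (R : realType) (a : R) (v : R -> R) : Prop :=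
  [/\ forall r : R, 0 < r < a ->
        [/\ derivable v r 1, derivable v^`() r 1 & {for r, continuous v^`(2)}],
      v r @[r --> 0^'+] --> v 0,
      v r @[r --> a^'-] --> v a,
      forall k : nat, (k = 1 \/ k = 2)%N ->
        exists l : R, v^`(k) r @[r --> 0^'+] --> l &
      forall k : nat, (k = 1 \/ k = 2)%N ->
        exists l : R, v^`(k) r @[r --> a^'-] --> l].

(* s |-> u s r is differentiable at t relatively to its domain
   {s in [0, T) | r <= X s}; this is the usual differentiability if
   0 < t < T and r < X t, for X continuous. *)
Definition time_differentiable (R : realType) (T : R) (X : R -> R)
    (u : R -> R -> R) (t r : R) : Prop :=
  exists l : R,
    (u s r - u t r) / (s - t)
      @[s --> within [set s : R | 0 <= s < T /\ r <= X s] t^'] --> l.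

Definition ext0 (R : realType) (X : R -> R) (u : R -> R -> R) (t r : R) : R :=
  if r <= X t then u t r else 0.

Record quasi_solution (R : realType) (j T : R) (rho0 : R -> R)
    (X : R -> R) (u : R -> R -> R) (eps : R) : Prop := QuasiSolution {
  qs_eps_gt0 : 0 < eps ;
  qs_edge_gt0 : forall t : R, 0 <= t < T -> 0 < X t ;
  qs_edge_lipschitz : exists k : R, k.-lipschitz_`[0, T[ X ;
  qs_edge_C1 : piecewise_C1 T X ;
  qs_ge0 : forall t r : R, 0 <= t < T -> 0 <= r <= X t -> 0 <= u t r ;
  qs_C2 : forall t : R, 0 <= t < T -> C2_with_limits (X t) (u t) ;
  qs_time : forall t r : R, 0 <= t < T -> 0 <= r <= X t ->
    time_differentiable T X u t r ;
  qs_heat : forall t r : R, 0 < t < T -> 0 < r < X t ->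
    is_derive t 1 (fun s => u s r) (2^-1 * ((u t)^`(2))%classic r) ;
  qs_neumann : forall t : R, 0 < t < T ->
    (u t)^`() r @[r --> 0^'+] --> - (2 * j) ;
  qs_dirichlet : forall t : R, 0 < t < T -> u t (X t) = 0 ;
  qs_initial :
    (\int[@lebesgue_measure R]_(r in halfline R)
       `|ext0 X u 0 r - rho0 r|%:E <= eps%:E)%E ;
  qs_mass : forall t : R, 0 <= t < T ->
    `|\int[@lebesgue_measure R]_(r in `[0, X t]) u t r -
      \int[@lebesgue_measure R]_(r in `[0, X 0]) u 0 r| <= eps }.

Definition optimal_sequence (R : realType) (j T : R) (rho0 : R -> R)
    (X : nat -> R -> R) (u : nat -> R -> R -> R) (eps : nat -> R) : Prop :=
  (forall n, quasi_solution j T rho0 (X n) (u n) (eps n)) /\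
  eps n @[n --> \oo] --> (0 : R).

(* Weak convergence of the measures f_n dr to f dr on R_+. *)
Definition weak_cvg (R : realType) (f : nat -> R -> R) (g : R -> R) : Prop :=
  forall phi : R -> R,
    {within halfline R, continuous phi} ->
    (exists M : R, forall r : R, 0 <= r -> `|phi r| <= M) ->
    \int[@lebesgue_measure R]_(r in halfline R) (phi r * f n r) @[n --> \oo]
      --> \int[@lebesgue_measure R]_(r in halfline R) (phi r * g r).

Definition generalized_solution (R : realType) (j T : R) (rho0 : R -> R)
    (rho : R -> R -> R) : Prop :=
  (forall t : R, 0 <= t < T ->
     (@lebesgue_measure R).-integrable (halfline R) (EFin \o rho t)) /\
  exists (X : nat -> R -> R) (u : nat -> R -> R -> R) (eps : nat -> R),
    optimal_sequence j T rho0 X u eps /\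
    forall t : R, 0 <= t < T -> weak_cvg (fun n => ext0 (X n) (u n) t) (rho t).

Definition the_generalized_solution (R : realType) (j : R) (rho0 : R -> R)
    (rhobar : R -> R -> R) : Prop :=
  forall T : R, 0 < T ->
    generalized_solution j T rho0 rhobar /\
    forall rho : R -> R -> R, generalized_solution j T rho0 rho ->
      forall t : R, 0 <= t < T -> eq_ae_halfline (rho t) (rhobar t).

(* Main.v *)
Require Import Defs.
From HB Require Import structures.
From mathcomp Require Import all_boot all_order all_algebra.
From mathcomp Require Import all_classical all_reals all_analysis.
From mathcomp Require Import measurable_realfun ring lra.

Set Implicit Arguments.
Unset Strict Implicit.
Unset Printing Implicit Defensive.

Import Order.TTheory GRing.Theory Num.Theory.
Import numFieldNormedType.Exports.

Local Open Scope classical_set_scope.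
Local Open Scope ring_scope.

(* By uniqueness it suffices to exhibit, for every T, a single optimal sequence
   with a limit under control. On a short time interval u(r, s) = P_s f(r) - 2 j r
   solves the heat equation with the right flux at 0, where P_s is the heat
   semigroup of the whole line and f is an even function equal to 2 j |r| far
   away; total positivity of the Gaussian kernel shows that u(., s) has exactly
   one zero X_s, and that it is transversal. Changing f beyond X_0 does not affect
   the initial profile, and the intermediate value theorem yields a change for
   which the mass at the end of the interval is the initial one. The pieces are
   then glued; the mass grows at rate at most j, so it stays within j tau of its
   initial value if the intervals have length tau.

   Let Phi_s(r) be the integral of u(., s) over [r, X_s]. Maximum principles for
   P_s h - (P_s FF - j r^2), FF being a primitive of f, bound Phi_(s+d) by the
   barriers: it lies between (G Phi_s - j d)^+ and G (Phi_s - j d)^+ + j d th, up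
   to a multiple of the accuracy, where G is the reflected heat flow acting on
   tails and th is the tail of the heat flow of D_0. Iterating, Phi at time n d is
   trapped between F(.; S_(nd)^(d, -)) and the same plus j d. Hence the tails
   converge, to the limit of the lower barriers; the limit is Lipschitz, so it is
   the tail of a density by Radon-Nikodym, which is therefore the generalized
   solution. This identifies it with S_t. The edge bounds follow from comparison
   with the stationary profiles 2 j (a - r)^+, whose tails are j ((a - r)^+)^2. *)

(** * Expectations under the standard Gaussian *)

Section GaussianExpectation.
Context {R : realType}.
Implicit Types (f h : R -> R) (z x y : R).
Notation mu := (@lebesgue_measure R).

(** A quasi-solution has a free boundary, which must be Lipschitz and piecewise C^1 while the mass
    is almost conserved. Prescribing data beyond the edge makes the problem linear: the boundary is
    a transversal zero, its regularity is the implicit function theorem, and conservation becomes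
    one scalar equation for the depth A of a negative plateau. Tails are preferred to densities
    because a barrier cut becomes f -> (f - j d)^+ and because the primitive L of u solves L_t = L''
    / 2 + j with L = 0 at the origin and L' = 0 at the edge: the constant source j is the only trace
    of the flux. In the comparison with the barriers a loss of j d does not accumulate, since it has
    the form of a cut, which the next barrier step performs anyway. Only multiples of the accuracy
    add up with the number of steps, and the accuracy tends to 0 while d is still fixed. The
    semigroup is an expectation over one fixed Gaussian, so that pointwise bounds with error e + K
    (x - y)^2 can be averaged, up to and including time 0. *)

Definition gd z : R := normal_pdf 0 1 z.

Lemma gdE z : gd z = (Num.sqrt (2 * pi))^-1 * expR (- z ^+ 2 / 2).
Proof.
rewrite /gd normal_pdfE ?oner_neq0// /normal_peak /normal_fun; congr (_^-1 * expR _).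
  by rewrite expr1n mul1r -mulr_natl.
by rewrite subr0 expr1n.
Qed.

Lemma gd_ge0 z : 0 <= gd z. Proof. exact: normal_pdf_ge0. Qed.

Lemma gd_gt0 z : 0 < gd z.
Proof. by rewrite gdE mulr_gt0 ?expR_gt0// invr_gt0 sqrtr_gt0 mulr_gt0// pi_gt0. Qed.

Lemma gd_continuous : continuous gd.
Proof. by apply: continuous_normal_pdf; rewrite oner_neq0. Qed.

Lemma gdN z : gd (- z) = gd z.
Proof. by rewrite !gdE sqrrN. Qed.

Lemma gd_deriv z : is_derive z 1 gd (- (z * gd z)).
Proof.
have -> : gd = (fun z => (Num.sqrt (2 * pi))^-1 * expR (- z ^+ 2 / 2)).
  by apply/funext => y; rewrite gdE.
apply: is_derive_eq.
by rewrite /GRing.scale/= !mulr1; set a := expR _; set b := _^-1; field.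
Qed.

(** The working class of integrands: continuity settles measurability, and bounding by powers of
    [1 + x ^+ 2], which is at least 1, lets bounds of different degrees be compared and added. *)
Definition tame h := continuous h /\
  exists (C : R) (k : nat), 0 <= C /\ forall x, `|h x| <= C * (1 + x ^+ 2) ^+ k.

Lemma one_le_sqr x : 1 <= 1 + x ^+ 2.
Proof. by rewrite lerDl sqr_ge0. Qed.

(** With y = x^2 / (4 (k+1)) one has 1 + x^2 <= 4 (k+1) (1 + y) <= 4 (k+1) exp y; the power k+1
    restores the exponent x^2 / 4. *)
Lemma pow_le_expR k x : (1 + x ^+ 2) ^+ k.+1 <= (4 * k.+1%:R) ^+ k.+1 * expR (x ^+ 2 / 4).
Proof.
have k0 : 0 < 4 * k.+1%:R :> R by rewrite mulr_gt0.
have -> : x ^+ 2 / 4 = (x ^+ 2 / (4 * k.+1%:R)) *+ k.+1.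
  rewrite -[in RHS]mulr_natl invfM.
  by rewrite [RHS]mulrC -!mulrA mulVf ?pnatr_eq0// mulr1.
rewrite -[X in expR X]mulr_natl expRM_natl -exprMn lerXn2r ?nnegrE//; first by rewrite (le_trans ler01)// one_le_sqr.
have h1 := expR_ge1Dx (x ^+ 2 / (4 * k.+1%:R)).
apply: (@le_trans _ _ ((4 * k.+1%:R) * (1 + x ^+ 2 / (4 * k.+1%:R)))); last by rewrite ler_pM2l.
rewrite mulrDr mulr1 mulrCA divff ?gt_eqF// mulr1 lerD2r.
by rewrite -natrM ler1n.
Qed.

(** Half of the Gaussian exponent pays for the polynomial; what is left is, up to a constant, the
    normal density of variance 2, which is integrable. *)
Lemma gd_pow_bound k : exists K : R, 0 <= K /\
  forall x, gd x * (1 + x ^+ 2) ^+ k <= K * normal_pdf 0 (Num.sqrt 2) x.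
Proof.
have s2 : Num.sqrt 2 != 0 :> R by rewrite gt_eqF// sqrtr_gt0.
have pE x : normal_pdf 0 (Num.sqrt 2) x = normal_peak (Num.sqrt 2) * expR (- x ^+ 2 / 4).
  rewrite normal_pdfE// /normal_fun subr0 sqr_sqrtr//; congr (_ * expR (_ / _)).
  by rewrite -mulr_natl -natrM.
have pk : 0 < normal_peak (Num.sqrt 2 : R) by exact: normal_peak_gt0.
pose c : R := (Num.sqrt (2 * pi))^-1.
have c0 : 0 <= c by rewrite invr_ge0 sqrtr_ge0.
exists (c * (4 * k.+1%:R) ^+ k.+1 / normal_peak (Num.sqrt 2)); split.
  by rewrite divr_ge0 ?mulr_ge0 ?exprn_ge0// ltW.
move=> x; rewrite pE gdE -/c.
rewrite [leRHS](_ : _ = c * ((4 * k.+1%:R) ^+ k.+1 * expR (- x ^+ 2 / 4))); last first.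
  by rewrite -!mulrA; congr (_ * (_ * _)); rewrite mulrA mulVf ?mul1r// gt_eqF.
rewrite -mulrA ler_wpM2l//.
apply: (@le_trans _ _ (expR (- x ^+ 2 / 2) * (1 + x ^+ 2) ^+ k.+1)).
  by rewrite ler_wpM2l ?expR_ge0// ler_weXn2l ?one_le_sqr.
apply: (@le_trans _ _ (expR (- x ^+ 2 / 2) * ((4 * k.+1%:R) ^+ k.+1 * expR (x ^+ 2 / 4)))).
  by rewrite ler_wpM2l ?expR_ge0// pow_le_expR.
by rewrite mulrCA -expRD (_ : - x ^+ 2 / 2 + x ^+ 2 / 4 = - x ^+ 2 / 4)//; field.
Qed.

Lemma gdM_continuous h : continuous h -> continuous (fun z => gd z * h z).
Proof. by move=> ch z; apply: continuousM; [exact: gd_continuous|exact: ch]. Qed.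

Lemma tame_integrable h : tame h -> mu.-integrable setT (EFin \o (fun z => gd z * h z)).
Proof.
move=> [ch [C [k [C0 hC]]]]; have [K [K0 hK]] := gd_pow_bound k.
apply: (@le_integrable _ _ _ mu setT _ _ (fun x => (C * K)%:E * (normal_pdf 0 (Num.sqrt 2) x)%:E)%E) => //.
- apply/measurable_EFinP; apply: continuous_measurable_fun; exact: gdM_continuous.
- move=> x _ /=; rewrite lee_fin normrM (ger0_norm (gd_ge0 x)).
  rewrite [X in _ <= X]ger0_norm; last by rewrite mulr_ge0 ?normal_pdf_ge0// mulr_ge0.
  apply: (@le_trans _ _ (gd x * (C * (1 + x ^+ 2) ^+ k))).
    by rewrite ler_wpM2l ?gd_ge0.
  by rewrite mulrCA -mulrA ler_wpM2l.
- by apply: integrableZl => //; exact: integrable_normal_pdf.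
Qed.

Definition E h : R := \int[mu]_z (gd z * h z).

Lemma tameD f h : tame f -> tame h -> tame (fun x => f x + h x).
Proof.
move=> [cf [C [k [C0 hC]]]] [ch [D [l [D0 hD]]]]; split.
  by move=> x; apply: continuousD; [exact: cf|exact: ch].
exists (C + D), (k + l)%N; split; first exact: addr_ge0.
move=> x; apply: (le_trans (ler_normD _ _)); rewrite mulrDl lerD//.
  by apply: (le_trans (hC x)); rewrite ler_wpM2l// ler_weXn2l ?one_le_sqr// leq_addr.
by apply: (le_trans (hD x)); rewrite ler_wpM2l// ler_weXn2l ?one_le_sqr// leq_addl.
Qed.

Lemma tameM f h : tame f -> tame h -> tame (fun x => f x * h x).
Proof.
move=> [cf [C [k [C0 hC]]]] [ch [D [l [D0 hD]]]]; split.
  by move=> x; apply: continuousM; [exact: cf|exact: ch].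
exists (C * D), (k + l)%N; split; first exact: mulr_ge0.
move=> x; rewrite normrM exprD mulrACA ler_pM//.
Qed.

Lemma tame_cst (c : R) : tame (fun=> c).
Proof.
split; first by move=> x; exact: cvg_cst.
by exists `|c|, 0; split => // x; rewrite expr0 mulr1.
Qed.

Lemma tame_id : tame (fun x => x).
Proof.
split; first by move=> x.
exists 1, 1%N; split => // x; rewrite expr1 mul1r.
have := sqr_ge0 (`|x| - 1); rewrite sqrrB expr1n mulr1 real_normK ?num_real//.
by have := sqr_ge0 x; lra.
Qed.

Lemma tameZ (c : R) f : tame f -> tame (fun x => c * f x).
Proof. by move=> tf; exact: tameM (tame_cst c) tf. Qed.

Lemma tameB f h : tame f -> tame h -> tame (fun x => f x - h x).
Proof.
move=> tf th; have -> : (fun x => f x - h x) = (fun x => f x + -1 * h x).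
  by apply/funext => x; rewrite mulN1r.
exact: tameD tf (tameZ _ th).
Qed.

Lemma tame_norm f : tame f -> tame (fun x => `|f x|).
Proof.
move=> [cf [C [k [C0 hC]]]]; split; last by exists C, k; split => // x; rewrite normr_id.
by move=> x; apply: continuous_comp; [exact: cf|exact: norm_continuous].
Qed.

Lemma tameX f n : tame f -> tame (fun x => f x ^+ n).
Proof.
move=> tf; elim: n => [|n ih]; first by under eq_fun do rewrite expr0; exact: tame_cst.
by under eq_fun do rewrite exprS; exact: tameM.
Qed.

Lemma tame_affine f (a b : R) : tame f -> tame (fun z => f (a + b * z)).
Proof.
move=> [cf [C [k [C0 hC]]]]; split.
  move=> x; apply: (@continuous_comp _ _ _ (fun z => a + b * z) f); last exact: cf.
  apply: continuousD; first exact: cvg_cst.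
  by apply: continuousM; [exact: cvg_cst|exact: cvg_id].
pose D := 1 + 2 * a ^+ 2 + 2 * b ^+ 2.
have D0 : 0 <= D by rewrite /D; have := sqr_ge0 a; have := sqr_ge0 b; lra.
exists (C * D ^+ k), k; split; first by rewrite mulr_ge0 ?exprn_ge0.
move=> x; apply: (le_trans (hC _)); rewrite -mulrA ler_wpM2l// -exprMn lerXn2r ?nnegrE//.
- by have := sqr_ge0 (a + b * x); lra.
- by rewrite mulr_ge0//; have := sqr_ge0 x; lra.
have h1 : (a + b * x) ^+ 2 <= 2 * a ^+ 2 + 2 * (b * x) ^+ 2.
  by have := sqr_ge0 (a - b * x); rewrite !sqrrD; lra.
rewrite exprMn in h1; rewrite /D.
have := mulr_ge0 (sqr_ge0 a) (sqr_ge0 x); have := sqr_ge0 x; have := sqr_ge0 b; nra.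
Qed.

Lemma eq_E f h : f =1 h -> E f = E h.
Proof. by move=> fh; congr E; exact/funext. Qed.

Lemma ED f h : tame f -> tame h -> E (fun x => f x + h x) = E f + E h.
Proof.
move=> tf th; rewrite /E -RintegralD//; try exact: tame_integrable.
by apply: eq_Rintegral => z _; rewrite mulrDr.
Qed.

Lemma EZ (c : R) f : tame f -> E (fun x => c * f x) = c * E f.
Proof.
move=> tf; rewrite /E -RintegralZl//; last exact: tame_integrable.
by apply: eq_Rintegral => z _; rewrite mulrCA.
Qed.

Lemma EB f h : tame f -> tame h -> E (fun x => f x - h x) = E f - E h.
Proof.
move=> tf th; rewrite /E -RintegralB//; try exact: tame_integrable.
by apply: eq_Rintegral => z _; rewrite mulrBr.
Qed.

Lemma E_cst (c : R) : E (fun=> c) = c.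
Proof.
rewrite (@eq_E _ (fun=> c * 1)); last by move=> x; rewrite mulr1.
rewrite (@EZ c (fun=> 1)); last exact: tame_cst.
have -> : E (fun=> 1) = 1; last by rewrite mulr1.
rewrite /E /Rintegral; under eq_integral do rewrite mulr1.
by rewrite integral_normal_pdf.
Qed.

Lemma E_le f h : tame f -> tame h -> (forall x, f x <= h x) -> E f <= E h.
Proof.
move=> tf th fh; apply: le_Rintegral => //; try exact: tame_integrable.
by move=> x _; rewrite ler_wpM2l ?gd_ge0.
Qed.

Lemma E_ge0 f : tame f -> (forall x, 0 <= f x) -> 0 <= E f.
Proof. by move=> tf f0; rewrite -(E_cst 0); apply: E_le => //; exact: tame_cst. Qed.

Lemma E_norm f : tame f -> `|E f| <= E (fun x => `|f x|).
Proof.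
move=> tf; rewrite ler_norml; apply/andP; split.
  rewrite -mulN1r -EZ; last exact: tame_norm.
  apply: E_le => //; first exact/tameZ/tame_norm.
  by move=> x; rewrite mulN1r lerNnormlW.
by apply: E_le => //; [exact: tame_norm|move=> x; exact: ler_norm].
Qed.

Lemma E_normB f h : tame f -> tame h -> `|E f - E h| <= E (fun x => `|f x - h x|).
Proof. by move=> tf th; rewrite -EB//; apply: E_norm; exact: tameB. Qed.

Lemma gd_tame_bound h : tame h -> exists2 C : R, 0 <= C & forall x, `|gd x * h x| <= C / (1 + x ^+ 2).
Proof.
move=> [ch [C [k [C0 hC]]]]; have [K [K0 hK]] := gd_pow_bound k.+1.
exists (C * (K * normal_peak (Num.sqrt 2))).
  by rewrite mulr_ge0// mulr_ge0// normal_peak_ge0.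
move=> x; have x1 : 0 < 1 + x ^+ 2 by rewrite (lt_le_trans ltr01)// one_le_sqr.
rewrite ler_pdivlMr// normrM (ger0_norm (gd_ge0 x)) -mulrA.
apply: (@le_trans _ _ (gd x * (C * (1 + x ^+ 2) ^+ k * (1 + x ^+ 2)))).
  by rewrite ler_wpM2l ?gd_ge0// ler_wpM2r// ltW.
rewrite -mulrA mulrCA -exprSr ler_wpM2l//.
apply: (le_trans (hK x)); rewrite ler_wpM2l// normal_pdf_ub// gt_eqF// sqrtr_gt0//.
Qed.

Lemma cvg_integral_symitv (g : R -> R) : mu.-integrable setT (EFin \o g) ->
  \int[mu]_(x in `[- (n%:R : R), n%:R]) g x @[n --> \oo] --> \int[mu]_x g x.
Proof.
move=> ig; rewrite /Rintegral; apply: fine_cvg.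
rewrite fineK; last exact: integrable_fin_num.
under eq_cvg do rewrite integral_mkcond.
have mg : measurable_fun setT (EFin \o g) by have /integrableP[] := ig.
apply: (@dominated_cvg _ _ _ mu setT measurableT _ (EFin \o g) (fun x => `|(g x)%:E|%E)) => //.
- move=> n; have := @measurable_restrictT _ _ _ _ `[- (n%:R : R), n%:R]%classic (EFin \o g); move=> [] // + _.
  by apply; exact: measurable_funTS.
- move=> x _; apply: cvg_near_cst.
  exists (Num.truncn `|x|).+1 => // n /= hn.
  rewrite patchE ifT// inE /= in_itv/= -ler_norml.
  rewrite ltW// (lt_le_trans (truncnS_gt _))// ler_nat//.
- exact: integrable_abse.
- move=> n x _; rewrite patchE; case: ifPn => // _.
  by rewrite abse0 abse_ge0.
Qed.

(** Integration by parts: (gd h)' = gd (h' - z h), and the boundary terms vanish because gd h decays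
    like 1 / (1 + x^2). *)
Lemma Stein h h' : tame h -> tame h' -> (forall x, is_derive x 1 h (h' x)) ->
  E (fun z => z * h z) = E h'.
Proof.
move=> th th' dh; apply/eqP; rewrite -subr_eq0 -EB//; last exact: tameM tame_id th.
pose k z := h' z - z * h z.
have tk : tame k by apply: tameB => //; exact: tameM tame_id th.
suff : E k = 0.
  move=> Ek; rewrite -oppr_eq0 -mulN1r -EZ; last by apply: tameB => //; exact: tameM tame_id th.
  by rewrite (@eq_E _ k) ?Ek// => x; rewrite /k mulN1r opprB.
have c1 := cvg_integral_symitv (tame_integrable tk).
apply: (cvg_unique _ c1); first exact: Rhausdorff.
pose Fz z := gd z * h z.
have dF z : is_derive z 1 Fz (gd z * k z).
  have d1 := gd_deriv z; have d2 := dh z.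
  apply: is_derive_eq; rewrite /k /GRing.scale/=; ring.
have FTC n : (0 < n)%N -> \int[mu]_(x in `[- (n%:R : R), n%:R]) (gd x * k x) = Fz n%:R - Fz (- n%:R).
  move=> n0; rewrite /Rintegral (@continuous_FTC2 _ _ Fz)//.
  - by rewrite -subr_gt0 opprK addr_gt0 ?ltr0n.
  - by apply: continuous_subspaceT; apply: gdM_continuous; case: tk.
  - have cF : continuous Fz.
      by move=> x; apply: differentiable_continuous; apply/derivable1_diffP; have [] := dF x.
    split.
    + by move=> x _; have [] := dF x.
    + by apply: cvg_at_right_filter; exact: cF.
    + by apply: cvg_at_left_filter; exact: cF.
  - by move=> x _; rewrite derive1E; have [_ ->] := dF x.
have [C C0 hC] := gd_tame_bound th.
have cz : (C / (1 + n%:R ^+ 2) : R) @[n --> \oo] --> (0 : R).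
  rewrite -(mulr0 C); apply: cvgMr.
  apply/gtr0_cvgV0; first by near=> n; rewrite (lt_le_trans ltr01)// one_le_sqr.
  apply: (@ger_cvgy _ _ _ _ (fun n => n%:R)); last exact: cvgr_idn.
  near=> n; rewrite -natrX -(natrD _ 1%N) ler_nat.
  by rewrite expnS expn1 add1n ltnW// ltnS leq_pmulr//; near: n; exists 1%N.
apply/cvgrPdist_le => e e0.
near=> n.
rewrite FTC; last by near: n; exists 1%N.
rewrite sub0r normrN (le_trans (ler_normB _ _))//.
have h2 : C / (1 + n%:R ^+ 2) <= e / 2.
  near: n; have /cvgrPdist_le /(_ (e / 2)) := cz.
  move=> /(_ ltac:(by rewrite divr_gt0))[N _ HN]; exists N => // n /HN /=.
  by rewrite sub0r normrN => /(le_trans (ler_norm _)).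
have := hC n%:R; have := hC (- n%:R); rewrite sqrrN /Fz; lra.
Unshelve. all: by end_near.
Qed.

Lemma E_opp h : tame h -> E (fun z => h (- z)) = E h.
Proof.
(* The change of variables is made for nonnegative functions; a general [h] is the difference of
   [h + B] and a polynomial majorant [B]. *)
suff pos f : tame f -> (forall x, 0 <= f x) -> E (fun z => f (- z)) = E f.
  move=> th; have [ch [C [k [C0 hC]]]] := th.
  pose B x := C * (1 + x ^+ 2) ^+ k.
  have tB : tame B.
    apply: tameZ; apply: tameX; apply: tameD; first exact: tame_cst.
    exact: tameX tame_id.
  have tp : tame (fun x => h x + B x) by exact: tameD.
  have hp x : 0 <= h x + B x.
    have := hC x; rewrite /B ler_norml => /andP[+ _]; lra.
  have tN f : tame f -> tame (fun z => f (- z)).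
    move=> tf; have -> : (fun z => f (- z)) = (fun z => f (0 + -1 * z)).
      by apply/funext => z; rewrite add0r mulN1r.
    exact: tame_affine.
  have := pos _ tp hp; rewrite ED//; last first.
  - exact: tN tB.
  - exact: tN th.
  rewrite (@ED h B)//; rewrite (pos B)//; first by move=> /addIr.
  by move=> x; rewrite mulr_ge0// exprn_ge0// (le_trans ler01)// one_le_sqr.
move=> tf f0; have [cf _] := tf.
have cg : continuous (fun z => gd z * f z) by exact: gdM_continuous.
have cg' : continuous (fun z => gd z * f (- z)).
  apply: gdM_continuous => x; apply: continuous_comp; [exact: opp_continuous|exact: cf].
have g0 x : 0 <= gd x * f x by rewrite mulr_ge0 ?gd_ge0.
have half (g : R -> R) : continuous g -> (forall x, 0 <= g x) ->
    (\int[mu]_x (g x)%:E = \int[mu]_(x in `[0%R, +oo[) (g x)%:E + \int[mu]_(x in `[0%R, +oo[) (g (- x))%:E)%E.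
  move=> cgg gg0.
  have -> : [set: R] = `]-oo, 0[%classic `|` `[0, +oo[%classic.
    by apply/seteqP; split => x //= _; rewrite !in_itv/= andbT; case: (ltP x 0); [left|right].
  have mge (D : set R) : measurable_fun D (EFin \o g).
    by apply/measurable_EFinP/measurable_funTS; exact: continuous_measurable_fun.
  rewrite ge0_integral_setU//=; first last.
  - apply/disj_setPS => x /= []; rewrite !in_itv/= andbT => a b.
    by move: (lt_le_trans a b); rewrite ltxx.
  - by move=> x _; rewrite lee_fin.
  - exact: mge.
  rewrite addeC; congr (_ + _)%E.
  have := @ge0_integration_by_substitutionNy R g 0.
  rewrite oppr0 => <-; first by rewrite integral_itv_bndo_bndc.
  - by apply: continuous_subspaceT.
  - by move=> x _.
rewrite /E /Rintegral half//; last by move=> x; rewrite mulr_ge0 ?gd_ge0.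
rewrite [in RHS]half// addeC; congr (fine (_ + _)).
- by apply: eq_integral => x _; rewrite gdN opprK.
- by apply: eq_integral => x _; rewrite gdN.
Qed.

Lemma E_odd h : tame h -> (forall x, h (- x) = - h x) -> E h = 0.
Proof.
move=> th oh; have := E_opp th; rewrite (eq_E (fun z => oh z)).
rewrite (_ : (fun x => - h x) = (fun x => -1 * h x)); last by apply/funext => x; rewrite mulN1r.
by rewrite EZ//; lra.
Qed.

Lemma E_id : E (fun z => z) = 0.
Proof. by apply: E_odd => //; exact: tame_id. Qed.

Lemma E_sqr : E (fun z => z ^+ 2) = 1.
Proof.
rewrite -[RHS](E_cst 1) -(@Stein (fun z => z))//; first exact: tame_id.
exact: tame_cst.
Qed.

Definition E4 : R := E (fun z => z ^+ 4).
Definition E1 : R := E (fun z => `|z|).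

Lemma E4_ge0 : 0 <= E4.
Proof. by apply: E_ge0; [exact: tameX tame_id|move=> x; rewrite exprn_even_ge0]. Qed.

Lemma E1_ge0 : 0 <= E1.
Proof. by apply: E_ge0; first exact: tame_norm tame_id. Qed.
End GaussianExpectation.

(** * The heat semigroup of the line *)

Section HeatSemigroup.
Context {R : realType}.
Implicit Types (f h : R -> R) (r s x y : R).

(** The average of f under the normal law of mean r and variance s, realised on one fixed Gaussian:
    s = 0 is included, and different times or points are compared under the same z. *)
Definition P s f r : R := E (fun z => f (r + Num.sqrt s * z)).

(* Equivalent to uniform continuity for a bounded function; this form passes to
   Gaussian averages because the variance is finite. *)
Definition ucont f := forall e : R, 0 < e ->
  exists2 K : R, 0 <= K & forall x y, `|f x - f y| <= e + K * (x - y) ^+ 2.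

(** With a bounded and uniformly continuous second derivative the Taylor remainders are uniform in
    the base point; they can be averaged, which makes the class stable under [P s]. *)
Record smooth2 f f1 f2 : Prop := Smooth2 {
  sm_d1 : forall x, is_derive x 1 f (f1 x) ;
  sm_d2 : forall x, is_derive x 1 f1 (f2 x) ;
  sm_bd : exists2 C : R, 0 <= C & forall x, `|f2 x| <= C ;
  sm_uc : ucont f2 }.

Lemma amgm (e a : R) : 0 < e -> a <= e + a ^+ 2 / e.
Proof.
move=> e0; rewrite -(ler_pM2r e0) mulrDl divfK ?gt_eqF//.
by have := sqr_ge0 (e - a); have := sqr_ge0 e; have := sqr_ge0 a; rewrite sqrrB !expr2; nra.
Qed.

Lemma amgm2 (q a b : R) : 0 < q -> a * b <= q * b ^+ 2 + q^-1 * a ^+ 2.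
Proof.
move=> q0; rewrite -(ler_pM2r q0) mulrDl (_ : q^-1 * a ^+ 2 * q = a ^+ 2); last first.
  by field; rewrite gt_eqF.
by have := sqr_ge0 (q * b - a); have := sqr_ge0 (q * b); have := sqr_ge0 a; rewrite sqrrB !expr2; nra.
Qed.

Lemma derive_continuous f f1 : (forall x, is_derive x 1 f (f1 x)) -> continuous f.
Proof.
by move=> df x; apply: differentiable_continuous; apply/derivable1_diffP; have [] := df x.
Qed.

Lemma MVT_norm f f1 (x y C : R) : (forall x, is_derive x 1 f (f1 x)) ->
  (forall c, `|c - x| <= `|y - x| -> `|f1 c| <= C) -> `|f y - f x| <= C * `|y - x|.
Proof.
move=> df; have cf := derive_continuous df.
have [xy|yx|->] := ltgtP x y.
- move=> hC; have [c cxy ->] := MVT xy (fun z _ => df z) (continuous_subspaceT cf).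
  rewrite normrM ler_wpM2r// hC//.
  move: cxy; rewrite in_itv/= => /andP[h1 h2].
  by rewrite !gtr0_norm ?subr_gt0// lerD2r ltW.
- move=> hC; have [c cxy h] := MVT yx (fun z _ => df z) (continuous_subspaceT cf).
  rewrite distrC h normrM distrC ler_wpM2r// hC//.
  move: cxy; rewrite in_itv/= => /andP[h1 h2].
  by rewrite !ltr0_norm ?subr_lt0// lerN2 lerD2r ltW.
- by move=> _; rewrite !subrr normr0 mulr0.
Qed.

Lemma ucont_continuous f : ucont f -> continuous f.
Proof.
move=> uf x; apply/cvgrPdist_le => e e0.
have [K K0 hK] := uf (e / 2) (divr_gt0 e0 (ltr0Sn _ 1)).
have d0 : 0 < Num.min 1 (e / 2 / (K + 1)).
  by rewrite lt_min ltr01/= divr_gt0 ?divr_gt0// ltr_wpDl.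
exists (Num.min 1 (e / 2 / (K + 1))) => //= y /=; rewrite lt_min => /andP[y1 yK].
apply: (le_trans (hK x y)).
rewrite [X in _ <= X](splitr e) lerD2l.
rewrite ltr_pdivlMr ?ltr_wpDl// in yK.
apply: (@le_trans _ _ (`|x - y| * (K + 1))); last exact: ltW.
rewrite -real_normK ?num_real// expr2 mulrCA.
rewrite ler_wpM2l//; apply: (@le_trans _ _ (K * 1)); [by rewrite ler_wpM2l// ltW|lra].
Qed.

Lemma lip_ucont f (L : R) : 0 <= L -> (forall x y, `|f x - f y| <= L * `|x - y|) -> ucont f.
Proof.
move=> L0 hL e e0; exists (L ^+ 2 / e); first by rewrite divr_ge0 ?sqr_ge0// ltW.
move=> x y; apply: (le_trans (hL x y)).
by apply: (le_trans (amgm _ e0)); rewrite exprMn real_normK ?num_real// mulrAC.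
Qed.

Lemma abs_le_sqr x : `|x| <= 1 + x ^+ 2.
Proof. by rewrite -real_normK ?num_real//; have := sqr_ge0 (`|x| - 1); rewrite sqrrB; nra. Qed.

Lemma tame_quad f (a b c : R) : continuous f -> 0 <= a -> 0 <= b -> 0 <= c ->
  (forall x, `|f x| <= a + b * `|x| + c * x ^+ 2) -> tame f.
Proof.
move=> cf a0 b0 c0 h; split => //; exists (a + b + c), 1%N; split; first by rewrite !addr_ge0.
move=> x; apply: (le_trans (h x)); rewrite expr1.
by have := abs_le_sqr x; have := sqr_ge0 x; nra.
Qed.

Section Smooth.
Variables (f f1 f2 : R -> R).
Hypothesis sf : smooth2 f f1 f2.

Let df := sm_d1 sf.
Let df1 := sm_d2 sf.

Lemma smooth2_c2 : continuous f2. Proof. exact: ucont_continuous (sm_uc sf). Qed.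

Lemma smooth2_bd : exists2 C : R, 0 < C & forall x, `|f2 x| <= C.
Proof.
have [C C0 hC] := sm_bd sf; exists (C + 1); first by rewrite ltr_wpDl.
by move=> x; rewrite (le_trans (hC x))// lerDl.
Qed.

Lemma taylor1 (C : R) x y : (forall x, `|f2 x| <= C) -> `|f1 (x + y) - f1 x| <= C * `|y|.
Proof.
move=> hC; have := @MVT_norm f1 f2 x (x + y) C df1 (fun c _ => hC c).
by rewrite (_ : x + y - x = y)//; lra.
Qed.

Lemma taylor1' (e K : R) x y : 0 <= K -> (forall x y, `|f2 x - f2 y| <= e + K * (x - y) ^+ 2) ->
  `|f1 (x + y) - f1 x - y * f2 x| <= (e + K * y ^+ 2) * `|y|.
Proof.
move=> K0 hK; pose g t := f1 t - (t - x) * f2 x.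
have dg (t : R) : is_derive t 1 g (f2 t - f2 x).
  have d := df1 t; apply: is_derive_eq; rewrite /GRing.scale/=; ring.
have := @MVT_norm g _ x (x + y) (e + K * y ^+ 2) dg.
rewrite /g (_ : x + y - x = y); last lra.
rewrite (_ : f1 (x + y) - y * f2 x - (f1 x - (x - x) * f2 x) = f1 (x + y) - f1 x - y * f2 x); last ring.
apply=> c cy; apply: (le_trans (hK _ _)); rewrite lerD2l ler_wpM2l//.
by rewrite -[leLHS]real_normK ?num_real// -[leRHS]real_normK ?num_real// lerXn2r ?nnegrE.
Qed.

Lemma taylor2 (C : R) x y : (forall x, `|f2 x| <= C) ->
  `|f (x + y) - f x - y * f1 x| <= C * y ^+ 2.
Proof.
move=> hC; pose g t := f t - (t - x) * f1 x.
have dg (t : R) : is_derive t 1 g (f1 t - f1 x).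
  have d := df t; apply: is_derive_eq; rewrite /GRing.scale/=; ring.
have := @MVT_norm g _ x (x + y) (C * `|y|) dg.
rewrite /g (_ : x + y - x = y); last lra.
rewrite (_ : f (x + y) - y * f1 x - (f x - (x - x) * f1 x) = f (x + y) - f x - y * f1 x); last ring.
rewrite -mulrA -expr2 real_normK ?num_real//; apply=> c cy.
have := @taylor1 C x (c - x) hC; rewrite (_ : x + (c - x) = c); last lra.
move=> /le_trans; apply; rewrite ler_wpM2l//.
by apply: le_trans (hC 0); exact: normr_ge0.
Qed.

Lemma taylor2' (e K : R) x y : 0 <= e -> 0 <= K ->
  (forall x y, `|f2 x - f2 y| <= e + K * (x - y) ^+ 2) ->
  `|f (x + y) - f x - y * f1 x - y ^+ 2 / 2 * f2 x| <= (e + K * y ^+ 2) * y ^+ 2.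
Proof.
move=> e0 K0 hK; pose g t := f t - (t - x) * f1 x - (t - x) ^+ 2 / 2 * f2 x.
have dg (t : R) : is_derive t 1 g (f1 t - f1 x - (t - x) * f2 x).
  have d := df t; apply: is_derive_eq.
  by rewrite /GRing.scale/= ?expr1; field.
have := @MVT_norm g _ x (x + y) ((e + K * y ^+ 2) * `|y|) dg.
rewrite /g (_ : x + y - x = y); last lra.
rewrite (_ : f (x + y) - y * f1 x - y ^+ 2 / 2 * f2 x - (f x - (x - x) * f1 x - (x - x) ^+ 2 / 2 * f2 x) = f (x + y) - f x - y * f1 x - y ^+ 2 / 2 * f2 x); last by field.
rewrite -[(e + K * y ^+ 2) * `|y| * `|y|]mulrA -(expr2 `|y|) real_normK ?num_real//; apply=> c cy.
have := @taylor1' e K x (c - x) K0 hK; rewrite (_ : x + (c - x) = c); last lra.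
move=> /le_trans; apply; apply: ler_pM => //.
  by rewrite addr_ge0// mulr_ge0// sqr_ge0.
rewrite lerD2l ler_wpM2l//.
by rewrite -[leLHS]real_normK ?num_real// -[leRHS]real_normK ?num_real// lerXn2r ?nnegrE.
Qed.

Lemma smooth2_tame2 : tame f2.
Proof.
have [C C0 hC] := sm_bd sf; apply: (@tame_quad _ C 0 0) => //; first exact: smooth2_c2.
by move=> x; rewrite !mul0r !addr0.
Qed.

Lemma smooth2_tame1 : tame f1.
Proof.
have [C C0 hC] := sm_bd sf; apply: (@tame_quad _ `|f1 0| C 0) => //; first exact: derive_continuous df1.
move=> x; rewrite mul0r addr0; have := @taylor1 C 0 x hC; rewrite add0r.
by have := ler_normD (f1 x - f1 0) (f1 0); rewrite subrK; lra.
Qed.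

Lemma smooth2_tame : tame f.
Proof.
have [C C0 hC] := sm_bd sf; apply: (@tame_quad _ `|f 0| `|f1 0| C) => //; first exact: derive_continuous df.
move=> x; have := @taylor2 C 0 x hC; rewrite add0r.
have := ler_normD (f x - f 0 - x * f1 0) (f 0 + x * f1 0).
rewrite (_ : f x - f 0 - x * f1 0 + (f 0 + x * f1 0) = f x); last ring.
have := ler_normD (f 0) (x * f1 0); rewrite normrM; lra.
Qed.
End Smooth.

Lemma tame_P f s r : tame f -> tame (fun z => f (r + Num.sqrt s * z)).
Proof. exact: tame_affine. Qed.

Lemma P0 f r : P 0 f r = f r.
Proof. by rewrite /P sqrtr0 (@eq_E _ _ (fun=> f r)) ?E_cst// => z; rewrite mul0r addr0. Qed.

Lemma P_cst s (c : R) r : P s (fun=> c) r = c.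
Proof. by rewrite /P E_cst. Qed.

Lemma PD s f h r : tame f -> tame h -> P s (fun x => f x + h x) r = P s f r + P s h r.
Proof. by move=> tf th; rewrite /P ED//; exact: tame_P. Qed.

Lemma PB s f h r : tame f -> tame h -> P s (fun x => f x - h x) r = P s f r - P s h r.
Proof. by move=> tf th; rewrite /P EB//; exact: tame_P. Qed.

Lemma PZ s (c : R) f r : tame f -> P s (fun x => c * f x) r = c * P s f r.
Proof. by move=> tf; rewrite /P EZ//; exact: tame_P. Qed.

Lemma P_le s f h r : tame f -> tame h -> (forall x, f x <= h x) -> P s f r <= P s h r.
Proof. by move=> tf th fh; apply: E_le => //; exact: tame_P. Qed.

Lemma P_norm_le s f h r : tame f -> tame h -> (forall x, `|f x| <= h x) -> `|P s f r| <= P s h r.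
Proof.
move=> tf th fh; apply: (le_trans (E_norm _)); first exact: tame_P.
by apply: E_le => //; [apply: tame_norm; exact: tame_P|exact: tame_P].
Qed.

Lemma P_id s r : P s (fun x => x) r = r.
Proof.
rewrite /P ED//; last by apply: tameZ; exact: tame_id.
  by rewrite E_cst EZ ?E_id ?mulr0 ?addr0//; exact: tame_id.
exact: tame_cst.
Qed.

Lemma P_sqr s r : 0 <= s -> P s (fun x => x ^+ 2) r = r ^+ 2 + s.
Proof.
move=> s0; rewrite /P (@eq_E _ _ (fun z => (r ^+ 2 + 2 * r * Num.sqrt s * z) + s * z ^+ 2)); last first.
  by move=> z; rewrite sqrrD exprMn sqr_sqrtr//; ring.
rewrite ED; last by apply: tameZ; apply: tameX; exact: tame_id.
  rewrite ED; first rewrite E_cst EZ ?E_id ?mulr0 ?addr0 ?EZ ?E_sqr ?mulr1//.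
  - by apply: tameX; exact: tame_id.
  - exact: tame_id.
  - exact: tame_cst.
  - by apply: tameZ; exact: tame_id.
by apply: tameD; [exact: tame_cst|apply: tameZ; exact: tame_id].
Qed.

Lemma E_sqr_affine (a b : R) : E (fun z => (a + b * z) ^+ 2) = a ^+ 2 + b ^+ 2.
Proof.
rewrite (@eq_E _ _ (fun z => (a ^+ 2 + 2 * a * b * z) + b ^+ 2 * z ^+ 2)); last first.
  by move=> z; ring.
rewrite ED; last by apply: tameZ; apply: tameX; exact: tame_id.
  rewrite ED; first rewrite E_cst EZ ?E_id ?mulr0 ?addr0 ?EZ ?E_sqr ?mulr1//.
  - by apply: tameX; exact: tame_id.
  - exact: tame_id.
  - exact: tame_cst.
  - by apply: tameZ; exact: tame_id.
by apply: tameD; [exact: tame_cst|apply: tameZ; exact: tame_id].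
Qed.

Lemma P_even s f r : tame f -> (forall x, f (- x) = f x) -> P s f (- r) = P s f r.
Proof.
move=> tf ef; rewrite /P -[RHS]E_opp; last exact: tame_P.
by apply: eq_E => z; rewrite -ef; congr f; ring.
Qed.

Lemma P_odd s f r : tame f -> (forall x, f (- x) = - f x) -> P s f (- r) = - P s f r.
Proof.
move=> tf of_; rewrite /P -[in RHS]E_opp; last exact: tame_P.
have t : tame (fun z => f (r + (- Num.sqrt s) * z)) by exact: tame_affine.
rewrite (@eq_E _ (fun z => f (r + Num.sqrt s * - z)) (fun z => f (r + (- Num.sqrt s) * z))); last first.
  by move=> z; congr f; ring.
transitivity (-1 * E (fun z => f (r + (- Num.sqrt s) * z))); last by rewrite mulN1r.
rewrite -EZ//; apply: eq_E => z; rewrite mulN1r -of_; congr f; ring.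
Qed.

Lemma P_center s f (c : R) : tame f -> (forall x, f x + f (- x) = 2 * c) -> P s f 0 = c.
Proof.
move=> tf h; have th : tame (fun x => f x - c) by apply: tameB => //; exact: tame_cst.
have : P s (fun x => f x - c) (- 0) = - P s (fun x => f x - c) 0.
  by apply: P_odd => // x; have := h x; lra.
by rewrite oppr0 PB ?P_cst//; [lra|exact: tame_cst].
Qed.

(** Differentiability from a remainder bound with explicit constants e and K, a form that Gaussian
    averages inherit. *)
Lemma is_derive_of_bound f (l : R) x :
  (forall e : R, 0 < e -> exists2 K : R, 0 <= K & forall y, `|f (x + y) - f x - y * l| <= (e + K * y ^+ 2) * `|y|) ->
  is_derive x 1 f l.
Proof.
move=> H; suff c : h^-1 *: (f (h%:A + x) - f x) @[h --> 0^'] --> l.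
  by split; [apply: cvgP c|rewrite /derive; apply: cvg_lim => //].
apply/cvgrPdist_le => e e0; have [K K0 hK] := H (e / 2) (divr_gt0 e0 (ltr0Sn _ 1)).
have d0 : 0 < Num.min 1 (e / 2 / (K + 1)).
  by rewrite lt_min ltr01/= divr_gt0 ?divr_gt0// ltr_wpDl.
exists (Num.min 1 (e / 2 / (K + 1))) => //= y /=; rewrite sub0r normrN lt_min => /andP[y1 yK] yn0.
rewrite ltr_pdivlMr ?ltr_wpDl// in yK.
rewrite /GRing.scale/= mulr1 (_ : y + x = x + y); last by rewrite addrC.
have := hK y; set q := _ - _ - _ => hq.
rewrite (_ : l - y^-1 * (f (x + y) - f x) = - (y^-1 * q)); last by rewrite /q; field.
rewrite normrN normrM normfV ler_pdivrMl ?normr_gt0// mulrC.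
apply: (le_trans hq); rewrite ler_wpM2r//.
rewrite [X in _ <= X](splitr e) lerD2l.
apply: (@le_trans _ _ (`|y| * (K + 1))); last exact: ltW.
rewrite -real_normK ?num_real// expr2 mulrCA.
rewrite ler_wpM2l//; apply: (@le_trans _ _ (K * 1)); [by rewrite ler_wpM2l// ltW|lra].
Qed.

Lemma ucont_P s f : tame f -> ucont f -> ucont (P s f).
Proof.
move=> tf uf e e0; have [K K0 hK] := uf e e0; exists K => // x y.
apply: (le_trans (E_normB _ _)); [exact: tame_P|exact: tame_P|].
rewrite -[leRHS](E_cst (e + K * (x - y) ^+ 2)); apply: E_le => /=.
- by apply: tame_norm; apply: tameB; exact: tame_P.
- exact: tame_cst.
- by move=> z; apply: (le_trans (hK _ _)); rewrite (_ : x + Num.sqrt s * z - (y + Num.sqrt s * z) = x - y)//; ring.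
Qed.

(** Differentiation under the expectation: the Taylor estimates at r + sqrt(s) z have constants
    independent of z, so averaging them gives the same estimates for [P s f]. *)
Lemma smooth2_P s f f1 f2 : smooth2 f f1 f2 -> smooth2 (P s f) (P s f1) (P s f2).
Proof.
move=> sf; have [t0 t1 t2] := And3 (smooth2_tame sf) (smooth2_tame1 sf) (smooth2_tame2 sf).
have [C C0 hC] := sm_bd sf.
have main (g g1 : R -> R) : tame g -> tame g1 ->
    (forall e : R, 0 < e -> exists2 K : R, 0 <= K & forall x y, `|g (x + y) - g x - y * g1 x| <= (e + K * y ^+ 2) * `|y|) ->
    forall x, is_derive x 1 (P s g) (P s g1 x).
  move=> tg tg1 H x; apply: is_derive_of_bound => e e0; have [K K0 hK] := H e e0.
  exists K => // y; rewrite -PZ// /P -EB; [|exact: tame_P|exact: tame_P].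
  rewrite -EB; first last.
  - by apply: tameZ; exact: tame_P.
  - by apply: tameB; exact: tame_P.
  apply: (le_trans (E_norm _)).
    by apply: tameB; [apply: tameB; exact: tame_P|apply: tameZ; exact: tame_P].
  rewrite -[leRHS]E_cst; apply: E_le; last first.
  - by move=> z; rewrite (_ : x + y + Num.sqrt s * z = (x + Num.sqrt s * z) + y); [exact: hK|ring].
  - exact: tame_cst.
  - by apply: tame_norm; apply: tameB; [apply: tameB; exact: tame_P|apply: tameZ; exact: tame_P].
split.
- apply: main => // e e0; exists (C ^+ 2 / e); first by rewrite divr_ge0 ?sqr_ge0// ltW.
  move=> x y; apply: (le_trans (taylor2 sf x y hC)).
  rewrite -real_normK ?num_real// expr2 mulrA ler_wpM2r//.
  by apply: (le_trans (amgm _ e0)); rewrite exprMn mulrAC.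
- apply: main => // e e0; have [K K0 hK] := sm_uc sf e0; exists K => // x y.
  exact: (taylor1' sf).
- exists C => // x; rewrite -(P_cst s C x); apply: P_norm_le => //; exact: tame_cst.
- by apply: ucont_P => //; exact: sm_uc sf.
Qed.

Lemma sqrtB_sqr s s' : 0 <= s -> 0 <= s' -> (Num.sqrt s - Num.sqrt s') ^+ 2 <= `|s - s'|.
Proof.
move=> s0 s'0.
rewrite -{2}(sqr_sqrtr s0) -{2}(sqr_sqrtr s'0) subr_sqr normrM -real_normK ?num_real// expr2.
rewrite ler_wpM2l// [leRHS]ger0_norm ?addr_ge0 ?sqrtr_ge0//.
by rewrite (le_trans (ler_normB _ _))// !ger0_norm ?sqrtr_ge0.
Qed.

(** Coupling by the same z: the two arguments differ by (r - r') + (sqrt s - sqrt s') z, whose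
    second moment is at most (r - r')^2 + |s - s'|. *)
Lemma P_ucont_joint f (e K : R) s s' r r' : tame f -> 0 <= K -> 0 <= s -> 0 <= s' ->
  (forall x y, `|f x - f y| <= e + K * (x - y) ^+ 2) ->
  `|P s f r - P s' f r'| <= e + K * ((r - r') ^+ 2 + `|s - s'|).
Proof.
move=> tf K0 s0 s'0 hK.
apply: (le_trans (E_normB _ _)); [exact: tame_P|exact: tame_P|].
apply: (@le_trans _ _ (e + K * ((r - r') ^+ 2 + (Num.sqrt s - Num.sqrt s') ^+ 2))); last first.
  by rewrite lerD2l ler_wpM2l// lerD2l sqrtB_sqr.
rewrite -E_sqr_affine -EZ; last by apply: tameX; exact: (tame_affine _ _ tame_id).
rewrite -[X in X + E _](E_cst e) -ED; [|exact: tame_cst|by apply: tameZ; apply: tameX; exact: (tame_affine _ _ tame_id)].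
apply: E_le.
- by apply: tame_norm; apply: tameB; exact: tame_P.
- by apply: tameD; [exact: tame_cst|apply: tameZ; apply: tameX; exact: (tame_affine _ _ tame_id)].
- move=> z; apply: (le_trans (hK _ _)); rewrite lerD2l ler_wpM2l//.
  by rewrite (_ : r + Num.sqrt s * z - (r' + Num.sqrt s' * z) = r - r' + (Num.sqrt s - Num.sqrt s') * z)//; ring.
Qed.

Lemma P_lip_joint f (L : R) s s' r : tame f -> 0 <= L -> 0 <= s -> 0 <= s' ->
  (forall x y, `|f x - f y| <= L * `|x - y|) ->
  `|P s f r - P s' f r| <= L * E1 * Num.sqrt `|s - s'|.
Proof.
move=> tf L0 s0 s'0 hL.
apply: (le_trans (E_normB _ _)); [exact: tame_P|exact: tame_P|].
apply: (@le_trans _ _ (L * `|Num.sqrt s - Num.sqrt s'| * E1)); last first.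
  rewrite mulrAC ler_wpM2l ?mulr_ge0 ?E1_ge0//.
  by rewrite -(ler_pXn2r (n := 2))// ?nnegrE ?sqrtr_ge0// sqr_sqrtr// real_normK ?num_real// sqrtB_sqr.
rewrite -EZ; last by apply: tame_norm; exact: tame_id.
apply: E_le.
- by apply: tame_norm; apply: tameB; exact: tame_P.
- by apply: tameZ; apply: tame_norm; exact: tame_id.
- move=> z; apply: (le_trans (hL _ _)); rewrite -mulrA ler_wpM2l// -normrM.
  by rewrite (_ : r + Num.sqrt s * z - (r + Num.sqrt s' * z) = (Num.sqrt s - Num.sqrt s') * z)//; ring.
Qed.

Definition jcont (u : R -> R -> R) := forall s r, 0 <= s -> forall e : R, 0 < e ->
  exists2 d : R, 0 < d & forall s' r', 0 <= s' -> `|s' - s| < d -> `|r' - r| < d ->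
    `|u s' r' - u s r| <= e.

(** [f] may grow quadratically and need not be uniformly continuous; the linear Taylor term is split
    by [amgm2] with a small weight q on f1^2, whose average V is finite. *)
Lemma smooth2_jcont f f1 f2 : smooth2 f f1 f2 -> jcont (P^~ f).
Proof.
move=> sf s r s0 e e0; have [C C0 hC] := smooth2_bd sf.
have [t0 t1] := conj (smooth2_tame sf) (smooth2_tame1 sf).
pose V := P s (fun x => f1 x ^+ 2) r.
have V0 : 0 <= V by apply: E_ge0; [by apply: tameX; exact: tame_P|move=> z; exact: sqr_ge0].
pose q := e / 2 / (V + 1).
have q0 : 0 < q by rewrite divr_gt0 ?divr_gt0// ltr_wpDl.
pose K := q^-1 + C.
have K0 : 0 < K by rewrite addr_gt0// invr_gt0.
have d0 : 0 < Num.min 1 (e / 4 / K) by rewrite lt_min ltr01/= !divr_gt0.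
exists (Num.min 1 (e / 4 / K)) => // s' r' s'0; rewrite !lt_min => /andP[s1 s2] /andP[r1 r2].
have key (x y : R) : `|f y - f x| <= q * f1 x ^+ 2 + K * (y - x) ^+ 2.
  have := taylor2 sf x (y - x) hC; rewrite (_ : x + (y - x) = y); last lra.
  have := ler_normD (f y - f x - (y - x) * f1 x) ((y - x) * f1 x); rewrite subrK.
  suff : `|(y - x) * f1 x| <= q * f1 x ^+ 2 + q^-1 * (y - x) ^+ 2 by rewrite /K; lra.
  rewrite normrM -[X in _ <= _ * X + _]real_normK ?num_real// -[X in _ <= _ + _ * X]real_normK ?num_real//.
  exact: amgm2.
apply: (le_trans (E_normB _ _)); [exact: tame_P|exact: tame_P|].
apply: (@le_trans _ _ (q * V + K * ((r' - r) ^+ 2 + (Num.sqrt s' - Num.sqrt s) ^+ 2))).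
  rewrite -E_sqr_affine -[K * E _]EZ; last by apply: tameX; exact: (tame_affine _ _ tame_id).
  rewrite /V -PZ; last exact: tameX.
  rewrite -ED; first last.
  - by apply: tameZ; apply: tameX; exact: (tame_affine _ _ tame_id).
  - by apply: tameZ; apply: tameX; exact: tame_P.
  apply: E_le.
  - by apply: tame_norm; apply: tameB; exact: tame_P.
  - by apply: tameD; [apply: tameZ; apply: tameX; exact: tame_P|apply: tameZ; apply: tameX; exact: (tame_affine _ _ tame_id)].
  - move=> z; apply: (le_trans (key _ _)); rewrite lerD2l ler_wpM2l//; first exact: ltW.
    by rewrite (_ : r' + Num.sqrt s' * z - (r + Num.sqrt s * z) = r' - r + (Num.sqrt s' - Num.sqrt s) * z)//; ring.
rewrite [X in _ <= X](splitr e) lerD//.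
  by rewrite /q mulrAC ler_pdivrMr ?ltr_wpDl// ler_pM2l ?divr_gt0// lerDl.
have h1 : (Num.sqrt s' - Num.sqrt s) ^+ 2 <= e / 4 / K.
  by apply: (le_trans (sqrtB_sqr _ _)) => //; exact: ltW.
have h2 : (r' - r) ^+ 2 <= e / 4 / K.
  rewrite -real_normK ?num_real// expr2; apply: le_trans (ltW r2).
  by rewrite ler_piMl// ltW.
apply: (@le_trans _ _ (K * (e / 4 / K + e / 4 / K))); first by rewrite ler_wpM2l ?(ltW K0)//; exact: lerD.
by rewrite le_eqVlt; apply/orP; left; apply/eqP; field; rewrite gt_eqF.
Qed.

Lemma ucont_jcont f : tame f -> ucont f -> jcont (P^~ f).
Proof.
move=> tf uf s r s0 e e0; have [K K0 hK] := uf (e / 2) (divr_gt0 e0 (ltr0Sn _ 1)).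
have d0 : 0 < Num.min 1 (e / 4 / (K + 1)) by rewrite lt_min ltr01/= !divr_gt0// ltr_wpDl.
exists (Num.min 1 (e / 4 / (K + 1))) => // s' r' s'0; rewrite !lt_min => /andP[s1 s2] /andP[r1 r2].
apply: (le_trans (P_ucont_joint r' r tf K0 s'0 s0 hK)).
rewrite [X in _ <= X](splitr e) lerD2l.
have h2 : (r' - r) ^+ 2 <= e / 4 / (K + 1).
  rewrite -real_normK ?num_real// expr2; apply: le_trans (ltW r2).
  by rewrite ler_piMl// ltW.
apply: (@le_trans _ _ ((K + 1) * (e / 4 / (K + 1) + e / 4 / (K + 1)))).
  apply: ler_pM => //; rewrite ?addr_ge0 ?sqr_ge0 ?lerDl//.
  by apply: lerD => //; exact: ltW.
by rewrite le_eqVlt; apply/orP; left; apply/eqP; field; rewrite gt_eqF// ltr_wpDl.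
Qed.

(** The heat equation with an explicit modulus, also at s = 0. There the second-order Taylor formula
    is averaged, and the fourth moment bounds the remainder. For s > 0 a first-order expansion in
    sqrt s' - sqrt s is enough, since Stein's identity turns the average of z f1 into sqrt(s) times
    that of f2. *)
Lemma P_time f f1 f2 s r : smooth2 f f1 f2 -> 0 <= s -> forall e : R, 0 < e ->
  exists2 d : R, 0 < d & forall s', 0 <= s' -> `|s' - s| < d ->
    `|P s' f r - P s f r - (s' - s) / 2 * P s f2 r| <= e * `|s' - s|.
Proof.
move=> sf s0 e e0; have [C C0 hC] := smooth2_bd sf.
have [t0 t1 t2] := And3 (smooth2_tame sf) (smooth2_tame1 sf) (smooth2_tame2 sf).
move: s0; rewrite le_eqVlt => /predU1P[<-|s0].
  have [K K0 hK] := sm_uc sf (divr_gt0 e0 (ltr0Sn _ 1)).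
  have h4 : 0 < K * E4 + 1 by rewrite ltr_wpDl// mulr_ge0// E4_ge0.
  exists (e / 2 / (K * E4 + 1)); first by rewrite !divr_gt0.
  move=> s' s'0; rewrite !subr0 ger0_norm// !P0 => hs.
  pose b := Num.sqrt s'.
  have b2 : b ^+ 2 = s' by rewrite sqr_sqrtr.
  have -> : P s' f r - f r - s' / 2 * f2 r =
     E (fun z => f (r + b * z) - f r - (b * z) * f1 r - (b * z) ^+ 2 / 2 * f2 r).
    have tz : tame (fun z => b * z) by apply: tameZ; exact: tame_id.
    rewrite EB; first last.
    - by apply: tameM; [apply: tameM; [exact: tameX|exact: tame_cst]|exact: tame_cst].
    - by apply: tameB; [apply: tameB; [exact: tame_P|exact: tame_cst]|apply: tameM => //; exact: tame_cst].
    rewrite EB; first last.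
    - by apply: tameM => //; exact: tame_cst.
    - by apply: tameB; [exact: tame_P|exact: tame_cst].
    rewrite EB; [|exact: tame_P|exact: tame_cst].
    rewrite E_cst -/(P s' f r).
    rewrite (@eq_E _ (fun z => b * z * f1 r) (fun z => (b * f1 r) * z)); last by move=> z; ring.
    rewrite EZ ?E_id ?mulr0 ?subr0; last exact: tame_id.
    rewrite (@eq_E _ (fun z => (b * z) ^+ 2 / 2 * f2 r) (fun z => (s' / 2 * f2 r) * z ^+ 2)); last first.
      by move=> z; rewrite -b2; ring.
    by rewrite EZ ?E_sqr ?mulr1//; apply: tameX; exact: tame_id.
  apply: (@le_trans _ _ (E (fun z => e / 2 * s' * z ^+ 2 + K * s' ^+ 2 * z ^+ 4))).
    have tz : tame (fun z => b * z) by apply: tameZ; exact: tame_id.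
    have tt : tame (fun z => f (r + b * z) - f r - (b * z) * f1 r - (b * z) ^+ 2 / 2 * f2 r).
      apply: tameB; last by apply: tameM; [apply: tameM; [exact: tameX|exact: tame_cst]|exact: tame_cst].
      by apply: tameB; [apply: tameB; [exact: tame_P|exact: tame_cst]|apply: tameM => //; exact: tame_cst].
    apply: (le_trans (E_norm tt)); apply: E_le.
    - exact: tame_norm.
    - by apply: tameD; apply: tameZ; apply: tameX; exact: tame_id.
    - move=> z; apply: (le_trans (taylor2' sf r (b * z) _ K0 hK)); first by rewrite divr_ge0// ltW.
      by rewrite le_eqVlt; apply/orP; left; apply/eqP; rewrite -b2; ring.
  rewrite ED; first last.
  - by apply: tameZ; apply: tameX; exact: tame_id.
  - by apply: tameZ; apply: tameX; exact: tame_id.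
  rewrite !EZ ?E_sqr ?mulr1 -/E4; [|by apply: tameX; exact: tame_id|by apply: tameX; exact: tame_id].
  rewrite ltr_pdivlMr// in hs.
  have : s' * (s' * (K * E4 + 1)) <= s' * (e / 2) by rewrite ler_wpM2l// ltW.
  have : 0 <= s' * s' by rewrite mulr_ge0.
  by rewrite expr2; nra.
exists (e * s / (2 * C)); first by rewrite divr_gt0 ?mulr_gt0.
move=> s' s'0; rewrite ltr_pdivlMr ?mulr_gt0// => hs.
pose a := Num.sqrt s; pose b := Num.sqrt s'.
have a2 : a ^+ 2 = s by rewrite sqr_sqrtr// ltW.
have b2 : b ^+ 2 = s' by rewrite sqr_sqrtr.
have a0 : 0 < a by rewrite sqrtr_gt0.
have b0 : 0 <= b by rewrite sqrtr_ge0.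
have St : E (fun z => z * f1 (r + a * z)) = a * P s f2 r.
  rewrite /P -EZ; last exact: tame_P.
  apply: (@Stein _ (fun z => f1 (r + a * z)) (fun z => a * f2 (r + a * z))).
  - exact: tame_affine.
  - by apply: tameZ; exact: tame_affine.
  - move=> x; have d1 := sm_d2 sf (r + a * x).
    have d2 : is_derive x 1 (fun x => r + a * x) a.
      by apply: is_derive_eq; rewrite /GRing.scale/=; ring.
    have := @is_derive1_comp _ f1 (fun x => r + a * x) x _ _ d1 d2.
    by rewrite mulrC.
have B1 : `|P s' f r - P s f r - (b - a) * (a * P s f2 r)| <= C * (b - a) ^+ 2.
  rewrite -St -EZ; last by apply: tameM; [exact: tame_id|exact: tame_affine].
  rewrite -EB; [|exact: tame_P|exact: tame_P].
  have t3 : tame (fun z => (b - a) * (z * f1 (r + a * z))).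
    by apply: tameZ; apply: tameM; [exact: tame_id|exact: tame_affine].
  have t4 : tame (fun z => f (r + b * z) - f (r + a * z)) by apply: tameB; exact: tame_affine.
  rewrite -EB//; apply: (le_trans (E_norm _)); first exact: tameB.
  rewrite -[X in _ <= X]mulr1 -E_sqr -EZ; last by apply: tameX; exact: tame_id.
  apply: E_le; [by apply: tame_norm; exact: tameB|by apply: tameZ; apply: tameX; exact: tame_id|].
  move=> z; have := taylor2 sf (r + a * z) ((b - a) * z) hC.
  rewrite (_ : r + a * z + (b - a) * z = r + b * z); last ring.
  by rewrite -mulrA exprMn mulrA.
have B2 : `|P s f2 r| <= C.
  by rewrite -(P_cst s C r); apply: P_norm_le => //; exact: tame_cst.
have -> : P s' f r - P s f r - (s' - s) / 2 * P s f2 r =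
  (P s' f r - P s f r - (b - a) * (a * P s f2 r)) - (b - a) ^+ 2 / 2 * P s f2 r.
  by rewrite -a2 -b2; field.
apply: (le_trans (ler_normB _ _)).
apply: (@le_trans _ _ (2 * C * (b - a) ^+ 2)).
  rewrite normrM (@ger0_norm _ (_ / 2)); last by rewrite divr_ge0 ?sqr_ge0.
  have : (b - a) ^+ 2 / 2 * `|P s f2 r| <= (b - a) ^+ 2 / 2 * C by rewrite ler_wpM2l// divr_ge0 ?sqr_ge0.
  have : 0 <= (b - a) ^+ 2 * C by rewrite mulr_ge0 ?sqr_ge0// ltW.
  by lra.
have h5 : `|s' - s| = `|b - a| * (b + a).
  by rewrite -a2 -b2 subr_sqr normrM (@ger0_norm _ (b + a))// addr_ge0// ltW.
(* Since sqrt s' + sqrt s >= sqrt s, the quadratic remainder in sqrt s' - sqrt s is at most a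
   multiple of (s' - s)^2 / s, hence of second order in s' - s. *)
have h6 : (b - a) ^+ 2 * s <= `|s' - s| ^+ 2.
  rewrite h5 exprMn real_normK ?num_real// ler_wpM2l ?sqr_ge0// -a2.
  by rewrite lerXn2r ?nnegrE ?addr_ge0 ?lerDr// ltW.
rewrite -(ler_pM2r s0) -mulrA -mulrA.
apply: (@le_trans _ _ (2 * C * `|s' - s| ^+ 2)).
  rewrite (_ : 2 * (C * (b - a) ^+ 2 * s) = 2 * C * ((b - a) ^+ 2 * s)); last by ring.
  by rewrite ler_wpM2l// mulr_ge0// ltW.
rewrite expr2 mulrA [in leRHS]mulrAC ler_wpM2r//.
by have := ltW hs; rewrite mulrC.
Qed.

End HeatSemigroup.

(** * The Gaussian kernel *)

Section GaussKernel.
Context {R : realType}.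
Implicit Types (f h : R -> R) (r s t x y z e c : R).
Notation mu := (@lebesgue_measure R).

Lemma gauss_gt0 s r y : 0 < s -> 0 < gauss s r y.
Proof. by move=> s0; rewrite divr_gt0 ?expR_gt0// sqrtr_gt0 !mulr_gt0// pi_gt0. Qed.

Lemma gauss_continuous s r : continuous (gauss s r).
Proof.
move=> y; apply: cvgM; last exact: cvg_cst.
apply: (@continuous_comp _ _ _ (fun y => - (r - y) ^+ 2 / (2 * s)) expR); last exact: continuous_expR.
apply: cvgM; last exact: cvg_cst.
apply: (@cvgN _ R^o).
apply: (@continuous_comp _ _ _ (fun y => r - y) (fun y => y ^+ 2)); last exact: exprn_continuous.
by apply: (@cvgB _ R^o); [exact: cvg_cst|exact: cvg_id].
Qed.

Lemma gauss_gd s r z : 0 < s -> gauss s r (r + Num.sqrt s * z) * Num.sqrt s = gd z.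
Proof.
move=> s0; rewrite gdE /gauss opprD addrA subrr add0r sqrrN exprMn sqr_sqrtr ?ltW//.
rewrite (_ : - (s * z ^+ 2) / (2 * s) = - z ^+ 2 / 2); last by field; rewrite gt_eqF.
rewrite sqrtrM ?mulr_ge0 ?pi_ge0// invfM.
by rewrite [RHS]mulrC -!mulrA mulVf ?mulr1// gt_eqF// sqrtr_gt0.
Qed.

Lemma integral_gauss_subst s r f : 0 < s -> continuous f -> (forall x, 0 <= f x) ->
  (\int[mu]_y (gauss s r y * f y)%:E = \int[mu]_z (gd z * f (r + Num.sqrt s * z))%:E)%E.
Proof.
move=> s0 cf f0; have q0 : 0 < Num.sqrt s by rewrite sqrtr_gt0.
pose Fz (z : R) : R := r + Num.sqrt s * z.
have dF z : is_derive z 1 Fz (Num.sqrt s).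
  by apply: is_derive_eq; rewrite /GRing.scale/=; ring.
have F'E : Fz^`()%classic = cst (Num.sqrt s).
  by apply/funext => z; rewrite derive1E; have [_ ->] := dF z.
rewrite (@increasing_ge0_integration_by_substitutionT _ Fz).
- by apply: eq_integral => z _; rewrite F'E; congr EFin; rewrite -(gauss_gd r z s0) mulrAC.
- by move=> x y xy; rewrite ltrD2l ltr_pM2l.
- by rewrite F'E => ?; exact: cvg_cst.
- by rewrite F'E; exact: is_cvg_cst.
- by rewrite F'E; exact: is_cvg_cst.
- by move=> x; have [] := dF x.
- apply/cvgrNyPle => A; near=> z.
  rewrite /Fz -lerBrDl mulrC -ler_pdivlMr//.
- apply/cvgryPge => A; near=> z.
  rewrite /Fz -lerBlDl mulrC -ler_pdivrMr//.
- by move=> y; apply: continuousM; [exact: gauss_continuous|exact: cf].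
- by move=> x; rewrite mulr_ge0// ltW// gauss_gt0.
Unshelve. all: by end_near.
Qed.

Lemma tame_split f : tame f -> exists B, [/\ tame B, forall x, 0 <= B x & forall x, 0 <= f x + B x].
Proof.
move=> [cf [C [k [C0 hC]]]]; exists (fun x => C * (1 + x ^+ 2) ^+ k).
have B0 x : 0 <= C * (1 + x ^+ 2) ^+ k by rewrite mulr_ge0// exprn_ge0// (le_trans ler01)// one_le_sqr.
split=> //.
- apply: tameZ; apply: tameX; apply: tameD; first exact: tame_cst.
  by apply: tameX; exact: tame_id.
- by move=> x; have := hC x; rewrite ler_norml => /andP[+ _]; rewrite lerNl; lra.
Qed.

Lemma gauss_integrable s r f : 0 < s -> tame f ->
  mu.-integrable setT (EFin \o (fun y => gauss s r y * f y)).
Proof.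
move=> s0 tf; have [cf _] := tf; apply/integrableP; split.
  apply/measurable_EFinP; apply: continuous_measurable_fun => y.
  by apply: continuousM; [exact: gauss_continuous|exact: cf].
rewrite (@eq_integral _ _ _ mu setT (fun y => (gauss s r y * `|f y|)%:E)); last first.
  by move=> y _ /=; rewrite normrM (@ger0_norm _ (gauss _ _ _))// ltW// gauss_gt0.
rewrite integral_gauss_subst//; last first.
  by move=> y; apply: continuous_comp; [exact: cf|exact: norm_continuous].
have tn : tame (fun z => `|f (r + Num.sqrt s * z)|) by apply: tame_norm; exact: tame_affine.
have /integrableP[_] := tame_integrable tn.
apply: le_lt_trans; rewrite le_eqVlt; apply/orP; left; apply/eqP; apply: eq_integral => z _ /=.
by rewrite normrM normr_id (@ger0_norm _ (gd z))// gd_ge0.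
Qed.

Lemma P_gauss s r f : 0 < s -> tame f -> P s f r = \int[mu]_y (gauss s r y * f y).
Proof.
move=> s0 tf.
have pos h : tame h -> (forall x, 0 <= h x) -> P s h r = \int[mu]_y (gauss s r y * h y).
  by move=> th h0; rewrite /Rintegral integral_gauss_subst//; case: th.
have [B [tB B0 fB0]] := tame_split tf.
have := pos _ (tameD tf tB) fB0; rewrite PD// (pos B)//.
have -> : \int[mu]_y (gauss s r y * (f y + B y)) = \int[mu]_y (gauss s r y * f y) + \int[mu]_y (gauss s r y * B y).
  rewrite -RintegralD//; try exact: gauss_integrable.
  by apply: eq_Rintegral => y _; rewrite mulrDr.
by move=> /addIr.
Qed.

Lemma Rintegral_lt0 f y0 : continuous f -> mu.-integrable setT (EFin \o f) ->
  (forall y, f y <= 0) -> f y0 < 0 -> \int[mu]_y f y < 0.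
Proof.
move=> cf intf f0 fy0.
have e0 : 0 < - f y0 / 2 by lra.
have /cvgrPdist_lt /(_ _ e0) [d /= d0 hd] := cf y0.
pose D := `](y0 - d), (y0 + d)[%classic.
have mD : measurable D by exact: measurable_itv.
have hD y : D y -> f y <= f y0 / 2.
  rewrite /D /= in_itv/= => /andP[a b]; have := hd y.
  rewrite /ball/= => /(_ ltac:(by rewrite ltr_norml; apply/andP; split; lra)).
  by rewrite ltr_norml => /andP[]; lra.
have muD : mu D = (2 * d)%:E.
  rewrite /D lebesgue_measure_itv/= lte_fin (_ : y0 - d < y0 + d); last lra.
  by rewrite -EFinB; congr EFin; ring.
apply: (@le_lt_trans _ _ (\int[mu]_(y in D) f y)).
  rewrite [leRHS]Rintegral_mkcond; apply: le_Rintegral => //.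
  - by rewrite -restrict_EFin; apply/integrable_restrict => //; rewrite setTI; exact: integrableS intf.
  - by move=> y _; rewrite patchE; case: ifPn.
apply: (@le_lt_trans _ _ (\int[mu]_(y in D) (f y0 / 2))).
  apply: le_Rintegral => //.
  - by apply: integrableS intf.
  - apply/integrableP; split; first exact: measurable_cst.
    under eq_integral do rewrite /=.
    by rewrite integral_cst//= muD -EFinM ltry.
have -> : \int[mu]_(y in D) (f y0 / 2) = f y0 / 2 * fine (2 * d)%:E by rewrite Rintegral_cst// -muD.
by rewrite /=; nra.
Qed.

Lemma tame_opp f : tame f -> tame (fun x => f (- x)).
Proof.
move=> tf; have -> : (fun z => f (- z)) = (fun z => f (0 + -1 * z)).
  by apply/funext => z; rewrite add0r mulN1r.
exact: tame_affine.
Qed.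

Lemma P_opp s f r : tame f -> P s (fun x => f (- x)) (- r) = P s f r.
Proof.
move=> tf; rewrite /P -[RHS]E_opp; last exact: tame_P.
by apply: eq_E => z; congr f; ring.
Qed.

(** Stein's identity for [P]: a factor x inside the average costs a derivative. It makes the
    quantity in [transversal] a single average of (N y - X D) k(y). *)
Lemma P_mulid s f f1 r : 0 <= s -> tame f -> tame f1 -> (forall x, is_derive x 1 f (f1 x)) ->
  P s (fun x => x * f x) r = r * P s f r + s * P s f1 r.
Proof.
move=> s0 tf tf1 df; pose a := Num.sqrt s.
have a2 : a * a = s by rewrite -expr2 sqr_sqrtr.
have St : E (fun z => z * f (r + a * z)) = a * P s f1 r.
  rewrite /P -EZ; last exact: tame_P.
  apply: (@Stein _ (fun z => f (r + a * z)) (fun z => a * f1 (r + a * z))).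
  - exact: tame_affine.
  - by apply: tameZ; exact: tame_affine.
  - move=> x; have d1 := df (r + a * x).
    have d2 : is_derive x 1 (fun x => r + a * x) a.
      by apply: is_derive_eq; rewrite /GRing.scale/=; ring.
    have := @is_derive1_comp _ f (fun x => r + a * x) x _ _ d1 d2.
    by rewrite mulrC.
have -> : s * P s f1 r = a * E (fun z => z * f (r + a * z)) by rewrite St mulrA a2.
rewrite /P -/a -!EZ; [|by apply: tameM; [exact: tame_id|exact: tame_affine]|exact: tame_affine].
rewrite -ED; first by apply: eq_E => z; ring.
- by apply: tameZ; exact: tame_affine.
- by apply: tameZ; apply: tameM; [exact: tame_id|exact: tame_affine].
Qed.

End GaussKernel.

(** * At most one sign change for the averages *)

Section SignChange.
Context {R : realType}.
Implicit Types (r s t x y z e c : R).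
Variables (j : R) (f f1 : R -> R) (X : R).
Hypotheses (j0 : 0 < j) (tf : tame f) (tf1 : tame f1).
Hypothesis df : forall x, is_derive x 1 f (f1 x).
Hypothesis ef : forall x, f (- x) = f x.
Hypothesis X0 : 0 < X.
Hypothesis fl : forall x, 0 <= x -> x <= X -> 0 <= f x - 2 * j * x.
Hypothesis fr : forall x, X <= x -> f x - 2 * j * x <= 0.
Notation mu := (@lebesgue_measure R).

Let k x := f x - 2 * j * x.
Let k1 x := f1 x - 2 * j.

Lemma gauss_opp (s r y : R) : gauss s (- r) (- y) = gauss s r y.
Proof. by rewrite /gauss -opprD sqrrN. Qed.

Lemma gauss_ratio (s r y : R) : 0 < s -> gauss s (- r) y = gauss s r y * expR (- (2 * r * y / s)).
Proof.
move=> s0; rewrite /gauss [RHS]mulrAC -expRD; congr (expR _ / _).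
by field; rewrite gt_eqF.
Qed.

Let tk : tame k.
Proof. by apply: tameB => //; apply: tameZ; exact: tame_id. Qed.

Let tk1 : tame k1.
Proof. by apply: tameB => //; exact: tame_cst. Qed.

Let dk x : is_derive x 1 k (k1 x).
Proof. by have d := df x; apply: is_derive_eq; rewrite /k1 /GRing.scale/=; ring. Qed.

(* The kernel cosh(r y) is totally positive, hence the averages of a function
   with one sign change at X change sign at most once, with nonzero slope. *)
Lemma transversal s r N D : 0 < s -> 0 < r ->
  N = gauss s r X + gauss s (- r) X -> D = gauss s r X - gauss s (- r) X ->
  N * (r * P s k r + s * P s k1 r) - X * D * P s k r < 0.
Proof.
move=> s0 r0 NE DE.
have GX : 0 < gauss s r X by exact: gauss_gt0.
have GX' : 0 < gauss s (- r) X by exact: gauss_gt0.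
have N0 : 0 < N by rewrite NE addr_gt0.
have D0 : 0 <= D.
  rewrite DE subr_ge0 gauss_ratio//; apply: ler_piMr; first exact: ltW.
  rewrite -expR0 ler_expR oppr_le0.
  by rewrite ltW// divr_gt0// !mulr_gt0.
(* Let G and G' be the kernels from r and -r. Folding y > 0 with -y, the factor of k(y) is N y (G -
   G') - X D (G + G'); the weight is chosen so that it vanishes at y = X, and elsewhere it has the
   sign of y - X because y tanh(r y / s) increases. The relation k(-y) = k(y) + 4 j y adds a
   strictly negative term. *)
pose h y := (N * y - X * D) * k y.
have th : tame h.
  by apply: tameM => //; apply: tameB; [apply: tameZ; exact: tame_id|exact: tame_cst].
have -> : N * (r * P s k r + s * P s k1 r) - X * D * P s k r = P s h r.
  rewrite -(P_mulid r (ltW s0) tk tk1 dk) -!PZ//; last by apply: tameM => //; exact: tame_id.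
  rewrite -PB; first by congr (P s _ r); apply/funext => y; rewrite /h; ring.
    by apply: tameZ; apply: tameM => //; exact: tame_id.
  exact: tameZ.
have th' := tame_opp th.
suff : P s h r + P s h r < 0 by lra.
rewrite -{2}(P_opp s r th) !P_gauss// -RintegralD//; try exact: gauss_integrable.
pose S y := gauss s r y * h y + gauss s (- r) y * h (- y).
have Sneg y : 0 < y -> S y <= - (4 * j * y * (N * y + X * D) * gauss s (- r) y).
  move=> y0; rewrite /S /h.
  have -> : k (- y) = k y + 4 * j * y by rewrite /k ef; ring.
  set g := k y; pose Q (t : R) := expR (- (2 * r * t / s)).
  have Q0 t : 0 < Q t by exact: expR_gt0.
  have Gy : 0 < gauss s r y by exact: gauss_gt0.
  suff : g * (N * y * (gauss s r y - gauss s (- r) y) - X * D * (gauss s r y + gauss s (- r) y)) <= 0 by lra.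
  rewrite NE DE !gauss_ratio// -/(Q X) -/(Q y).
  set a := gauss s r y in Gy *; set b := gauss s r X in GX *.
  have -> : (b + b * Q X) * y * (a - a * Q y) - X * (b - b * Q X) * (a + a * Q y) =
     a * b * (y * ((1 + Q X) * (1 - Q y)) - X * ((1 - Q X) * (1 + Q y))) by ring.
  have ab : 0 < a * b by exact: mulr_gt0.
  have Qle t : 0 < t -> Q t <= 1.
    move=> t0; rewrite /Q -expR0 ler_expR oppr_le0.
    by rewrite ltW// divr_gt0// !mulr_gt0.
  have Qmono t t' : t <= t' -> Q t' <= Q t.
    move=> tt'; rewrite ler_expR lerN2 ler_pM2r ?invr_gt0// ler_pM2l//.
    by rewrite mulr_gt0.
  have [yX|Xy] := leP y X.
    have g0 : 0 <= g by apply: fl => //; exact: ltW.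
    rewrite mulr_ge0_le0// pmulr_rle0// subr_le0.
    have h1 := Qmono _ _ yX; have h2 := Q0 X; have h3 := Q0 y; have h4 := Qle _ X0; have h5 := Qle _ y0.
    apply: ler_pM => //; [exact: ltW|by apply: mulr_ge0; lra|nra].
  have g0 : g <= 0 by apply: fr; exact: ltW.
  rewrite mulr_le0_ge0// pmulr_rge0// subr_ge0.
  have h1 := Qmono _ _ (ltW Xy); have h2 := Q0 X; have h3 := Q0 y; have h4 := Qle _ X0; have h5 := Qle _ y0.
  by apply: ler_pM => //; [exact: ltW|apply: mulr_ge0; lra|exact: ltW|nra].
have Sneg' y : 0 < y -> S y < 0.
  move=> y0; apply: (le_lt_trans (Sneg _ y0)); rewrite oppr_lt0.
  apply: mulr_gt0; last exact: gauss_gt0.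
  apply: mulr_gt0; first by rewrite !mulr_gt0.
  by rewrite ltr_wpDr ?mulr_ge0 ?mulr_gt0// ltW.
have cS : continuous S.
  move=> y; apply: (@continuousD _ _ _ (fun y => gauss s r y * h y) (fun y => gauss s (- r) y * h (- y))).
    by apply: continuousM; [exact: gauss_continuous|case: th => c _; exact: c].
  by apply: continuousM; [exact: gauss_continuous|case: th' => c _; exact: c].
apply: (@Rintegral_lt0 _ _ 1) => //; last exact: Sneg'.
- by apply: (@integrableD _ _ _ mu setT measurableT (EFin \o (fun y => gauss s r y * h y)) (EFin \o (fun y => gauss s (- r) y * h (- y)))); exact: gauss_integrable.
- have Sev y : S (- y) = S y.
    by rewrite /S opprK -{1}(opprK r) !gauss_opp addrC.
  suff Sle y : S y <= 0 by [].
  have [y0|y0|<-] := ltgtP 0 y.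
  + by rewrite ltW// Sneg'.
  + by rewrite -[S y]Sev ltW// Sneg'// oppr_gt0.
  + apply/ler_addgt0Pl => e e0; have /cvgrPdist_lt /(_ _ e0) [d /= d0 hd] := cS 0.
    have := hd (d / 2); rewrite /ball/= sub0r normrN gtr0_norm ?divr_gt0//.
    rewrite ltr_pdivrMr// ltr_pMr// ltr1n => /(_ isT).
    have := Sneg' _ (divr_gt0 d0 (ltr0Sn _ 1)).
    by rewrite ltr_norml => + /andP[_]; lra.
Qed.

End SignChange.

(** * Decay far away, continuity in time, and rates *)

Section Tail.
Context {R : realType}.
Implicit Types (f h : R -> R) (r s t x y z e c : R).

(** Chebyshev with the fourth moment: h(x) can be nonzero only for x < Z, at distance at least r / 2
    from r, where r^2 <= 4 (x - r)^2 and 1 + x^2 <= 14 (x - r)^2; the constant 56 is 4 times 14. *)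
Lemma P_tail h (C Z : R) : tame h -> 0 <= C -> (forall x, `|h x| <= C * (1 + x ^+ 2)) ->
  (forall x, Z <= x -> h x = 0) ->
  forall s r, 0 <= s -> 1 <= r -> 2 * `|Z| <= r -> `|P s h r| <= 56 * C * E4 * s ^+ 2 / r ^+ 2.
Proof.
move=> th C0 hC hZ s r s0 r1 rZ.
have r0 : 0 < r by exact: lt_le_trans r1.
have -> : 56 * C * E4 * s ^+ 2 / r ^+ 2 = 56 * C / r ^+ 2 * s ^+ 2 * E4 by field; rewrite gt_eqF.
rewrite /E4 -EZ; last by apply: tameX; exact: tame_id.
apply: (le_trans (E_norm _)); first exact: tame_P.
apply: E_le; first by apply: tame_norm; exact: tame_P.
  by apply: tameZ; apply: tameX; exact: tame_id.
move=> z; set x := r + _.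
have -> : 56 * C / r ^+ 2 * s ^+ 2 * z ^+ 4 = 56 * C / r ^+ 2 * (x - r) ^+ 4.
  rewrite /x (_ : r + Num.sqrt s * z - r = Num.sqrt s * z); last ring.
  rewrite (_ : (Num.sqrt s * z) ^+ 4 = (Num.sqrt s ^+ 2) ^+ 2 * z ^+ 4); last by ring.
  by rewrite sqr_sqrtr// [RHS]mulrA.
have [Zx|xZ] := leP Z x.
  rewrite hZ// normr0; apply: mulr_ge0; last exact: exprn_even_ge0.
  by apply: divr_ge0; [exact: mulr_ge0|exact: sqr_ge0].
have d2 : r ^+ 2 <= 4 * (x - r) ^+ 2.
  have -> : 4 * (x - r) ^+ 2 = (2 * (r - x)) ^+ 2 by ring.
  rewrite ler_sqr ?nnegrE//; [have := ler_norm Z; lra|exact: ltW|].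
  by have := ler_norm Z; lra.
have r2 : 1 <= r ^+ 2 by rewrite exprn_ege1.
apply: (le_trans (hC x)).
have h1 : 1 + x ^+ 2 <= 14 * (x - r) ^+ 2.
  have : 0 <= (x - r - r) ^+ 2 by exact: sqr_ge0.
  have -> : x ^+ 2 = 2 * (x - r) ^+ 2 + 2 * r ^+ 2 - (x - r - r) ^+ 2 by ring.
  by lra.
apply: (@le_trans _ _ (C * (14 * (x - r) ^+ 2))); first by rewrite ler_wpM2l.
rewrite -(@ler_pM2r _ (r ^+ 2)) ?exprn_gt0//.
have -> : 56 * C / r ^+ 2 * (x - r) ^+ 4 * r ^+ 2 = C * (14 * (x - r) ^+ 2) * (4 * (x - r) ^+ 2).
  by field; rewrite gt_eqF.
by rewrite ler_wpM2l// mulr_ge0// mulr_ge0// sqr_ge0.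
Qed.

Lemma P_cvg_time f f1 f2 r s : smooth2 f f1 f2 -> 0 < s ->
  is_derive s 1 (fun s => P s f r) (2^-1 * P s f2 r).
Proof.
move=> sf s0.
suff c : h^-1 *: (P (h%:A + s) f r - P s f r) @[h --> 0^'] --> 2^-1 * P s f2 r.
  by split; [apply: cvgP c|rewrite /derive; apply: cvg_lim => //].
apply/cvgrPdist_le => e e0; have [d d0 hd] := P_time r sf (ltW s0) e0.
have d0' : 0 < Num.min d s by rewrite lt_min d0.
exists (Num.min d s) => //= y /=; rewrite sub0r normrN lt_min => /andP[yd ys] yn0.
rewrite /GRing.scale/= mulr1.
have hs : 0 <= y + s by have := ler_norm (- y); rewrite normrN; lra.
have := hd _ hs; rewrite addrK => /(_ yd) hb.
set q := P (y + s) f r - P s f r in hb *.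
rewrite (_ : _ - _ = - (y^-1 * (q - y / 2 * P s f2 r))); last by field.
by rewrite normrN normrM normfV ler_pdivrMl ?normr_gt0// [`|y| * e]mulrC.
Qed.

Lemma P_neg s f r : s <= 0 -> P s f r = f r.
Proof. by move=> s0; rewrite -[RHS](P0 f r) /P sqrtr0 ler0_sqrtr. Qed.

(** For negative s the square root is 0 and [P s f] is [f], so continuity at 0 is two-sided and the
    mean value theorem applies on intervals starting at 0. *)
Lemma jcont_time f r : jcont (P^~ f) -> continuous (fun s => P s f r).
Proof.
move=> jc s; apply/cvgrPdist_le => e e0.
have [s0|s0] := leP 0 s; last first.
  exists (- s) => //=; first by rewrite oppr_gt0.
  move=> t /=; rewrite ltr_norml => /andP[h _].
  by rewrite (P_neg f r (ltW s0)) P_neg ?subrr ?normr0 ?ltW//; lra.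
have [d d0 hd] := jc s r s0 e e0; exists d => //= t /= ht.
have [t0|t0] := leP 0 t.
  by rewrite distrC hd// ?subrr ?normr0// distrC.
rewrite (P_neg _ _ (ltW t0)) -(P0 f r) distrC hd// ?subrr ?normr0// sub0r normrN ger0_norm//.
by move: ht; rewrite ltr_norml => /andP[_]; lra.
Qed.

(** Over n equal subintervals the errors of order (t - s)^(3/2) sum to a multiple of n^(-1/2), which
    tends to 0. *)
Lemma subdivision (h : R -> R) (j C : R) : 0 <= C ->
  (forall s t, 0 <= s -> s < t -> h t - h s <= (t - s) * (j + C * Num.sqrt (t - s))) ->
  forall s t, 0 <= s -> s < t -> h t - h s <= j * (t - s).
Proof.
move=> C0 H s t s0 st; apply/ler_addgt0Pr => e e0.
have ts : 0 < t - s by rewrite subr_gt0.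
pose w := (t - s) * C; have w0 : 0 <= w by rewrite mulr_ge0// ltW.
pose b := (e / (w + 1)) ^+ 2; have b0 : 0 < b by rewrite exprn_gt0// divr_gt0// ltr_wpDl.
pose n := (Num.truncn ((t - s) / b)).+1.
have n0 : 0 < n%:R :> R by rewrite ltr0n.
pose d := (t - s) / n%:R; have d0 : 0 < d by rewrite divr_gt0.
have db : d <= b.
  by rewrite /d ler_pdivrMr// mulrC -ler_pdivrMr// ltW// truncnS_gt.
have sd : Num.sqrt d <= e / (w + 1).
  rewrite -[leRHS]ger0_norm; last by rewrite divr_ge0// ltW// ltr_wpDl.
  by rewrite -sqrtr_sqr ler_wsqrtr.
have key k : (k <= n)%N -> h (s + k%:R * d) - h s <= k%:R * (d * (j + C * Num.sqrt d)).
  elim: k => [_|k ih kn]; first by rewrite !mul0r addr0 subrr.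
  have k0 : 0 <= k%:R :> R by rewrite ler0n.
  have := H (s + k%:R * d) (s + k.+1%:R * d).
  rewrite (_ : s + k.+1%:R * d - (s + k%:R * d) = d); last by rewrite -natr1; ring.
  move=> /(_ ltac:(by rewrite addr_ge0// mulr_ge0// ltW)) /(_ ltac:(by rewrite -natr1 ltrD2l mulrDl mul1r ltrDl)).
  have := ih (ltnW kn); set a := h (s + k.+1%:R * d); set c := h (s + _); set q := d * _.
  by rewrite -[k.+1%:R]natr1 mulrDl mul1r; set p := k%:R * q; lra.
have := key n (leqnn _).
have nd : n%:R * d = t - s by rewrite /d mulrC divfK// gt_eqF.
rewrite nd mulrA nd (_ : s + (t - s) = t); last ring.
move=> /le_trans; apply; rewrite mulrDr mulrC lerD2l mulrA -/w.
apply: (@le_trans _ _ (w * (e / (w + 1)))); first by rewrite ler_wpM2l.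
by rewrite mulrA ler_pdivrMr ?ltr_wpDl// mulrC ler_pM2l// lerDl.
Qed.

End Tail.

(** An initial profile u = f - 2 j x with a transversal zero at X. Past Z it is the negative
    constant -A, so that u has a zero at any later time at which u is positive at the origin. *)
Record datum (R : realType) (j : R) (f f1 f2 FF : R -> R) (X A Z : R) : Prop := Datum {
  d_j : 0 < j ;
  d_sf : smooth2 f f1 f2 ;
  d_sF : smooth2 FF f f1 ;
  d_even : forall x : R, f (- x) = f x ;
  d_odd : forall x : R, FF (- x) = - FF x ;
  d_X : 0 < X ;
  d_pos : forall x : R, 0 <= x -> x < X -> 0 < f x - 2 * j * x ;
  d_neg : forall x : R, X <= x -> f x - 2 * j * x <= 0 ;
  d_slope : f1 X < 2 * j ;
  d_A : 0 < A ;
  d_far : forall x : R, Z <= x -> f x = 2 * j * x - A }.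

(** * A single time interval: the zero and the mass *)

Section Piece.
Context {R : realType}.
Implicit Types (r s t x y z e c m : R).
Variables (j : R) (f f1 f2 FF : R -> R).

Definition uu s r := P s f r - 2 * j * r.
Definition uu1 s r := P s f1 r - 2 * j.
(** The integral of [uu s] over [0, r] when [FF] is odd. It solves L_t = L'' / 2 + j, the source j
    being the trace of the flux at the origin. *)
Definition Lam s r := P s FF r - j * r ^+ 2.

Section Smoothness.
Hypotheses (sf : smooth2 f f1 f2) (sF : smooth2 FF f f1).

Lemma uu_derive s r : is_derive r 1 (uu s) (uu1 s r).
Proof.
have d := sm_d1 (smooth2_P s sf) r; rewrite /uu /uu1.
by apply: is_derive_eq; rewrite /GRing.scale/=; ring.
Qed.

Lemma uu1_derive s r : is_derive r 1 (uu1 s) (P s f2 r).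
Proof.
have d := sm_d2 (smooth2_P s sf) r; rewrite /uu1.
by apply: is_derive_eq; rewrite subr0.
Qed.

Lemma Lam_derive s r : is_derive r 1 (Lam s) (uu s r).
Proof.
have d := sm_d1 (smooth2_P s sF) r; rewrite /Lam /uu.
by apply: is_derive_eq; rewrite /GRing.scale/= ?expr1; ring.
Qed.

Lemma uu_continuous s : continuous (uu s).
Proof. exact: derive_continuous (uu_derive s). Qed.

Lemma Lam_continuous s : continuous (Lam s).
Proof. exact: derive_continuous (Lam_derive s). Qed.

End Smoothness.

Lemma uuE s r : tame f -> uu s r = P s (fun x => f x - 2 * j * x) r.
Proof.
move=> tf; rewrite PB//; last by apply: tameZ; exact: tame_id.
by rewrite PZ ?P_id//; exact: tame_id.
Qed.

Lemma uu1E s r : tame f1 -> uu1 s r = P s (fun x => f1 x - 2 * j) r.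
Proof. by move=> tf; rewrite PB ?P_cst//; exact: tame_cst. Qed.

Variables (X A Z : R).
Hypothesis dat : datum j f f1 f2 FF X A Z.
Let sf := d_sf dat.
Let sF := d_sF dat.
Let j0 := d_j dat.
Let X0 := d_X dat.
Let tf := smooth2_tame sf.
Let tf1 := smooth2_tame1 sf.

Lemma ge0_left_limit (g : R -> R) x : continuous g -> 0 < x ->
  (forall r, 0 <= r -> r < x -> 0 < g r) -> 0 <= g x.
Proof.
move=> cg x0 px; apply/ler_addgt0Pl => e e0.
have /cvgrPdist_lt /(_ _ e0) [d /= d0 hd] := cg x.
have m0 : 0 < Num.min (d / 2) x by rewrite lt_min divr_gt0.
have m1 : Num.min (d / 2) x <= d / 2 by rewrite ge_min lexx.
have m2 : Num.min (d / 2) x <= x by rewrite ge_min lexx orbT.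
set mm := Num.min _ _ in m0 m1 m2.
have h1 := px (x - mm / 2) ltac:(lra) ltac:(lra).
have := hd (x - mm / 2); rewrite /ball/=.
move=> /(_ ltac:(by rewrite ltr_norml; apply/andP; split; lra)).
by rewrite ltr_norml => /andP[a b]; lra.
Qed.

Lemma datum_X : f X = 2 * j * X.
Proof.
have h1 := d_neg dat (lexx X).
have cg : continuous (fun x => f x - 2 * j * x).
  move=> x; apply: (@continuousB _ _ _ f (fun x => 2 * j * x)).
    exact: (derive_continuous (sm_d1 sf)).
  by apply: continuousM; [exact: cvg_cst|exact: cvg_id].
have := ge0_left_limit cg X0 (d_pos dat); lra.
Qed.

(** At a zero of u the expression in [transversal] reduces to the slope times a positive factor. *)
Lemma uu_at_zero s r : 0 < s -> 0 < r -> uu s r = 0 -> uu1 s r < 0.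
Proof.
move=> s0 r0 u0.
have := @transversal _ j f f1 X j0 tf tf1 (sm_d1 sf) (d_even dat) X0 _ (d_neg dat) s r _ _ s0 r0 erefl erefl.
rewrite -uuE// -uu1E// u0 !mulr0 subr0 add0r mulrA pmulr_rlt0.
  apply=> x x0 xX; have [xX'|xX'] := ltP x X; first by rewrite ltW// (d_pos dat).
  by have -> : x = X; [apply/eqP; rewrite eq_le xX|rewrite datum_X subrr].
by rewrite mulr_gt0// addr_gt0// gauss_gt0.
Qed.

Lemma gauss_derive s r : 0 < s -> is_derive r 1 (fun r => gauss s r X) (- ((r - X) / s * gauss s r X)).
Proof.
move=> s0; rewrite /gauss; apply: is_derive_eq.
rewrite /GRing.scale/= ?expr1; set a := expR _; set b := Num.sqrt _.
have b0 : b != 0 by rewrite gt_eqF// sqrtr_gt0 !mulr_gt0// pi_gt0.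
by field; rewrite b0 gt_eqF.
Qed.

(** Divide [uu s] by N(r), the sum of the kernels from r and -r to X. The numerator of the
    derivative of the quotient is, up to the factor s, the expression in [transversal]; the quotient
    is strictly decreasing, so once nonpositive it becomes negative. *)
Lemma uu_after s r1 r2 : 0 < s -> 0 <= r1 -> r1 < r2 -> uu s r1 <= 0 -> uu s r2 < 0.
Proof.
move=> s0 r10 r12 u1.
pose N r := gauss s r X + gauss s (- r) X.
have N0 r : 0 < N r by rewrite addr_gt0// gauss_gt0.
have dN r : is_derive r 1 N (- ((r - X) / s * gauss s r X) - (r + X) / s * gauss s (- r) X).
  have -> : N = (fun r => gauss s r X + gauss s (-1 * r) X).
    by apply/funext => y; rewrite mulN1r.
  have d1 := gauss_derive r s0; have d2 := gauss_derive (-1 * r) s0.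
  have d3 : is_derive r 1 (fun r => -1 * r) (-1).
    by apply: is_derive_eq; rewrite /GRing.scale/=; ring.
  have d4 := @is_derive1_comp _ (fun r => gauss s r X) (fun r => -1 * r) r _ _ d2 d3.
  have d5 := is_deriveD d1 d4.
  by apply: is_derive_eq d5 _; rewrite mulN1r; ring.
pose K r := uu s r / N r.
have dK r : is_derive r 1 K ((uu1 s r * N r - uu s r * (- ((r - X) / s * gauss s r X) - (r + X) / s * gauss s (- r) X)) / N r ^+ 2).
  have d1 := uu_derive sf s r; have d2 := dN r.
  have N0r : N r != 0 by rewrite gt_eqF.
  rewrite /K; apply: is_derive_eq.
  move: N0r; set n := N r; set q := _ - _ * gauss _ _ _; rewrite /GRing.scale/= => n0.
  by field.
have cK : continuous K by exact: derive_continuous dK.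
have [c + hc] := MVT r12 (fun z _ => dK z) (continuous_subspaceT cK).
rewrite in_itv/= => /andP[rc _].
have c0 : 0 < c by exact: le_lt_trans rc.
have : K r2 - K r1 < 0.
  rewrite hc pmulr_llt0 ?subr_gt0// pmulr_llt0 ?invr_gt0 ?exprn_gt0//.
  have := @transversal _ j f f1 X j0 tf tf1 (sm_d1 sf) (d_even dat) X0 _ (d_neg dat) s c _ _ s0 c0 erefl erefl.
  rewrite -uuE// -uu1E// => H.
  rewrite -(pmulr_rlt0 _ s0); apply: le_lt_trans (H _).
    rewrite le_eqVlt; apply/orP; left; apply/eqP; rewrite /N; field; rewrite gt_eqF//.
  move=> x x0 xX; have [xX'|xX'] := ltP x X; first by rewrite ltW// (d_pos dat).
  by have -> : x = X; [apply/eqP; rewrite eq_le xX|rewrite datum_X subrr].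
have : K r1 <= 0 by rewrite /K pmulr_lle0// invr_gt0.
move=> k1 k2; have : K r2 < 0 by lra.
by rewrite /K pmulr_llt0// invr_gt0.
Qed.

(** [f x - 2 * j * x + A] vanishes past Z, so by [P_tail] its average tends to 0 far away and [uu s]
    tends to -A. *)
Lemma uu_far s r : 0 <= s -> exists2 r', r <= r' & uu s r' < 0.
Proof.
move=> s0; pose h x := f x - 2 * j * x + A.
have th : tame h.
  apply: tameD; last exact: tame_cst.
  by apply: tameB => //; apply: tameZ; exact: tame_id.
have [C C0 hC] := sm_bd sf.
pose D := `|f 0| + `|f1 0| + C + 2 * j + A.
have A0 := d_A dat.
have D0 : 0 <= D by rewrite /D !addr_ge0// ltW// mulr_gt0.
have hD x : `|h x| <= D * (1 + x ^+ 2).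
  have := taylor2 sf 0 x hC; rewrite add0r => h1.
  have h2 : `|h x| <= `|f 0| + `|f1 0| * `|x| + C * x ^+ 2 + 2 * j * `|x| + A.
    rewrite /h; have -> : f x - 2 * j * x + A = (f x - f 0 - x * f1 0) + f 0 + x * f1 0 + (- (2 * j * x)) + A by ring.
    apply: (le_trans (ler_normD _ _)); apply: lerD; last by rewrite ger0_norm// ltW.
    apply: (le_trans (ler_normD _ _)); apply: lerD; last first.
      by rewrite normrN normrM ger0_norm// mulr_ge0// ltW.
    have := ler_normD (f x - f 0 - x * f1 0 + f 0) (x * f1 0).
    have := ler_normD (f x - f 0 - x * f1 0) (f 0).
    by rewrite normrM; lra.
  apply: (le_trans h2).
  have T : 0 <= 1 + x ^+ 2 - `|x| by rewrite subr_ge0 abs_le_sqr.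
  have := mulr_ge0 (normr_ge0 (f1 0)) T; have := mulr_ge0 (mulr_ge0 (ler0n R 2) (ltW j0)) T.
  have := mulr_ge0 (normr_ge0 (f 0)) (sqr_ge0 x); have := mulr_ge0 (ltW A0) (sqr_ge0 x).
  by rewrite /D; lra.
have hZ x : Z <= x -> h x = 0 by move=> Zx; rewrite /h (d_far dat Zx); ring.
pose B := 56 * D * E4 * s ^+ 2.
have B0 : 0 <= B by rewrite !mulr_ge0// E4_ge0.
pose r' := Num.max (Num.max 1 r) (Num.max (2 * `|Z|) (B / A + 1)).
have r'1 : 1 <= r' by rewrite !le_max lexx.
exists r'; first by rewrite !le_max lexx orbT.
have := P_tail th D0 hD hZ s0 r'1 _.
have -> : P s h r' = uu s r' + A.
  rewrite PD ?P_cst; [by rewrite uuE|by apply: tameB => //; apply: tameZ; exact: tame_id|exact: tame_cst].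
move=> /(_ ltac:(by rewrite !le_max lexx !orbT)).
rewrite -/B ler_norml => /andP[_]; suff : B / r' ^+ 2 < A by lra.
have r'0 : 0 < r' by exact: lt_le_trans r'1.
rewrite ltr_pdivrMr ?exprn_gt0// mulrC -ltr_pdivrMr//.
have h1 : B / A < r'.
  apply: (@lt_le_trans _ _ (B / A + 1)); first by rewrite ltrDl.
  by rewrite !le_max lexx !orbT.
by apply: (lt_le_trans h1); rewrite expr2 ler_peMl// ltW.
Qed.

Definition zero s x := [/\ 0 < x, forall r, 0 <= r -> r < x -> 0 < uu s r &
  forall r, x <= r -> uu s r <= 0].

Lemma zero0 : zero 0 X.
Proof.
split; first exact: X0.
- by move=> r r0 rX; rewrite /uu P0 (d_pos dat).
- by move=> r rX; rewrite /uu P0 (d_neg dat).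
Qed.

Lemma zero_uniq s x y : zero s x -> zero s y -> x = y.
Proof.
move=> [x0 px nx] [y0 py ny]; apply/eqP; rewrite eq_le !leNgt; apply/andP; split; apply/negP => xy.
- by have := px _ (ltW y0) xy; have := ny _ (lexx y); lra.
- by have := py _ (ltW x0) xy; have := nx _ (lexx x); lra.
Qed.

Lemma zero_exists s : 0 < s -> 0 < uu s 0 -> exists x, zero s x.
Proof.
move=> s0 u0; have [b b0 ub] := uu_far 0 (ltW s0).
have v0 : Num.min (uu s 0) (uu s b) <= 0 <= Num.max (uu s 0) (uu s b).
  by rewrite ge_min le_max (ltW u0) (ltW ub) orbT.
have [c + uc] := IVT b0 (continuous_subspaceT (uu_continuous sf (s := s))) v0.
rewrite in_itv/= => /andP[c0 cb].
have c0' : 0 < c by rewrite lt_def c0 andbT; apply/eqP => cE; move: uc u0; rewrite cE => ->; rewrite ltxx.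
exists c; split => //.
- move=> r r0 rc; rewrite ltNge; apply/negP => ur.
  by have := uu_after s0 r0 rc ur; rewrite uc ltxx.
- move=> r; rewrite le_eqVlt => /predU1P[<-|cr]; first by rewrite uc.
  by rewrite ltW// (@uu_after s c)// uc.
Qed.

Lemma zero_eq s x : zero s x -> uu s x = 0.
Proof.
move=> [x0 px nx]; apply/eqP; rewrite eq_le nx//=.
exact: (ge0_left_limit (uu_continuous sf (s := s)) x0 px).
Qed.

Lemma zero_slope s x : 0 <= s -> zero s x -> uu1 s x < 0.
Proof.
rewrite le_eqVlt => /predU1P[<-|s0] zx.
  by rewrite (zero_uniq zx zero0) /uu1 P0 subr_lt0 (d_slope dat).
by have [x0 _ _] := zx; apply: uu_at_zero => //; exact: zero_eq.
Qed.

Lemma Lam0 s : Lam s 0 = 0.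
Proof.
rewrite /Lam expr0n mulr0 subr0; have tF := smooth2_tame sF.
by apply: P_center => // x; rewrite (d_odd dat) subrr mulr0.
Qed.

Lemma Lam_max s x r : zero s x -> 0 <= r -> Lam s r <= Lam s x.
Proof.
move=> [x0 px nx] r0; have cL := continuous_subspaceT (Lam_continuous sF (s := s)).
have [rx|xr|->] := ltgtP r x; last by [].
- have [c + h] := MVT rx (fun z _ => Lam_derive sF s z) (cL _).
  rewrite in_itv/= => /andP[h1 h2].
  rewrite -subr_ge0 h mulr_ge0//; last by rewrite subr_ge0 ltW.
  by rewrite ltW// px// ltW// (le_lt_trans r0).
- have [c + h] := MVT xr (fun z _ => Lam_derive sF s z) (cL _).
  rewrite in_itv/= => /andP[h1 h2].
  rewrite -subr_le0 h mulr_le0_ge0//; last by rewrite subr_ge0 ltW.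
  by rewrite nx// ltW.
Qed.

(** The mass at time s: the maximum of [Lam s], reached at the zero of u. The value 0 covers the
    absence of a zero, so that the mass makes sense before a zero is known to exist. *)
Definition isM s m := (forall r, 0 <= r -> Lam s r <= m) /\
  ((exists2 x, zero s x & Lam s x = m) \/ m = 0).

Lemma isM_exists s : 0 <= s -> exists m, isM s m.
Proof.
move=> s0; have [[x zx]|nz] := pselect (exists x, zero s x).
  by exists (Lam s x); split; [move=> r; exact: Lam_max|left; exists x].
exists 0; split; [|by right].
have s1 : 0 < s by rewrite lt_def s0 andbT; apply/eqP => sE; apply: nz; exists X; rewrite sE; exact: zero0.
have u0 : uu s 0 <= 0 by rewrite leNgt; apply/negP => u0; apply: nz; exact: zero_exists.
move=> r; rewrite le_eqVlt => /predU1P[<-|r0]; first by rewrite Lam0.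
have [c + h] := MVT r0 (fun z _ => Lam_derive sF s z) (continuous_subspaceT (Lam_continuous sF (s := s))).
rewrite in_itv/= => /andP[h1 h2]; move: h; rewrite Lam0 !subr0 => ->.
by rewrite mulr_le0_ge0//; [apply: ltW; exact: uu_after h1 u0|exact: ltW].
Qed.

Lemma isM_uniq s m m' : isM s m -> isM s m' -> m = m'.
Proof.
have half a b : isM s a -> isM s b -> a <= b.
  move=> [_ [[x zx <-]|->]] [h _]; first by apply: h; have [/ltW] := zx.
  by rewrite -(Lam0 s) h.
by move=> h1 h2; apply/eqP; rewrite eq_le !half.
Qed.

(** At the later zero x the new mass is [Lam t x], while [Lam s x] is at most the old one. The time
    derivative of [Lam] at x is half of [P c f1 x] for some intermediate c, and P t f1 x < 2 j
    because u has negative slope at its zero; moving from t to c costs the square root. *)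
Lemma growth : exists2 C : R, 0 <= C & forall s t m m', 0 <= s -> s < t ->
  isM s m -> isM t m' -> m' - m <= (t - s) * (j + C * Num.sqrt (t - s)).
Proof.
have [L L0 hL] := sm_bd sf.
have E1' : 0 <= E1 :> R by exact: E1_ge0.
exists (2^-1 * (L * E1)); first by rewrite !mulr_ge0.
move=> s t m m' s0 st [hm _] [_ hm'].
have t0 : 0 < t by exact: le_lt_trans st.
have ts : 0 < t - s by rewrite subr_gt0.
have rhs0 : 0 <= (t - s) * (j + 2^-1 * (L * E1) * Num.sqrt (t - s)).
  by rewrite mulr_ge0 ?(ltW ts)// addr_ge0 ?(ltW j0)// !mulr_ge0// sqrtr_ge0.
case: hm' => [[x zx <-]|->]; last first.
  have := hm 0 (lexx _); rewrite Lam0; lra.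
have [x0 _ _] := zx.
have := hm _ (ltW x0) => h1.
suff : Lam t x - Lam s x <= (t - s) * (j + 2^-1 * (L * E1) * Num.sqrt (t - s)) by lra.
have -> : Lam t x - Lam s x = P t FF x - P s FF x by rewrite /Lam; ring.
have dP z : z \in `]s, t[ -> is_derive z 1 (fun s => P s FF x) (2^-1 * P z f1 x).
  by rewrite in_itv/= => /andP[sz _]; apply: P_cvg_time sF _; exact: le_lt_trans sz.
have [c + ->] := MVT st dP (continuous_subspaceT (jcont_time (r := x) (smooth2_jcont sF))).
rewrite in_itv/= => /andP[sc ct].
rewrite mulrC ler_wpM2l ?(ltW ts)//.
have c0 : 0 <= c by rewrite (le_trans s0)// ltW.
have hlip a b : `|f1 a - f1 b| <= L * `|a - b|.
  by have := taylor1 sf b (a - b) hL; rewrite (_ : b + (a - b) = a)//; ring.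
have := P_lip_joint x tf1 L0 c0 (ltW t0) hlip.
have := zero_slope (ltW t0) zx; rewrite /uu1 => h2.
rewrite ler_norml => /andP[_ h3].
have h4 : Num.sqrt `|c - t| <= Num.sqrt (t - s).
  by rewrite ler_wsqrtr// ltr0_norm ?subr_lt0//; lra.
have h5 : L * E1 * Num.sqrt `|c - t| <= L * E1 * Num.sqrt (t - s) by rewrite ler_wpM2l// mulr_ge0.
by lra.
Qed.

Lemma mass_growth s t m m' : 0 <= s -> s <= t -> isM s m -> isM t m' -> m' - m <= j * (t - s).
Proof.
move=> s0; rewrite le_eqVlt => /predU1P[<-|st] h1 h2.
  by rewrite (isM_uniq h1 h2) !subrr mulr0.
pose h t := xget 0 [set m | isM t m].
have hP u : 0 <= u -> isM u (h u) by move=> u0; exact/(@xgetPex _ 0 [set m | isM u m])/isM_exists.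
have t0 : 0 <= t by rewrite (le_trans s0)// ltW.
rewrite (isM_uniq h1 (hP _ s0)) (isM_uniq h2 (hP _ t0)).
have [C C0 hC] := growth.
apply: (subdivision C0) => // a b a0 ab; apply: hC => //; first exact: hP.
by apply: hP; rewrite (le_trans a0)// ltW.
Qed.

(* If the mass is back to its initial value at time tau then it never vanished
   before, because it grows at rate at most j. *)
Lemma zero_all tau : 0 <= tau -> j * tau < Lam 0 X -> isM tau (Lam 0 X) ->
  forall s, 0 <= s -> s <= tau -> exists2 x, zero s x & `|Lam s x - Lam 0 X| <= j * tau.
Proof.
move=> tau0 jt hM s s0 st.
have [m hm] := isM_exists s0.
have M0 : isM 0 (Lam 0 X) by split; [move=> r; apply: Lam_max; exact: zero0|left; exists X => //; exact: zero0].
have g1 := mass_growth (lexx 0) s0 M0 hm.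
have g2 := mass_growth s0 st hm hM.
have js : j * s <= j * tau by rewrite ler_wpM2l// ltW.
have js0 : 0 <= j * s by rewrite mulr_ge0// ltW.
rewrite subr0 in g1; rewrite mulrBr in g2.
have [_ [[x zx mE]|m0]] := hm; last by move: g2; rewrite m0; lra.
exists x => //; rewrite mE ler_norml; apply/andP; split; lra.
Qed.

End Piece.

(** * Minima over a region with moving boundary *)

Section ContOn.
Context {R : realType}.
Implicit Types (r s t x y z e c m : R).

Definition cont_on (tau : R) (g : R -> R) := forall s, 0 <= s -> s <= tau -> forall e, 0 < e ->
  exists2 d : R, 0 < d & forall s', 0 <= s' -> s' <= tau -> `|s' - s| < d -> `|g s' - g s| <= e.

Lemma cont_on_within tau g : cont_on tau g -> {within `[0, tau], continuous g}.
Proof.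
move=> cg; apply/subspace_continuousP => s /=; rewrite in_itv/= => /andP[s0 st].
apply/cvgrPdist_le => e e0; have [d d0 hd] := cg s s0 st e e0.
exists d => //= t /= ht; rewrite in_itv/= => /andP[t0 tt].
by rewrite distrC; apply: hd => //; rewrite distrC.
Qed.

Lemma cont_on_bounded tau g : 0 <= tau -> cont_on tau g ->
  exists2 B : R, 0 < B & forall s, 0 <= s -> s <= tau -> `|g s| <= B.
Proof.
move=> tau0 /cont_on_within cg.
have [c _ hc] := EVT_max tau0 cg; have [c' _ hc'] := EVT_min tau0 cg.
exists (`|g c| + `|g c'| + 1); first by rewrite ltr_wpDl// addr_ge0.
move=> s s0 st; have sI : s \in `[0, tau] by rewrite in_itv/= s0.
have h1 := hc _ sI; have h2 := hc' _ sI.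
have := ler_norm (g c); have := ler_norm (- g c'); rewrite normrN => h3 h4.
have h5 := normr_ge0 (g c); have h6 := normr_ge0 (g c').
by rewrite ler_norml; apply/andP; split; lra.
Qed.

(** Rescaling r = q X(s) maps the region to a rectangle, where a minimum exists by compactness; the
    hypothesis excludes that it is negative. *)
Lemma min_region tau (X : R -> R) (G : R -> R -> R) : 0 <= tau -> cont_on tau X ->
  (forall s, 0 <= s -> s <= tau -> 0 < X s) -> jcont G ->
  (forall s r, 0 <= s -> s <= tau -> 0 <= r -> r <= X s -> G s r < 0 ->
     exists s' r', [/\ 0 <= s', s' <= tau, 0 <= r', r' <= X s' & G s' r' < G s r]) ->
  forall s r, 0 <= s -> s <= tau -> 0 <= r -> r <= X s -> 0 <= G s r.
Proof.
move=> tau0 cX X0 cG H s r s0 st r0 rX.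
pose K := `[0, tau]%classic `*` `[0, 1]%classic : set (R * R).
pose g (p : R * R) := G p.1 (p.2 * X p.1).
have cK : compact K by apply: compact_setX; exact: segment_compact.
have cg : {within K, continuous g}.
  apply/subspace_continuousP => -[a b] [/=]; rewrite !in_itv/= => /andP[a0 at_] /andP[b0 b1].
  apply/cvgrPdist_le => e e0.
  have [d d0 hd] := cG a (b * X a) a0 e e0.
  have [B B0 hB] := cont_on_bounded tau0 cX.
  have [d' d'0 hd'] := cX a a0 at_ (d / 4) (divr_gt0 d0 (ltr0Sn _ 3)).
  have dB : 0 < d / 4 / B by rewrite !divr_gt0.
  pose q := Num.min (Num.min d d') (d / 4 / B).
  have q0 : 0 < q by rewrite !lt_min d0 d'0.
  exists (ball a q, ball b q) => /=.
    by split; exact: nbhsx_ballx.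
  move=> [x y] /= [xq yq] [/=]; rewrite !in_itv/= => /andP[x0 xt] /andP[y0 y1].
  move: xq yq; rewrite /ball/= !lt_min => /andP[/andP[h1 h2] _] /andP[_ h3].
  rewrite /from_subspace /g/= distrC; apply: hd => //; first by rewrite distrC.
  have -> : y * X x - b * X a = y * (X x - X a) + (y - b) * X a by ring.
  apply: (le_lt_trans (ler_normD _ _)); rewrite !normrM.
  have k1 : `|y| * `|X x - X a| <= d / 4.
    rewrite -[leRHS]mul1r ler_pM//; first by rewrite ger0_norm.
    by apply: hd' => //; rewrite distrC.
  have k2 : `|y - b| * `|X a| <= d / 4.
    have -> : d / 4 = d / 4 / B * B by rewrite divfK// gt_eqF.
    rewrite ler_pM//; last exact: hB.
    by rewrite distrC ltW.
  lra.
have K0 : K !=set0 by exists (0, 0); split => /=; rewrite in_itv/= lexx/=.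
have [[a b] abK hmin] := compact_EVT_min K0 cK cg.
move: abK; rewrite inE => -[/=]; rewrite !in_itv/= => /andP[a0 at_] /andP[b0 b1].
have Xa := X0 _ a0 at_.
have gab : 0 <= g (a, b).
  rewrite leNgt; apply/negP => gn.
  have [||s' [r' [s'0 s't r'0 r'X lt]]] := H a (b * X a) a0 at_ _ _ gn.
  - by rewrite mulr_ge0// ltW.
  - by rewrite ler_piMl// ltW.
  have Xs' := X0 _ s'0 s't.
  have q01 : 0 <= r' / X s' <= 1 by rewrite divr_ge0 ?(ltW Xs')//= ler_pdivrMr// mul1r.
  have := hmin (s', r' / X s'); rewrite inE /K/= !in_itv/= s'0 s't/= => /(_ (conj isT q01)).
  by rewrite /g/= divfK ?gt_eqF// leNgt lt.
have Xs := X0 _ s0 st.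
have q01 : 0 <= r / X s <= 1 by rewrite divr_ge0 ?(ltW Xs)//= ler_pdivrMr// mul1r.
apply: (le_trans gab); have := hmin (s, r / X s); rewrite inE /K/= !in_itv/= s0 st/= => /(_ (conj isT q01)).
by rewrite /g/= divfK ?gt_eqF.
Qed.

Lemma jcontD u v : jcont u -> jcont v -> jcont (fun s r : R => u s r + v s r).
Proof.
move=> cu cv s r s0 e e0; have e2 : 0 < e / 2 by rewrite divr_gt0.
have [d d0 hd] := cu s r s0 _ e2; have [d' d'0 hd'] := cv s r s0 _ e2.
exists (Num.min d d'); first by rewrite lt_min d0.
move=> s' r' s'0; rewrite !lt_min => /andP[h1 h2] /andP[h3 h4].
have := hd s' r' s'0 h1 h3; have := hd' s' r' s'0 h2 h4.
have := ler_normD (u s' r' - u s r) (v s' r' - v s r).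
rewrite (_ : u s' r' - u s r + (v s' r' - v s r) = u s' r' + v s' r' - (u s r + v s r)); last ring.
lra.
Qed.

Lemma jcontN u : jcont u -> jcont (fun s r : R => - u s r).
Proof.
move=> cu s r s0 e e0; have [d d0 hd] := cu s r s0 _ e0; exists d => // s' r' s'0 h1 h2.
by rewrite -opprD normrN; exact: hd.
Qed.

Lemma jcontB u v : jcont u -> jcont v -> jcont (fun s r : R => u s r - v s r).
Proof. by move=> cu cv; apply: jcontD => //; exact: jcontN. Qed.

Lemma jcont_space (g : R -> R) : continuous g -> jcont (fun _ r : R => g r).
Proof.
move=> cg s r s0 e e0; have /cvgrPdist_le /(_ _ e0) [d /= d0 hd] := cg r.
by exists d => // s' r' _ _ h; rewrite distrC; apply: hd; rewrite /ball/= distrC.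
Qed.

Lemma jcont_lin (c : R) : jcont (fun s _ : R => c * s).
Proof.
move=> s r s0 e e0; exists (e / (`|c| + 1)); first by rewrite divr_gt0// ltr_wpDl.
move=> s' r' _ h _; rewrite -mulrBr normrM.
rewrite ltr_pdivlMr ?ltr_wpDl// in h.
by apply: le_trans (ltW h); rewrite mulrC ler_wpM2l// lerDl.
Qed.

Lemma jcont_shift a u : 0 <= a -> jcont u -> jcont (fun s r : R => u (a + s) r).
Proof.
move=> a0 cu s r s0 e e0; have [d d0 hd] := cu (a + s) r (addr_ge0 a0 s0) e e0.
exists d => // s' r' s'0 h1 h2; apply: hd => //; first exact: addr_ge0.
by rewrite (_ : a + s' - (a + s) = s' - s)//; ring.
Qed.

(** The contrapositive of the first and second order necessary conditions at an interior minimum. *)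
Lemma space_descent (g g1 : R -> R) (g2 r lo hi : R) :
  (forall x, is_derive x 1 g (g1 x)) -> is_derive r 1 g1 g2 ->
  lo < r -> r < hi -> g1 r != 0 \/ g2 < 0 ->
  exists r', [/\ lo <= r', r' <= hi & g r' < g r].
Proof.
move=> dg dg1 lor rhi H.
have first_order y (g' : R) : is_derive r 1 g g' -> g' != 0 -> exists r', [/\ lo <= r', r' <= hi & g r' < g r].
  move=> d gn.
  have /cvgrPdist_lt /(_ (`|g'| / 2)) [|e /= e0 he] : h^-1 *: (g (h%:A + r) - g r) @[h --> 0^'] --> g'.
  - by have [dd <-] := d; exact: dd.
  - by rewrite divr_gt0// normr_gt0.
  pose h := Num.min (e / 2) (Num.min ((r - lo) / 2) ((hi - r) / 2)).
  have h0 : 0 < h by rewrite !lt_min !divr_gt0// subr_gt0.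
  have h1 : h <= e / 2 by rewrite ge_min lexx.
  have h2 : h <= (r - lo) / 2 by rewrite !ge_min lexx orbT.
  have h3 : h <= (hi - r) / 2 by rewrite !ge_min lexx !orbT.
  have [gp|gneg] := ltP 0 g'.
    exists (r - h); split; [lra|lra|].
    have := he (- h); rewrite /ball/= sub0r opprK gtr0_norm// oppr_eq0 gt_eqF//.
    move=> /(_ ltac:(lra) isT); rewrite /GRing.scale/= mulr1 (_ : - h + r = r - h); last ring.
    rewrite (gtr0_norm gp) ltr_norml => /andP[_].
    rewrite invrN mulNr opprK => k.
    have : 0 < - (h^-1 * (g (r - h) - g r)) by lra.
    by rewrite oppr_gt0 pmulr_rlt0 ?invr_gt0// subr_lt0.
  have gn' : g' < 0 by rewrite lt_def eq_sym gn.
  exists (r + h); split; [lra|lra|].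
  have := he h; rewrite /ball/= sub0r normrN gtr0_norm// gt_eqF//.
  move=> /(_ ltac:(lra) isT); rewrite /GRing.scale/= mulr1 (_ : h + r = r + h); last ring.
  rewrite (ltr0_norm gn') ltr_norml => /andP[k _].
  have : h^-1 * (g (r + h) - g r) < 0 by lra.
  by rewrite pmulr_rlt0 ?invr_gt0// subr_lt0.
have [g10|g1n] := eqVneq (g1 r) 0; last exact: (first_order r _ (dg r) g1n).
case: H => [/eqP //|g20].
have /cvgrPdist_lt /(_ (- g2 / 2)) [|e /= e0 he] : h^-1 *: (g1 (h%:A + r) - g1 r) @[h --> 0^'] --> g2.
- by have [dd <-] := dg1; exact: dd.
- by rewrite divr_gt0// oppr_gt0.
pose h := Num.min (e / 2) ((hi - r) / 2).
have h0 : 0 < h by rewrite !lt_min !divr_gt0// subr_gt0.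
have h1 : h <= e / 2 by rewrite ge_min lexx.
have h3 : h <= (hi - r) / 2 by rewrite !ge_min lexx !orbT.
exists (r + h); split; [lra|lra|].
have rh : r < r + h by rewrite ltrDl.
have [c + hc] := MVT rh (fun z _ => dg z) (continuous_subspaceT (derive_continuous dg)).
rewrite in_itv/= => /andP[rc ch].
rewrite -subr_lt0 hc pmulr_llt0 ?subr_gt0//.
have := he (c - r); rewrite /ball/= sub0r normrN gtr0_norm ?subr_gt0// subr_eq0 gt_eqF//.
move=> /(_ ltac:(lra) isT); rewrite /GRing.scale/= mulr1 subrK g10 subr0.
rewrite ltr_norml => /andP[k _].
have k' : (c - r)^-1 * g1 c < 0 by lra.
by move: k'; rewrite pmulr_rlt0// invr_gt0 subr_gt0.
Qed.

Lemma right_descent (g : R -> R) (g' r hi : R) : is_derive r 1 g g' -> g' < 0 -> r < hi ->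
  exists r', [/\ r <= r', r' <= hi & g r' < g r].
Proof.
move=> d gn rhi.
have /cvgrPdist_lt /(_ (- g' / 2)) [|e /= e0 he] : h^-1 *: (g (h%:A + r) - g r) @[h --> 0^'] --> g'.
- by have [dd <-] := d; exact: dd.
- by rewrite divr_gt0// oppr_gt0.
pose h := Num.min (e / 2) ((hi - r) / 2).
have h0 : 0 < h by rewrite !lt_min !divr_gt0// subr_gt0.
have h1 : h <= e / 2 by rewrite ge_min lexx.
have h3 : h <= (hi - r) / 2 by rewrite !ge_min lexx !orbT.
exists (r + h); split; [lra|lra|].
have := he h; rewrite /ball/= sub0r normrN gtr0_norm// gt_eqF//.
move=> /(_ ltac:(lra) isT); rewrite /GRing.scale/= mulr1 (_ : h + r = r + h); last ring.
rewrite ltr_norml => /andP[k _].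
have : h^-1 * (g (r + h) - g r) < 0 by lra.
by rewrite pmulr_rlt0 ?invr_gt0// subr_lt0.
Qed.

Lemma left_descent (g : R -> R) (g' r lo : R) : is_derive r 1 g g' -> 0 < g' -> lo < r ->
  exists r', [/\ lo <= r', r' <= r & g r' < g r].
Proof.
move=> d gp lor.
have d' : is_derive (- r) 1 (fun x => g (- x)) (- g').
  have d1 : is_derive (- r) 1 (fun x : R => - x) (-1) by apply: is_derive_eq.
  have d2 : is_derive (- - r) 1 g g' by rewrite opprK.
  have d3 := @is_derive1_comp _ g (fun x => - x) (- r) _ _ d2 d1.
  by apply: (is_derive_eq d3); rewrite ?mulN1r ?mulrN1.
have [||x [h1 h2 h3]] := right_descent (hi := - lo) d'; rewrite ?oppr_lt0 ?ltrN2//.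
exists (- x); rewrite lerNr h2 lerNl h1; split => //.
by move: h3; rewrite opprK.
Qed.

Lemma time_descent (G : R -> R) (s l q : R) : 0 < s -> 0 < l -> 0 < q ->
  (forall e, 0 < e -> exists2 d : R, 0 < d & forall s', 0 <= s' -> `|s' - s| < d ->
     `|G s' - G s - (s' - s) * l| <= e * `|s' - s|) ->
  exists s', [/\ 0 <= s', s' < s, `|s' - s| < q & G s' < G s].
Proof.
move=> s0 l0 q0 H; have [d d0 hd] := H (l / 2) (divr_gt0 l0 (ltr0Sn _ 1)).
pose h := Num.min (d / 2) (Num.min s (q / 2)).
have h0 : 0 < h by rewrite !lt_min s0 !divr_gt0.
have h1 : h <= d / 2 by rewrite ge_min lexx.
have h2 : h <= s by rewrite !ge_min lexx orbT.
have h3 : h <= q / 2 by rewrite !ge_min lexx !orbT.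
exists (s - h); rewrite (_ : s - h - s = - h); last ring.
rewrite normrN gtr0_norm//; split; [lra|lra|lra|].
have := hd (s - h) ltac:(lra); rewrite (_ : s - h - s = - h); last ring.
rewrite normrN gtr0_norm// => /(_ ltac:(lra)); rewrite ler_norml => /andP[_].
by nra.
Qed.
End ContOn.

(** * Maximum principles *)

Section Comparison.
Context {R : realType}.
Implicit Types (r s t x y z e c m : R) (h f : R -> R).

Lemma E_gt0 f : tame f -> (forall x, 0 < f x) -> 0 < E f.
Proof.
move=> tf f0; have tN := tameZ (-1) tf.
suff : E (fun x => -1 * f x) < 0 by rewrite EZ// mulN1r oppr_lt0.
apply: (@Rintegral_lt0 _ _ 0).
- by apply: gdM_continuous; case: tN.
- exact: tame_integrable.
- by move=> y; rewrite mulN1r mulrN oppr_le0 mulr_ge0 ?gd_ge0// ltW.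
- by rewrite mulN1r mulrN oppr_lt0 mulr_gt0 ?gd_gt0.
Qed.

Lemma P_gt0 s f r : tame f -> (forall x, 0 < f x) -> 0 < P s f r.
Proof. by move=> tf f0; apply: E_gt0 => //; exact: tame_P. Qed.

Section Interior.
Variables (h h1 h2 k k1 k2 q q1 : R -> R) (a b s0 c qq : R).
Hypotheses (sh : smooth2 h h1 h2) (sk : smooth2 k k1 k2) (a0 : 0 <= a) (s00 : 0 <= s0).
Hypothesis dq : forall x, is_derive x 1 q (q1 x).
Hypothesis dq1 : forall x, is_derive x 1 q1 qq.
Hypothesis bq : qq / 2 < b.

(** A difference of two heat flows plus c + b s + q(r). Its time derivative minus half its second
    derivative is b - q'' / 2, positive by [bq]; hence it has no interior minimum at a positive
    time, the final time included. *)
Definition gap s r := P (a + s) h r - P (s0 + s) k r + c + b * s + q r.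

Lemma gap_jcont : jcont gap.
Proof.
apply: jcontD; last first.
  by apply: jcont_space; exact: derive_continuous dq.
apply: jcontD; last exact: jcont_lin.
apply: jcontD; last by apply: (jcont_space (g := fun=> c)) => x; exact: cvg_cst.
apply: jcontB.
  exact: (jcont_shift (u := P^~ h) a0 (smooth2_jcont sh)).
exact: (jcont_shift (u := P^~ k) s00 (smooth2_jcont sk)).
Qed.

Lemma gap_derive s r : is_derive r 1 (gap s) (P (a + s) h1 r - P (s0 + s) k1 r + q1 r).
Proof.
have d1 := sm_d1 (smooth2_P (a + s) sh) r; have d2 := sm_d1 (smooth2_P (s0 + s) sk) r.
have d3 := dq r; rewrite /gap.
by apply: is_derive_eq; rewrite !addr0.
Qed.

Lemma interior_descent s r lo hi e : 0 < s -> lo < r -> r < hi -> 0 < e ->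
  (exists r', [/\ lo <= r', r' <= hi & gap s r' < gap s r]) \/
  (exists s', [/\ 0 <= s', s' < s, `|s' - s| < e & gap s' r < gap s r]).
Proof.
move=> sp lor rhi e0.
pose g1 r := P (a + s) h1 r - P (s0 + s) k1 r + q1 r.
pose g2 := P (a + s) h2 r - P (s0 + s) k2 r + qq.
have dg1 : is_derive r 1 g1 g2.
  have d1 := sm_d2 (smooth2_P (a + s) sh) r; have d2 := sm_d2 (smooth2_P (s0 + s) sk) r.
  by have d3 := dq1 r; rewrite /g1; apply: is_derive_eq.
have [g2n|g2p] := ltP g2 0.
  by left; apply: (space_descent (gap_derive s) dg1) => //; right.
right; have l0 : 0 < P (a + s) h2 r / 2 - P (s0 + s) k2 r / 2 + b.
  by move: g2p bq; rewrite /g2; set A := P _ h2 r; set B := P _ k2 r; lra.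
apply: (time_descent sp l0 e0) => w w0.
have w2 : 0 < w / 2 by rewrite divr_gt0.
have [d d0 hd] := P_time r sh (addr_ge0 a0 (ltW sp)) w2.
have [d' d'0 hd'] := P_time r sk (addr_ge0 s00 (ltW sp)) w2.
exists (Num.min d d'); first by rewrite lt_min d0.
move=> s' s'0; rewrite lt_min => /andP[k1' k2'].
have e1 : a + s' - (a + s) = s' - s by ring.
have e2 : s0 + s' - (s0 + s) = s' - s by ring.
have := hd (a + s') (addr_ge0 a0 s'0); rewrite e1 => /(_ k1').
have := hd' (s0 + s') (addr_ge0 s00 s'0); rewrite e2 => /(_ k2').
set A := P (s0 + s') k r - _ - _; set B := P (a + s') h r - _ - _ => hA hB.
have -> : gap s' r - gap s r - (s' - s) * (P (a + s) h2 r / 2 - P (s0 + s) k2 r / 2 + b) = B - A.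
  by rewrite /gap /A /B; field.
by have := ler_normB B A; lra.
Qed.
End Interior.

Lemma le_of_eta (x T : R) : (forall e, 0 < e -> 0 <= x + e * T) -> 0 <= x.
Proof.
move=> H; have [T0|T0] := leP T 0.
  by have := H 1 ltr01; lra.
by apply/ler_addgt0Pr => e e0; have := H (e / T) (divr_gt0 e0 T0); rewrite divfK ?gt_eqF//; lra.
Qed.

(** [L] is 0 at the origin and has derivative u = 0 at the edge. An upper comparison function must
    thus be nonnegative at 0 and increasing at the edge, which [h1 > 0] ensures since averages keep
    it positive; j (s1 - s0) is the contribution of the source. *)
Definition prop_up (j : R) (X : R -> R) (L : R -> R -> R) s0 s1 :=
  forall h h1 h2 a c, smooth2 h h1 h2 -> 0 <= a ->
  (forall s, 0 <= s -> 0 <= P s h 0 + c) -> (forall x, 0 < h1 x) ->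
  (forall r, 0 <= r -> r <= X s0 -> L s0 r <= P a h r + c) ->
  forall r, 0 <= r -> r <= X s1 -> L s1 r <= P (a + (s1 - s0)) h r + c + j * (s1 - s0).

(** At the edge a bound by the total [L s (X s)] replaces the condition on the slope: an increasing
    comparison function has the wrong slope for a lower bound. *)
Definition prop_low (j : R) (X : R -> R) (L : R -> R -> R) s0 s1 :=
  forall h h1 h2 a c, smooth2 h h1 h2 -> 0 <= a ->
  (forall s, s0 <= s -> s <= s1 -> P (a + (s - s0)) h 0 + c + j * (s - s0) <= 0) ->
  (forall s, s0 <= s -> s <= s1 -> P (a + (s - s0)) h (X s) + c + j * (s - s0) <= L s (X s)) ->
  (forall r, 0 <= r -> r <= X s0 -> P a h r + c <= L s0 r) ->
  forall r, 0 <= r -> r <= X s1 -> P (a + (s1 - s0)) h r + c + j * (s1 - s0) <= L s1 r.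

(** For u itself the slope is given at the origin and the value at the edge: the comparison function
    has slope below -2 j at 0 and is positive at the edge. *)
Definition prop_sup (j : R) (X : R -> R) (u : R -> R -> R) s0 s1 :=
  forall h h1 h2 a, smooth2 h h1 h2 -> 0 <= a ->
  (forall x, 0 < h x) -> (forall s, 0 <= s -> P s h1 0 < - (2 * j)) ->
  (forall r, 0 <= r -> r <= X s0 -> u s0 r <= P a h r) ->
  forall r, 0 <= r -> r <= X s1 -> u s1 r <= P (a + (s1 - s0)) h r.

Section InPiece.
Variables (j : R) (f f1 f2 FF X : R -> R) (tau : R).
Hypothesis j0 : 0 <= j.
Hypotheses (sf : smooth2 f f1 f2) (sF : smooth2 FF f f1).
Hypothesis ef : forall x, f (- x) = f x.
Hypothesis oF : forall x, FF (- x) = - FF x.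
Hypothesis cX : cont_on tau X.
Hypothesis X0 : forall s, 0 <= s -> s <= tau -> 0 < X s.
Hypothesis uX : forall s, 0 <= s -> s <= tau -> uu j f s (X s) = 0.

Lemma shift_cont s0 s1 : 0 <= s0 -> s0 <= s1 -> s1 <= tau -> cont_on (s1 - s0) (fun s => X (s0 + s)).
Proof.
move=> s00 s01 st s sp ss e e0.
have [d d0 hd] := cX (addr_ge0 s00 sp) (ltac:(lra) : s0 + s <= tau) e0.
exists d => // s' s'0 s't h; apply: hd; [lra|lra|].
by rewrite (_ : s0 + s' - (s0 + s) = s' - s)//; ring.
Qed.

Lemma Lam_at0 s : Lam j FF s 0 = 0.
Proof.
rewrite /Lam expr0n mulr0 subr0; have tF := smooth2_tame sF.
by apply: P_center => // x; rewrite oF subrr mulr0.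
Qed.

Lemma odd_derive x : f1 (- x) = - f1 x.
Proof.
have d1 := sm_d1 sf (- x).
have d2 : is_derive x 1 (fun x : R => - x) (-1) by apply: is_derive_eq.
have d3 := @is_derive1_comp _ f (fun x => - x) x _ _ d1 d2.
have d4 := sm_d1 sf x.
have fE : (f \o (fun x => - x)) = f by apply/funext => y /=; exact: ef.
rewrite fE in d3; have [_ e3] := d3; have [_ e4] := d4.
have e5 : f1 (- x) * -1 = f1 x by rewrite -e3 e4.
by rewrite -e5 mulrN1 opprK.
Qed.

Lemma uu1_at0 s : uu1 j f1 s 0 = - (2 * j).
Proof.
rewrite /uu1 (_ : P s f1 0 = 0) ?sub0r//; apply: P_center; first exact: smooth2_tame1 sf.
by move=> x; rewrite odd_derive subrr mulr0.
Qed.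

(* Region argument shared by the three comparisons: it only remains to treat
   the two lateral boundaries. *)
Lemma gap_region (h h1 h2 k k1 k2 q q1 : R -> R) (a b s0 s1 c qq b0 : R) :
  smooth2 h h1 h2 -> smooth2 k k1 k2 -> 0 <= a -> 0 <= s0 -> s0 <= s1 -> s1 <= tau -> 0 <= b0 ->
  (forall x, is_derive x 1 q (q1 x)) -> (forall x, is_derive x 1 q1 qq) -> qq / 2 < b ->
  (forall r, 0 <= r -> r <= X s0 -> 0 <= gap h k q a b b0 c 0 r) ->
  (forall s, 0 <= s -> s <= s1 - s0 -> gap h k q a b b0 c s 0 < 0 ->
     P (a + s) h1 0 - P (b0 + s) k1 0 + q1 0 < 0) ->
  (forall s, 0 <= s -> s <= s1 - s0 -> gap h k q a b b0 c s (X (s0 + s)) < 0 ->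
     0 < P (a + s) h1 (X (s0 + s)) - P (b0 + s) k1 (X (s0 + s)) + q1 (X (s0 + s))) ->
  forall r, 0 <= r -> r <= X s1 -> 0 <= gap h k q a b b0 c (s1 - s0) r.
Proof.
move=> sh sk a0 s00 s01 st b00 dq dq1 bq init left right r r0 rX.
have T0 : 0 <= s1 - s0 by rewrite subr_ge0.
have cX' := shift_cont s00 s01 st.
have X0' s : 0 <= s -> s <= s1 - s0 -> 0 < X (s0 + s) by move=> sp ss; apply: X0; lra.
apply: (min_region T0 cX' X0' (gap_jcont b c sh sk a0 b00 dq)) => //; last by rewrite addrC subrK.
move=> s {r0 rX}r sp ss r0 rX neg.
have s0' : 0 < s.
  rewrite lt_def sp andbT; apply/eqP => sE; move: neg rX; rewrite sE addr0 => neg rX.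
  by have := init r r0 rX; lra.
have dg x : is_derive x 1 (gap h k q a b b0 c s) (P (a + s) h1 x - P (b0 + s) k1 x + q1 x).
  exact: gap_derive sh sk dq _ _.
move: r0; rewrite le_eqVlt => /predU1P[rE|r0].
  have d := dg r; rewrite -rE in neg d.
  have [r' [h3 h4 h5]] := right_descent d (left _ sp ss neg) (X0' _ sp ss).
  by exists s, r'; rewrite -rE; split.
move: rX; rewrite le_eqVlt => /predU1P[rE|rX].
  have d := dg r; rewrite rE in neg d.
  have [r' [h3 h4 h5]] := left_descent d (right _ sp ss neg) (X0' _ sp ss).
  by exists s, r'; rewrite rE; split.
have e0 : 0 < (X (s0 + s) - r) / 2 by rewrite divr_gt0// subr_gt0.
have [d d0 hd] := cX' s sp ss _ e0.
have [[r' [h3 h4 h5]]|[s' [h3 h4 h5 h6]]] := interior_descent c sh sk a0 b00 dq dq1 bq s0' r0 rX d0.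
  by exists s, r'; split.
exists s', r; split => //; [lra|exact: ltW|].
have := hd s' h3 (ltac:(lra)) h5; rewrite ler_norml => /andP[k3 _]; lra.
Qed.

Lemma piece_up s0 s1 : 0 <= s0 -> s0 <= s1 -> s1 <= tau -> prop_up j X (Lam j FF) s0 s1.
Proof.
move=> s00 s01 st h h1 h2 a c sh a0 h0 h1p init r r0 rX.
rewrite -subr_ge0; apply: (@le_of_eta _ (s1 - s0)) => e e0.
(* Here q = j r^2 comes from [Lam], and b = j + e exceeds q'' / 2 = j by an amount that [le_of_eta]
   sends to 0. *)
have := @gap_region h h1 h2 FF f f1 (fun r => j * r ^+ 2) (fun r => 2 * j * r) a (j + e) s0 s1 c (2 * j) s0
  sh sF a0 s00 s01 st s00.
rewrite /gap => H; have := H _ _ _ _ _ _ r r0 rX.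
rewrite (_ : s0 + (s1 - s0) = s1); last ring.
rewrite /Lam; set A := P _ h r; set B := P _ FF r => K.
suff : 0 <= A - B + c + (j + e) * (s1 - s0) + j * r ^+ 2 by lra.
apply: K.
- by move=> x; apply: is_derive_eq; rewrite /GRing.scale/= ?expr1; ring.
- by move=> x; apply: is_derive_eq; rewrite /GRing.scale/=; ring.
- lra.
- by move=> y y0 yX; have := init y y0 yX; rewrite !addr0 mulr0 /Lam; lra.
- move=> s sp ss neg; exfalso; move: neg; apply/negP; rewrite -leNgt.
  have := Lam_at0 (s0 + s); rewrite /Lam expr0n mulr0 subr0 => ->.
  have := h0 (a + s) (addr_ge0 a0 sp).
  have : 0 <= (j + e) * s by rewrite mulr_ge0// addr_ge0// ltW.
  by rewrite subr0 addr0; lra.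
- move=> s sp ss _.
  have := uX (s := s0 + s) ltac:(lra) ltac:(lra); rewrite /uu => u0.
  have := P_gt0 (a + s) (X (s0 + s)) (smooth2_tame1 sh) h1p; lra.
Qed.

Lemma piece_low s0 s1 : 0 <= s0 -> s0 <= s1 -> s1 <= tau -> prop_low j X (Lam j FF) s0 s1.
Proof.
move=> s00 s01 st h h1 h2 a c sh a0 left right init r r0 rX.
rewrite -subr_ge0; apply: (@le_of_eta _ (s1 - s0)) => e e0.
have := @gap_region FF f f1 h h1 h2 (fun r => - (j * r ^+ 2)) (fun r => - (2 * j * r)) s0 (- j + e) s0 s1 (- c) (- (2 * j)) a
  sF sh s00 s00 s01 st a0.
rewrite /gap => H; have := H _ _ _ _ _ _ r r0 rX.
rewrite (_ : s0 + (s1 - s0) = s1); last ring.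
rewrite /Lam; set A := P _ h r; set B := P _ FF r => K.
suff : 0 <= B - A - c + (- j + e) * (s1 - s0) - j * r ^+ 2 by lra.
apply: K.
- by move=> x; apply: is_derive_eq; rewrite /GRing.scale/= ?expr1; ring.
- by move=> x; apply: is_derive_eq; rewrite /GRing.scale/=; ring.
- lra.
- by move=> y y0 yX; have := init y y0 yX; rewrite !addr0 mulr0 /Lam; lra.
- move=> s sp ss neg; exfalso; move: neg; apply/negP; rewrite -leNgt.
  have := Lam_at0 (s0 + s); rewrite /Lam expr0n mulr0 subr0 => ->.
  have := left (s0 + s) ltac:(lra) ltac:(lra); rewrite (_ : s0 + s - s0 = s); last ring.
  have : 0 <= e * s by rewrite mulr_ge0// ltW.
  by lra.
- move=> s sp ss neg; exfalso; move: neg; apply/negP; rewrite -leNgt.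
  have := right (s0 + s) ltac:(lra) ltac:(lra); rewrite (_ : s0 + s - s0 = s) /Lam; last ring.
  have : 0 <= e * s by rewrite mulr_ge0// ltW.
  by lra.
Qed.

Lemma piece_sup s0 s1 : 0 <= s0 -> s0 <= s1 -> s1 <= tau -> prop_sup j X (uu j f) s0 s1.
Proof.
move=> s00 s01 st h h1 h2 a sh a0 h0 h1n init r r0 rX.
rewrite -subr_ge0; apply: (@le_of_eta _ (s1 - s0)) => e e0.
have := @gap_region h h1 h2 f f1 f2 (fun r => 2 * j * r) (fun r => 2 * j) a e s0 s1 0 0 s0
  sh sf a0 s00 s01 st s00.
rewrite /gap => H; have := H _ _ _ _ _ _ r r0 rX.
rewrite (_ : s0 + (s1 - s0) = s1); last ring.
rewrite /uu; set A := P _ h r; set B := P _ f r => K.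
suff : 0 <= A - B + 0 + e * (s1 - s0) + 2 * j * r by lra.
apply: K.
- by move=> x; apply: is_derive_eq; rewrite /GRing.scale/=; ring.
- by rewrite mul0r.
- by move=> y y0 yX; have := init y y0 yX; rewrite !addr0 mulr0 /uu; lra.
- move=> s sp ss _; have := uu1_at0 (s0 + s); rewrite /uu1.
  by have := h1n (a + s) (addr_ge0 a0 sp); lra.
- move=> s sp ss neg; exfalso; move: neg; apply/negP; rewrite -leNgt.
  have := uX (s := s0 + s) ltac:(lra) ltac:(lra); rewrite /uu => u0.
  have := P_gt0 (a + s) (X (s0 + s)) (smooth2_tame sh) h0.
  have : 0 <= e * s by rewrite mulr_ge0// ltW.
  by lra.
Qed.
End InPiece.
End Comparison.

(** * Evolutions and the motion of the edge *)

Section Evolution.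
Context {R : realType}.
Implicit Types (r s t x y z e c m d : R).

(** Compared with [piecewise_C1], the derivative also has a left limit at T, so that T can become an
    interior time after gluing. *)
Definition pC1 (T : R) (X : R -> R) : Prop :=
  (exists2 D : set R, finite_set D & forall t, 0 < t -> t < T -> ~ D t ->
     derivable X t 1 /\ {for t, continuous (X^`())%classic}) /\
  (forall t, 0 <= t -> t < T -> exists l : R, (X^`())%classic s @[s --> t^'+] --> l) /\
  (forall t, 0 < t -> t <= T -> exists l : R, (X^`())%classic s @[s --> t^'-] --> l).

(* The last three clauses are the maximum principles for u and its primitive L;
   in this form, with comparison functions solving the heat equation on the whole
   line, they survive the gluing of successive evolutions. *)
Record evol (j eps T : R) (X : R -> R) (u u1 u2 L : R -> R -> R) : Prop := Evol {
  ev_pos : forall t, 0 <= t -> t <= T -> 0 < X t ;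
  ev_lip : exists2 k : R, 0 <= k & forall s t, 0 <= s -> s <= T -> 0 <= t -> t <= T ->
    `|X s - X t| <= k * `|s - t| ;
  ev_C1 : pC1 T X ;
  ev_du : forall t r, 0 <= t -> t <= T -> is_derive r 1 (u t) (u1 t r) ;
  ev_du1 : forall t r, 0 <= t -> t <= T -> is_derive r 1 (u1 t) (u2 t r) ;
  ev_cu2 : forall t, 0 <= t -> t <= T -> continuous (u2 t) ;
  ev_dL : forall t r, 0 <= t -> t <= T -> is_derive r 1 (L t) (u t r) ;
  ev_L0 : forall t, 0 <= t -> t <= T -> L t 0 = 0 ;
  ev_neumann : forall t, 0 <= t -> t <= T -> u1 t 0 = - (2 * j) ;
  ev_ge0 : forall t r, 0 <= t -> t <= T -> 0 <= r -> r <= X t -> 0 <= u t r ;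
  ev_dir : forall t, 0 <= t -> t <= T -> u t (X t) = 0 ;
  ev_time : forall t r, 0 <= t -> t <= T -> 0 <= r -> r <= X t -> forall e, 0 < e ->
    exists2 d, 0 < d & forall s, 0 <= s -> s <= T -> r <= X s -> `|s - t| < d ->
      `|u s r - u t r - (s - t) / 2 * u2 t r| <= e * `|s - t| ;
  ev_mass : forall t, 0 <= t -> t <= T -> `|L t (X t) - L 0 (X 0)| <= eps ;
  ev_up : forall s t, 0 <= s -> s <= t -> t <= T -> prop_up j X L s t ;
  ev_low : forall s t, 0 <= s -> s <= t -> t <= T -> prop_low j X L s t ;
  ev_sup : forall s t, 0 <= s -> s <= t -> t <= T -> prop_sup j X u s t }.

Lemma jcont_cont_on T u (X : R -> R) : jcont u -> cont_on T X -> cont_on T (fun s => u s (X s)).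
Proof.
move=> cu cX s s0 sT e e0; have [d d0 hd] := cu s (X s) s0 e e0.
have [d' d'0 hd'] := cX s s0 sT (d / 2) (divr_gt0 d0 (ltr0Sn _ 1)).
exists (Num.min d d'); first by rewrite lt_min d0.
move=> s' s'0 s'T; rewrite lt_min => /andP[h1 h2]; apply: hd => //.
by apply: (le_lt_trans (hd' _ s'0 s'T h2)); rewrite ltr_pdivrMr// ltr_pMr// ltr1n.
Qed.

Lemma cont_on_ratio T a b : cont_on T a -> cont_on T b -> (forall s, 0 <= s -> s <= T -> b s != 0) ->
  cont_on T (fun s => a s / b s).
Proof.
move=> ca cb b0 s s0 sT e e0; have bs := b0 s s0 sT.
have nb : 0 < `|b s| by rewrite normr_gt0.
pose K := `|a s| + `|b s|.
have K0 : 0 < K by rewrite ltr_wpDl.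
pose q := Num.min (`|b s| / 2) (e * `|b s| ^+ 2 / (2 * K)).
have q0 : 0 < q by rewrite lt_min !divr_gt0 ?mulr_gt0 ?exprn_gt0.
have [d d0 hd] := ca s s0 sT q q0; have [d' d'0 hd'] := cb s s0 sT q q0.
exists (Num.min d d'); first by rewrite lt_min d0.
move=> s' s'0 s'T; rewrite lt_min => /andP[h1 h2].
have k1 := hd _ s'0 s'T h1; have k2 := hd' _ s'0 s'T h2.
have b's := b0 s' s'0 s'T.
have q1 : q <= `|b s| / 2 by rewrite ge_min lexx.
have q2 : q <= e * `|b s| ^+ 2 / (2 * K) by rewrite ge_min lexx orbT.
have nb' : `|b s| / 2 <= `|b s'|.
  have := ler_normD (b s - b s') (b s'); rewrite subrK distrC; lra.
rewrite (_ : a s' / b s' - a s / b s = ((a s' - a s) * b s - a s * (b s' - b s)) / (b s' * b s)); last first.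
  by field; rewrite b's bs.
rewrite normrM normfV normrM ler_pdivrMr; last by rewrite mulr_gt0// normr_gt0.
apply: (le_trans (ler_normB _ _)); rewrite !normrM.
apply: (@le_trans _ _ (q * K)).
  rewrite /K mulrDr addrC; apply: lerD; first by rewrite mulrC ler_wpM2r.
  by rewrite ler_wpM2r.
rewrite ler_pdivlMr ?mulr_gt0// in q2.
apply: (@le_trans _ _ (e * (`|b s| / 2 * `|b s|))).
  by rewrite expr2 in q2; lra.
by rewrite ler_wpM2l ?(ltW e0)// ler_wpM2r.
Qed.

Section OnePiece.
Variables (j : R) (f f1 f2 FF : R -> R) (X A Z tau : R).
Hypothesis dat : datum j f f1 f2 FF X A Z.
Hypothesis tau0 : 0 < tau.
Hypothesis hz : forall s, 0 <= s -> s <= tau -> exists x, zero j f s x.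
Let sf := d_sf dat.
Let sF := d_sF dat.
Let j0 := d_j dat.
Notation u := (uu j f).
Notation u1 := (uu1 j f1).
Notation L := (Lam j FF).

Definition edgec s := xget 0 [set x | zero j f s x].

Lemma edgecP s : 0 <= s -> s <= tau -> zero j f s (edgec s).
Proof. by move=> s0 st; exact/(@xgetPex _ 0 [set x | zero j f s x])/hz. Qed.

Lemma edgec0 : edgec 0 = X.
Proof. exact: zero_uniq (edgecP (lexx 0) (ltW tau0)) (zero0 dat). Qed.

Lemma uu_jcont : jcont u.
Proof.
apply: jcontB; first exact: smooth2_jcont sf.
by apply: (jcont_space (g := fun x => 2 * j * x)); exact: mulrl_continuous.
Qed.

Lemma uu1_jcont : jcont u1.
Proof.
apply: jcontB; first exact: ucont_jcont (smooth2_tame1 sf) (sm_uc sF).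
by apply: (jcont_space (g := fun=> 2 * j)) => x; exact: cvg_cst.
Qed.

Lemma edgec_slope s : 0 <= s -> s <= tau -> u1 s (edgec s) < 0.
Proof. by move=> s0 st; apply: (zero_slope dat) => //; exact: edgecP. Qed.

Lemma edgec_eq0 s : 0 <= s -> s <= tau -> u s (edgec s) = 0.
Proof. by move=> s0 st; apply: (zero_eq dat); exact: edgecP. Qed.

Lemma edgec_gt0 s : 0 <= s -> s <= tau -> 0 < edgec s.
Proof. by move=> s0 st; have [] := edgecP s0 st. Qed.

(** Just left of the zero u is positive, and by the negative slope it is negative at some point just
    right of it; both signs persist at nearby times and trap the zero. *)
Lemma edgec_cont : cont_on tau edgec.
Proof.
move=> s s0 st e e0; set x := edgec s.
have x0 : 0 < x by exact: edgec_gt0.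
have [_ px nx] := edgecP s0 st; rewrite -/x in px nx.
pose q := Num.min e x / 2.
have q0 : 0 < q by rewrite divr_gt0// lt_min e0.
have qe : q <= e / 2 by rewrite ler_pM2r ?invr_gt0// ge_min lexx.
have qx : q <= x / 2 by rewrite ler_pM2r ?invr_gt0// ge_min lexx orbT.
have ul : 0 < u s (x - q) by apply: px; lra.
have [r [xr rh ur]] := right_descent (uu_derive j sf s x) (edgec_slope s0 st) (ltac:(lra) : x < x + q).
rewrite (edgec_eq0 s0 st) in ur.
have [d d0 hd] := uu_jcont (x - q) s0 (divr_gt0 ul (ltr0Sn _ 1)).
have ur' : 0 < - u s r / 2 by lra.
have [d' d'0 hd'] := uu_jcont r s0 ur'.
exists (Num.min d d'); first by rewrite lt_min d0.
move=> s' s'0 s't; rewrite lt_min => /andP[h1 h2].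
have := hd s' (x - q) s'0 h1; rewrite subrr normr0 => /(_ d0).
have := hd' s' r s'0 h2; rewrite subrr normr0 => /(_ d'0).
rewrite !ler_norml => /andP[_ k1] /andP[k2 _].
have [x'0 px' nx'] := edgecP s'0 s't.
have low : x - q <= edgec s'.
  by rewrite leNgt; apply/negP => lt; have := nx' _ (ltW lt); lra.
have up : edgec s' <= r.
  by rewrite leNgt; apply/negP => lt; have := px' r (ltac:(lra)) lt; lra.
by apply/andP; split; lra.
Qed.

(** The implicit function theorem: X' = - u_t / u_r at the edge, with u_t = u'' / 2. *)
Definition velo s := - (P s f2 (edgec s) / 2) / u1 s (edgec s).

Lemma edgec_derive s : 0 <= s -> s <= tau -> forall e, 0 < e ->
  exists2 d, 0 < d & forall s', 0 <= s' -> s' <= tau -> `|s' - s| < d ->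
    `|edgec s' - edgec s - (s' - s) * velo s| <= e * `|s' - s|.
Proof.
move=> s0 st e e0; pose x : R := edgec s; pose b : R := u1 s x; pose al : R := P s f2 x / 2.
have b0 : b < 0 by exact: edgec_slope.
rewrite -/x.
pose q := Num.min 1 (e * `|b| / 2).
have nb : 0 < `|b| by rewrite normr_gt0 lt_eqF.
have q0 : 0 < q by rewrite lt_min ltr01/= divr_gt0// mulr_gt0.
have q1 : q <= 1 by rewrite ge_min lexx.
have q2 : q <= e * `|b| / 2 by rewrite ge_min lexx orbT.
pose B : R := `|al| + 1.
have B0 : 0 < B by rewrite ltr_wpDl.
pose q' := Num.min (`|b| / 2) (e * `|b| ^+ 2 / (4 * B)).
have q'0 : 0 < q' by rewrite lt_min !divr_gt0 ?mulr_gt0// ?exprn_gt0.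
have q'1 : q' <= `|b| / 2 by rewrite ge_min lexx.
have q'2 : q' <= e * `|b| ^+ 2 / (4 * B) by rewrite ge_min lexx orbT.
have [d1 d10 hd1] := P_time x sf s0 q0.
have [d2 d20 hd2] := uu1_jcont x s0 q'0.
have [d3 d30 hd3] := edgec_cont s0 st (divr_gt0 d20 (ltr0Sn _ 1)).
exists (Num.min d1 (Num.min d2 d3)); first by rewrite !lt_min d10 d20.
move=> s' s'0 s't; rewrite !lt_min => /andP[k1 /andP[k2 k3]].
pose x' : R := edgec s'; pose D : R := s' - s; rewrite -/x' -/D.
have w1 : `|u s' x - D * al| <= q * `|D|.
  have := hd1 s' s'0 k1; rewrite -/D.
  have := edgec_eq0 s0 st; rewrite -/x /uu => ux.
  by rewrite (_ : P s' f x - P s f x - D / 2 * P s f2 x = P s' f x - 2 * j * x - D * al)//; rewrite /al; lra.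
have xx' : `|x' - x| < d2.
  by apply: (le_lt_trans (hd3 _ s'0 s't k3)); rewrite ltr_pdivrMr// ltr_pMr// ltr1n.
have w2 : `|- u s' x - b * (x' - x)| <= q' * `|x' - x|.
  have ux' : u s' x' = 0 by exact: edgec_eq0.
  pose g y := u s' y - b * y.
  have dg y : is_derive y 1 g (u1 s' y - b).
    by have d := uu_derive j sf s' y; apply: is_derive_eq; rewrite /GRing.scale/=; ring.
  have := @MVT_norm _ g _ x x' q' dg.
  have -> : g x' - g x = - u s' x - b * (x' - x).
    by rewrite /g ux'; move: (u s' x) => p; ring.
  apply=> y hy; have := hd2 s' y s'0 k2; rewrite /b; apply.
  exact: le_lt_trans hy xx'.
have w3 : `|b * (x' - x) + D * al| <= q * `|D| + q' * `|x' - x|.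
  rewrite (_ : b * (x' - x) + D * al = - (u s' x - D * al) - (- u s' x - b * (x' - x))); last ring.
  by apply: (le_trans (ler_normB _ _)); rewrite normrN; lra.
(* A crude bound of x' - x by a multiple of D, obtained by absorbing half of |b| |x' - x|; it turns
   the linearisation error q' |x' - x| into one of order |D|. *)
have w4 : `|b| * `|x' - x| <= 2 * B * `|D|.
  have : `|b * (x' - x)| <= `|b * (x' - x) + D * al| + `|D * al|.
    by rewrite -{1}(addrK (D * al) (b * (x' - x))); exact: ler_normB.
  rewrite (normrM b (x' - x)) (normrM D al) => h.
  have : q' * `|x' - x| <= `|b| / 2 * `|x' - x| by rewrite ler_wpM2r.
  have : q * `|D| <= 1 * `|D| by rewrite ler_wpM2r.
  by rewrite /B; lra.
rewrite -(ler_pM2l nb) -normrM /velo -/x -/b -/al.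
rewrite (_ : b * (x' - x - D * (- al / b)) = b * (x' - x) + D * al); last by field; rewrite lt_eqF.
apply: (le_trans w3).
have w5 : q' * `|x' - x| <= e * `|b| / 2 * `|D|.
  rewrite -(ler_pM2r nb).
  apply: (@le_trans _ _ (q' * (2 * B * `|D|))).
    have -> : q' * `|x' - x| * `|b| = q' * (`|b| * `|x' - x|) by ring.
    by apply: ler_wpM2l w4; exact: ltW.
  rewrite ler_pdivlMr ?mulr_gt0// in q'2.
  have : q' * (4 * B) * `|D| <= e * `|b| ^+ 2 * `|D| by rewrite ler_wpM2r.
  by rewrite expr2; lra.
have : q * `|D| <= e * `|b| / 2 * `|D| by rewrite ler_wpM2r.
lra.
Qed.

Lemma velo_cont : cont_on tau velo.
Proof.
apply: cont_on_ratio.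
- apply: (@jcont_cont_on _ (fun s x => - (P s f2 x / 2)) edgec); last exact: edgec_cont.
  apply: jcontN => s r s0 e e0.
  have [d d0 hd] := ucont_jcont (smooth2_tame2 sf) (sm_uc sf) r s0 e0.
  exists d => // s' r' s'0 h1 h2; rewrite -mulrBl normrM (@ger0_norm _ 2^-1)//.
  have := hd s' r' s'0 h1 h2; have := normr_ge0 (P s' f2 r' - P s f2 r); lra.
- exact: jcont_cont_on uu1_jcont edgec_cont.
- by move=> s s0 st; rewrite lt_eqF// edgec_slope.
Qed.

Lemma edgec_is_derive s : 0 < s -> s < tau -> is_derive s 1 edgec (velo s).
Proof.
move=> s0 st.
suff c : h^-1 *: (edgec (h%:A + s) - edgec s) @[h --> 0^'] --> velo s.
  by split; [apply: cvgP c|rewrite /derive; apply: cvg_lim => //].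
apply/cvgrPdist_le => e e0; have [d d0 hd] := edgec_derive (ltW s0) (ltW st) e0.
have d0' : 0 < Num.min d (Num.min s (tau - s)) by rewrite !lt_min d0 s0 subr_gt0.
exists (Num.min d (Num.min s (tau - s))) => //= y /=; rewrite sub0r normrN !lt_min.
move=> /andP[yd /andP[ys yt]] yn0.
rewrite /GRing.scale/= mulr1.
have := ler_norm (- y); have := ler_norm y; rewrite normrN => n1 n2.
have := hd (y + s) (ltac:(lra)) (ltac:(lra)); rewrite addrK => /(_ yd) hb.
set q := edgec (y + s) - edgec s in hb *.
rewrite (_ : velo s - y^-1 * q = - (y^-1 * (q - y * velo s))); last by field.
by rewrite normrN normrM normfV ler_pdivrMl ?normr_gt0// [`|y| * e]mulrC.
Qed.

Lemma edgec_lip : exists2 k : R, 0 <= k & forall s t, 0 <= s -> s <= tau -> 0 <= t -> t <= tau ->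
    `|edgec s - edgec t| <= k * `|s - t|.
Proof.
have [B B0 hB] := cont_on_bounded (ltW tau0) velo_cont.
exists B; first exact: ltW.
have half s t : 0 <= s -> s < t -> t <= tau -> `|edgec t - edgec s| <= B * `|t - s|.
  move=> s0 st tt.
  have cw : {within `[s, t], continuous edgec}.
    apply: (@continuous_subspaceW _ _ _ `[0, tau]); last exact: cont_on_within edgec_cont.
    by move=> x /=; rewrite !in_itv/= => /andP[h1 h2]; apply/andP; split; lra.
  have dw x : x \in `]s, t[ -> is_derive x 1 edgec (velo x).
    by rewrite in_itv/= => /andP[h1 h2]; apply: edgec_is_derive; lra.
  have [c + ->] := MVT st dw cw; rewrite in_itv/= => /andP[h1 h2].
  by rewrite normrM ler_wpM2r// hB; lra.
move=> s t s0 st t0 tt; have [lt|lt|->] := ltgtP s t.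
- by rewrite distrC [`|s - t|]distrC half.
- by rewrite half.
- by rewrite !subrr normr0 mulr0.
Qed.

Lemma edgec_pC1 : pC1 tau edgec.
Proof.
have vE s : 0 < s -> s < tau -> (edgec^`())%classic s = velo s.
  by move=> s0 st; rewrite derive1E; have [_ ->] := edgec_is_derive s0 st.
have near_velo s : 0 <= s -> s <= tau -> forall e, 0 < e -> exists2 d, 0 < d &
    forall s', 0 < s' -> s' < tau -> `|s' - s| < d -> `|velo s - (edgec^`())%classic s'| <= e.
  move=> s0 st e e0; have [d d0 hd] := velo_cont s0 st e0; exists d => // s' h1 h2 h3.
  by rewrite vE// distrC; apply: hd => //; exact: ltW.
split; [|split].
- exists set0 => // t t0 tt _; split; first by have [] := edgec_is_derive t0 tt.
  rewrite /prop_for /continuous_at vE//; apply/cvgrPdist_le => e e0.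
  have [d d0 hd] := near_velo t (ltW t0) (ltW tt) e e0.
  have q0 : 0 < Num.min d (Num.min t (tau - t)) by rewrite !lt_min d0 t0 subr_gt0.
  exists (Num.min d (Num.min t (tau - t))) => //= s /=; rewrite !lt_min => /andP[h1 /andP[h2 h3]].
  have n2 := ler_norm (t - s); have := ler_norm (s - t); rewrite distrC => n1.
  by apply: hd; [lra|lra|rewrite distrC].
- move=> t t0 tt; exists (velo t); apply/cvgrPdist_le => e e0.
  have [d d0 hd] := near_velo t t0 (ltW tt) e e0.
  have q0 : 0 < Num.min d (tau - t) by rewrite !lt_min d0 subr_gt0.
  exists (Num.min d (tau - t)) => //= s /=; rewrite !lt_min => /andP[h1 h2] ts.
  have := ler_norm (s - t); rewrite distrC => n1.
  by apply: hd; [lra|lra|rewrite distrC].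
- move=> t t0 tt; exists (velo t); apply/cvgrPdist_le => e e0.
  have [d d0 hd] := near_velo t (ltW t0) tt e e0.
  have q0 : 0 < Num.min d t by rewrite !lt_min d0.
  exists (Num.min d t) => //= s /=; rewrite !lt_min => /andP[h1 h2] ts.
  have := ler_norm (t - s) => n1.
  by apply: hd; [lra|lra|rewrite distrC].
Qed.

Lemma piece_evol (eps : R) : (forall s, 0 <= s -> s <= tau -> `|L s (edgec s) - L 0 (edgec 0)| <= eps) ->
  evol j eps tau edgec u u1 (fun s => P s f2) L.
Proof.
move=> hm; split => //.
- exact: edgec_gt0.
- exact: edgec_lip.
- exact: edgec_pC1.
- by move=> t r _ _; exact: (uu_derive j sf).
- by move=> t r _ _; exact: (uu1_derive j sf).
- by move=> t _ _; exact: smooth2_c2 (smooth2_P t sf).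
- by move=> t r _ _; exact: (Lam_derive j sF).
- by move=> t _ _; exact: (Lam0 dat).
- by move=> t _ _; apply: (uu1_at0 j sf (d_even dat)).
- move=> t r t0 tt r0; rewrite le_eqVlt => /predU1P[->|rX]; first by rewrite edgec_eq0.
  by have [_ px _] := edgecP t0 tt; rewrite ltW// px.
- exact: edgec_eq0.
- move=> t r t0 tt r0 rX e e0; have [d d0 hd] := P_time r sf t0 e0.
  exists d => // s s0 st _ h; have := hd s s0 h; rewrite /uu.
  by rewrite (_ : P s f r - 2 * j * r - (P t f r - 2 * j * r) = P s f r - P t f r)//; ring.
- move=> s t s0 st tt; apply: (piece_up (ltW j0) sF (d_odd dat) edgec_cont (@edgec_gt0) (@edgec_eq0)) => //.
- move=> s t s0 st tt; apply: (piece_low sF (d_odd dat) edgec_cont (@edgec_gt0)) => //.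
- move=> s t s0 st tt; apply: (piece_sup sf (d_even dat) edgec_cont (@edgec_gt0) (@edgec_eq0)) => //.
Qed.

End OnePiece.
End Evolution.

(** * Gluing successive evolutions *)

Section PropTransitivity.
Context {R : realType}.
Implicit Types (r s t x y z e c m d : R).

(** The age a of the comparison function [P a h] is free, so the conclusion at s1 is again an
    admissible starting bound, with age a + (s1 - s0) and constant c + j (s1 - s0). *)
Lemma prop_up_trans (j : R) (X : R -> R) L s0 s1 s2 : 0 <= j -> s0 <= s1 -> s1 <= s2 ->
  prop_up j X L s0 s1 -> prop_up j X L s1 s2 -> prop_up j X L s0 s2.
Proof.
move=> j0 s01 s12 p q h h1 h2 a c sh a0 h0 h1p init r r0 rX.
have js : 0 <= j * (s1 - s0) by rewrite mulr_ge0// subr_ge0.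
rewrite (_ : _ + c + j * (s2 - s0) = P (a + (s1 - s0) + (s2 - s1)) h r + (c + j * (s1 - s0)) + j * (s2 - s1)); last first.
  by rewrite (_ : a + (s1 - s0) + (s2 - s1) = a + (s2 - s0)); ring.
apply: (q h h1 h2) => //; first lra.
- by move=> s s0'; have := h0 s s0'; lra.
- by move=> r' r'0 r'X; rewrite addrA; exact: (p h h1 h2).
Qed.

Lemma prop_low_trans j (X : R -> R) L s0 s1 s2 : s0 <= s1 -> s1 <= s2 ->
  prop_low j X L s0 s1 -> prop_low j X L s1 s2 -> prop_low j X L s0 s2.
Proof.
move=> s01 s12 p q h h1 h2 a c sh a0 l rt init r r0 rX.
have e1 s : a + (s1 - s0) + (s - s1) = a + (s - s0) by ring.
have e2 s : c + j * (s1 - s0) + j * (s - s1) = c + j * (s - s0) by ring.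
have e3 s x : P (a + (s - s0)) h x + c + j * (s - s0) =
    P (a + (s1 - s0) + (s - s1)) h x + (c + j * (s1 - s0)) + j * (s - s1).
  by rewrite e1 -addrA -e2; ring.
rewrite e3; apply: (q h h1 h2) => //; first lra.
- by move=> s s1s ss2; rewrite -e3; apply: l; lra.
- by move=> s s1s ss2; rewrite -e3; apply: rt; lra.
- move=> r' r'0 r'X; rewrite addrA; apply: (p h h1 h2 a c sh) => //.
  + by move=> s ss0 ss1; apply: l => //; exact: le_trans s12.
  + by move=> s ss0 ss1; apply: rt => //; exact: le_trans s12.
Qed.

Lemma prop_sup_trans j (X : R -> R) u s0 s1 s2 : s0 <= s1 -> s1 <= s2 ->
  prop_sup j X u s0 s1 -> prop_sup j X u s1 s2 -> prop_sup j X u s0 s2.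
Proof.
move=> s01 s12 p q h h1 h2 a sh a0 h0 h1n init r r0 rX.
have := q h h1 h2 (a + (s1 - s0)) sh.
rewrite (_ : a + (s1 - s0) + (s2 - s1) = a + (s2 - s0)); last ring.
apply=> //; first lra.
by move=> r' r'0 r'X; exact: (p h h1 h2 a sh).
Qed.

Lemma prop_up_ext j (X Y : R -> R) L K s0 s1 c0 :
  (forall s, s0 <= s -> s <= s1 -> Y (s + c0) = X s /\
     forall r, 0 <= r -> r <= X s -> K (s + c0) r = L s r) -> s0 <= s1 ->
  prop_up j X L s0 s1 -> prop_up j Y K (s0 + c0) (s1 + c0).
Proof.
move=> H s01 p h h1 h2 a c sh a0 h0 h1p init r r0.
have [Y1 K1] := H s1 s01 (lexx _); have [Y0 K0] := H s0 (lexx _) s01.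
rewrite Y1 => rX; rewrite K1// (_ : s1 + c0 - (s0 + c0) = s1 - s0); last ring.
apply: (p h h1 h2) => // r' r'0 r'X; rewrite -K0//; apply: init => //; by rewrite Y0.
Qed.

Lemma prop_low_ext j (X Y : R -> R) L K s0 s1 c0 :
  (forall s, s0 <= s -> s <= s1 -> Y (s + c0) = X s /\
     forall r, 0 <= r -> r <= X s -> K (s + c0) r = L s r) ->
  (forall s, s0 <= s -> s <= s1 -> 0 <= X s) -> s0 <= s1 ->
  prop_low j X L s0 s1 -> prop_low j Y K (s0 + c0) (s1 + c0).
Proof.
move=> H X0 s01 p h h1 h2 a c sh a0 l rt init r r0.
have [Y1 K1] := H s1 s01 (lexx _); have [Y0 K0] := H s0 (lexx _) s01.
have e s : s + c0 - (s0 + c0) = s - s0 by ring.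
rewrite Y1 => rX; rewrite K1// e; apply: (p h h1 h2) => //.
- move=> s ss0 ss1; have := l (s + c0); rewrite e; apply; lra.
- move=> s ss0 ss1; have [Ys Ks] := H s ss0 ss1.
  have := rt (s + c0); rewrite e Ys Ks ?X0//; apply; lra.
- by move=> r' r'0 r'X; rewrite -K0//; apply: init => //; rewrite Y0.
Qed.

Lemma prop_sup_ext j (X Y : R -> R) L K s0 s1 c0 :
  (forall s, s0 <= s -> s <= s1 -> Y (s + c0) = X s /\
     forall r, 0 <= r -> r <= X s -> K (s + c0) r = L s r) -> s0 <= s1 ->
  prop_sup j X L s0 s1 -> prop_sup j Y K (s0 + c0) (s1 + c0).
Proof.
move=> H s01 p h h1 h2 a sh a0 h0 h1n init r r0.
have [Y1 K1] := H s1 s01 (lexx _); have [Y0 K0] := H s0 (lexx _) s01.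
rewrite Y1 => rX; rewrite K1// (_ : s1 + c0 - (s0 + c0) = s1 - s0); last ring.
apply: (p h h1 h2) => // r' r'0 r'X; rewrite -K0//; apply: init => //; by rewrite Y0.
Qed.

(** The junction belongs to the left piece; the right piece has its own clock, starting at 0. *)
Definition glue (B : Type) (Ta : R) (a b : R -> B) t := if t <= Ta then a t else b (t - Ta).

Lemma glueL (B : Type) (Ta : R) (a b : R -> B) t : t <= Ta -> glue Ta a b t = a t.
Proof. by rewrite /glue => ->. Qed.

Lemma glueR (B : Type) (Ta : R) (a b : R -> B) t : Ta < t -> glue Ta a b t = b (t - Ta).
Proof. by rewrite /glue leNgt => ->. Qed.

Lemma derive1_shift (g : R -> R) c t : ((fun s => g (s - c))^`())%classic t = (g^`())%classic (t - c).
Proof.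
rewrite !derive1E /derive; apply: (f_equal (fun k : R -> R => lim (k @ 0^'))).
by apply/funext => h /=; rewrite addrA.
Qed.

Lemma derivable_shift (g : R -> R) c t : derivable g (t - c) 1 -> derivable (fun s => g (s - c)) t 1.
Proof.
rewrite /derivable => d; apply: (eq_ind _ (fun k : R -> R => cvg (k @ 0^')) d).
by apply/funext => h /=; rewrite addrA.
Qed.

Lemma near_lt_eq (B : Type) (f g : R -> B) (c t : R) : t < c -> (forall s, s < c -> f s = g s) ->
  \forall s \near t, f s = g s.
Proof. by move=> tc H; near do apply: H; exact: lt_nbhsl. Unshelve. all: by end_near. Qed.

Lemma near_gt_eq (B : Type) (f g : R -> B) (c t : R) : c < t -> (forall s, c < s -> f s = g s) ->
  \forall s \near t, f s = g s.
Proof. by move=> tc H; near do apply: H; exact: lt_nbhsr. Unshelve. all: by end_near. Qed.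

Lemma pC1_glue (Ta Tb : R) (Xa Xb : R -> R) : 0 < Ta -> 0 <= Tb -> pC1 Ta Xa -> pC1 Tb Xb ->
  pC1 (Ta + Tb) (glue Ta Xa Xb).
Proof.
move=> Ta0 Tb0 [[Da fDa ha] [ra la]] [[Db fDb hb] [rb lb]].
pose X := glue Ta Xa Xb; rewrite -/X.
have XL s : s < Ta -> X s = Xa s by move=> h; rewrite /X glueL// ltW.
have XR s : Ta < s -> X s = Xb (s - Ta) by move=> h; rewrite /X glueR.
have dL s : s < Ta -> (X^`())%classic s = (Xa^`())%classic s.
  by move=> h; rewrite !derive1E; apply: near_eq_derive; exact: near_lt_eq h XL.
have dR s : Ta < s -> (X^`())%classic s = (Xb^`())%classic (s - Ta).
  move=> h; rewrite -derive1_shift !derive1E; apply: near_eq_derive; exact: near_gt_eq h XR.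
split; [|split].
- exists (Da `|` ([set Ta] `|` [set s + Ta | s in Db])).
    rewrite !finite_setU; split => //; split; [exact: finite_set1|exact: finite_image].
  move=> t t0 tT nD; have [lt|gt|eq] := ltgtP t Ta.
  + have [d c] := ha t t0 lt (fun h => nD (or_introl h)); split.
      by apply: near_eq_derivable d; apply: (near_lt_eq lt) => s h; exact/esym/XL.
    rewrite /prop_for /continuous_at (dL t lt).
    have /cvgrPdist_le hc := c.
    apply/cvgrPdist_le => e e0; have [d' /= d'0 hd'] := hc e e0.
    exists (Num.min d' (Ta - t)) => /=; first by rewrite lt_min d'0 subr_gt0.
    move=> s /=; rewrite lt_min => /andP[h1 h2]; have := ler_norm (s - t); rewrite distrC => h3.
    by rewrite dL; [exact: hd'|lra].
  + have nDb : ~ Db (t - Ta) by move=> h; apply: nD; right; right; exists (t - Ta) => //; rewrite subrK.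
    have [d c] := hb (t - Ta) ltac:(lra) ltac:(lra) nDb; split.
      by apply: near_eq_derivable (derivable_shift d); apply: (near_gt_eq gt) => s h; exact/esym/XR.
    rewrite /prop_for /continuous_at (dR t gt).
    have /cvgrPdist_le hc := c.
    apply/cvgrPdist_le => e e0; have [d' /= d'0 hd'] := hc e e0.
    exists (Num.min d' (t - Ta)) => /=; first by rewrite lt_min d'0 subr_gt0.
    move=> s /=; rewrite lt_min => /andP[h1 h2]; have h3 := ler_norm (t - s).
    rewrite dR; last lra.
    by apply: hd' => /=; rewrite (_ : t - Ta - (s - Ta) = t - s)//; ring.
  + by exfalso; apply: nD; right; left.
- move=> t t0 tT; have [lt|ge] := ltP t Ta.
    have [l /cvgrPdist_le hl] := ra t t0 lt; exists l; apply/cvgrPdist_le => e e0.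
    have [d /= d0 hd] := hl e e0; exists (Num.min d (Ta - t)) => /=.
      by rewrite lt_min d0 subr_gt0.
    move=> s /=; rewrite lt_min => /andP[h1 h2] ts; have := ler_norm (s - t); rewrite distrC => n1.
    by rewrite dL; [exact: hd|lra].
  have [l /cvgrPdist_le hl] := rb (t - Ta) ltac:(lra) ltac:(lra); exists l; apply/cvgrPdist_le => e e0.
  have [d /= d0 hd] := hl e e0; exists d => //= s /= h1 ts.
  rewrite dR; last lra.
  by apply: hd => /=; [rewrite (_ : t - Ta - (s - Ta) = t - s)//; ring|lra].
- move=> t t0 tT; have [lt|ge] := leP t Ta.
    have [l /cvgrPdist_le hl] := la t t0 lt; exists l; apply/cvgrPdist_le => e e0.
    have [d /= d0 hd] := hl e e0; exists d => //= s /= h1 ts.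
    by rewrite dL; [exact: hd|lra].
  have [l /cvgrPdist_le hl] := lb (t - Ta) ltac:(lra) ltac:(lra); exists l; apply/cvgrPdist_le => e e0.
  have [d /= d0 hd] := hl e e0; exists (Num.min d (t - Ta)) => /=.
    by rewrite lt_min d0 subr_gt0.
  move=> s /=; rewrite lt_min => /andP[h1 h2] ts; have := ler_norm (t - s) => n1.
  rewrite dR; last lra.
  by apply: hd => /=; [rewrite (_ : t - Ta - (s - Ta) = t - s)//; ring|lra].
Qed.

(** Agreement of u'' at the junction, and not only of u, makes u differentiable in time there from
    both sides. A mass at Ta equal to that at 0 keeps the mass errors of the pieces from adding
    up. *)
Lemma evol_glue (j eps Ta Tb : R) (Xa Xb : R -> R) (ua u1a u2a La ub u1b u2b Lb : R -> R -> R) :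
  0 <= j -> 0 < Ta -> 0 <= Tb ->
  evol j eps Ta Xa ua u1a u2a La -> evol j eps Tb Xb ub u1b u2b Lb ->
  Xb 0 = Xa Ta ->
  (forall r, 0 <= r -> r <= Xa Ta -> ub 0 r = ua Ta r) ->
  (forall r, 0 <= r -> r <= Xa Ta -> u2b 0 r = u2a Ta r) ->
  La Ta (Xa Ta) = La 0 (Xa 0) ->
  evol j eps (Ta + Tb) (glue Ta Xa Xb) (glue Ta ua ub) (glue Ta u1a u1b) (glue Ta u2a u2b) (glue Ta La Lb).
Proof.
move=> j0 Ta0 Tb0 ea eb Xj uj u2j mj.
have Lj r : 0 <= r -> r <= Xa Ta -> Lb 0 r = La Ta r.
  move=> r0 rX; have d x : is_derive x 1 (fun x => Lb 0 x - La Ta x) (ub 0 x - ua Ta x).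
    have d1 := ev_dL eb x (lexx 0) Tb0; have d2 := ev_dL ea x (ltW Ta0) (lexx Ta).
    by apply: is_derive_eq.
  move: r0; rewrite le_eqVlt => /predU1P[<-|r0].
    by rewrite (ev_L0 eb)// (ev_L0 ea)// ltW.
  have cg := continuous_subspaceT (derive_continuous d).
  have [c + hc] := MVT r0 (fun z _ => d z) (cg _).
  rewrite in_itv/= => /andP[c0 cr]; move: hc.
  by rewrite uj ?subrr ?mul0r ?(ev_L0 eb)// ?(ev_L0 ea) ?(ltW Ta0)//; lra.
have caseT t (Q : Prop) : 0 <= t -> t <= Ta + Tb ->
   (t <= Ta -> Q) -> (Ta < t -> 0 <= t - Ta -> t - Ta <= Tb -> Q) -> Q.
  move=> t0 tT q1 q2; have [h|h] := leP t Ta; first exact: q1.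
  by apply: q2; lra.
pose X := glue Ta Xa Xb; pose L := glue Ta La Lb.
have XR t : Ta <= t -> X t = Xb (t - Ta).
  rewrite le_eqVlt => /predU1P[<-|h]; last by rewrite /X glueR.
  by rewrite /X glueL// subrr Xj.
have X0 t : 0 <= t -> t <= Ta + Tb -> 0 < X t.
  move=> t0 tT; apply: (caseT t) => //.
  - by move=> h; rewrite /X glueL//; exact: (ev_pos ea).
  - by move=> h h1 h2; rewrite /X glueR//; exact: (ev_pos eb).
have jR (gb ga : R -> R -> R) t r : (forall r, 0 <= r -> r <= Xa Ta -> gb 0 r = ga Ta r) ->
    Ta <= t -> 0 <= r -> r <= X t -> glue Ta ga gb t r = gb (t - Ta) r.
  move=> H; rewrite le_eqVlt => /predU1P[<-|h]; last by rewrite glueR.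
  by move=> r0; rewrite /X !glueL// subrr => rX; rewrite H.
have extA s : s <= Ta -> X (s + 0) = Xa s /\ forall r, 0 <= r -> r <= Xa s -> L (s + 0) r = La s r.
  by move=> h; rewrite addr0 /X /L !glueL.
have extB s : 0 <= s -> X (s + Ta) = Xb s /\ forall r, 0 <= r -> r <= Xb s -> L (s + Ta) r = Lb s r.
  move=> h; have h' : Ta <= s + Ta by lra.
  by rewrite XR// addrK; split => // r r0 rX; rewrite /L (jR Lb La)// ?XR// addrK.
have extAu s : s <= Ta -> X (s + 0) = Xa s /\ forall r, 0 <= r -> r <= Xa s -> glue Ta ua ub (s + 0) r = ua s r.
  by move=> h; rewrite addr0 /X !glueL.
have extBu s : 0 <= s -> X (s + Ta) = Xb s /\ forall r, 0 <= r -> r <= Xb s -> glue Ta ua ub (s + Ta) r = ub s r.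
  move=> h; have h' : Ta <= s + Ta by lra.
  by rewrite XR// addrK; split => // r r0 rX; rewrite (jR ub ua)// ?XR// addrK.
have splitT (Q : R -> R -> Prop) : (forall s t, 0 <= s -> s <= t -> t <= Ta -> Q s t) ->
    (forall s t, Ta <= s -> s <= t -> t <= Ta + Tb -> Q s t) ->
    (forall s t, s <= Ta -> Ta <= t -> Q s Ta -> Q Ta t -> Q s t) ->
    forall s t, 0 <= s -> s <= t -> t <= Ta + Tb -> Q s t.
  move=> q1 q2 q3 s t s0 st tT; have [h|h] := leP t Ta; first exact: q1.
  have [h'|h'] := leP Ta s; first exact: q2.
  by apply: q3 => //; [exact: ltW|exact: ltW|apply: q1 => //; exact: ltW|apply: q2 => //; exact: ltW].
split.
- exact: X0.
- have [ka ka0 ha] := ev_lip ea; have [kb kb0 hb] := ev_lip eb.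
  exists (ka + kb); first exact: addr_ge0.
  have half s t : 0 <= s -> s <= t -> t <= Ta + Tb -> `|X s - X t| <= (ka + kb) * `|s - t|.
    apply: (splitT (fun s t => `|X s - X t| <= (ka + kb) * `|s - t|)) => [{}s {}t s0 st tT|{}s {}t s0 st tT|{}s {}t sT Tt h1 h2].
    + rewrite /X !glueL//; last exact: le_trans tT.
      by apply: (le_trans (ha s t s0 (le_trans st tT) (le_trans s0 st) tT)); rewrite ler_wpM2r// lerDl.
    + rewrite !XR//; last exact: le_trans st.
      rewrite (_ : s - t = s - Ta - (t - Ta)); last ring.
      by apply: (le_trans (hb (s - Ta) (t - Ta) _ _ _ _)); [lra|lra|lra|lra|rewrite ler_wpM2r// lerDr].
    + have := ler_normD (X s - X Ta) (X Ta - X t); rewrite addrA subrK.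
      have -> : `|s - t| = `|s - Ta| + `|Ta - t| by rewrite !ler0_norm; lra.
      by rewrite mulrDr; lra.
  move=> s t s0 sT t0 tT; have [h|h] := leP s t; first exact: half.
  by rewrite distrC [`|s - t|]distrC; apply: half => //; exact: ltW.
- exact: pC1_glue (ev_C1 ea) (ev_C1 eb).
- move=> t r t0 tT; apply: (caseT t) => // [h|h h1 h2]; first by rewrite !glueL//; exact: (ev_du ea).
  by rewrite !glueR//; exact: (ev_du eb).
- move=> t r t0 tT; apply: (caseT t) => // [h|h h1 h2]; first by rewrite !glueL//; exact: (ev_du1 ea).
  by rewrite !glueR//; exact: (ev_du1 eb).
- move=> t t0 tT; apply: (caseT t) => // [h|h h1 h2]; first by rewrite !glueL//; exact: (ev_cu2 ea).
  by rewrite !glueR//; exact: (ev_cu2 eb).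
- move=> t r t0 tT; apply: (caseT t) => // [h|h h1 h2]; first by rewrite !glueL//; exact: (ev_dL ea).
  by rewrite !glueR//; exact: (ev_dL eb).
- move=> t t0 tT; apply: (caseT t) => // [h|h h1 h2]; first by rewrite !glueL//; exact: (ev_L0 ea).
  by rewrite !glueR//; exact: (ev_L0 eb).
- move=> t t0 tT; apply: (caseT t) => // [h|h h1 h2]; first by rewrite !glueL//; exact: (ev_neumann ea).
  by rewrite !glueR//; exact: (ev_neumann eb).
- move=> t r t0 tT; apply: (caseT t) => // [h|h h1 h2]; first by rewrite !glueL//; exact: (ev_ge0 ea).
  by rewrite !glueR//; exact: (ev_ge0 eb).
- move=> t t0 tT; apply: (caseT t) => // [h|h h1 h2]; first by rewrite !glueL//; exact: (ev_dir ea).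
  by rewrite !glueR//; exact: (ev_dir eb).
- move=> t r t0 tT r0 rX e e0.
  have HA : t <= Ta -> exists2 d, 0 < d & forall s, 0 <= s -> s <= Ta -> r <= X s -> `|s - t| < d ->
      `|glue Ta ua ub s r - glue Ta ua ub t r - (s - t) / 2 * glue Ta u2a u2b t r| <= e * `|s - t|.
    move=> tTa; have rX' : r <= Xa t by move: rX; rewrite /X glueL.
    have [d d0 hd] := ev_time ea t0 tTa r0 rX' e0.
    exists d => // s s0 sT; rewrite /X !glueL// => rXs h; exact: hd.
  have HB : Ta <= t -> exists2 d, 0 < d & forall s, Ta <= s -> s <= Ta + Tb -> r <= X s -> `|s - t| < d ->
      `|glue Ta ua ub s r - glue Ta ua ub t r - (s - t) / 2 * glue Ta u2a u2b t r| <= e * `|s - t|.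
    move=> tTa; have rX' : r <= Xb (t - Ta) by rewrite -XR.
    have [d d0 hd] := @ev_time _ _ _ _ _ _ _ _ _ eb (t - Ta) r ltac:(lra) ltac:(lra) r0 rX' e e0.
    exists d => // s s0 sT rXs; rewrite (_ : s - t = s - Ta - (t - Ta)); last ring.
    by move=> h; rewrite !jR//; apply: hd; [lra|lra|rewrite -XR|].
  have [lt|gt|eq] := ltgtP t Ta.
  + have [d d0 hd] := HA (ltW lt); exists (Num.min d (Ta - t)); first by rewrite lt_min d0 subr_gt0.
    move=> s s0 sT rXs; rewrite lt_min => /andP[h1 h2]; have := ler_norm (s - t) => n.
    by apply: hd => //; lra.
  + have [d d0 hd] := HB (ltW gt); exists (Num.min d (t - Ta)); first by rewrite lt_min d0 subr_gt0.
    move=> s s0 sT rXs; rewrite lt_min => /andP[h1 h2]; have := ler_norm (t - s); rewrite distrC => n.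
    by apply: hd => //; lra.
  + have [d d0 hd] := HA ltac:(lra); have [d' d'0 hd'] := HB ltac:(lra).
    exists (Num.min d d'); first by rewrite lt_min d0.
    move=> s s0 sT rXs; rewrite lt_min => /andP[h1 h2].
    have [h|h] := leP s Ta; first exact: hd.
    by apply: hd' => //; exact: ltW.
- move=> t t0 tT; rewrite (glueL _ _ (ltW Ta0 : 0 <= Ta)) (glueL _ _ (ltW Ta0 : 0 <= Ta)).
  apply: (caseT t) => // [h|h h1 h2]; first by rewrite !glueL//; exact: (ev_mass ea).
  rewrite !glueR// -mj -(Lj (Xa Ta)) ?(ltW (ev_pos ea _ _))// ?(ltW Ta0)// -Xj.
  exact: (ev_mass eb).
- apply: splitT => [s t s0 st tT|s t s0 st tT|s t sT Tt].
  + have := @prop_up_ext j Xa X La L s t 0; rewrite !addr0; apply=> // [w w1 w2|].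
      by apply: extA; exact: le_trans tT.
    exact: (ev_up ea).
  + have := @prop_up_ext j Xb X Lb L (s - Ta) (t - Ta) Ta; rewrite !subrK; apply.
    * by move=> w w1 w2; apply: extB; lra.
    * lra.
    * by apply: (ev_up eb); lra.
  + exact: prop_up_trans.
- apply: splitT => [s t s0 st tT|s t s0 st tT|s t sT Tt].
  + have := @prop_low_ext j Xa X La L s t 0; rewrite !addr0; apply=> // [w w1 w2|w w1 w2|].
    * by apply: extA; exact: le_trans tT.
    * by apply/ltW/(ev_pos ea); lra.
    * exact: (ev_low ea).
  + have := @prop_low_ext j Xb X Lb L (s - Ta) (t - Ta) Ta; rewrite !subrK; apply.
    * by move=> w w1 w2; apply: extB; lra.
    * by move=> w w1 w2; apply/ltW/(ev_pos eb); lra.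
    * lra.
    * by apply: (ev_low eb); lra.
  + exact: prop_low_trans.
- apply: splitT => [s t s0 st tT|s t s0 st tT|s t sT Tt].
  + have := @prop_sup_ext j Xa X ua (glue Ta ua ub) s t 0; rewrite !addr0; apply=> // [w w1 w2|].
      by apply: extAu; exact: le_trans tT.
    exact: (ev_sup ea).
  + have := @prop_sup_ext j Xb X ub (glue Ta ua ub) (s - Ta) (t - Ta) Ta; rewrite !subrK; apply.
    * by move=> w w1 w2; apply: extBu; lra.
    * lra.
    * by apply: (ev_sup eb); lra.
  + exact: prop_sup_trans.
Qed.

End PropTransitivity.

(** * Calculus tools: primitives, cutoffs, compact supports *)

Section Tools.
Context {R : realType}.
Notation mu := (@lebesgue_measure R).
Implicit Types (r s t x y z e c m d a b X Z : R) (f FF : R -> R).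

Lemma segment_bounded f Z : continuous f -> exists2 C : R, 0 < C & forall x, `|x| <= Z -> `|f x| <= C.
Proof.
move=> cf; have [Z0|Z0] := leP 0 Z; last first.
  by exists 1 => // x xZ; have := normr_ge0 x; lra.
have cn : {within `[- Z, Z], continuous (fun x => `|f x|)}.
  apply: continuous_subspaceT => x.
  by apply: (@continuous_comp _ _ _ f (fun y => `|y|)); [exact: cf|exact: norm_continuous].
have [c _ hc] := EVT_max (ltac:(lra) : - Z <= Z) cn.
exists (`|f c| + 1); first by rewrite ltr_wpDl.
move=> x; rewrite ler_norml => xZ; apply: (@le_trans _ _ `|f c|); last by rewrite lerDl.
by apply: hc; rewrite in_itv/=.
Qed.

Lemma csupp_bounded f Z : continuous f -> (forall x, Z <= `|x| -> f x = 0) ->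
  exists2 C : R, 0 < C & forall x, `|f x| <= C.
Proof.
move=> cf fZ; have [C C0 hC] := segment_bounded Z cf; exists C => // x.
by have [h|/ltW h] := leP `|x| Z; [exact: hC|rewrite fZ// normr0 ltW].
Qed.

(** Heine's theorem with a large constant in place of a small radius: away from the diagonal M (x -
    y)^2 exceeds the oscillation 2 C. *)
Lemma csupp_ucont f Z : continuous f -> (forall x, Z <= `|x| -> f x = 0) -> ucont f.
Proof.
move=> cf fZ e e0; have [C C0 hC] := csupp_bounded cf fZ.
have : \forall M \near +oo, `[- Z, Z]%classic `<=`
    (fun x => 0 <= M /\ forall y, `|f x - f y| <= e + M * (x - y) ^+ 2).
  have nc : near_covering (`[- Z, Z]%classic : set R).
    by apply/compact_near_coveringP; exact: segment_compact.
  apply: (nc R (pinfty_nbhs R) (fun M x => 0 <= M /\ forall y, `|f x - f y| <= e + M * (x - y) ^+ 2)) => x _.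
  have /cvgrPdist_le /(_ _ (divr_gt0 e0 (ltr0Sn _ 1))) [d /= d0 hd] := cf x.
  exists (ball x (d / 2), [set M | 8 * C / d ^+ 2 <= M]).
    split; first by apply: nbhsx_ballx; rewrite divr_gt0.
    exact: nbhs_pinfty_ge (num_real _).
  move=> [x' M] /= [xx' hM].
  have M0 : 0 <= M by apply: le_trans hM; rewrite divr_ge0 ?sqr_ge0// mulr_ge0// ltW.
  split => // y.
  have M0' : 0 <= M * (x' - y) ^+ 2 by rewrite mulr_ge0 ?sqr_ge0.
  have xx1 : `|x - x'| < d by apply: (lt_trans xx'); rewrite ltr_pdivrMr// ltr_pMr// ltr1n.
  have [yd|yd] := ltP `|x' - y| (d / 2).
    have xy : `|x - y| < d.
      have := ler_normD (x - x') (x' - y); rewrite addrA subrK.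
      by move: xx'; rewrite /ball/=; lra.
    have := hd x' xx1; have := hd y xy.
    have := ler_normB (f x - f y) (f x - f x'); rewrite opprB addrC addrA subrK.
    by lra.
  have d2 : d ^+ 2 / 4 <= (x' - y) ^+ 2.
    rewrite -[leRHS]real_normK ?num_real// (_ : d ^+ 2 / 4 = (d / 2) ^+ 2); last by field.
    by rewrite lerXn2r// ?nnegrE ?divr_ge0// ltW.
  have : 2 * C <= M * (x' - y) ^+ 2.
    apply: (le_trans _ (ler_wpM2l M0 d2)); apply: (le_trans _ (ler_wpM2r _ hM)).
      by rewrite (_ : 8 * C / d ^+ 2 * (d ^+ 2 / 4) = 2 * C)//; field; rewrite gt_eqF.
    by rewrite divr_ge0// sqr_ge0.
  by have := ler_normB (f x') (f y); have := hC x'; have := hC y; lra.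
case=> M0 [_ hM]; pose M : R := `|M0| + 1.
have {}hM := hM M (le_lt_trans (ler_norm M0) (ltac:(by rewrite /M ltrDl) : `|M0| < M)).
exists M; first by rewrite addr_ge0.
move=> x y.
have ge : 0 <= e + M * (x - y) ^+ 2.
  by apply: addr_ge0; [exact: ltW|apply: mulr_ge0; rewrite ?sqr_ge0// /M addr_ge0].
have [h|/ltW h] := leP `|x| Z.
  by have [] := hM x; rewrite /= ?in_itv/= -?ler_norml.
have [h'|/ltW h'] := leP `|y| Z; last by rewrite !fZ// subrr normr0.
by have [] := hM y; rewrite /= ?in_itv/= -?ler_norml// => _ /(_ x); rewrite distrC -sqrrN opprB.
Qed.

Lemma csupp_smooth2 f f1 f2 Z : (forall x, is_derive x 1 f (f1 x)) -> (forall x, is_derive x 1 f1 (f2 x)) ->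
  continuous f2 -> (forall x, Z <= `|x| -> f2 x = 0) -> smooth2 f f1 f2.
Proof.
move=> d1 d2 c2 fZ; have [C C0 hC] := csupp_bounded c2 fZ.
by split => //; [exists C => //; exact: ltW|exact: csupp_ucont fZ].
Qed.

(** Outside [-Z, Z] the function f1 is locally constant, hence it is bounded everywhere; it is
    Lipschitz because f2 is bounded. *)
Lemma csupp_smooth2_prim FF f f1 f2 Z : 0 <= Z ->
  (forall x, is_derive x 1 FF (f x)) -> (forall x, is_derive x 1 f (f1 x)) ->
  (forall x, is_derive x 1 f1 (f2 x)) ->
  continuous f2 -> (forall x, Z <= `|x| -> f2 x = 0) -> smooth2 FF f f1.
Proof.
move=> Z0 dF d1 d2 c2 fZ; have [C C0 hC] := csupp_bounded c2 fZ.
have [D D0 hD] := segment_bounded Z (derive_continuous d2).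
split => //; last first.
  apply: (@lip_ucont _ f1 C); first exact: ltW.
  move=> x y; rewrite distrC [`|x - y|]distrC; exact: MVT_norm d2 (fun c _ => hC c).
have farc a b : a < b -> (forall c, a < c -> c < b -> Z <= `|c|) -> f1 b = f1 a.
  move=> ab h; have cg := continuous_subspaceT (derive_continuous d2).
  have [c + hc] := MVT ab (fun z _ => d2 z) (cg _).
  rewrite in_itv/= => /andP[ac cb]; move: hc; rewrite fZ ?mul0r; last exact: h.
  by move/eqP; rewrite subr_eq0 => /eqP.
exists D; first exact: ltW.
move=> x; have [h|h] := leP `|x| Z; first exact: hD.
have [x0|x0] := leP 0 x.
  rewrite ger0_norm// in h; rewrite (farc Z x)//; first by apply: hD; rewrite ger0_norm.
  by move=> c h1 h2; apply: le_trans (ler_norm c); exact: ltW.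
rewrite ltr0_norm// in h; rewrite -(farc x (- Z)); first by apply: hD; rewrite normrN ger0_norm.
  by lra.
by move=> c h1 h2; rewrite -normrN; apply: le_trans (ler_norm (- c)); lra.
Qed.

(** Integrals from -n, normalised at 0 so as not to depend on n; n = |x| + 1 gives one function,
    which near each point coincides with one for a fixed n. *)
Lemma primitive f : continuous f -> exists F : R -> R, forall x, is_derive x 1 F (f x).
Proof.
move=> cf.
have int a b : mu.-integrable `[a, b] (EFin \o f).
  apply: continuous_compact_integrable; first exact: segment_compact.
  exact: continuous_subspaceT.
pose I a x := \int[mu]_(t in `[a, x]) f t.
have add a b x : a <= b -> b <= x -> I a x = I a b + \int[mu]_(t in `]b, x]) f t.
  move=> ab bx; have := @Rintegral_itvB R f (BLeft a) (BRight x) b (int a x).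
  rewrite !bnd_simp => /(_ ab bx) h; rewrite -h /I; ring.
pose G (n : R) x := I (- n) x - I (- n) 0.
have GE n m x : 0 <= n -> n <= m -> - n <= x -> G m x = G n x.
  move=> n0 nm nx; rewrite /G.
  have -> : I (- m) x = I (- m) (- n) + \int[mu]_(t in `]- n, x]) f t by apply: add; lra.
  have -> : I (- m) 0 = I (- m) (- n) + \int[mu]_(t in `]- n, 0]) f t by apply: add; lra.
  have -> : I (- n) x = I (- n) (- n) + \int[mu]_(t in `]- n, x]) f t by apply: add; lra.
  have -> : I (- n) 0 = I (- n) (- n) + \int[mu]_(t in `]- n, 0]) f t by apply: add; lra.
  ring.
exists (fun x => G (`|x| + 1) x) => x.
pose n : R := `|x| + 3.
have dG : is_derive x 1 (G n) (f x).
  have [||h1 h2] := @continuous_FTC1_closed R f (- n) x (x + 1) (ltac:(by rewrite ltrDl)) (int _ _).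
  - have := ler_norm (- x); rewrite /n; rewrite normrN; lra.
  - exact: cf.
  have h3 : is_derive x 1 (I (- n)) (f x) by split; [exact: h1|rewrite -h2 derive1E].
  by rewrite /G; apply: is_derive_eq; rewrite subr0.
apply: near_eq_is_derive dG; exists 1 => //= y /= h.
have := ler_norm (- y); rewrite normrN => h1.
have := ler_normB x (x - y); rewrite opprB addrCA subrr addr0 => h2.
by apply: GE; rewrite /n; [rewrite addr_ge0|lra|lra].
Qed.

Lemma odd_primitive f : continuous f -> (forall x, f (- x) = f x) ->
  exists F : R -> R, (forall x, is_derive x 1 F (f x)) /\ forall x, F (- x) = - F x.
Proof.
move=> cf ef; have [F dF] := primitive cf.
exists (fun x => (F x - F (- x)) / 2); split; last by move=> x; rewrite opprK; lra.
move=> x; have d1 := dF x.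
have d2 : is_derive x 1 (F \o -%R) (- f x).
  have d3 : is_derive x 1 (fun x : R => - x) (-1) by apply: is_derive_eq.
  have := @is_derive1_comp _ F (fun x => - x) x _ _ (dF (- x)) d3.
  by rewrite mulrN1 ef.
have -> : (fun x => (F x - F (- x)) / 2) = (fun x => 2^-1 * (F x - (F \o -%R) x)).
  by apply/funext => y /=; rewrite mulrC.
by apply: is_derive_eq; rewrite /GRing.scale/=; field.
Qed.

Definition posp x : R := Num.max x 0.

Lemma posp_ge0 x : 0 <= posp x. Proof. by rewrite le_max lexx orbT. Qed.
Lemma posp_id x : 0 <= x -> posp x = x. Proof. by move=> h; rewrite /posp max_l. Qed.
Lemma posp_0 x : x <= 0 -> posp x = 0. Proof. by move=> h; rewrite /posp max_r. Qed.

Lemma posp_continuous : continuous posp.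
Proof.
move=> x; apply/cvgrPdist_le => e e0; exists e => //= y /= h.
apply: (le_trans _ (ltW h)).
rewrite /posp; case: (leP x 0) => h1; case: (leP y 0) => h2; rewrite ?subrr ?normr0//.
- by rewrite sub0r normrN gtr0_norm// ler0_norm; lra.
- by rewrite subr0 gtr0_norm// ger0_norm; lra.
Qed.

Lemma posp_sqr_derive x : is_derive x 1 (fun x => posp x ^+ 2) (2 * posp x).
Proof.
apply: is_derive_of_bound => e e0; exists e^-1; first by rewrite invr_ge0 ltW.
move=> y; apply: (@le_trans _ _ (y ^+ 2)).
  rewrite ler_norml !expr2 /posp; case: (leP x 0) => h1; case: (leP (x + y) 0) => h2.
  - by have := sqr_ge0 y; rewrite expr2 => h; apply/andP; split; lra.
  - by apply/andP; split; nra.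
  - have := mulr_ge0 (ltW h1) (ltac:(lra) : 0 <= - (x + 2 * y)).
    by have := sqr_ge0 (x + y); rewrite expr2 => h h'; apply/andP; split; lra.
  - by have := sqr_ge0 y; rewrite expr2 => h; apply/andP; split; lra.
rewrite -real_normK ?num_real// [X in X <= _]expr2 ler_wpM2r//.
by apply: (le_trans (amgm `|y| e0)); rewrite mulrC.
Qed.

Lemma posp_cube_derive x : is_derive x 1 (fun x => posp x ^+ 3) (3 * posp x ^+ 2).
Proof.
have -> : (fun x => posp x ^+ 3) = (fun x => x * posp x ^+ 2).
  apply/funext => y; rewrite /posp; case: (leP y 0) => h; last by rewrite -exprS.
  by rewrite !expr0n !mulr0.
have d := posp_sqr_derive x.
apply: is_derive_eq; rewrite /GRing.scale/= /posp.
by case: (leP x 0) => h; ring.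
Qed.

Record cutoff (X Z : R) (k k1 k2 : R -> R) : Prop := Cutoff {
  co_d1 : forall x, is_derive x 1 k (k1 x) ;
  co_d2 : forall x, is_derive x 1 k1 (k2 x) ;
  co_c2 : continuous k2 ;
  co_bd : forall x, 0 <= k x <= 1 ;
  co_lo : forall x, x <= X -> [/\ k x = 0, k1 x = 0 & k2 x = 0] ;
  co_hi : forall x, Z <= x -> [/\ k x = 1, k1 x = 0 & k2 x = 0] }.

(** Let q be the cube of the positive part of the affine function going from 0 at X to 1 at Z, and
    take 1 - ((1 - q)^+)^3: cubes of positive parts are C^2, which flattens both ends. *)
Lemma cutoff_exists X Z : X < Z -> exists k k1 k2, cutoff X Z k k1 k2.
Proof.
move=> XZ; pose h := (Z - X)^-1.
have h0 : 0 < h by rewrite invr_gt0 subr_gt0.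
pose l x := h * x - h * X.
have dl x : is_derive x 1 l h by rewrite /l; apply: is_derive_eq; rewrite subr0 /GRing.scale/= mulr1.
pose p x := posp x ^+ 3.
pose p1 x := 3 * posp x ^+ 2.
pose p2 x := 6 * posp x.
have dp x : is_derive x 1 p (p1 x) by exact: posp_cube_derive.
have dp1 x : is_derive x 1 p1 (p2 x).
  by have d := posp_sqr_derive x; rewrite /p1; apply: is_derive_eq; rewrite /GRing.scale/= /p2; ring.
have cp2 : continuous p2 by move=> x; apply: cvgM; [exact: cvg_cst|exact: posp_continuous].
pose q x := p (l x).
have dq x : is_derive x 1 q (p1 (l x) * h) := is_derive1_comp (dp (l x)) (dl x).
have dq1 x : is_derive x 1 (fun x => p1 (l x) * h) (p2 (l x) * h * h).
  have d : is_derive x 1 (fun x => p1 (l x)) (p2 (l x) * h) := is_derive1_comp (dp1 (l x)) (dl x).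
  by apply: is_derive_eq; rewrite /GRing.scale/=; ring.
pose k x := 1 - p (1 - q x).
pose k1 x := p1 (1 - q x) * (p1 (l x) * h).
pose k2 x := p1 (1 - q x) * (p2 (l x) * h * h) - p2 (1 - q x) * ((p1 (l x) * h) * (p1 (l x) * h)).
have dc x : is_derive x 1 (fun x => 1 - q x) (- (p1 (l x) * h)).
  by have d := dq x; apply: is_derive_eq; first [by rewrite sub0r|by rewrite add0r|ring|done].
have dk x : is_derive x 1 k (k1 x).
  have d : is_derive x 1 (fun x => p (1 - q x)) (p1 (1 - q x) * (- (p1 (l x) * h))) :=
    @is_derive1_comp _ p (fun x => 1 - q x) x _ _ (dp (1 - q x)) (dc x).
  by rewrite /k; apply: is_derive_eq; rewrite /k1; ring.
have dk1 x : is_derive x 1 k1 (k2 x).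
  have d : is_derive x 1 (fun x => p1 (1 - q x)) (p2 (1 - q x) * (- (p1 (l x) * h))) :=
    @is_derive1_comp _ p1 (fun x => 1 - q x) x _ _ (dp1 (1 - q x)) (dc x).
  have d' := dq1 x.
  by rewrite /k1; apply: is_derive_eq; rewrite /k2 /GRing.scale/=; ring.
have cl := derive_continuous dl; have cq : continuous (fun x => 1 - q x) := derive_continuous dc.
have cp1 := derive_continuous dp1.
have ck2 : continuous k2.
  move=> x; apply: cvgB; apply: cvgM.
  - by apply: (@continuous_comp _ _ _ (fun x => 1 - q x) p1); [exact: cq|exact: cp1].
  - apply: cvgM; last exact: cvg_cst.
    apply: cvgM; last exact: cvg_cst.
    by apply: (@continuous_comp _ _ _ l p2); [exact: cl|exact: cp2].
  - by apply: (@continuous_comp _ _ _ (fun x => 1 - q x) p2); [exact: cq|exact: cp2].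
  - by apply: cvgM; exact: (derive_continuous dq1).
have q_lo x : x <= X -> [/\ l x <= 0 & q x = 0].
  move=> xX; have l0 : l x <= 0 by rewrite /l -mulrBr pmulr_rle0// subr_le0.
  by split => //; rewrite /q /p posp_0// expr0n.
have q_hi x : Z <= x -> 1 - q x <= 0.
  move=> xZ; have l1 : 1 <= l x.
    by rewrite /l -mulrBr /h mulrC ler_pdivlMr ?subr_gt0// mul1r lerB.
  by rewrite subr_le0 /q /p posp_id ?(le_trans ler01)// exprn_ege1.
have p0 y : y <= 0 -> [/\ p y = 0, p1 y = 0 & p2 y = 0].
  by move=> y0; rewrite /p /p1 /p2 posp_0// !expr0n !mulr0.
exists k, k1, k2; split => //.
- move=> x; have q0 : 0 <= q x by rewrite exprn_ge0// posp_ge0.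
  have r0 : 0 <= p (1 - q x) by rewrite exprn_ge0// posp_ge0.
  have r1 : p (1 - q x) <= 1.
    by rewrite /p exprn_ile1 ?posp_ge0// /posp ge_max ler01 andbT; lra.
  by rewrite /k; apply/andP; split; lra.
- move=> x xX; have [l0 q0] := q_lo x xX; have [e1 e2 e3] := p0 _ l0.
  rewrite /k /k1 /k2 q0 e2 e3 !mul0r !mulr0 subrr; split => //.
  by rewrite subr0 /p posp_id// expr1n subrr.
- move=> x xZ; have [e1 e2 e3] := p0 _ (q_hi x xZ).
  by rewrite /k /k1 /k2 e1 e2 e3 !mul0r !subr0.
Qed.

Lemma E_gt0' f y0 : tame f -> (forall x, 0 <= f x) -> 0 < f y0 -> 0 < E f.
Proof.
move=> tf f0 fy; have tN := tameZ (-1) tf.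
suff : E (fun x => -1 * f x) < 0 by rewrite EZ// mulN1r oppr_lt0.
apply: (@Rintegral_lt0 _ _ y0).
- by apply: gdM_continuous; case: tN.
- exact: tame_integrable.
- by move=> y; rewrite mulN1r mulrN oppr_le0 mulr_ge0 ?gd_ge0.
- by rewrite mulN1r mulrN oppr_lt0 mulr_gt0 ?gd_gt0.
Qed.

End Tools.

(** * Extending a profile beyond its edge *)

Section Restart.
Context {R : realType}.
Implicit Types (r s t x y z e c m d a b A B X Z : R).

Lemma opp_derive (h h1 : R -> R) x : (forall x, is_derive x 1 h (h1 x)) ->
  is_derive x 1 (fun x => h (- x)) (- h1 (- x)).
Proof.
move=> dh; have d : is_derive x 1 (fun x : R => - x) (-1) by apply: is_derive_eq.
have := @is_derive1_comp _ h (fun x => - x) x _ _ (dh (- x)) d.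
by rewrite mulrN1.
Qed.

Lemma odd_at0 (h : R -> R) : (forall x, h (- x) = - h x) -> h 0 = 0.
Proof. by move=> oh; have := oh 0; rewrite oppr0; lra. Qed.

Lemma const_on (h h1 : R -> R) a b : a <= b -> (forall x, is_derive x 1 h (h1 x)) ->
  (forall x, a < x -> x < b -> h1 x = 0) -> h b = h a.
Proof.
move=> + dh h0; rewrite le_eqVlt => /predU1P[->//|ab].
have [c + hc] := MVT ab (fun z _ => dh z) (continuous_subspaceT (derive_continuous dh) (A := _)).
by rewrite in_itv/= => /andP[h1' h2]; move: hc; rewrite h0// mul0r => /eqP; rewrite subr_eq0 => /eqP.
Qed.

(** What one time interval hands over to the next. Only the values of w up to X will be kept; beyond
    X the next interval chooses its own data. *)
Record state (j : R) (w w1 w2 W : R -> R) (X : R) : Prop := State {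
  st_d1 : forall x, is_derive x 1 w (w1 x) ;
  st_d2 : forall x, is_derive x 1 w1 (w2 x) ;
  st_c2 : continuous w2 ;
  st_dW : forall x, is_derive x 1 W (w x) ;
  st_oW : forall x, W (- x) = - W x ;
  st_even : forall x, w (- x) = w x ;
  st_X : 0 < X ;
  st_pos : forall x, 0 <= x -> x < X -> 0 < w x - 2 * j * x ;
  st_zero : w X - 2 * j * X = 0 ;
  st_slope : w1 X < 2 * j }.

Section Build.
Variables (j : R) (w w1 w2 W : R -> R) (X tau : R).
Hypothesis j0 : 0 < j.
Hypothesis st : state j w w1 w2 W X.
Hypothesis tau0 : 0 < tau.
Hypothesis mass_big : j * tau < W X - j * X ^+ 2.

Let X0 := st_X st.
Let g x := w x - 2 * j * x.
Let g1 x := w1 x - 2 * j.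

Let dg x : is_derive x 1 g (g1 x).
Proof.
have d := st_d1 st x; rewrite /g /g1.
by apply: is_derive_eq; rewrite /GRing.scale/=; ring.
Qed.

Let dg1 x : is_derive x 1 g1 (w2 x).
Proof. by have d := st_d2 st x; rewrite /g1; apply: is_derive_eq; rewrite subr0. Qed.

(** u has negative slope at X, so it is negative just after. On a strip of width at most 1 where u
    >= - j tau / 2 it removes at most half of j tau, the most that the source supplies during the
    interval. *)
Lemma negative_strip : exists2 Z, X < Z & Z <= X + 1 /\
  forall x, X <= x -> x <= Z -> g x <= 0 /\ - (j * tau / 2) <= g x.
Proof.
have cg := derive_continuous dg; have cg1 := derive_continuous dg1.
have g1X : 0 < - g1 X by rewrite /g1; have := st_slope st; lra.
have /cvgrPdist_lt /(_ _ g1X) [d /= d0 hd] := cg1 X.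
have e0 : 0 < j * tau / 2 by rewrite divr_gt0// mulr_gt0.
have /cvgrPdist_le /(_ _ e0) [d' /= d'0 hd'] := cg X.
pose q := Num.min 1 (Num.min (d / 2) (d' / 2)).
have q0 : 0 < q by rewrite !lt_min ltr01 !divr_gt0.
have q1 : q <= 1 by rewrite ge_min lexx.
have q2 : q <= d / 2 by rewrite !ge_min lexx orbT.
have q3 : q <= d' / 2 by rewrite !ge_min lexx !orbT.
exists (X + q); first by rewrite ltrDl.
split; first lra.
move=> x Xx xq.
have nx : `|X - x| = x - X by rewrite distrC ger0_norm// subr_ge0.
split; last first.
  have := hd' x; rewrite /= nx => /(_ ltac:(lra)); rewrite /g (st_zero st) sub0r normrN.
  by rewrite ler_norml => /andP[h _].
move: Xx; rewrite le_eqVlt => /predU1P[<-|Xx]; first by rewrite /g (st_zero st).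
have [c + hc] := MVT Xx (fun z _ => dg z) (continuous_subspaceT cg (A := _)).
rewrite in_itv/= => /andP[h1 h2]; move: hc; rewrite {2}/g (st_zero st) subr0 => ->.
rewrite nmulr_rle0 ?subr_ge0 ?(ltW Xx)//.
have := hd c; rewrite /= distrC ger0_norm; last by rewrite subr_ge0 ltW.
by move=> /(_ ltac:(lra)); rewrite ltr_norml => /andP[h _]; lra.
Qed.

Section WithCutoff.
Variables (Z : R) (k k1 k2 : R -> R).
Hypothesis XZ : X < Z.
Hypothesis ZX1 : Z <= X + 1.
Hypothesis strip : forall x, X <= x -> x <= Z -> g x <= 0 /\ - (j * tau / 2) <= g x.
Hypothesis co : cutoff X Z k k1 k2.

Let dk := co_d1 co.
Let dk1 := co_d2 co.
Definition psi x := k x + k (- x).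
Definition psi1 x := k1 x - k1 (- x).
Definition psi2 x := k2 x + k2 (- x).
Let e1 x := k1 x * g x + k x * g1 x.
Let e2 x := k2 x * g x + 2 * (k1 x * g1 x) + k x * w2 x.
(** For x >= 0 this is w up to X and 2 j x past Z, with w - 2 j x multiplied by 1 - k in between;
    the last term makes it even. *)
Definition ff0 x := w x - k x * g x - k (- x) * g (- x).
Definition ff1 x := w1 x - e1 x + e1 (- x).
Definition ff2 x := w2 x - e2 x - e2 (- x).

Lemma dpsi x : is_derive x 1 psi (psi1 x).
Proof. by have d1 := dk x; have d2 := opp_derive x dk; rewrite /psi; apply: is_derive_eq. Qed.

Lemma dpsi1 x : is_derive x 1 psi1 (psi2 x).
Proof.
have d1 := dk1 x; have d2 := opp_derive x dk1; rewrite /psi1.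
by apply: is_derive_eq; rewrite opprK.
Qed.

Let de x : is_derive x 1 (fun x => k x * g x) (e1 x).
Proof. by have d1 := dk x; have d2 := dg x; apply: is_derive_eq; rewrite /e1 /GRing.scale/=; ring. Qed.

Let de1 x : is_derive x 1 e1 (e2 x).
Proof.
have d1 := dk x; have d2 := dg x; have d3 := dk1 x; have d4 := dg1 x; rewrite /e1.
by apply: is_derive_eq; rewrite /e2 /GRing.scale/=; ring.
Qed.

Lemma dff0 x : is_derive x 1 ff0 (ff1 x).
Proof.
have d1 := de x; have d2 := opp_derive x de; have d3 := st_d1 st x; rewrite /ff0.
by apply: is_derive_eq; rewrite /ff1 opprK.
Qed.

Lemma dff1 x : is_derive x 1 ff1 (ff2 x).
Proof.
have d1 := de1 x; have d2 := opp_derive x de1; have d3 := st_d2 st x; rewrite /ff1.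
by apply: is_derive_eq.
Qed.

Let comp_opp (h : R -> R) : continuous h -> continuous (fun x => h (- x)).
Proof.
move=> ch x; apply: (@continuous_comp _ _ _ (fun x => - x) h); last exact: ch.
by apply: (@continuousN _ _ _ id).
Qed.

Lemma cpsi2 : continuous psi2.
Proof. by move=> x; apply: cvgD; [exact: (co_c2 co)|apply: comp_opp; exact: (co_c2 co)]. Qed.

Lemma cff2 : continuous ff2.
Proof.
have ce2 : continuous e2.
  move=> x; apply: cvgD; [apply: cvgD|].
  - by apply: cvgM; [exact: (co_c2 co)|exact: (derive_continuous dg)].
  - apply: cvgM; first exact: cvg_cst.
    by apply: cvgM; [exact: (derive_continuous dk1)|exact: (derive_continuous dg1)].
  - by apply: cvgM; [exact: (derive_continuous dk)|exact: (st_c2 st)].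
move=> x; apply: cvgB; last exact: comp_opp.
by apply: cvgB; [exact: (st_c2 st)|exact: ce2].
Qed.

Let near x : x <= X -> [/\ k x = 0, k1 x = 0 & k2 x = 0]. Proof. exact: (co_lo co). Qed.
Let far x : Z <= x -> [/\ k x = 1, k1 x = 0 & k2 x = 0]. Proof. exact: (co_hi co). Qed.
Let Z0 : 0 < Z. Proof. exact: lt_trans XZ. Qed.
Let opp_le x : 0 <= x -> - x <= X. Proof. by move=> x0; have := X0; lra. Qed.
Let opp_le1 x : X <= x -> - x <= X. Proof. by move=> x0; have := X0; lra. Qed.
Let opp_le2 x : Z <= x -> - x <= X. Proof. by move=> x0; have := X0; have := Z0; lra. Qed.

Lemma even_w2 x : w2 (- x) = w2 x.
Proof.
have o1 y : w1 (- y) = - w1 y.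
  have [_ h1] := opp_derive y (st_d1 st); have [_ h2] := st_d1 st y.
  have fE : (fun x => w (- x)) = w by apply/funext => z; exact: st_even st z.
  by rewrite -h2 -fE h1 opprK.
have [_ h1] := opp_derive x (st_d2 st); have [_ h2] := st_d2 st x.
have fE : (fun x => w1 (- x)) = (fun x => - w1 x) by apply/funext => z; exact: o1.
have d : is_derive x 1 (fun x => - w1 x) (- w2 x) by have d := st_d2 st x; apply: is_derive_eq.
by move: h1; rewrite fE; have [_ ->] := d => /oppr_inj.
Qed.

Lemma farE x : Z <= x -> [/\ psi x = 1, psi2 x = 0, ff0 x = 2 * j * x & ff2 x = 0].
Proof.
move=> Zx; have [h1 h2 h3] := far Zx; have [h4 h5 h6] := near (opp_le2 Zx).
rewrite /psi /psi2 /ff0 /ff2 /e2 h1 h2 h3 h4 h5 h6 /g; split; ring.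
Qed.

Let psi2_even x : psi2 (- x) = psi2 x. Proof. by rewrite /psi2 opprK addrC. Qed.
Let ff2_even x : ff2 (- x) = ff2 x. Proof. by rewrite /ff2 opprK even_w2; ring. Qed.
Lemma ff0_even x : ff0 (- x) = ff0 x. Proof. by rewrite /ff0 opprK (st_even st); ring. Qed.
Lemma psi_even x : psi (- x) = psi x. Proof. by rewrite /psi opprK addrC. Qed.

Let far_even (h : R -> R) : (forall x, h (- x) = h x) -> (forall x, Z <= x -> h x = 0) ->
  forall x, Z <= `|x| -> h x = 0.
Proof.
move=> eh hZ x; have [x0|x0] := leP 0 x; first by rewrite ger0_norm//; exact: hZ.
by rewrite ltr0_norm// => ?; rewrite -eh hZ.
Qed.

Lemma psi2_far x : Z <= `|x| -> psi2 x = 0.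
Proof. by apply: far_even => // y Zy; have [] := farE Zy. Qed.

Lemma ff2_far x : Z <= `|x| -> ff2 x = 0.
Proof. by apply: far_even => // y Zy; have [] := farE Zy. Qed.

Lemma psi_bd x : 0 <= psi x <= 1.
Proof.
have /andP[a1 a2] := co_bd co x; have /andP[a3 a4] := co_bd co (- x); rewrite /psi.
have [x0|x0] := leP 0 x.
  by have [-> _ _] := near (opp_le x0); apply/andP; split; lra.
have xX : x <= X by have := X0; lra.
by have [-> _ _] := near xX; apply/andP; split; lra.
Qed.

Lemma profile_inE x : `|x| <= X -> [/\ psi x = 0, psi1 x = 0, ff0 x = w x, ff1 x = w1 x & ff2 x = w2 x /\ psi2 x = 0].
Proof.
rewrite ler_norml => /andP[h h'].
have [h1 h2 h3] := near h'; have [h4 h5 h6] := near (ltac:(lra) : - x <= X).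
rewrite /psi /psi1 /psi2 /ff0 /ff1 /ff2 /e1 /e2 h1 h2 h3 h4 h5 h6; split; [ring|ring|ring|ring|split; ring].
Qed.

Lemma ff0_neg x : X <= x -> ff0 x - 2 * j * x = (1 - k x) * g x /\ psi x = k x.
Proof.
move=> Xx; have [h4 h5 h6] := near (opp_le1 Xx).
by rewrite /ff0 /psi h4 /g; split; ring.
Qed.

Lemma ff0_neg_bd x : X <= x -> ff0 x - 2 * j * x <= 0 /\ - (j * tau / 2) <= ff0 x - 2 * j * x.
Proof.
move=> Xx; have [-> _] := ff0_neg Xx.
have /andP[a1 a2] := co_bd co x.
have p0 : 0 < j * tau / 2 by rewrite divr_gt0// mulr_gt0.
have [xZ|/ltW xZ] := leP x Z; last first.
  by have [-> _ _] := far xZ; rewrite subrr mul0r oppr_le0; split => //; exact: ltW.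
have [b1 b2] := strip Xx xZ; split; first by rewrite mulr_ge0_le0// subr_ge0.
by apply: (le_trans b2); rewrite -subr_ge0 mulrBl mul1r; have := mulr_ge0_le0 a1 b1; lra.
Qed.

Variables (F0 Psi : R -> R).
Hypothesis dF0 : forall x, is_derive x 1 F0 (ff0 x).
Hypothesis oF0 : forall x, F0 (- x) = - F0 x.
Hypothesis dPsi : forall x, is_derive x 1 Psi (psi x).
Hypothesis oPsi : forall x, Psi (- x) = - Psi x.

Lemma F0X : F0 X = W X.
Proof.
have d x : is_derive x 1 (fun x => F0 x - W x) (ff0 x - w x).
  by have d1 := dF0 x; have d2 := st_dW st x; apply: is_derive_eq.
have := const_on (ltW X0) d; rewrite (odd_at0 oF0) (odd_at0 (st_oW st)) subrr.
move=> h; apply/eqP; rewrite -subr_eq0; apply/eqP/h => x x0 xX.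
by have [|_ _ -> _ _] := @profile_inE x; rewrite ?subrr// ger0_norm ltW.
Qed.

Lemma PsiX : Psi X = 0.
Proof.
rewrite (const_on (ltW X0) dPsi) ?odd_at0// => x x0 xX.
by have [|-> ] := @profile_inE x; rewrite // ger0_norm ltW.
Qed.

Lemma F0_far x : Z <= x -> F0 x - j * x ^+ 2 = F0 Z - j * Z ^+ 2.
Proof.
have d y : is_derive y 1 (fun x => F0 x - j * x ^+ 2) (ff0 y - 2 * j * y).
  by have d1 := dF0 y; apply: is_derive_eq; rewrite /GRing.scale/= ?expr1; ring.
move=> Zx; apply: (const_on Zx d) => y Zy _; have [_ _ -> _] := farE (ltW Zy); ring.
Qed.

Lemma F0_Z : F0 X - j * X ^+ 2 - j * tau / 2 <= F0 Z - j * Z ^+ 2.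
Proof.
have d y : is_derive y 1 (fun x => F0 x - j * x ^+ 2) (ff0 y - 2 * j * y).
  by have d1 := dF0 y; apply: is_derive_eq; rewrite /GRing.scale/= ?expr1; ring.
have [c + hc] := MVT XZ (fun z _ => d z) (continuous_subspaceT (derive_continuous d) (A := _)).
rewrite in_itv/= => /andP[h1 h2].
have [b1 b2] := ff0_neg_bd (ltW h1).
have : - (j * tau / 2) <= (ff0 c - 2 * j * c) * (Z - X).
  set b := ff0 c - 2 * j * c in b1 b2 *.
  have : b * 1 <= b * (Z - X) by apply: ler_wnM2l => //; rewrite lerBlDl.
  lra.
lra.
Qed.

Definition fA A x := ff0 x - A * psi x.
Definition fA1 A x := ff1 x - A * psi1 x.
Definition fA2 A x := ff2 x - A * psi2 x.
Definition FA A x := F0 x - A * Psi x.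

Lemma smooth_psi : smooth2 psi psi1 psi2 /\ smooth2 Psi psi psi1.
Proof.
by split; [exact: (csupp_smooth2 dpsi dpsi1 cpsi2 psi2_far)|
  exact: (csupp_smooth2_prim (ltW Z0) dPsi dpsi dpsi1 cpsi2 psi2_far)].
Qed.

Lemma smooth_ff : smooth2 ff0 ff1 ff2 /\ smooth2 F0 ff0 ff1.
Proof.
by split; [exact: (csupp_smooth2 dff0 dff1 cff2 ff2_far)|
  exact: (csupp_smooth2_prim (ltW Z0) dF0 dff0 dff1 cff2 ff2_far)].
Qed.

Lemma datumA A : 0 < A -> datum j (fA A) (fA1 A) (fA2 A) (FA A) X A Z.
Proof.
move=> A0.
have d0 x : is_derive x 1 (FA A) (fA A x).
  by have d1 := dF0 x; have d2 := dPsi x; rewrite /FA; apply: is_derive_eq; rewrite /GRing.scale/= ?expr1.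
have d1 x : is_derive x 1 (fA A) (fA1 A x).
  by have d1 := dff0 x; have d2 := dpsi x; rewrite /fA; apply: is_derive_eq; rewrite /GRing.scale/=.
have d2 x : is_derive x 1 (fA1 A) (fA2 A x).
  by have d1' := dff1 x; have d2 := dpsi1 x; rewrite /fA1; apply: is_derive_eq; rewrite /GRing.scale/=.
have c2 : continuous (fA2 A).
  by move=> x; apply: cvgB; [exact: cff2|apply: cvgM; [exact: cvg_cst|exact: cpsi2]].
have f2Z x : Z <= `|x| -> fA2 A x = 0 by move=> h; rewrite /fA2 ff2_far// psi2_far// mulr0 subrr.
split => //.
- exact: csupp_smooth2 f2Z.
- exact: (csupp_smooth2_prim (ltW Z0) d0 d1 d2 c2 f2Z).
- by move=> x; rewrite /fA ff0_even psi_even.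
- by move=> x; rewrite /FA oF0 oPsi; ring.
- move=> x x0 xX; have [|psiE _ fE _ _] := @profile_inE x; first by rewrite ger0_norm// ltW.
  by rewrite /fA psiE mulr0 subr0 fE (st_pos st).
- move=> x Xx; have [b _] := ff0_neg_bd Xx; rewrite /fA.
  by have /andP[p _] := psi_bd x; have := mulr_ge0 (ltW A0) p; lra.
- have [|_ p1 _ fE _] := @profile_inE X; first by rewrite ger0_norm// ltW.
  by rewrite /fA1 p1 mulr0 subr0 fE (st_slope st).
- by move=> x Zx; have [p _ fE _] := farE Zx; rewrite /fA p fE mulr1.
Qed.

End WithCutoff.

(** The data f0 - A p for all A > 0: they agree with w up to the edge, and A is the depth of the
    plateau past Z. This is the information from which A will be selected. *)
Record family (Z : R) (f0 f1 f2 F0 p p1 p2 Q : R -> R) : Prop := Family {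
  fa_sf : smooth2 f0 f1 f2 ;
  fa_sF : smooth2 F0 f0 f1 ;
  fa_sp : smooth2 p p1 p2 ;
  fa_sQ : smooth2 Q p p1 ;
  fa_p : forall x, 0 <= p x <= 1 ;
  fa_pZ : p Z = 1 ;
  fa_oQ : forall x, Q (- x) = - Q x ;
  fa_QX : Q X = 0 ;
  fa_FX : F0 X = W X ;
  fa_in : forall x, `|x| <= X -> [/\ p x = 0, p2 x = 0, f0 x = w x & f2 x = w2 x] ;
  fa_far : forall x, Z <= x -> F0 x - j * x ^+ 2 = F0 Z - j * Z ^+ 2 ;
  fa_Z : F0 X - j * X ^+ 2 - j * tau / 2 <= F0 Z - j * Z ^+ 2 ;
  fa_dat : forall A, 0 < A -> datum j (fun x => f0 x - A * p x) (fun x => f1 x - A * p1 x)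
     (fun x => f2 x - A * p2 x) (fun x => F0 x - A * Q x) X A Z }.

Lemma family_exists : exists Z f0 f1 f2 F0 p p1 p2 Q, family Z f0 f1 f2 F0 p p1 p2 Q.
Proof.
have [Z XZ [ZX1 strip]] := negative_strip.
have [k [k1 [k2 co]]] := cutoff_exists XZ.
have [F0 [dF0 oF0]] := odd_primitive (derive_continuous (dff0 co)) (ff0_even k).
have [Q [dQ oQ]] := odd_primitive (derive_continuous (dpsi co)) (@psi_even k).
have [sp sQ] := smooth_psi XZ co dQ.
have [sf sF] := smooth_ff XZ co dF0.
exists Z, (ff0 k), (ff1 k k1), (ff2 k k1 k2), F0, (psi k), (psi1 k1), (psi2 k2), Q; split => //.
- exact: psi_bd co.
- by have [] := farE XZ co (lexx Z).
- exact: PsiX co _ dQ oQ.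
- exact: F0X co _ dF0 oF0.
- by move=> x xX; have [? ? ? ? []] := profile_inE co xX; split.
- exact: F0_far XZ co _ dF0.
- exact: F0_Z XZ ZX1 strip co _ dF0.
- by move=> A; exact: (datumA XZ strip co dF0 oF0 dQ oQ).
Qed.
End Build.
End Restart.

(** * Choosing the plateau that restores the mass *)

Section Selection.
Context {R : realType}.
Implicit Types (r s t x y z e c m d a b A B : R).
Variables (j : R) (w w2 W : R -> R) (X tau Z : R) (f0 f1 f2 F0 p p1 p2 Q : R -> R).
Hypothesis j0 : 0 < j.
Hypothesis tau0 : 0 < tau.
Hypothesis X0 : 0 < X.
Hypothesis fa : family j w w2 W X tau Z f0 f1 f2 F0 p p1 p2 Q.
Let M0 := W X - j * X ^+ 2.
Hypothesis mass_big : j * tau < M0.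

Let f A x := f0 x - A * p x.
Let FA A x := F0 x - A * Q x.
Let tf := smooth2_tame (fa_sf fa).
Let tF := smooth2_tame (fa_sF fa).
Let tp := smooth2_tame (fa_sp fa).

Let tQ := smooth2_tame (fa_sQ fa).
Let dat A (A0 : 0 < A) : datum j (f A) _ _ (FA A) X A Z := fa_dat fa A0.

Let LamE A r : Lam j (FA A) tau r = Lam j F0 tau r - A * P tau Q r.
Proof. by rewrite /Lam PB//; [rewrite PZ//; ring|exact: tameZ]. Qed.

Let uuE' A r : uu j (f A) tau r = uu j f0 tau r - A * P tau p r.
Proof. by rewrite /uu PB//; [rewrite PZ//; ring|exact: tameZ]. Qed.

Let p_bd r : 0 <= P tau p r <= 1.
Proof.
apply/andP; split.
  by rewrite -(P_cst tau 0 r); apply: P_le => //; [exact: tame_cst|move=> x; have /andP[] := fa_p fa x].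
by rewrite -[leRHS](P_cst tau 1 r); apply: P_le => //; [exact: tame_cst|move=> x; have /andP[] := fa_p fa x].
Qed.

Let p_gt0 : 0 < P tau p 0.
Proof.
apply: (@E_gt0' _ _ (Z / Num.sqrt tau)); first exact: tame_P.
- by move=> x; have /andP[] := fa_p fa (0 + Num.sqrt tau * x).
- by rewrite add0r mulrC divfK ?gt_eqF ?sqrtr_gt0// (fa_pZ fa).
Qed.

Let Q_bd r : 0 <= r -> 0 <= P tau Q r <= r.
Proof.
have d := sm_d1 (smooth2_P tau (fa_sQ fa)).
have Q0 : P tau Q 0 = 0 by apply: P_center => // x; rewrite (fa_oQ fa) subrr mulr0.
rewrite le_eqVlt => /predU1P[<-|r0]; first by rewrite Q0 lexx.
have [c + hc] := MVT r0 (fun z _ => d z) (continuous_subspaceT (derive_continuous d) (A := _)).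
move=> _; move: hc; rewrite Q0 !subr0 => ->; have /andP[b1 b2] := p_bd c.
by rewrite mulr_ge0 ?(ltW r0)//= ler_piMl// ltW.
Qed.

Let m0 := F0 Z - j * Z ^+ 2.

(** For A near 0 the final mass is too large. When A = 0, the primitive of u past Z is the constant
    m0 >= M0 - j tau / 2, the source adds j tau, and far away the error is at most j tau / 4; a
    small A > 0 keeps the value above M0. *)
Let large_A0 : exists2 A : R, 0 < A & exists2 r, 0 <= r & M0 <= Lam j (FA A) tau r.
Proof.
have jt : 0 < j * tau by rewrite mulr_gt0.
pose h x := F0 x - (j * x ^+ 2 + m0).
have th : tame h.
  apply: tameB => //; apply: tameD; last exact: tame_cst.
  by apply: tameZ; apply: tameX; exact: tame_id.
have hZ x : Z <= x -> h x = 0 by move=> Zx; have := fa_far fa Zx; rewrite /h /m0; lra.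
have [C C0 hC] := sm_bd (fa_sF fa).
pose D : R := `|F0 0| + `|f0 0| + C + j + `|m0|.
have D0 : 0 <= D by rewrite /D !addr_ge0// ltW.
have hD x : `|h x| <= D * (1 + x ^+ 2).
  have := taylor2 (fa_sF fa) 0 x hC; rewrite add0r => t2.
  have := ler_normB (F0 x) (j * x ^+ 2 + m0); have := ler_normD (j * x ^+ 2) m0.
  rewrite normrM (gtr0_norm j0) (ger0_norm (sqr_ge0 x)) -/(h x).
  have := ler_normD (F0 x - F0 0 - x * f0 0) (F0 0 + x * f0 0).
  rewrite (_ : F0 x - F0 0 - x * f0 0 + (F0 0 + x * f0 0) = F0 x); last ring.
  have := ler_normD (F0 0) (x * f0 0); rewrite normrM.
  have : `|x| * `|f0 0| <= (1 + x ^+ 2) * `|f0 0| by rewrite ler_wpM2r// abs_le_sqr.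
  have : 0 <= x ^+ 2 * (`|F0 0| + `|m0|) by rewrite mulr_ge0 ?sqr_ge0// addr_ge0.
  rewrite /D; move: t2 C0 (ltW j0).
  set a := `|F0 x|; set b := `|F0 0|; set cc := `|f0 0|; set dd := `|F0 x - _ - _|.
  set y := x ^+ 2; set v := `|m0|; move=> t2 C0 jj; nra.
pose B : R := 56 * D * E4 * tau ^+ 2.
have B0 : 0 <= B by rewrite /B !mulr_ge0 ?E4_ge0 ?exprn_ge0// ltW.
pose r : R := Num.max 1 (Num.max (2 * `|Z|) (4 * B / (j * tau))).
have r1 : 1 <= r by rewrite le_max lexx.
have r2 : 2 * `|Z| <= r by rewrite !le_max lexx !orbT.
have r3 : 4 * B / (j * tau) <= r by rewrite !le_max lexx !orbT.
have r0 : 0 <= r by exact: le_trans r1.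
have := P_tail th D0 hD hZ (ltW tau0) r1 r2; rewrite -/B => pt.
have pt' : `|P tau h r| <= j * tau / 4.
  apply: (le_trans pt); rewrite ler_pdivrMr ?exprn_gt0 ?(lt_le_trans ltr01)//.
  rewrite ler_pdivrMr// in r3.
  have : r * 1 <= r ^+ 2 by rewrite expr2 ler_wpM2l.
  move=> rr; have : j * tau * r <= j * tau * r ^+ 2 by rewrite ler_pM2l//; lra.
  lra.
have PhE : P tau h r = P tau F0 r - (j * (r ^+ 2 + tau) + m0).
  have t1 : tame (fun x : R => j * x ^+ 2) by apply: tameZ; apply: tameX; exact: tame_id.
  rewrite /h PB//; last by apply: tameD => //; exact: tame_cst.
  rewrite PD//; last exact: tame_cst.
  by rewrite PZ ?P_sqr ?P_cst//; [exact: ltW|apply: tameX; exact: tame_id].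
have big : M0 < Lam j F0 tau r.
  have := fa_Z fa; rewrite (fa_FX fa) -/M0 -/m0 => mz.
  move: pt'; rewrite ler_norml => /andP[q1 _]; rewrite /Lam; lra.
have /andP[Q0 _] := Q_bd r0.
have Q1 : 0 < P tau Q r + 1 by rewrite ltr_wpDl.
exists ((Lam j F0 tau r - M0) / (P tau Q r + 1)); first by rewrite divr_gt0// subr_gt0.
exists r => //; rewrite LamE; set q := P tau Q r in Q0 Q1 *; set l := Lam j F0 tau r in big *.
have : (l - M0) / (q + 1) * q <= l - M0.
  by rewrite mulrAC ler_pdivrMr// ler_wpM2l ?lerDl//; lra.
lra.
Qed.

(** Intermediate values of the final mass phi(A). It is nonincreasing because [P tau Q] is
    nonnegative on the half-line, and Lipschitz for A >= A0 because the zeros then stay below one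
    bound K. *)
Lemma selection : exists2 A : R, 0 < A & isM j (f A) (FA A) tau (Lam j (FA A) 0 X).
Proof.
have [A0 A00 [r0 r00 hr0]] := large_A0.
have ex A (hA : 0 < A) : exists m, isM j (f A) (FA A) tau m := isM_exists (dat hA) (ltW tau0).
pose phi A := xget 0 [set m | isM j (f A) (FA A) tau m].
have phiP A (hA : 0 < A) : isM j (f A) (FA A) tau (phi A).
  exact/(@xgetPex _ 0 [set m | isM j (f A) (FA A) tau m])/ex.
have phi0 A (hA : 0 < A) : 0 <= phi A.
  by rewrite -(Lam0 (dat hA) tau); have [h _] := phiP A hA; exact: h.
have mono A B : 0 < A -> A <= B -> phi B <= phi A.
  move=> hA AB; have hB : 0 < B by exact: lt_le_trans AB.
  have [hA1 _] := phiP A hA; have [_ [[x [x0 _ _] <-]|->]] := phiP B hB; last exact: phi0.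
  apply: le_trans (hA1 x (ltW x0)); rewrite !LamE lerD2l lerN2 ler_wpM2r//.
  by have /andP[] := Q_bd (ltW x0).
have [K K0 hK] := uu_far (dat A00) 0 (ltW tau0).
have lip A B : A0 <= A -> A <= B -> phi A <= phi B + (B - A) * K.
  move=> h0 AB; have hA : 0 < A by exact: lt_le_trans h0.
  have hB : 0 < B by exact: lt_le_trans AB.
  have [hB1 _] := phiP B hB; have [_ [[x zx <-]|->]] := phiP A hA; last first.
    by rewrite addr_ge0 ?phi0// mulr_ge0// subr_ge0.
  have [x0 px _] := zx.
  have xK : x <= K.
    rewrite leNgt; apply/negP => Kx; have := px K K0 Kx; rewrite uuE'.
    move: hK; rewrite uuE'; have /andP[b1 _] := p_bd K.
    have : A0 * P tau p K <= A * P tau p K by rewrite ler_wpM2r.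
    lra.
  have := hB1 x (ltW x0); rewrite !LamE; have /andP[q0 q1] := Q_bd (ltW x0).
  have : (B - A) * P tau Q x <= (B - A) * K by rewrite ler_wpM2l ?subr_ge0// (le_trans q1).
  lra.
(* With this A1, u is negative at the origin at time tau: there is no zero and the mass is 0. *)
pose A1 : R := A0 + `|P tau f0 0| / P tau p 0.
have A01 : A0 <= A1 by rewrite lerDl divr_ge0// ltW.
have A10 : 0 < A1 by exact: lt_le_trans A01.
have end1 : phi A1 <= M0.
  have [_ [[x [x0 px _] _]|->]] := phiP A1 A10; last first.
    by apply: ltW; apply: lt_trans mass_big; rewrite mulr_gt0.
  exfalso; have := px 0 (lexx 0) x0; rewrite uuE' /uu mulr0 subr0 /A1 mulrDl divfK ?gt_eqF//.
  have := mulr_gt0 A00 p_gt0; have := ler_norm (P tau f0 0); lra.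
have end0 : M0 <= phi A0 by apply: (le_trans hr0); have [h _] := phiP A0 A00; exact: h.
(* Frozen below A0, so as to be continuous on the whole line. *)
pose ph A := phi (Num.max A A0).
have cph : continuous ph.
  have lipp A B : `|ph A - ph B| <= K * `|A - B|.
    have half A' B' : A' <= B' -> `|ph A' - ph B'| <= K * (B' - A').
      move=> AB; rewrite /ph; set a := Num.max A' A0; set b := Num.max B' A0.
      have a0 : A0 <= a by rewrite le_max lexx orbT.
      have ab : a <= b by rewrite /a /b ge_max !le_max AB lexx !orbT.
      have ba : b - a <= B' - A' by rewrite /a /b; case: (leP A' A0) => ?; case: (leP B' A0) => ?; lra.
      have := mono a b (lt_le_trans A00 a0) ab; have := lip a b a0 ab.
      have : (b - a) * K <= (B' - A') * K by rewrite ler_wpM2r.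
      move=> h1 h2 h3; rewrite ger0_norm; lra.
    have [h|/ltW h] := leP A B.
      by rewrite [`|A - B|]ler0_norm ?subr_le0// opprB half.
    by rewrite distrC [`|A - B|]ger0_norm ?subr_ge0// half.
  exact: ucont_continuous (lip_ucont K0 lipp).
have [|A + hA] := IVT A01 (continuous_subspaceT cph (A := _)) (v := M0).
  rewrite /ph (max_l A01) maxxx.
  by rewrite ge_min le_max end0 end1 !orbT.
rewrite in_itv/= => /andP[h1 h2].
have hA0 : 0 < A by exact: lt_le_trans h1.
exists A => //; move: hA; rewrite /ph (max_l h1) => hA.
have -> : Lam j (FA A) 0 X = M0 by rewrite /Lam P0 /FA (fa_QX fa) mulr0 subr0 (fa_FX fa).
by rewrite -hA; exact: phiP.
Qed.
End Selection.

(** * Iterating over time intervals *)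

Section Iteration.
Context {R : realType}.
Implicit Types (r s t x y z e c m d a b A B : R).

(** Used at both ends of an evolution. The agreement is on [0, X] only, since each restart changes
    the profile beyond the edge. *)
Record ends_at (j T : R) (Y : R -> R) (u u2 L : R -> R -> R) (w w2 W : R -> R) (X : R) : Prop := EndsAt {
  ea_X : Y T = X ;
  ea_u : forall r, 0 <= r -> r <= X -> u T r = w r - 2 * j * r ;
  ea_u2 : forall r, 0 <= r -> r <= X -> u2 T r = w2 r ;
  ea_L : L T X = W X - j * X ^+ 2 }.

Lemma one_step (j tau : R) (w w1 w2 W : R -> R) (X : R) : 0 < j -> 0 < tau ->
  state j w w1 w2 W X -> j * tau < W X - j * X ^+ 2 ->
  exists Y u u1 u2 L, [/\ evol j (j * tau) tau Y u u1 u2 L,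
    ends_at j 0 Y u u2 L w w2 W X &
    exists v v1 v2 V, [/\ state j v v1 v2 V (Y tau),
      ends_at j tau Y u u2 L v v2 V (Y tau) & V (Y tau) - j * Y tau ^+ 2 = W X - j * X ^+ 2]].
Proof.
move=> j0 tau0 st mb; have X0 := st_X st.
have [Z [f0 [f1 [f2 [F0 [p [p1 [p2 [Q fa]]]]]]]]] := family_exists j0 st tau0.
have [A A0 hM] := selection j0 tau0 fa mb.
have dat := fa_dat fa A0.
set f := (fun x => f0 x - A * p x) in hM dat *; set FF := (fun x => F0 x - A * Q x) in hM dat *.
set g2 := (fun x => f2 x - A * p2 x) in dat *.
have L0X : Lam j FF 0 X = W X - j * X ^+ 2.
  by rewrite /Lam P0 /FF (fa_QX fa) mulr0 subr0 (fa_FX fa).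
have mb' : j * tau < Lam j FF 0 X by rewrite L0X.
have za := zero_all dat (ltW tau0) mb' hM.
have hz s : 0 <= s -> s <= tau -> exists x, zero j f s x.
  by move=> s0 sT; have [x zx _] := za s s0 sT; exists x.
pose Y := edgec j f.
have Y0 : Y 0 = X := edgec0 dat tau0 hz.
have zY s : 0 <= s -> s <= tau -> zero j f s (Y s) by move=> s0 sT; exact: edgecP hz s s0 sT.
have ev : evol j (j * tau) tau Y (uu j f) (uu1 j (fun x => f1 x - A * p1 x)) (fun s => P s g2) (Lam j FF).
  apply: (piece_evol dat tau0 hz) => s s0 sT.
  have [x zx hx] := za s s0 sT; rewrite -/(Y s) -/(Y 0) (zero_uniq (zY s s0 sT) zx) Y0.
  exact: hx.
have tT := lexx tau.
have MT : Lam j FF tau (Y tau) = Lam j FF 0 X.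
  apply: (isM_uniq dat _ hM); split; last by left; exists (Y tau) => //; apply: zY => //; exact: ltW.
  by move=> r r0; apply: (Lam_max dat) => //; apply: zY => //; exact: ltW.
exists Y, (uu j f), (uu1 j (fun x => f1 x - A * p1 x)), (fun s => P s g2), (Lam j FF); split => //.
  split => //.
  - move=> r r0 rX; have [|p0 _ fE _] := fa_in fa (x := r); first by rewrite ger0_norm.
    by rewrite /uu P0 /f p0 mulr0 subr0 fE.
  - move=> r r0 rX; have [|_ p0 _ fE] := fa_in fa (x := r); first by rewrite ger0_norm.
    by rewrite P0 /g2 p0 mulr0 subr0 fE.
exists (P tau f), (P tau (fun x => f1 x - A * p1 x)), (P tau g2), (P tau FF); split.
- have sP := smooth2_P tau (d_sf dat); have sPF := smooth2_P tau (d_sF dat).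
  have z := zY tau (ltW tau0) tT.
  split.
  + exact: sm_d1 sP.
  + exact: sm_d2 sP.
  + exact: smooth2_c2 sP.
  + exact: sm_d1 sPF.
  + by move=> x; apply: P_odd; [exact: smooth2_tame (d_sF dat)|exact: d_odd dat].
  + by move=> x; apply: P_even; [exact: smooth2_tame (d_sf dat)|exact: d_even dat].
  + by have [] := z.
  + by have [_ h _] := z => x; exact: h.
  + exact: (zero_eq dat z).
  + by have := zero_slope dat (ltW tau0) z; rewrite /uu1; lra.
- by split.
- by rewrite -[LHS]/(Lam j FF tau (Y tau)) MT.
Qed.

(** The mass returns exactly to its initial value at each multiple of tau, so the condition j tau <
    mass needed for restarting never degrades. *)
Lemma iterated_evol (j tau : R) (w w1 w2 W : R -> R) (X : R) n : 0 < j -> 0 < tau ->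
  state j w w1 w2 W X -> j * tau < W X - j * X ^+ 2 ->
  exists Y u u1 u2 L, [/\ evol j (j * tau) (n.+1%:R * tau) Y u u1 u2 L,
    ends_at j 0 Y u u2 L w w2 W X &
    exists v v1 v2 V, [/\ state j v v1 v2 V (Y (n.+1%:R * tau)),
      ends_at j (n.+1%:R * tau) Y u u2 L v v2 V (Y (n.+1%:R * tau)) &
      V (Y (n.+1%:R * tau)) - j * Y (n.+1%:R * tau) ^+ 2 = W X - j * X ^+ 2]].
Proof.
move=> j0 tau0 st mb; elim: n => [|n [Y [u [u1 [u2 [L [ev e0 [v [v1 [v2 [V [sv ve mv]]]]]]]]]]]].
  by rewrite mul1r; exact: one_step st mb.
rewrite -mv in mb.
have [Y' [u' [u1' [u2' [L' [ev' e0' [v' [v1' [v2' [V' [sv' ve' mv']]]]]]]]]]] := one_step j0 tau0 sv mb.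
pose Ta : R := n.+1%:R * tau.
have Ta0 : 0 < Ta by rewrite mulr_gt0.
have -> : n.+2%:R * tau = Ta + tau by rewrite -[n.+2]addn1 natrD mulrDl mul1r.
have TaT : Ta < Ta + tau by rewrite ltrDl.
have sub : Ta + tau - Ta = tau by ring.
exists (glue Ta Y Y'), (glue Ta u u'), (glue Ta u1 u1'), (glue Ta u2 u2'), (glue Ta L L'); split.
- apply: (evol_glue (ltW j0) Ta0 (ltW tau0) ev ev').
  + exact: (ea_X e0').
  + by move=> r r0 rX; rewrite (ea_u e0')// (ea_u ve).
  + by move=> r r0 rX; rewrite (ea_u2 e0')// (ea_u2 ve).
  + by rewrite (ea_L ve) mv -(ea_L e0) (ea_X e0).
- by split; rewrite ?glueL ?(ltW Ta0)//; [exact: (ea_X e0)|exact: (ea_u e0)|exact: (ea_u2 e0)|exact: (ea_L e0)].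
- exists v', v1', v2', V'; rewrite glueR// sub; split => //.
  + by split; rewrite ?glueR ?sub//; [exact: (ea_u ve')|exact: (ea_u2 ve')|exact: (ea_L ve')].
  + by rewrite mv' mv.
Qed.

End Iteration.

(** * Mollification by second differences *)

Section Steklov.
Context {R : realType}.
Implicit Types (r s t x y z e c m d a b k L : R) (f g : R -> R).

(** The model is convolution with the hat kernel of half-width k, written as the second difference
    of a second primitive divided by k^2: bounds, monotonicity and symmetries pass to g without
    computing a convolution. *)
Record mollifier f k g g1 g2 : Prop := Mollifier {
  mo_d1 : forall x, is_derive x 1 g (g1 x) ;
  mo_d2 : forall x, is_derive x 1 g1 (g2 x) ;
  mo_g2 : forall x, g2 x = (f (x + k) - 2 * f x + f (x - k)) / k ^+ 2 ;
  mo_ge : forall x m, (forall y, `|y - x| <= k -> m <= f y) -> m <= g x ;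
  mo_le : forall x m, (forall y, `|y - x| <= k -> f y <= m) -> g x <= m ;
  mo_mono : (forall x y, x <= y -> f y <= f x) -> forall x, g1 x <= 0 ;
  mo_center : forall c, (forall x, f x + f (- x) = 2 * c) -> forall x, g x + g (- x) = 2 * c ;
  mo_even : (forall x, f (- x) = f x) -> forall x, g (- x) = g x }.

Lemma shift_derive (h h1 : R -> R) c x : (forall x, is_derive x 1 h (h1 x)) ->
  is_derive x 1 (fun x => h (x + c)) (h1 (x + c)).
Proof.
move=> dh; have d : is_derive x 1 (fun x : R => x + c) 1 by apply: is_derive_eq; rewrite addr0.
by have := @is_derive1_comp _ h (fun x => x + c) x _ _ (dh (x + c)) d; rewrite mulr1.
Qed.

Lemma nondecr_of_derive (h h1 : R -> R) a b : a <= b -> (forall x, is_derive x 1 h (h1 x)) ->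
  (forall x, a < x -> x < b -> 0 <= h1 x) -> h a <= h b.
Proof.
move=> + dh h0; rewrite le_eqVlt => /predU1P[->//|ab].
have [c + hc] := MVT ab (fun z _ => dh z) (continuous_subspaceT (derive_continuous dh) (A := _)).
rewrite in_itv/= => /andP[h1' h2]; have := h0 c h1' h2 => p0.
have := mulr_ge0 p0 (ltW (ltac:(lra) : 0 < b - a)); rewrite -hc; lra.
Qed.

(** As a function of y, Q(x + y) + Q(x - y) - m y^2 has derivative 0 at 0 and nonnegative second
    derivative, so it is nondecreasing on [0, k]. *)
Lemma second_difference (Q Q1 f : R -> R) x k m : 0 <= k ->
  (forall x, is_derive x 1 Q (Q1 x)) -> (forall x, is_derive x 1 Q1 (f x)) ->
  (forall y, `|y - x| <= k -> m <= f y) -> m * k ^+ 2 <= Q (x + k) - 2 * Q x + Q (x - k).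
Proof.
move=> k0 dQ dQ1 fm.
pose p y := Q (x + y) + Q (x - y) - m * y ^+ 2.
pose p1 y := Q1 (x + y) - Q1 (x - y) - 2 * m * y.
pose p2 y := f (x + y) + f (x - y) - 2 * m.
have plus (h h1 : R -> R) y : (forall x, is_derive x 1 h (h1 x)) -> is_derive y 1 (fun y => h (x + y)) (h1 (x + y)).
  move=> dh; have -> : (fun y => h (x + y)) = (fun y => h (y + x)) by apply/funext => z; rewrite addrC.
  by rewrite addrC; exact: shift_derive.
have minus (h h1 : R -> R) y : (forall x, is_derive x 1 h (h1 x)) -> is_derive y 1 (fun y => h (x - y)) (- h1 (x - y)).
  by move=> dh; exact: (opp_derive y (fun z => plus h h1 z dh)).
have dp y : is_derive y 1 p (p1 y).
  have d1 := plus _ _ y dQ; have d2 := minus _ _ y dQ; rewrite /p.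
  by apply: is_derive_eq; rewrite /p1 /GRing.scale/= ?expr1; ring.
have dp1 y : is_derive y 1 p1 (p2 y).
  have d1 := plus _ _ y dQ1; have d2 := minus _ _ y dQ1; rewrite /p1.
  by apply: is_derive_eq; rewrite /p2 /GRing.scale/=; ring.
have p1_ge0 y : 0 < y -> y < k -> 0 <= p1 y.
  move=> y0 yk; have := nondecr_of_derive (ltW y0) dp1.
  rewrite {1}/p1 addr0 subr0 subrr mulr0 subrr; apply=> z z0 zy.
  have h1 : m <= f (x + z) by apply: fm; rewrite addrC addKr ger0_norm; lra.
  have h2 : m <= f (x - z) by apply: fm; rewrite addrC addKr normrN ger0_norm; lra.
  by rewrite /p2; lra.
have := nondecr_of_derive k0 dp p1_ge0.
by rewrite /p addr0 subr0 expr0n mulr0 subr0; lra.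
Qed.

Lemma mollifier_exists f k : continuous f -> 0 < k -> exists g g1 g2, mollifier f k g g1 g2.
Proof.
move=> cf k0; have [Q1 dQ1] := primitive cf; have [Q dQ] := primitive (derive_continuous dQ1).
have kk : 0 < k ^+ 2 by rewrite exprn_gt0.
pose D (h : R -> R) x := k ^- 2 * (h (x + k) - 2 * h x + h (x - k)).
have dD (h h1 : R -> R) x : (forall x, is_derive x 1 h (h1 x)) -> is_derive x 1 (D h) (D h1 x).
  move=> dh; have d1 := shift_derive k x dh; have d2 := shift_derive (- k) x dh; have d3 := dh x.
  by rewrite /D; apply: is_derive_eq.
have lo x m : (forall y, `|y - x| <= k -> m <= f y) -> m <= D Q x.
  move=> h; rewrite /D mulrC ler_pdivlMr//; exact: second_difference (ltW k0) dQ dQ1 h.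
have hi x m : (forall y, `|y - x| <= k -> f y <= m) -> D Q x <= m.
  move=> h; rewrite /D mulrC ler_pdivrMr//.
  have d1 y : is_derive y 1 (fun y => - Q y) (- Q1 y) by have d := dQ y; apply: is_derive_eq.
  have d2 y : is_derive y 1 (fun y => - Q1 y) (- f y) by have d := dQ1 y; apply: is_derive_eq.
  have := second_difference (ltW k0) d1 d2 (m := - m) (x := x).
  move=> H; have := H (fun y hy => ltac:(by rewrite lerN2; exact: h)); lra.
exists (D Q), (D Q1), (D f); split => //.
- by move=> x; exact: dD.
- by move=> x; exact: dD.
- by move=> x; rewrite /D mulrC.
- move=> mono x; rewrite /D pmulr_rle0 ?invr_gt0//.
  have c1 := continuous_subspaceT (derive_continuous dQ1).
  have [a + ha] := MVT (ltac:(lra) : x < x + k) (fun z _ => dQ1 z) (c1 _).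
  have [b + hb] := MVT (ltac:(lra) : x - k < x) (fun z _ => dQ1 z) (c1 _).
  rewrite !in_itv/= => /andP[b1 b2] /andP[a1 a2].
  have ab : f a <= f b by apply: mono; lra.
  have : (f a - f b) * k <= 0 by rewrite pmulr_lle0// subr_le0.
  have e1 : x + k - x = k by ring.
  have e2 : x - (x - k) = k by ring.
  move: ha hb; rewrite e1 e2; lra.
- move=> c hc x.
  (* Q(y) + Q(-y) has the constant second derivative 2 c, so [second_difference] for it and for its
     opposite gives an equality. *)
  have d1 y : is_derive y 1 (fun y => Q y + Q (- y)) (Q1 y - Q1 (- y)).
    by have d := dQ y; have d' := opp_derive y dQ; apply: is_derive_eq.
  have d2 y : is_derive y 1 (fun y => Q1 y - Q1 (- y)) (2 * c).
    have d := dQ1 y; have d' := opp_derive y dQ1; apply: is_derive_eq.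
    by rewrite opprK hc.
  have h1 := second_difference (ltW k0) d1 d2 (m := 2 * c) (x := x) (fun y _ => lexx _).
  have d1' y : is_derive y 1 (fun y => - (Q y + Q (- y))) (- (Q1 y - Q1 (- y))).
    by have d := d1 y; apply: is_derive_eq.
  have d2' y : is_derive y 1 (fun y => - (Q1 y - Q1 (- y))) (- (2 * c)).
    by have d := d2 y; apply: is_derive_eq.
  have h2 := second_difference (ltW k0) d1' d2' (m := - (2 * c)) (x := x) (fun y _ => lexx _).
  apply: (mulfI (lt0r_neq0 kk)); rewrite /D.
  rewrite (_ : - x + k = - (x - k)); last ring.
  rewrite (_ : - x - k = - (x + k)); last ring.
  rewrite mulrDr !mulrA divff ?gt_eqF// !mul1r; lra.
- move=> ef x.
  have d1 y : is_derive y 1 (fun y => Q y - Q (- y)) (Q1 y + Q1 (- y)).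
    by have d := dQ y; have d' := opp_derive y dQ; apply: is_derive_eq; rewrite opprK.
  have d2 y : is_derive y 1 (fun y => Q1 y + Q1 (- y)) 0.
    by have d := dQ1 y; have d' := opp_derive y dQ1; apply: is_derive_eq; rewrite ef subrr.
  have h1 := second_difference (ltW k0) d1 d2 (m := 0) (x := x) (fun y _ => lexx _).
  have d1' y : is_derive y 1 (fun y => - (Q y - Q (- y))) (- (Q1 y + Q1 (- y))).
    by have d := d1 y; apply: is_derive_eq.
  have d2' y : is_derive y 1 (fun y => - (Q1 y + Q1 (- y))) 0.
    by have d := d2 y; apply: is_derive_eq; rewrite oppr0.
  have h2 := second_difference (ltW k0) d1' d2' (m := 0) (x := x) (fun y _ => lexx _).
  apply: (mulfI (lt0r_neq0 kk)); rewrite /D.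
  rewrite (_ : - x + k = - (x - k)); last ring.
  rewrite (_ : - x - k = - (x + k)); last ring.
  rewrite !mulrA divff ?gt_eqF// !mul1r; lra.
Qed.

Lemma mollifier_close f k g g1 g2 L : mollifier f k g g1 g2 -> 0 <= L ->
  (forall x y, `|f x - f y| <= L * `|x - y|) -> forall x, `|g x - f x| <= L * k.
Proof.
move=> mo L0 lip x.
have H y : `|y - x| <= k -> f x - L * k <= f y <= f x + L * k.
  move=> hy; have := lip y x; rewrite ler_norml => /andP[h1 h2].
  have : L * `|y - x| <= L * k by rewrite ler_wpM2l.
  by move=> h3; apply/andP; split; lra.
have h1 := mo_ge mo (fun y hy => proj1 (andP (H y hy))).
have h2 := mo_le mo (fun y hy => proj2 (andP (H y hy))).
by rewrite ler_norml; apply/andP; split; lra.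
Qed.

Lemma mollifier_smooth f k g g1 g2 L : mollifier f k g g1 g2 -> 0 <= L -> 0 < k ->
  (forall x y, `|f x - f y| <= L * `|x - y|) -> smooth2 g g1 g2.
Proof.
move=> mo L0 k0 lip; have kk : 0 < k ^+ 2 by rewrite exprn_gt0.
split; [exact: mo_d1 mo|exact: mo_d2 mo| |].
- exists (2 * L * k / k ^+ 2); first by rewrite divr_ge0 ?sqr_ge0 ?mulr_ge0 ?(ltW k0).
  move=> x; rewrite (mo_g2 mo) normrM normfV (gtr0_norm kk) ler_pM2r ?invr_gt0//.
  have := lip (x + k) x; rewrite addrAC subrr add0r (gtr0_norm k0) => h1.
  have := lip (x - k) x; rewrite addrAC subrr add0r normrN (gtr0_norm k0) => h2.
  have := ler_normD (f (x + k) - f x) (f (x - k) - f x).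
  by rewrite (_ : f (x + k) - f x + (f (x - k) - f x) = f (x + k) - 2 * f x + f (x - k)); [lra|ring].
- apply: (@lip_ucont _ _ (4 * L / k ^+ 2)); first by rewrite divr_ge0 ?sqr_ge0 ?mulr_ge0.
  move=> x y; rewrite !(mo_g2 mo) -mulrBl normrM normfV (gtr0_norm kk).
  rewrite (_ : 4 * L / k ^+ 2 * `|x - y| = 4 * L * `|x - y| / k ^+ 2); last by rewrite mulrAC.
  rewrite ler_pM2r ?invr_gt0//.
  have := lip (x + k) (y + k); rewrite (_ : x + k - (y + k) = x - y); last ring.
  have := lip (x - k) (y - k); rewrite (_ : x - k - (y - k) = x - y); last ring.
  have := lip x y; move: (`|x - y|) => n h1 h2 h3.
  have := ler_normD (f (x + k) - f (y + k) - 2 * (f x - f y)) (f (x - k) - f (y - k)).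
  have := ler_normB (f (x + k) - f (y + k)) (2 * (f x - f y)).
  rewrite normrM (ger0_norm (ltW (ltr0Sn _ 1)) : `|2| = 2).
  rewrite (_ : f (x + k) - f (y + k) - 2 * (f x - f y) + (f (x - k) - f (y - k)) =
     f (x + k) - 2 * f x + f (x - k) - (f (y + k) - 2 * f y + f (y - k))); last ring.
  lra.
Qed.

End Steklov.

(** * The reflected heat flow on tails *)

Section Barriers.
Context {R : realType}.
Notation mu := (@lebesgue_measure R).
Implicit Types (r s t x y z e c m d a b k L : R) (f g h : R -> R).

Definition cb f := ucont f /\ exists C : R, forall x, `|f x| <= C.

Lemma ucont_lip_comp f g : ucont f -> (forall x y, `|g x - g y| <= `|x - y|) -> ucont (fun x => f (g x)).
Proof.
move=> uf gl e e0; have [K K0 hK] := uf e e0; exists K => // x y.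
apply: (le_trans (hK _ _)); rewrite lerD2l ler_wpM2l//.
by rewrite -[leLHS]real_normK ?num_real// -[leRHS]real_normK ?num_real// lerXn2r// nnegrE.
Qed.

Lemma ucontD f g : ucont f -> ucont g -> ucont (fun x => f x + g x).
Proof.
move=> uf ug e e0; have [K K0 hK] := uf (e / 2) (divr_gt0 e0 (ltr0Sn _ 1)).
have [K' K'0 hK'] := ug (e / 2) (divr_gt0 e0 (ltr0Sn _ 1)).
exists (K + K'); first exact: addr_ge0.
move=> x y; have := hK x y; have := hK' x y.
have := ler_normD (f x - f y) (g x - g y).
rewrite (_ : f x - f y + (g x - g y) = f x + g x - (f y + g y)); last ring.
by rewrite mulrDl; lra.
Qed.

Lemma ucontZ c f : ucont f -> ucont (fun x => c * f x).
Proof.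
move=> uf e e0; have c0 : 0 < `|c| + 1 by rewrite ltr_wpDl.
have [K K0 hK] := uf (e / (`|c| + 1)) (divr_gt0 e0 c0).
exists ((`|c| + 1) * K); first by rewrite mulr_ge0// ltW.
move=> x y; rewrite -mulrBr normrM; apply: (@le_trans _ _ ((`|c| + 1) * `|f x - f y|)).
  by rewrite ler_wpM2r// lerDl.
apply: (le_trans (ler_wpM2l (ltW c0) (hK x y))).
by rewrite mulrDr mulrC divfK ?gt_eqF// mulrA.
Qed.

Lemma ucont_cst c : ucont (fun=> c).
Proof. by move=> e e0; exists 0 => // x y; rewrite subrr normr0 mul0r addr0 ltW. Qed.

(* f on the half-line, extended to R by central symmetry about (0, f 0): this is
   how the heat flow with reflection acts on tail functions. *)
Definition ox f x : R := f (posp x) + f 0 - f (posp (- x)).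

Lemma cbD f g : cb f -> cb g -> cb (fun x => f x + g x).
Proof.
move=> [cf [C hC]] [cg [D hD]]; split; first exact: ucontD.
by exists (C + D) => x; apply: (le_trans (ler_normD _ _)); exact: lerD.
Qed.

Lemma cbZ c f : cb f -> cb (fun x => c * f x).
Proof.
move=> [cf [C hC]]; split; first exact: ucontZ.
by exists (`|c| * C) => x; rewrite normrM ler_wpM2l.
Qed.

Lemma cb_cst c : cb (fun=> c).
Proof. by split; [exact: ucont_cst|exists `|c|]. Qed.

Lemma cbB f g : cb f -> cb g -> cb (fun x => f x - g x).
Proof.
move=> cf cg; have -> : (fun x => f x - g x) = (fun x => f x + -1 * g x).
  by apply/funext => x; rewrite mulN1r.
exact: cbD cf (cbZ _ cg).
Qed.

Lemma posp_le x : `|posp x| <= `|x|.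
Proof.
by rewrite /posp; case: (leP x 0) => h; rewrite ?normr0.
Qed.

Lemma posp_mono x y : x <= y -> posp x <= posp y.
Proof. by move=> xy; rewrite /posp ge_max !le_max xy lexx !orbT. Qed.

Lemma posp_ge x : x <= posp x. Proof. by rewrite /posp le_max lexx. Qed.

Lemma posp_lip x y : `|posp x - posp y| <= `|x - y|.
Proof.
rewrite /posp; case: (leP x 0) => h1; case: (leP y 0) => h2; rewrite ?subrr ?normr0//.
- by rewrite sub0r normrN gtr0_norm// ler0_norm; lra.
- by rewrite subr0 gtr0_norm// ger0_norm; lra.
Qed.

Lemma cb_posp f : cb f -> cb (fun x => posp (f x)).
Proof.
move=> [cf [C hC]]; split.
  move=> e e0; have [K K0 hK] := cf e e0; exists K => // x y; exact: le_trans (posp_lip _ _) (hK x y).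
by exists C => x; exact: le_trans (posp_le _) (hC x).
Qed.

Lemma ox_pos f x : 0 <= x -> ox f x = f x.
Proof. by move=> x0; rewrite /ox posp_id// [posp (- x)]posp_0 ?oppr_le0// addrK. Qed.

Lemma ox_neg f x : x <= 0 -> ox f x = 2 * f 0 - f (- x).
Proof. by move=> x0; rewrite /ox posp_0// posp_id ?oppr_ge0//; ring. Qed.

Lemma ox_center f x : ox f x + ox f (- x) = 2 * f 0.
Proof. by rewrite /ox opprK; ring. Qed.

Lemma ox_D f g x : ox (fun x => f x + g x) x = ox f x + ox g x.
Proof. by rewrite /ox; ring. Qed.

Lemma ox_cst c x : ox (fun=> c) x = c. Proof. by rewrite /ox; ring. Qed.

Lemma ox_Z c f x : ox (fun x => c * f x) x = c * ox f x.
Proof. by rewrite /ox; ring. Qed.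

Lemma ox_ge0 f x : (forall x, 0 <= x -> 0 <= f x) -> (forall x, 0 <= x -> f x <= f 0) -> 0 <= ox f x.
Proof.
move=> f0 fm; have [x0|/ltW x0] := leP 0 x; first by rewrite ox_pos// f0.
by rewrite ox_neg//; have := fm (- x); have := f0 0; rewrite oppr_ge0 x0 lexx => /(_ isT) h /(_ isT); lra.
Qed.

Lemma ox_mono f : (forall x y, 0 <= x -> x <= y -> f y <= f x) -> forall x y, x <= y -> ox f y <= ox f x.
Proof.
move=> fm x y xy; have h1 := fm _ _ (posp_ge0 x) (posp_mono xy).
have xy' : - y <= - x by rewrite lerN2.
have h2 := fm _ _ (posp_ge0 (- y)) (posp_mono xy').
by rewrite /ox; lra.
Qed.

Lemma ox_lip f L : 0 <= L -> (forall x y, `|f x - f y| <= L * `|x - y|) ->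
  forall x y, `|ox f x - ox f y| <= 2 * L * `|x - y|.
Proof.
move=> L0 lip x y.
rewrite (_ : ox f x - ox f y = f (posp x) - f (posp y) - (f (posp (- x)) - f (posp (- y)))); last first.
  by rewrite /ox; ring.
apply: (le_trans (ler_normB _ _)).
have h1 := le_trans (lip (posp x) (posp y)) (ler_wpM2l L0 (posp_lip x y)).
have := le_trans (lip (posp (- x)) (posp (- y))) (ler_wpM2l L0 (posp_lip (- x) (- y))).
by rewrite -opprD normrN => h2; lra.
Qed.

Lemma ox_ucont f : ucont f -> ucont (ox f).
Proof.
move=> uf; have -> : ox f = (fun x => (f (posp x) + f 0) + -1 * f (posp (- x))).
  by apply/funext => x; rewrite mulN1r.
apply: ucontD; first by apply: ucontD; [exact: (ucont_lip_comp uf posp_lip)|exact: ucont_cst].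
apply: ucontZ; apply: (ucont_lip_comp (g := fun x => posp (- x)) uf) => x y.
by apply: (le_trans (posp_lip _ _)); rewrite -opprD normrN.
Qed.

Lemma tame_bounded f C : continuous f -> (forall x, `|f x| <= C) -> tame f.
Proof.
move=> cf hC; have C0 : 0 <= C := le_trans (normr_ge0 _) (hC 0).
by apply: (@tame_quad _ _ C 0 0) => // x; rewrite !mul0r !addr0.
Qed.

Lemma ox_bounded f C : (forall x, `|f x| <= C) -> forall x, `|ox f x| <= 3 * C.
Proof.
move=> hC x; rewrite /ox; have := ler_normB (f (posp x) + f 0) (f (posp (- x))).
have := ler_normD (f (posp x)) (f 0).
by have := hC (posp x); have := hC (posp (- x)); have := hC 0; lra.
Qed.

Lemma tame_ox f : cb f -> tame (ox f).
Proof. by move=> [cf [C hC]]; exact: tame_bounded (ucont_continuous (ox_ucont cf)) (ox_bounded hC). Qed.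

Lemma P_close s f g c r : tame f -> tame g -> (forall x, `|f x - g x| <= c) -> `|P s f r - P s g r| <= c.
Proof.
move=> tf tg h; rewrite -PB// -[leRHS](P_cst s c r); apply: P_norm_le => //.
  exact: tameB.
exact: tame_cst.
Qed.

Section Step.
Variable d : R.
Hypothesis d0 : 0 < d.

Definition Gn f r := P d (ox f) r.

Lemma cb_Gn f : cb f -> cb (Gn f).
Proof.
move=> cf; have tf := tame_ox cf; have [_ [C hC]] := cf.
have C0 : 0 <= 3 * C by rewrite mulr_ge0//; exact: le_trans (hC 0).
have bd : forall x, `|Gn f x| <= 3 * C.
  move=> x; rewrite -[leRHS](P_cst d (3 * C) x); apply: P_norm_le => //; first exact: tame_cst.
  exact: ox_bounded.
by split; [apply: ucont_P => //; apply: ox_ucont; case: cf|exists (3 * C)].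
Qed.

Lemma GnD f g r : cb f -> cb g -> Gn (fun x => f x + g x) r = Gn f r + Gn g r.
Proof.
move=> cf cg; rewrite /Gn -PD//; try exact: tame_ox.
by congr (P d _ r); apply/funext => x; rewrite ox_D.
Qed.

Lemma GnZ c f r : cb f -> Gn (fun x => c * f x) r = c * Gn f r.
Proof.
move=> cf; rewrite /Gn -PZ//; try exact: tame_ox.
by congr (P d _ r); apply/funext => x; rewrite ox_Z.
Qed.

Lemma Gn_cst c r : Gn (fun=> c) r = c.
Proof. by rewrite /Gn -[RHS](P_cst d c r); congr (P d _ r); apply/funext => x; rewrite ox_cst. Qed.

Lemma Gn0 f : cb f -> Gn f 0 = f 0.
Proof. by move=> cf; apply: P_center; [exact: tame_ox|exact: ox_center]. Qed.

Definition kern r x := Defs.gauss d r x - Defs.gauss d (- r) x.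

(* Twice the Gaussian mass of the negative half-line seen from r >= 0, i.e. the
   tail function of G^neum_d * D_0. *)
Definition th r : R := 1 - 2^-1 * \int[mu]_x `|kern (posp r) x|.

Lemma kern_sign r x : 0 <= r -> (0 <= x -> 0 <= kern r x) /\ (x <= 0 -> kern r x <= 0).
Proof.
move=> r0; rewrite /kern gauss_ratio// -[X in X - _]mulr1 -mulrBr.
have g0 := gauss_gt0 r x d0; split => x0.
  rewrite mulr_ge0 ?(ltW g0)// subr_ge0 -expR0 ler_expR oppr_le0 divr_ge0 ?(ltW d0)//.
  by rewrite !mulr_ge0.
rewrite mulr_ge0_le0 ?(ltW g0)// subr_le0 -expR0 ler_expR oppr_ge0 pmulr_lle0 ?invr_gt0//.
by rewrite mulr_ge0_le0// mulr_ge0.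
Qed.

Lemma kern_integrable f r : tame f -> mu.-integrable setT (EFin \o (fun x => kern r x * f x)).
Proof.
move=> tf; have := integrableB measurableT (gauss_integrable r d0 tf) (gauss_integrable (- r) d0 tf).
by congr (integrable _ _ _); apply/funext => x /=; rewrite /kern mulrBl EFinB.
Qed.

Lemma norm_kern_integrable r : mu.-integrable setT (EFin \o (fun x => `|kern r x|)).
Proof.
have := integrable_norm (kern_integrable r (tame_cst 1)).
by congr (integrable _ _ _); apply/funext => x /=; rewrite mulr1.
Qed.

Lemma P_kern f r : tame f -> (forall x, f (- x) = - f x) -> P d f r = 2^-1 * \int[mu]_x (kern r x * f x).
Proof.
move=> tf of_; have h := P_odd d r tf of_.
rewrite (_ : P d f r = 2^-1 * (P d f r - P d f (- r))); last by rewrite h; field.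
congr (_ * _); rewrite !P_gauss// -RintegralB//; try exact: gauss_integrable.
by apply: eq_Rintegral => x _; rewrite /kern mulrBl.
Qed.

(** [ox f - f 0] is odd, so it only meets the antisymmetric part of the kernel, which has a sign on
    each half-line when r >= 0. *)
Lemma Gn_kern f r : cb f -> Gn f r = f 0 + 2^-1 * \int[mu]_x (kern r x * (ox f x - f 0)).
Proof.
move=> cf; have tf := tame_ox cf.
rewrite -P_kern; last first.
- by move=> x; have := ox_center f x; lra.
- by apply: tameB => //; exact: tame_cst.
rewrite PB//; last exact: tame_cst.
by rewrite P_cst /Gn; ring.
Qed.

(** In [Gn_kern] the kernel has the sign of x, while [ox f - f 0] is at least - f(0) on the right
    and at most f(0) on the left. The extreme case is f = 0 for x > 0, when all the mass f(0) sits
    at the origin. *)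
Lemma Gn_ge_th f r : cb f -> (forall x, 0 <= x -> 0 <= f x) -> 0 <= r -> f 0 * th r <= Gn f r.
Proof.
move=> cf f0 r0; rewrite Gn_kern// /th posp_id// mulrBr mulr1 -subr_ge0.
set I := \int[mu]_x _; set J := \int[mu]_x _.
suff : - (f 0 * J) <= I by move: (I) (J) => I' J'; lra.
rewrite /I /J  -mulNr -RintegralZl//; last exact: norm_kern_integrable.
apply: le_Rintegral => //.
- have := integrableZl measurableT (- f 0) (norm_kern_integrable r).
  by congr (integrable _ _ _); apply/funext => x /=; rewrite EFinM.
- by apply: kern_integrable; apply: tameB; [exact: tame_ox|exact: tame_cst].
move=> x _; have [k1 k2] := kern_sign x r0; have [x0|/ltW x0] := leP 0 x.
  rewrite ger0_norm ?k1// ox_pos//; have := mulr_ge0 (k1 x0) (f0 x x0); lra.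
rewrite ler0_norm ?k2// ox_neg//.
have fx : 0 <= f (- x) by apply: f0; rewrite oppr_ge0.
have := mulr_le0_ge0 (k2 x0) fx; lra.
Qed.

Lemma th_ge0 r : 0 <= th r.
Proof.
rewrite /th; set q := posp r.
suff : \int[mu]_x `|kern q x| <= 2 by lra.
have -> : 2 = \int[mu]_x (Defs.gauss d q x * 1 + Defs.gauss d (- q) x * 1) :> R.
  rewrite RintegralD//; try exact: gauss_integrable (tame_cst 1).
  by rewrite -!P_gauss ?P_cst//; exact: tame_cst.
apply: le_Rintegral => //; first exact: norm_kern_integrable.
- have := integrableD measurableT (gauss_integrable q d0 (tame_cst 1)) (gauss_integrable (- q) d0 (tame_cst 1)).
  by congr (integrable _ _ _).
move=> x _; rewrite !mulr1 /kern; apply: (le_trans (ler_normB _ _)).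
by rewrite !ger0_norm// ltW// gauss_gt0.
Qed.

(** Positivity of [P] is not enough, since [ox f] contains - f(-x) for x < 0; [Gn_ge_th] is applied
    to g - f. *)
Lemma Gn_mono f g r : cb f -> cb g -> (forall x, 0 <= x -> f x <= g x) -> 0 <= r -> Gn f r <= Gn g r.
Proof.
move=> cf cg fg r0; have h x : 0 <= x -> 0 <= g x - f x by move=> x0; rewrite subr_ge0 fg.
have := Gn_ge_th (cbB cg cf) h r0.
have -> : Gn (fun x => g x - f x) r = Gn g r - Gn f r.
  rewrite -[- Gn f r]mulN1r -GnZ// -GnD//; last exact: cbZ.
  by rewrite (_ : (fun x => g x - f x) = (fun x => g x + -1 * f x))//; apply/funext => x; rewrite mulN1r.
have := mulr_ge0 (h 0 (lexx 0)) (th_ge0 r); lra.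
Qed.

(** A continuous approximation of the tail of D_0, equal to 1 at 0 and to 0 past k. *)
Definition spike k x := posp (1 - k^-1 * posp x).

Lemma spike_lip k : 0 < k -> forall x y, `|spike k x - spike k y| <= k^-1 * `|x - y|.
Proof.
move=> k0 x y; apply: (le_trans (posp_lip _ _)).
rewrite (_ : 1 - k^-1 * posp x - (1 - k^-1 * posp y) = - (k^-1 * (posp x - posp y))); last ring.
by rewrite normrN normrM gtr0_norm ?invr_gt0// ler_wpM2l ?invr_ge0 ?(ltW k0)// posp_lip.
Qed.

Lemma spike_bd k x : 0 < k -> 0 <= spike k x <= 1.
Proof.
move=> k0; rewrite posp_ge0/= /spike /posp ge_max ler01 andbT.
by rewrite gerBl mulr_ge0// ?invr_ge0 ?(ltW k0)// posp_ge0.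
Qed.

Lemma cb_spike k : 0 < k -> cb (spike k).
Proof.
move=> k0; split; first by apply: (lip_ucont _ (spike_lip k0)); rewrite invr_ge0 ltW.
by exists 1 => x; have /andP[h1 h2] := spike_bd x k0; rewrite ger0_norm.
Qed.

Lemma gauss_le r x : Defs.gauss d r x <= (Num.sqrt (2 * pi * d))^-1.
Proof.
rewrite /Defs.gauss ler_piMl ?invr_ge0 ?sqrtr_ge0// -expR0 ler_expR.
by rewrite mulr_le0_ge0 ?oppr_le0 ?sqr_ge0// invr_ge0 mulr_ge0// ltW.
Qed.

(** The error is half the integral of |kern| (1 - |x| / k)^+, where |kern| is at most the peak of
    the Gaussian and the interval has length 2 k. *)
Lemma th_spike k r : 0 < k -> 0 <= r ->
  th r <= Gn (spike k) r /\ Gn (spike k) r <= th r + (Num.sqrt (2 * pi * d))^-1 * k.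
Proof.
move=> k0 r0.
have s0 : spike k 0 = 1 by rewrite /spike [posp 0]posp_id// mulr0 subr0 posp_id.
split.
  have := Gn_ge_th (cb_spike k0) _ r0; rewrite s0 mul1r; apply => x _.
  by have /andP[] := spike_bd x k0.
have ts := tame_ox (cb_spike k0).
have kI : mu.-integrable setT (EFin \o (fun x => kern r x * (ox (spike k) x - 1))).
  by apply: kern_integrable; apply: tameB => //; exact: tame_cst.
have E (x : R) : `|kern r x| + kern r x * (ox (spike k) x - 1) = `|kern r x| * posp (1 - k^-1 * `|x|).
  have [k1 k2] := kern_sign x r0; have [x0|/ltW x0] := leP 0 x.
    by rewrite (ger0_norm (k1 x0)) (ger0_norm x0) ox_pos// /spike (posp_id x0); ring.
  have x0' : 0 <= - x by rewrite oppr_ge0.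
  by rewrite (ler0_norm (k2 x0)) (ler0_norm x0) ox_neg// s0 /spike (posp_id x0'); ring.
rewrite (Gn_kern r (cb_spike k0)) s0 /th posp_id// -addrA lerD2l -lerBlDl opprK -mulrDr.
rewrite addrC -RintegralD//; last exact: norm_kern_integrable.
set c := (Num.sqrt _)^-1; have c0 : 0 <= c by rewrite invr_ge0 sqrtr_ge0.
rewrite mulrC ler_pdivrMr// (_ : c * k * 2 = \int[mu]_(x in `[- k, k]) c); last first.
  rewrite Rintegral_cst// /=; have := lebesgue_measure_itv (`[- k, k] : interval R).
  by rewrite /= lte_fin ltrNl; case: ifP => [_ ->|/negP []] /=; [ring|lra].
rewrite [leRHS]Rintegral_mkcond; apply: le_Rintegral => //.
- have := integrableD measurableT (norm_kern_integrable r) kI.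
  by congr (integrable _ _ _).
- rewrite -restrict_EFin; apply/integrable_restrict => //; rewrite setTI.
  apply: continuous_compact_integrable; first exact: segment_compact.
  by apply: continuous_subspaceT => x; exact: cvg_cst.
move=> x _.
have kc : `|kern r x| <= c.
  rewrite ler_norml /kern; have := gauss_le r x; have := gauss_le (- r) x.
  by have := gauss_gt0 r x d0; have := gauss_gt0 (- r) x d0; rewrite -/c => *; apply/andP; split; lra.
rewrite E patchE; case: ifPn => xk.
  rewrite -[leRHS]mulr1; apply: ler_pM => //; first exact: posp_ge0.
  rewrite /posp ge_max ler01 andbT gerBl mulr_ge0// invr_ge0 ltW//.
rewrite posp_0 ?mulr0// subr_le0 mulrC ler_pdivlMr// mul1r leNgt; apply/negP => h.
by move: xk; rewrite notin_setE/= in_itv/= -ler_norml; apply; exact: ltW.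
Qed.

(** On the half-line th is the uniform limit of the flows of [spike k] as k tends to 0. *)
Lemma cb_th : cb th.
Proof.
have [c c0 hc] : exists2 c : R, 0 <= c & c = (Num.sqrt (2 * pi * d))^-1.
  by eexists; last reflexivity; rewrite invr_ge0 sqrtr_ge0.
have thp r : th r = th (posp r) by rewrite /th [posp (posp r)]posp_id ?posp_ge0.
split; last first.
  exists 1 => r; rewrite ger0_norm ?th_ge0// /th gerBl mulr_ge0//.
  by apply: Rintegral_ge0 => x _.
move=> e e0; pose k : R := e / 4 / (c + 1).
have k0 : 0 < k by rewrite !divr_gt0// ltr_wpDl.
have ck : c * k <= e / 4.
  have : (c + 1) * k = e / 4 by rewrite /k mulrC divfK// gt_eqF// ltr_wpDl.
  by rewrite mulrDl mul1r; have := ltW k0; lra.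
have e2 : 0 < e / 2 by rewrite divr_gt0.
have [ug _] := cb_Gn (cb_spike k0).
have [K K0 hK] := ucont_lip_comp ug posp_lip e2.
exists K => // x y; rewrite thp (thp y).
have [a1 a2] := th_spike k0 (posp_ge0 x); have [b1 b2] := th_spike k0 (posp_ge0 y).
move: (hK x y) a1 a2 b1 b2; rewrite -hc.
move: (th (posp x)) (th (posp y)) (Gn _ (posp x)) (Gn _ (posp y)) (K * _) => A B A' B' v.
by rewrite !ler_norml => /andP[h1 h2] a1 a2 b1 b2; apply/andP; split; lra.
Qed.

End Step.
End Barriers.

(** * The barriers as maps on tails *)

Section BarrierMaps.
Context {R : realType}.
Implicit Types (r s t x y z e c m d a b k L : R) (f g h : R -> R).

Section Maps.
Variables (j d : R).
Hypothesis j0 : 0 < j.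
Hypothesis d0 : 0 < d.

Definition cut f x := posp (f x - j * d).
(* One step of S^(d, -), with the cut taken before the heat flow: if f is the
   tail of the datum, then Hn f n is the tail of the heat flow of S_minus j d n. *)
Definition Tn f r := Gn d (cut f) r + j * d * th d r.

Fixpoint Hn f (n : nat) r : R := if n is m.+1 then Tn (Hn f m) r else Gn d f r.

Lemma cb_cut f : cb f -> cb (cut f).
Proof. by move=> cf; apply: cb_posp; apply: cbB => //; exact: cb_cst. Qed.

Lemma cb_Tn f : cb f -> cb (Tn f).
Proof. by move=> cf; apply: cbD; [apply: cb_Gn => //; exact: cb_cut|apply: cbZ; exact: cb_th]. Qed.

Lemma cb_Hn f n : cb f -> cb (Hn f n).
Proof. by move=> cf; elim: n => [|n IH]; [exact: cb_Gn|exact: cb_Tn]. Qed.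

Lemma GnB f g r : cb f -> cb g -> Gn d (fun x => f x - g x) r = Gn d f r - Gn d g r.
Proof.
move=> cf cg; rewrite -[- Gn d g r]mulN1r -GnZ// -GnD//; last exact: cbZ.
by rewrite (_ : (fun x => f x - g x) = (fun x => f x + -1 * g x))//; apply/funext => x; rewrite mulN1r.
Qed.

Lemma Gn_shift f c r : cb f -> Gn d (fun x => f x + c) r = Gn d f r + c.
Proof. by move=> cf; rewrite GnD ?Gn_cst//; exact: cb_cst. Qed.

Lemma Tn_mono f g r : cb f -> cb g -> (forall x, 0 <= x -> f x <= g x) -> 0 <= r -> Tn f r <= Tn g r.
Proof.
move=> cf cg fg r0; rewrite /Tn lerD2r; apply: Gn_mono => //; try exact: cb_cut.
by move=> x x0; apply: posp_mono; rewrite lerD2r fg.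
Qed.

Lemma Tn_shift f c r : cb f -> 0 <= c -> 0 <= r -> Tn (fun x => f x + c) r <= Tn f r + c.
Proof.
move=> cf c0 r0; rewrite /Tn addrAC lerD2r -Gn_shift; last exact: cb_cut.
apply: Gn_mono => //.
- by apply: cb_cut; apply: cbD => //; exact: cb_cst.
- by apply: cbD; [exact: cb_cut|exact: cb_cst].
move=> x x0; rewrite /cut {1}/posp ge_max; have := posp_ge (f x - j * d); have := posp_ge0 (f x - j * d).
by move=> h1 h2; apply/andP; split; lra.
Qed.

(** Moving the mass j d from the far end to the origin lowers tails: [f - cut f] is nonnegative with
    value j d at 0, so [Gn_ge_th] applies. *)
Lemma Tn_le_Gn f r : cb f -> (forall x, 0 <= x -> 0 <= f x) -> j * d <= f 0 -> 0 <= r -> Tn f r <= Gn d f r.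
Proof.
move=> cf f0 fj r0; have cc := cb_cut cf.
have jd : 0 < j * d by rewrite mulr_gt0.
have h x : 0 <= x -> 0 <= f x - cut f x.
  by move=> x0; rewrite subr_ge0 /cut {1}/posp ge_max f0// andbT gerBl ltW.
have := Gn_ge_th d0 (cbB cf cc) h r0; rewrite GnB// /cut posp_id ?subr_ge0//.
by rewrite opprB addrC subrK /Tn; lra.
Qed.

Lemma th_at0 : th d 0 = 1.
Proof.
rewrite /th (_ : \int[_]_x _ = 0) ?mulr0 ?subr0//.
have -> : (fun x => `|kern d (posp 0) x|) = cst 0.
  by apply/funext => x; rewrite /kern posp_id// oppr0 subrr normr0.
by rewrite Rintegral_cst// mul0r.
Qed.

Lemma Tn0 f : cb f -> j * d <= f 0 -> Tn f 0 = f 0.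
Proof. by move=> cf fj; rewrite /Tn (Gn0 _ (cb_cut cf)) th_at0 /cut posp_id ?subr_ge0//; ring. Qed.

Lemma Hn0 f n : cb f -> j * d <= f 0 -> Hn f n 0 = f 0.
Proof.
move=> cf fj; elim: n => [|n IH]; first exact: Gn0.
by rewrite /= Tn0 ?IH//; exact: cb_Hn.
Qed.

(** Only at 0 is f compared with g; elsewhere it is compared with the smaller [cut g], and the mass
    j d cut off is regained through th. A loss of j d in a lower bound thus disappears at the next
    step. *)
Lemma Tn_le_Gn_of f g c r : cb f -> cb g -> j * d <= g 0 -> g 0 - c <= f 0 ->
  (forall x, 0 <= x -> cut g x - c <= f x) -> 0 <= r -> Tn g r - c <= Gn d f r.
Proof.
move=> cf cg gj gf h r0; have cc := cb_cut cg; have cc' : cb (fun x => f x + c) by apply: cbD => //; exact: cb_cst.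
have h' x : 0 <= x -> 0 <= f x + c - cut g x by move=> x0; have := h x x0; lra.
have := Gn_ge_th d0 (cbB cc' cc) h' r0; rewrite GnB// Gn_shift//.
have : j * d * th d r <= (f 0 + c - cut g 0) * th d r.
  by rewrite ler_wpM2r ?th_ge0// /cut posp_id ?subr_ge0//; lra.
by rewrite /Tn; lra.
Qed.

Lemma Hn_mono f g n r : cb f -> cb g -> (forall x, 0 <= x -> f x <= g x) -> 0 <= r -> Hn f n r <= Hn g n r.
Proof.
move=> cf cg fg; elim: n r => [|n IH] r r0; first exact: Gn_mono.
by apply: Tn_mono => //; exact: cb_Hn.
Qed.

End Maps.
End BarrierMaps.

(** * Trapping an evolution between barriers *)

Section OneStepComparison.
Context {R : realType}.
Implicit Types (r s t x y z e c m d a b k : R).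

Lemma segment_lip (h h1 : R -> R) (X B : R) : (forall x, is_derive x 1 h (h1 x)) ->
  (forall x, 0 <= x -> x <= X -> `|h1 x| <= B) ->
  forall x y, 0 <= x -> x <= X -> 0 <= y -> y <= X -> `|h x - h y| <= B * `|x - y|.
Proof.
move=> dh hB.
have half x y : 0 <= x -> x <= y -> y <= X -> `|h y - h x| <= B * (y - x).
  move=> x0 xy yX.
  have dp z : is_derive z 1 (fun z => B * z - h z) (B - h1 z).
    by have d := dh z; apply: is_derive_eq; rewrite /GRing.scale/= mulr1.
  have dm z : is_derive z 1 (fun z => B * z + h z) (B + h1 z).
    by have d := dh z; apply: is_derive_eq; rewrite /GRing.scale/= mulr1.
  have bd z : x < z -> z < y -> - B <= h1 z <= B.
    by move=> xz zy; rewrite -ler_norml hB; lra.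
  have := nondecr_of_derive xy dp (fun z xz zy => ltac:(by have /andP[? ?] := bd z xz zy; lra)).
  have := nondecr_of_derive xy dm (fun z xz zy => ltac:(by have /andP[? ?] := bd z xz zy; lra)).
  by move=> h2 h3; rewrite ler_norml; apply/andP; split; lra.
move=> x y x0 xX y0 yX; have [xy|/ltW xy] := leP x y.
  by rewrite distrC [`|x - y|]ler0_norm ?subr_le0// opprB half.
by rewrite [`|x - y|]ger0_norm ?subr_ge0// half.
Qed.

Lemma smooth2_affine (g g1 g2 : R -> R) (a b c : R) : smooth2 g g1 g2 ->
  smooth2 (fun x => a * g x + b * x + c) (fun x => a * g1 x + b) (fun x => a * g2 x).
Proof.
move=> sg; split.
- move=> x; have d := sm_d1 sg x.
  by apply: is_derive_eq; rewrite /GRing.scale/= mulr1 addr0.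
- by move=> x; have d := sm_d2 sg x; apply: is_derive_eq; rewrite /GRing.scale/= addr0.
- have [C C0 hC] := sm_bd sg; exists (`|a| * C); first by rewrite mulr_ge0.
  by move=> x; rewrite normrM ler_wpM2l.
- exact: ucontZ (sm_uc sg).
Qed.

Lemma P_affine s (g : R -> R) (a b c : R) r : tame g ->
  P s (fun x => a * g x + b * x + c) r = a * P s g r + b * r + c.
Proof.
move=> tg; have t1 := tameZ a tg; have t2 := tameZ b (@tame_id R).
rewrite PD ?P_cst//; [|exact: tameD|exact: tame_cst].
by rewrite PD// !PZ ?P_id//; exact: tame_id.
Qed.

Section WithEvolution.
Variables (j eps T : R) (X : R -> R) (u u1 u2 L : R -> R -> R).
Hypothesis j0 : 0 < j.
Hypothesis eps0 : 0 <= eps.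
Hypothesis ev : evol j eps T X u u1 u2 L.

(** Clamping the argument to [0, X s] makes the tail constant for r <= 0 and 0 beyond the edge,
    hence bounded and Lipschitz on the line. *)
Definition Phi s r : R := L s (X s) - L s (Num.min (posp r) (X s)).

Section AtTime.
Variable s : R.
Hypothesis s0 : 0 <= s.
Hypothesis sT : s <= T.

Let X0 := ev_pos ev s0 sT.
Let cl r := Num.min (posp r) (X s).

Lemma clamp_bd r : 0 <= cl r /\ cl r <= X s.
Proof. by rewrite /cl le_min ge_min posp_ge0 (ltW X0) lexx orbT. Qed.

Lemma Phi_in r : 0 <= r -> r <= X s -> Phi s r = L s (X s) - L s r.
Proof. by move=> r0 rX; rewrite /Phi posp_id// min_l. Qed.

Lemma Phi_out r : X s <= r -> Phi s r = 0.
Proof. by move=> rX; rewrite /Phi posp_id ?(le_trans (ltW X0))// min_r// subrr. Qed.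

Lemma Phi0 : Phi s 0 = L s (X s).
Proof. by rewrite Phi_in ?(ltW X0)// (ev_L0 ev)// subr0. Qed.

Lemma L_mono x y : 0 <= x -> x <= y -> y <= X s -> L s x <= L s y.
Proof.
move=> x0 xy yX; apply: (nondecr_of_derive xy (fun z => ev_dL ev z s0 sT)) => z xz zy.
by apply: (ev_ge0 ev) => //; lra.
Qed.

Lemma Phi_mono x y : x <= y -> Phi s y <= Phi s x.
Proof.
move=> xy; rewrite /Phi lerD2l lerN2; apply: L_mono; have [h1 h2] := clamp_bd x; have [h3 h4] := clamp_bd y => //.
by rewrite le_min !ge_min posp_mono// lexx orbT.
Qed.

Lemma Phi_ge0 r : 0 <= Phi s r.
Proof. by rewrite /Phi subr_ge0; have [h1 h2] := clamp_bd r; exact: L_mono. Qed.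

Lemma Phi_le r : Phi s r <= L s (X s).
Proof.
rewrite /Phi gerBl -(ev_L0 ev s0 sT); have [h1 h2] := clamp_bd r.
exact: L_mono.
Qed.

Lemma Phi_lip (B : R) : (forall r, 0 <= r -> r <= X s -> u s r <= B) ->
  forall x y, `|Phi s x - Phi s y| <= B * `|x - y|.
Proof.
move=> hB x y; have [h1 h2] := clamp_bd x; have [h3 h4] := clamp_bd y.
have B0 : 0 <= B by apply: le_trans (hB 0 (lexx 0) (ltW X0)); exact: (ev_ge0 ev) (ltW X0).
rewrite (_ : Phi s x - Phi s y = - (L s (cl x) - L s (cl y))); last by rewrite /Phi /cl; ring.
rewrite normrN; apply: (@le_trans _ _ (B * `|cl x - cl y|)).
  apply: (segment_lip (fun z => ev_dL ev z s0 sT) (X := X s)) => // z z0 zX.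
  by rewrite ger0_norm; [exact: hB|exact: (ev_ge0 ev)].
rewrite ler_wpM2l//; apply: le_trans (posp_lip x y).
rewrite /cl; case: (leP (posp x)) => k1; case: (leP (posp y)) => k2 //; rewrite ?subrr ?normr0//.
- by rewrite !ler0_norm; lra.
- by rewrite !ger0_norm; lra.
Qed.

Lemma u_bounded : exists2 B : R, 0 < B & forall r, 0 <= r -> r <= X s -> u s r <= B.
Proof.
have [B B0 hB] := segment_bounded (X s) (derive_continuous (fun z => ev_du ev z s0 sT)).
by exists B => // r r0 rX; apply: le_trans (ler_norm _) (hB r _); rewrite ger0_norm.
Qed.

Lemma cb_Phi : cb (Phi s).
Proof.
have [B B0 hB] := u_bounded; split; first exact: lip_ucont (ltW B0) (Phi_lip hB).
by exists (L s (X s)) => x; rewrite ger0_norm ?Phi_ge0 ?Phi_le.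
Qed.

End AtTime.

Lemma mass_close s t : 0 <= s -> s <= T -> 0 <= t -> t <= T -> L s (X s) - L t (X t) <= 2 * eps.
Proof.
move=> s0 sT t0 tT; have := ev_mass ev s0 sT; have := ev_mass ev t0 tT.
by rewrite !ler_norml => /andP[h1 h2] /andP[h3 h4]; lra.
Qed.

Section Step.
Variables (s0 s1 : R).
Hypothesis s00 : 0 <= s0.
Hypothesis s01 : s0 < s1.
Hypothesis s1T : s1 <= T.
Let d := s1 - s0.
Let d0 : 0 < d. Proof. by rewrite /d subr_gt0. Qed.
Let s0T : s0 <= T. Proof. exact: le_trans (ltW s01) s1T. Qed.
Let s10 : 0 <= s1. Proof. exact: le_trans s00 (ltW s01). Qed.

(** An upper comparison for L: at s1 it is at most Phi(s0)(0) - Gn Phi(s0) + j d. Returning to tails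
    involves the masses at both times, whence 2 eps. *)
Lemma step_low r : 0 <= r -> Gn d (Phi s0) r - j * d - 2 * eps <= Phi s1 r.
Proof.
have X1 : 0 < X s1 := ev_pos ev s10 s1T.
have cP := cb_Phi s00 s0T; have tP := tame_ox cP.
have mono : forall x y, x <= y -> ox (Phi s0) y <= ox (Phi s0) x.
  by apply: ox_mono => x y _; exact: Phi_mono.
have inside r' : 0 <= r' -> r' <= X s1 -> Gn d (Phi s0) r' - j * d - 2 * eps <= Phi s1 r'.
  move=> r0 rX; have [B B0 hB] := u_bounded s00 s0T.
  have lipP := Phi_lip s00 s0T hB; have lip := ox_lip (ltW B0) lipP.
  have B2 : 0 <= 2 * B by rewrite mulr_ge0// ltW.
  rewrite -subr_ge0; apply: (@le_of_eta _ _ (2 * (2 * B) + r')) => e e0.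
  have [g [g1 [g2 mo]]] := mollifier_exists (ucont_continuous (ox_ucont (proj1 cP))) e0.
  have sg := mollifier_smooth mo B2 e0 lip; have tg := smooth2_tame sg.
  have close := mollifier_close mo B2 lip.
  (* The mollified tail is only nonincreasing; the term e x makes the derivative of the comparison
     function strictly positive, as [prop_up] requires. *)
  have sh := smooth2_affine (-1) e 0 sg.
  have Pg0 s : P s g 0 = Phi s0 0 by apply: P_center => //; apply: (mo_center mo); exact: ox_center.
  have := ev_up ev s00 (ltW s01) s1T sh (lexx 0) (c := Phi s0 0 + 2 * B * e).
  rewrite -/d add0r => H; have := H _ _ _ r' r0 rX.
  rewrite P_affine// => K.
  have Pc := P_close d r' tg tP close; rewrite -/(Gn d (Phi s0) r') in Pc.
  have {}K : L s1 r' <= -1 * P d g r' + e * r' + 0 + (Phi s0 0 + 2 * B * e) + j * d.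
    apply: K.
    - move=> s _; rewrite P_affine// Pg0 mulr0 !addr0.
      by have := mulr_ge0 B2 (ltW e0); lra.
    - by move=> x; have := mo_mono mo mono x; lra.
    - move=> y y0 yX; rewrite P0; have := Phi_in y0 yX; rewrite (Phi0 s00 s0T) => hy.
      have := close y; rewrite ox_pos// ler_norml => /andP[_ h].
      by have := mulr_ge0 (ltW e0) y0; lra.
  have := Phi_in r0 rX; rewrite (Phi0 s00 s0T) in K.
  have := mass_close s00 s0T s10 s1T.
  move: Pc; rewrite ler_norml => /andP[k1 k2]; lra.
move=> r0; have [rX|/ltW rX] := leP r (X s1); first exact: inside.
rewrite (Phi_out s10 s1T rX) -(Phi_out s10 s1T (lexx _)).
apply: le_trans (inside (X s1) (ltW X1) (lexx _)).
rewrite !lerD2r; apply: E_le; [exact: tame_P|exact: tame_P|].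
by move=> z; apply: mono; rewrite lerD2r.
Qed.

(** The atom j d of the barrier is replaced by a continuous spike, so that the new tail has the
    value Phi(s0)(0) at the origin; central symmetry then fixes this value for all times. *)
Lemma step_up_spike k r : 0 < k -> j * d <= Phi s0 0 -> 0 <= r ->
  Phi s1 r <= Gn d (fun x => cut j d (Phi s0) x + j * d * spike k x) r + 4 * eps.
Proof.
move=> k0 jd; have X1 : 0 < X s1 := ev_pos ev s10 s1T.
have jd0 : 0 < j * d by rewrite mulr_gt0.
have cP := cb_Phi s00 s0T.
pose b x := cut j d (Phi s0) x + j * d * spike k x.
have cb_b : cb b by apply: cbD; [exact: cb_cut|apply: cbZ; exact: cb_spike].
have tb := tame_ox cb_b.
have b0 : b 0 = Phi s0 0.
  rewrite /b /cut posp_id ?subr_ge0// /spike [posp 0]posp_id// mulr0 subr0 posp_id// mulr1.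
  by rewrite subrK.
have b_ge0 x : 0 <= b x.
  by rewrite addr_ge0 ?posp_ge0// mulr_ge0 ?(ltW jd0)//; have /andP[] := spike_bd x k0.
have b_le x : 0 <= x -> b x <= b 0.
  move=> x0; rewrite b0; apply: (@le_trans _ _ (cut j d (Phi s0) 0 + j * d * 1)).
    rewrite /b lerD//; first by apply: posp_mono; rewrite lerD2r; exact: Phi_mono.
    by rewrite ler_pM2l//; have /andP[] := spike_bd x k0.
  by rewrite /cut posp_id ?subr_ge0// mulr1 subrK.
have oxb0 x : 0 <= ox b x by apply: ox_ge0 => // y y0; exact: b_ge0.
move=> r0; have [rX|/ltW rX] := leP r (X s1); last first.
  rewrite (Phi_out s10 s1T rX); apply: addr_ge0; last by rewrite mulr_ge0.
  by apply: E_ge0 => [|z]; [exact: tame_P|exact: oxb0].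
have [B B0 hB] := u_bounded s00 s0T; have lipP := Phi_lip s00 s0T hB.
pose Lb := B + j * d * k^-1.
have Lb0 : 0 <= Lb by rewrite addr_ge0 ?(ltW B0)// mulr_ge0 ?(ltW jd0)// invr_ge0 ltW.
have lipb x y : `|b x - b y| <= Lb * `|x - y|.
  rewrite (_ : b x - b y = cut j d (Phi s0) x - cut j d (Phi s0) y + j * d * (spike k x - spike k y)).
    apply: (le_trans (ler_normD _ _)); rewrite /Lb mulrDl lerD//.
      apply: (le_trans (posp_lip _ _)).
      by rewrite (_ : _ - _ - (_ - _) = Phi s0 x - Phi s0 y); [exact: lipP|ring].
    by rewrite normrM (gtr0_norm jd0) -mulrA ler_pM2l// spike_lip.
  by rewrite /b; ring.
have lip := ox_lip Lb0 lipb.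
have L2 : 0 <= 2 * Lb by rewrite mulr_ge0.
rewrite -subr_ge0; apply: (@le_of_eta _ _ (2 * (2 * Lb))) => e e0.
have [g [g1 [g2 mo]]] := mollifier_exists (ucont_continuous (ox_ucont (proj1 cb_b))) e0.
have sg := mollifier_smooth mo L2 e0 lip; have tg := smooth2_tame sg.
have close := mollifier_close mo L2 lip.
have sh := smooth2_affine (-1) 0 0 sg.
have Pg0 s : P s g 0 = Phi s0 0.
  by rewrite -b0; apply: P_center => //; apply: (mo_center mo); exact: ox_center.
have g_ge0 x : 0 <= g x by apply: (mo_ge mo) => y _; exact: oxb0.
have Pg_ge0 s x : 0 <= P s g x by apply: E_ge0 => [|z]; [exact: tame_P|exact: g_ge0].
(* The total mass minus the inflow j d of the whole step, the mollification error and the possible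
   defect of mass: this makes the initial and both lateral conditions of [prop_low] hold. *)
pose c : R := Phi s0 0 - j * d - 2 * Lb * e - 2 * eps.
have eps0' := eps0.
have e2 := mulr_ge0 L2 (ltW e0).
have M0 := Phi0 s00 s0T.
have := ev_low ev s00 (ltW s01) s1T sh (lexx 0) (c := c).
rewrite -/d add0r => H; have := H _ _ _ r r0 rX.
rewrite P_affine// => K.
have {}K : -1 * P d g r + 0 * r + 0 + c + j * d <= L s1 r.
  apply: K.
  - move=> s ss0 ss1; rewrite add0r P_affine// Pg0.
    have : j * (s - s0) <= j * d by rewrite ler_pM2l// lerD2r.
    by rewrite /c; lra.
  - move=> s ss0 ss1; rewrite add0r P_affine//.
    have : j * (s - s0) <= j * d by rewrite ler_pM2l// lerD2r.
    have := mass_close s00 s0T (le_trans s00 ss0) (le_trans ss1 s1T).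
    by have := Pg_ge0 (s - s0) (X s); rewrite /c M0; lra.
  - move=> y y0 yX; rewrite P0; have := Phi_in y0 yX; rewrite -M0 => hy.
    have := close y; rewrite ox_pos// ler_norml => /andP[h _].
    have h1 : Phi s0 y - j * d <= b y.
      apply: (le_trans (posp_ge _)); rewrite lerDl mulr_ge0 ?(ltW jd0)//.
      by have /andP[] := spike_bd y k0.
    by rewrite /c; lra.
have hr := Phi_in r0 rX; have hm := mass_close s10 s1T s00 s0T.
have := P_close d r tg tb close; rewrite -/(Gn d b r) ler_norml => /andP[k1 k2].
move: K; rewrite /c M0; move: hr hm k1 k2; rewrite -/b.
by move: (P d g r) (Gn d b r) (Phi s1 r) (L s1 r) (L s1 (X s1)) (L s0 (X s0)) => *; lra.
Qed.

Lemma step_up r : j * d <= Phi s0 0 -> 0 <= r -> Phi s1 r <= Tn j d (Phi s0) r + 4 * eps.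
Proof.
move=> jd r0; have cP := cb_Phi s00 s0T.
have jd0 : 0 < j * d by rewrite mulr_gt0.
rewrite -subr_ge0; apply: (@le_of_eta _ _ (j * d * (Num.sqrt (2 * pi * d))^-1)) => e e0.
have := step_up_spike e0 jd r0.
have [_ h] := th_spike d0 e0 r0.
rewrite GnD//; [|exact: cb_cut|by apply: cbZ; exact: cb_spike].
rewrite GnZ; last exact: cb_spike.
have : j * d * Gn d (spike e) r <= j * d * (th d r + (Num.sqrt (2 * pi * d))^-1 * e) by rewrite ler_pM2l.
rewrite /Tn; move: (Gn d (spike e) r) (Gn d _ r) (th d r) (Num.sqrt _) (Phi s1 r) => q1 q2 q3 q4 q5.
lra.
Qed.

End Step.

(** The bound does not depend on eps or on the edge, so it yields a Lipschitz tail in the limit. The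
    comparison function is 3 j (|x| - x) + C with |x| mollified; its averages have slope -3 j < -2 j
    at the origin. *)
Lemma u_uniform (K : R) : (forall r, 0 <= r -> r <= X 0 -> u 0 r <= K) ->
  forall s r, 0 <= s -> s <= T -> 0 <= r -> r <= X s ->
  u s r <= `|K| + 3 * j * (E1 * Num.sqrt T + 2) + 1.
Proof.
move=> hK s r s0 sT r0 rX.
have lip1 (x y : R) : `| `|x| - `|y| | <= 1 * `|x - y| by rewrite mul1r ler_dist_dist.
have cn : continuous (fun x : R => `|x|) by move=> x; exact: norm_continuous.
have [g [g1 [g2 mo]]] := mollifier_exists cn (@ltr01 R).
have sg := mollifier_smooth mo ler01 ltr01 lip1; have tg := smooth2_tame sg.
have close x := mollifier_close mo ler01 lip1 x; rewrite mulr1 in close.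
have eg := mo_even mo (fun x => normrN x).
have og1 x : g1 (- x) = - g1 x.
  have [_ h1] := opp_derive x (mo_d1 mo); have [_ h2] := mo_d1 mo x.
  have fE : (fun x => g (- x)) = g by apply/funext => z; exact: eg.
  by rewrite -h2 -fE h1 opprK.
pose C : R := `|K| + 3 * j + 1.
have sh := smooth2_affine (3 * j) (- (3 * j)) C sg.
have j3 : 0 < 3 * j by rewrite mulr_gt0.
have h_ge x : `|K| + 1 <= 3 * j * g x + - (3 * j) * x + C.
  have := close x; rewrite ler_norml => /andP[h _]; have h' := ler_norm x.
  have : 3 * j * (x - 1) <= 3 * j * g x by rewrite ler_pM2l//; lra.
  by rewrite /C; lra.
have := ev_sup ev (lexx 0) s0 sT sh (lexx 0).
rewrite subr0 add0r => H; have := H _ _ _ r r0 rX.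
rewrite P_affine// => {}H.
have : u s r <= 3 * j * P s g r + - (3 * j) * r + C.
  apply: H.
  - by move=> x; apply: lt_le_trans (h_ge x); rewrite ltr_wpDl.
  - move=> t t0; have tg1 := smooth2_tame1 sg.
    rewrite PD ?P_cst//; [|exact: tameZ|exact: tame_cst].
    rewrite PZ// (_ : P t g1 0 = 0); first lra.
    by apply: P_center => // x; rewrite og1 subrr mulr0.
  - move=> y y0 yX; rewrite P0; apply: le_trans (h_ge y).
    by apply: (le_trans (hK y y0 yX)); have := ler_norm K; lra.
have tn : tame (fun x : R => `|x|) by apply: tame_norm; exact: tame_id.
have := P_close s r tg tn close; rewrite ler_norml => /andP[_ h1].
have := P_lip_joint r tn ler01 s0 (lexx 0) lip1.
rewrite P0 subr0 mul1r (ger0_norm s0) (ger0_norm r0) ler_norml => /andP[_ h2].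
have h3 : E1 * Num.sqrt s <= E1 * Num.sqrt T :> R.
  by rewrite ler_wpM2l ?E1_ge0// ler_sqrt// (le_trans s0).
have : 3 * j * (P s g r - r) <= 3 * j * (E1 * Num.sqrt T + 1) by rewrite ler_pM2l//; lra.
rewrite /C; lra.
Qed.

(** h = 2 j a x - j x^2 is the primitive of the stationary profile 2 j (a - x), and P t h = h - j t
    cancels the source: the initial comparison with j (a - r)^2 persists, and at r = a it says that
    almost no mass lies beyond a. *)
Lemma upper_edge (a e : R) : 0 <= a -> eps <= e -> L 0 (X 0) <= j * a ^+ 2 + e ->
  (forall r, 0 <= r -> r <= X 0 -> Phi 0 r <= j * (a - r) ^+ 2 + e) ->
  forall s, 0 <= s -> s <= T -> Phi s a <= e + 2 * eps.
Proof.
move=> a0 ee h0 init s s0 sT.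
have e0 : 0 <= e by exact: le_trans ee.
have [aX|/ltW aX] := leP a (X s); last by rewrite (Phi_out s0 sT aX) addr_ge0// mulr_ge0.
have T0 : 0 <= T by exact: le_trans sT.
pose h x : R := 2 * j * a * x - j * x ^+ 2.
have sh : smooth2 h (fun x => 2 * j * a - 2 * j * x) (fun=> - (2 * j)).
  split.
  - by move=> x; rewrite /h; apply: is_derive_eq; rewrite /GRing.scale/= ?expr1; ring.
  - by move=> x; apply: is_derive_eq; rewrite /GRing.scale/=; ring.
  - by exists (2 * j) => [|x]; rewrite ?normrN ?ger0_norm ?mulr_ge0// ltW.
  - exact: ucont_cst.
have th : tame h := smooth2_tame sh.
have Ph t x : 0 <= t -> P t h x = h x - j * t.
  move=> t0; have tq : tame (fun x : R => x ^+ 2) by apply: tameX; exact: tame_id.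
  rewrite /h PB; [|by apply: tameZ; exact: tame_id|exact: tameZ].
  rewrite PZ; last exact: tame_id.
  by rewrite PZ// P_id P_sqr//; ring.
pose c : R := L 0 (X 0) - j * a ^+ 2 - e.
have := ev_low ev (lexx 0) s0 sT sh (lexx 0) (c := c).
rewrite subr0 add0r => H; have := H _ _ _ a a0 aX.
rewrite Ph// => {}H.
have := Phi_in a0 aX; have : h a - j * s + c + j * s <= L s a.
  apply: H.
  - by move=> t t0 ts; rewrite subr0 add0r Ph// /h /c; lra.
  - move=> t t0 ts; rewrite subr0 add0r Ph// /h /c.
    have := mass_close (lexx 0) T0 t0 (le_trans ts sT).
    have := ev_mass ev t0 (le_trans ts sT); rewrite ler_norml => /andP[q1 _].
    by have := mulr_ge0 (ltW j0) (sqr_ge0 (a - X t)); rewrite sqrrB; lra.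
  - move=> r r0 rX; rewrite P0 /h /c; have := Phi_in r0 rX; have := init r r0 rX.
    by rewrite sqrrB; lra.
have := ev_mass ev s0 sT; rewrite ler_norml => /andP[_ q2].
by have eps0' := eps0; rewrite /h /c expr2; lra.
Qed.

Section Sandwich.
Variables (d c : R) (F0 : R -> R).
Hypothesis d0 : 0 < d.
Hypothesis c0 : 0 <= c.
Hypothesis cF : cb F0.
Hypothesis close0 : forall x, 0 <= x -> `|Phi 0 x - F0 x| <= c.
Hypothesis big : j * d + c + eps <= F0 0.

(** The loss j d in [step_low] has the form of the [cut] that the induction hypothesis allows,
    thanks to [Tn_le_Gn_of]; only multiples of eps accumulate, at most 4 eps per step. *)
Lemma sandwich n r : n.+1%:R * d <= T -> 0 <= r ->
  cut j d (Hn j d F0 n) r - (c + 4 * eps * n.+1%:R) <= Phi (n.+1%:R * d) r /\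
  Phi (n.+1%:R * d) r <= Hn j d F0 n r + (c + 4 * eps * n.+1%:R).
Proof.
have jd0 : 0 < j * d by rewrite mulr_gt0.
have T0 s : 0 < s -> s <= T -> 0 <= T by move=> s0 sT; exact: le_trans (ltW s0) sT.
have c0' := c0; have eps0' := eps0; have big' := big; have d0' := d0.
have F0j : j * d <= F0 0 by lra.
have Fc x : 0 <= x -> Phi 0 x <= F0 x + c /\ F0 x - c <= Phi 0 x.
  by move=> x0; have := close0 x0; rewrite ler_norml => /andP[h1 h2]; split; lra.
have massj s : 0 <= s -> s <= T -> F0 0 - c - eps <= Phi s 0.
  move=> s0 sT; have TT : 0 <= T := le_trans s0 sT.
  have [_ h] := Fc 0 (lexx 0); rewrite (Phi0 (lexx 0) TT) in h; rewrite (Phi0 s0 sT).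
  by have := ev_mass ev s0 sT; rewrite ler_norml => /andP[h1 _]; lra.
elim: n r => [|n IH] r.
  rewrite mul1r mulr1 => dT r0; have TT := T0 d d0 dT.
  have cP := cb_Phi (lexx 0) TT.
  have low := @step_low 0 d (lexx 0) d0 dT r r0; have up := @step_up 0 d (lexx 0) d0 dT r.
  rewrite subr0 in low up.
  have jP : j * d <= Phi 0 0 by have := massj 0 (lexx 0) TT; lra.
  have {}up := up jP r0.
  have ge := @Tn_le_Gn _ _ _ j0 d0 _ r cP (fun x _ => Phi_ge0 (lexx 0) TT x) jP r0.
  have cF' : cb (fun x => F0 x + c) by apply: cbD => //; exact: cb_cst.
  have cF'' : cb (fun x => F0 x + - c) by apply: cbD => //; exact: cb_cst.
  have m1 : Gn d (Phi 0) r <= Gn d (fun x => F0 x + c) r.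
    by apply: Gn_mono => // x x0; case: (Fc x x0).
  have m2 : Gn d (fun x => F0 x + - c) r <= Gn d (Phi 0) r.
    by apply: Gn_mono => // x x0; case: (Fc x x0).
  rewrite Gn_shift// in m1; rewrite Gn_shift// in m2.
  have p0 := Phi_ge0 (ltW d0) dT r.
  split; last by rewrite /=; lra.
  by rewrite /cut /= /posp; case: (leP (Gn d F0 r - j * d)) => ?; lra.
move=> dT r0.
pose s : R := n.+1%:R * d.
have s0 : 0 < s by rewrite mulr_gt0.
have sE : n.+2%:R * d = s + d by rewrite -[n.+2]addn1 natrD mulrDl mul1r.
rewrite sE in dT *; have sT : s <= T by lra.
have cE : 4 * eps * n.+2%:R = 4 * eps * n.+1%:R + 4 * eps :> R by rewrite -[n.+2]addn1 natrD mulrDr mulr1.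
rewrite cE; set cn := 4 * eps * n.+1%:R in IH *.
have cn0 : 4 * eps <= cn.
  by rewrite /cn ler_peMr ?mulr_ge0// ler1n.
have IH' x : 0 <= x -> cut j d (Hn j d F0 n) x - (c + cn) <= Phi s x /\ Phi s x <= Hn j d F0 n x + (c + cn).
  by move=> x0; exact: IH.
have low := @step_low s (s + d) (ltW s0) (ltac:(by rewrite ltrDl)) dT r r0.
have up := @step_up s (s + d) (ltW s0) (ltac:(by rewrite ltrDl)) dT r.
rewrite (_ : s + d - s = d) in low up; last by ring.
have mj := massj s (ltW s0) sT.
have {}up := up (ltac:(lra)) r0.
have cP := cb_Phi (ltW s0) sT; have cH := cb_Hn j d0 n cF.
have H0 : Hn j d F0 n 0 = F0 0 by exact: Hn0.
have k1 : Tn j d (Hn j d F0 n) r - (c + cn) <= Gn d (Phi s) r.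
  apply: Tn_le_Gn_of => //.
  - by rewrite H0.
  - by rewrite H0; lra.
  - by move=> x x0; case: (IH' x x0).
have cH' : cb (fun x => Hn j d F0 n x + (c + cn)) by apply: cbD => //; exact: cb_cst.
have k2 : Tn j d (Phi s) r <= Tn j d (fun x => Hn j d F0 n x + (c + cn)) r.
  by apply: Tn_mono => // x x0; case: (IH' x x0).
have ccn : 0 <= c + cn by lra.
have k3 := Tn_shift j d0 cH ccn r0.
have p0 := Phi_ge0 (ltac:(lra) : 0 <= s + d) dT r.
split; last by rewrite /=; lra.
by rewrite /cut /= /posp; case: (leP (Tn j d (Hn j d F0 n) r - j * d)) => ?; lra.
Qed.
End Sandwich.
End WithEvolution.
End OneStepComparison.

(** * Tails of densities and Tonelli's theorem *)

Section Tonelli.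
Context {R : realType}.
Notation mu := (@lebesgue_measure R).
Implicit Types (r s t x y z e c m d a b k L : R) (f g h v : R -> R).

Lemma integral_ge_if r (f : R -> \bar R) :
  (\int[mu]_(x in `[r, +oo[) f x = \int[mu]_x (if (r <= x)%R then f x else 0))%E.
Proof.
rewrite integral_mkcond; apply: eq_integral => x _.
rewrite patchE; case: ifPn => xr.
  by move: xr; rewrite inE/= in_itv/= andbT => ->.
by case: ifPn => // xr'; move: xr; rewrite notin_setE/= in_itv/= andbT xr'.
Qed.

Lemma integral_le_if b (f : R -> \bar R) :
  (\int[mu]_(x in `]-oo, b]) f x = \int[mu]_x (if (x <= b)%R then f x else 0))%E.
Proof.
rewrite integral_mkcond; apply: eq_integral => x _.
rewrite patchE; case: ifPn => xr.
  by move: xr; rewrite inE/= in_itv/= => ->.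
by case: ifPn => // xr'; move: xr; rewrite notin_setE/= in_itv/= xr'.
Qed.

Lemma integral_lt_if b (f : R -> \bar R) :
  (\int[mu]_(x in `]-oo, b[) f x = \int[mu]_x (if (x < b)%R then f x else 0))%E.
Proof.
rewrite integral_mkcond; apply: eq_integral => x _.
rewrite patchE; case: ifPn => xr.
  by move: xr; rewrite inE/= in_itv/= => ->.
by case: ifPn => // xr'; move: xr; rewrite notin_setE/= in_itv/= xr'.
Qed.

Lemma reflect_integral a b (G : R -> R) : continuous G -> (forall x, 0 <= G x) ->
  (\int[mu]_(x in `]-oo, b]) (G x)%:E = \int[mu]_(x in `[a, +oo[) (G (a + b - x))%:E)%E.
Proof.
move=> cG G0; pose F x := a + b - x.
have dF x : is_derive x 1 F (-1) by rewrite /F; apply: is_derive_eq; first [by rewrite sub0r|by rewrite add0r|ring].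
have dE : (F^`())%classic = (fun=> -1).
  by apply/funext => x; rewrite derive1E; have [_ ->] := dF x.
have cF : continuous F by exact: derive_continuous dF.
have bE : b = F a by rewrite /F; ring.
rewrite [in LHS]bE (@decreasing_ge0_integration_by_substitutiony R F G a).
- by apply: eq_integral => x _; rewrite dE/= opprK mulr1.
- by move=> x y _ _ xy; rewrite /F ltrD2l ltrN2.
- by rewrite dE => x _; exact: cvg_cst.
- by rewrite dE; apply: cvgP; exact: cvg_cst.
- by rewrite dE; apply: cvgP; exact: cvg_cst.
- split; first by move=> x _; have [] := dF x.
  exact/cvg_at_right_filter/cF.
- apply/cvgrNyPle => A; near=> x; rewrite /F lerBlDl -lerBlDr.
  by near: x; apply: nbhs_pinfty_ge; exact: num_real.
- exact: continuous_subspaceT.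
- by move=> x _; exact: G0.
Unshelve. all: by end_near.
Qed.

Lemma gauss_continuous1 d y : continuous (fun x => Defs.gauss d x y).
Proof.
have -> : (fun x => Defs.gauss d x y) = Defs.gauss d y.
  by apply/funext => x; rewrite /Defs.gauss -(sqrrN (x - y)) opprB.
exact: gauss_continuous.
Qed.

Lemma gauss_measurable2 (dd : measure_display) (T : measurableType dd) d (f g : T -> R) :
  measurable_fun setT f -> measurable_fun setT g -> measurable_fun setT (fun p => Defs.gauss d (f p) (g p)).
Proof.
move=> mf mg; apply: measurable_funM; last exact: measurable_cst.
apply: (measurableT_comp (f := expR)); first exact: measurable_expR.
apply: measurable_funM; last exact: measurable_cst.
apply: (measurableT_comp (f := fun x : R => - x)); first exact: oppr_measurable.
apply: (measurableT_comp (f := fun x : R => x ^+ 2)); first exact: exprn_measurable.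
exact: measurable_funB.
Qed.

Section Kernel.
Variable d : R.
Hypothesis d0 : 0 < d.
Local Notation gs := (Defs.gauss d).

Lemma gs_ge0 x y : 0 <= gs x y. Proof. exact/ltW/gauss_gt0. Qed.

Lemma reflect_gauss r b : (\int[mu]_(x in `]-oo, b]) (gs r x)%:E = \int[mu]_(x in `[r, +oo[) (gs x b)%:E)%E.
Proof.
rewrite (@reflect_integral r b (gs r))//; [|exact: gauss_continuous|exact: gs_ge0].
by apply: eq_integral => x _; rewrite /Defs.gauss (_ : r - (r + b - x) = x - b)//; ring.
Qed.

(** The tail from r of the reflected kernel with its mass at y, that is of G^neum_d * D_y. *)
Definition qq r y : \bar R := (\int[mu]_(x in `[r, +oo[) (gauss_neum d x y)%:E)%E.

Lemma gauss_measurable r (D : set R) : measurable_fun D (fun x => (gs r x)%:E).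
Proof.
apply: measurable_funTS; apply/measurable_EFinP; apply: continuous_measurable_fun.
exact: gauss_continuous.
Qed.

Lemma gauss1_measurable y (D : set R) : measurable_fun D (fun x => (gs x y)%:E).
Proof.
apply: measurable_funTS; apply/measurable_EFinP; apply: continuous_measurable_fun.
exact: gauss_continuous1.
Qed.

(** For y >= 0 this is, as a function of x, the centrally symmetric extension [ox] of the tail of
    D_y. *)
Definition WW x y : R := (x <= y)%R%:R + (x < - y)%R%:R.

Lemma qqE r y : qq r y = (\int[mu]_x (gs r x * WW x y)%:E)%E.
Proof.
rewrite /qq /gauss_neum.
under eq_integral do rewrite EFinD.
rewrite ge0_integralD//=; [|by move=> x _; rewrite lee_fin gs_ge0|exact: gauss1_measurable|
  by move=> x _; rewrite lee_fin gs_ge0|exact: gauss1_measurable].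
rewrite -!reflect_gauss -(integral_itv_bndo_bndc (r := - y)); last exact: gauss_measurable.
rewrite integral_le_if integral_lt_if -ge0_integralD//=.
- apply: eq_integral => x _; rewrite /WW; case: (x <= y); case: (x < - y);
    by rewrite ?mulr0n ?mulr1n ?addr0 ?add0r ?mulr1 ?mulr0 ?adde0 ?add0e// mulrDr !mulr1 EFinD.
- by move=> x _; case: ifP => _ //; rewrite lee_fin gs_ge0.
- apply: measurable_fun_ifT => //; [|exact: gauss_measurable].
  by apply: measurable_fun_ler => //; exact: measurable_cst.
- by move=> x _; case: ifP => _ //; rewrite lee_fin gs_ge0.
- apply: measurable_fun_ifT => //; [|exact: gauss_measurable].
  by apply: measurable_fun_ltr => //; exact: measurable_cst.
Qed.

Lemma gauss_total r : (\int[mu]_x (gs r x)%:E = 1)%E.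
Proof.
have gi := gauss_integrable r d0 (tame_cst 1).
have h : P d (fun=> 1) r = \int[mu]_y (gs r y * 1) by apply: P_gauss => //; exact: tame_cst.
rewrite P_cst in h.
have -> : (\int[mu]_x (gs r x)%:E = \int[mu]_x (gs r x * 1)%:E)%E by apply: eq_integral => x _; rewrite mulr1.
by rewrite -[LHS]fineK; [rewrite -/(Rintegral _ _ _) -h|exact: integrable_fin_num].
Qed.

(** Both sides equal 2 a(r), where a(s) is the Gaussian mass of the negative half-line seen from s;
    for th this uses a(r) + a(-r) = 1. *)
Lemma th_qq r : 0 <= r -> (th d r)%:E = qq r 0.
Proof.
move=> r0.
have gi s := gauss_integrable s d0 (tame_cst 1).
pose a s : \bar R := (\int[mu]_(x in `]-oo, 0%R]) (gs s x)%:E)%E.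
have a0 s : (0 <= a s)%E by apply: integral_ge0 => x _; rewrite lee_fin gs_ge0.
have a1 s : (a s <= 1)%E.
  rewrite -(gauss_total s); apply: ge0_subset_integral => //; first exact: gauss_measurable.
  by move=> x _; rewrite lee_fin gs_ge0.
have af s : a s \is a fin_num by rewrite ge0_fin_numE// (le_lt_trans (a1 s))// ltry.
have qE : qq r 0 = (a r + a r)%E.
  rewrite /qq /gauss_neum oppr0.
  under eq_integral do rewrite EFinD.
  rewrite ge0_integralD//=; [|by move=> x _; rewrite lee_fin gs_ge0|exact: gauss1_measurable|
    by move=> x _; rewrite lee_fin gs_ge0|exact: gauss1_measurable].
  by rewrite -!reflect_gauss.
have aN : (a (- r)%R + a r = 1)%E.
  have -> : a (- r)%R = (\int[mu]_(x in `[0%R, +oo[) (gs r x)%:E)%E.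
    rewrite ge0_integration_by_substitution0//; [|exact: gauss_measurable|by move=> x; rewrite lee_fin gs_ge0].
    by apply: eq_integral => x _; rewrite -gauss_opp opprK.
  rewrite -(gauss_total r) -(setUv `]-oo, 0%R]%classic) ge0_integral_setU//=.
  - rewrite addeC; congr (_ + _)%E.
    by rewrite setCitvl/= -integral_itv_obnd_cbnd//; exact: gauss_measurable.
  - exact: measurableC.
  - by rewrite setUv; exact: gauss_measurable.
  - by move=> x _; rewrite lee_fin gs_ge0.
  - by rewrite disj_set2E setICr.
have Ia s : \int[mu]_x (gs s x * (x <= 0)%R%:R) = fine (a s).
  rewrite /Rintegral /a integral_le_if; congr fine; apply: eq_integral => x _.
  by case: ifP; rewrite ?mulr1 ?mulr0.
have Ii s : mu.-integrable setT (EFin \o (fun x => gs s x * (x <= 0)%R%:R)).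
  apply: (le_integrable measurableT _ _ (gi s)).
    apply/measurable_EFinP; apply: measurable_funM; first by apply/measurable_EFinP; exact: gauss_measurable.
    have -> : (fun x : R => (x <= 0)%R%:R) = (fun x : R => if x <= 0 then 1 else 0 : R).
      by apply/funext => x; case: (x <= 0).
    by apply: measurable_fun_ifT => //; apply: measurable_fun_ler => //; exact: measurable_cst.
  move=> x _ /=; rewrite lee_fin !normrM ler_wpM2l//.
  by case: (x <= 0); rewrite ?normr1 ?normr0.
rewrite qE /th posp_id//.
have -> : \int[mu]_x `|kern d r x| = \int[mu]_x
   ((gs r x * 1 - gs (- r) x * 1) - ((gs r x * (x <= 0)%R%:R *+ 2) - (gs (- r) x * (x <= 0)%R%:R *+ 2))).
  have Ek (x : R) : `|kern d r x| = (gs r x * 1 - gs (- r) x * 1) -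
      ((gs r x * (x <= 0)%R%:R *+ 2) - (gs (- r) x * (x <= 0)%R%:R *+ 2)).
    have [k1 k2] := kern_sign d0 x r0.
    case: (leP x 0) => x0; first by rewrite ler0_norm ?k2// /kern /=; ring.
    by rewrite ger0_norm ?k1 ?ltW// /kern /=; ring.
  by apply: eq_Rintegral => x _; exact: Ek.
have I2 s : mu.-integrable setT (EFin \o (fun x => gs s x * (x <= 0)%R%:R *+ 2)).
  have := integrableD measurableT (Ii s) (Ii s).
  by congr (integrable _ _ _); apply/funext => x /=; rewrite mulr2n.
have I2E s : \int[mu]_x (gs s x * (x <= 0)%R%:R *+ 2) = 2 * fine (a s).
  by rewrite -Ia -RintegralZl//; first [exact: Ii|apply: eq_Rintegral => x _; rewrite mulr2n; ring].
rewrite RintegralB//; first last.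
- have := integrableB measurableT (I2 r) (I2 (- r)).
  by congr (integrable _ _ _); apply/funext => x /=; rewrite EFinB.
- have := integrableB measurableT (gi r) (gi (- r)).
  by congr (integrable _ _ _); apply/funext => x /=; rewrite EFinB.
have e1 : \int[mu]_x (gs r x * 1 - gs (- r) x * 1) = \int[mu]_x (gs r x * 1) - \int[mu]_x (gs (- r) x * 1).
  by rewrite RintegralB//; exact: gi.
have e2 : \int[mu]_x (gs r x * (x <= 0)%R%:R *+ 2 - gs (- r) x * (x <= 0)%R%:R *+ 2) =
   \int[mu]_x (gs r x * (x <= 0)%R%:R *+ 2) - \int[mu]_x (gs (- r) x * (x <= 0)%R%:R *+ 2).
  by rewrite RintegralB//; exact: I2.
rewrite e1 e2 !I2E -!P_gauss ?P_cst//; try exact: tame_cst.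
have h : fine (a (- r)) + fine (a r) = 1 by rewrite -fineD// aN.
rewrite -(fineK (af r)) -EFinD /=; congr EFin.
by move: h; move: (fine (a r)) (fine (a (- r))) => A A' h; clear -h; lra.
Qed.

(** A representative bounded at every point of the half-line rather than almost everywhere; the heat
    flow and the cut stay in this class. *)
Record okd (v : R -> R) (B : R) : Prop := Okd {
  ok_meas : measurable_fun (`[0, +oo[%classic : set R) v ;
  ok_bd : forall x, 0 <= x -> 0 <= v x <= B ;
  ok_int : mu.-integrable `[0, +oo[ (EFin \o v) }.

Definition tl (v : R -> R) r : R := \int[mu]_(x in `[posp r, +oo[) v x.

Section Density.
Variables (v : R -> R) (B : R).
Hypothesis ok : okd v B.

Let sub r : 0 <= r -> `[r, +oo[%classic `<=` (`[0, +oo[%classic : set R).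
Proof. by move=> r0 x /=; rewrite !in_itv/= !andbT; exact: le_trans. Qed.

Lemma ok_int_from r : 0 <= r -> mu.-integrable `[r, +oo[ (EFin \o v).
Proof. by move=> r0; apply: integrableS (ok_int ok) => //; exact: sub. Qed.

Lemma ok_meas_from r : 0 <= r -> measurable_fun (`[r, +oo[%classic : set R) (fun x => (v x)%:E).
Proof. by move=> r0; apply/measurable_EFinP; apply: (measurable_funS _ (sub r0) (ok_meas ok)). Qed.

Lemma tlE r : 0 <= r -> (tl v r)%:E = (\int[mu]_(x in `[r, +oo[) (v x)%:E)%E.
Proof.
move=> r0; rewrite /tl posp_id// /Rintegral fineK//.
by apply: integrable_fin_num => //; exact: ok_int_from.
Qed.

Lemma tl_split x y : 0 <= x -> x <= y ->
  tl v x = \int[mu]_(t in `[x, y[) v t + tl v y.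
Proof.
move=> x0 xy; have y0 : 0 <= y by exact: le_trans xy.
rewrite /tl !posp_id// -Rintegral_setU//=.
- by rewrite -itv_bndbnd_setU// bnd_simp.
- by rewrite -itv_bndbnd_setU// ?bnd_simp//; exact: ok_int_from.
- rewrite disj_set2E; apply/eqP/seteqP; split => // t /= []; rewrite !in_itv/= andbT => /andP[_ h1] h2.
  by rewrite ltNge h2 in h1.
Qed.

Lemma tl_piece x y : 0 <= x -> x <= y -> 0 <= \int[mu]_(t in `[x, y[) v t /\
  \int[mu]_(t in `[x, y[) v t <= B * (y - x).
Proof.
move=> x0 xy; have sx : `[x, y[%classic `<=` (`[0, +oo[%classic : set R).
  by move=> t /=; rewrite !in_itv/= andbT => /andP[h _]; exact: le_trans h.
have bd t : `[x, y[%classic t -> 0 <= v t <= B.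
  by move=> /sx /=; rewrite in_itv/= andbT => h; exact: (ok_bd ok).
split; first by apply: Rintegral_ge0 => t /bd /andP[].
have -> : B * (y - x) = \int[mu]_(t in `[x, y[) B.
  rewrite Rintegral_cst//=; congr (_ * _).
  rewrite lebesgue_measure_itv/= lte_fin; move: xy; rewrite le_eqVlt => /predU1P[->|->//].
  by rewrite ltxx subrr.
apply: le_Rintegral => //.
- apply: integrableS (ok_int ok) => //.
- have sxy : `[x, y[%classic `<=` (`[x, y]%classic : set R).
    by move=> t /=; rewrite !in_itv/= => /andP[-> /ltW].
  apply: (@integrableS _ _ _ mu (`[x, y]%classic) (`[x, y[%classic)) => //.
  apply: continuous_compact_integrable; first exact: segment_compact.
  by apply: continuous_subspaceT => t; exact: cvg_cst.
- by move=> t /bd /andP[].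
Qed.

Lemma tl_mono x y : 0 <= x -> x <= y -> tl v y <= tl v x.
Proof. by move=> x0 xy; rewrite (tl_split x0 xy); have [h _] := tl_piece x0 xy; lra. Qed.

Lemma tl_ge0 x : 0 <= tl v x.
Proof.
apply: Rintegral_ge0 => t /=; rewrite in_itv/= andbT => h.
by have /andP[] := ok_bd ok (le_trans (posp_ge0 x) h).
Qed.

Lemma tl_posp x : tl v (posp x) = tl v x.
Proof. by rewrite /tl [posp (posp x)]posp_id// posp_ge0. Qed.

Lemma tl_le0 x : tl v x <= tl v 0.
Proof. by rewrite -tl_posp tl_mono// posp_ge0. Qed.

Lemma tl_lip x y : `|tl v x - tl v y| <= B * `|x - y|.
Proof.
have B0 : 0 <= B by have /andP[h1 h2] := ok_bd ok (lexx 0); exact: le_trans h2.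
have half a b : 0 <= a -> a <= b -> `|tl v a - tl v b| <= B * `|a - b|.
  move=> a0 ab; rewrite (tl_split a0 ab) addrK; have [h1 h2] := tl_piece a0 ab.
  by rewrite ger0_norm// [`|a - b|]ler0_norm ?subr_le0// opprB.
apply: (le_trans _ (ler_wpM2l B0 (posp_lip x y))); rewrite -(tl_posp x) -(tl_posp y).
have [xy|/ltW xy] := leP (posp x) (posp y); first by rewrite half// posp_ge0.
by rewrite distrC [`|_ - posp y|]distrC half// posp_ge0.
Qed.

Lemma cb_tl : cb (tl v).
Proof.
have B0 : 0 <= B by have /andP[h1 h2] := ok_bd ok (lexx 0); exact: le_trans h2.
split; first exact: lip_ucont B0 tl_lip.
by exists (tl v 0) => x; rewrite ger0_norm ?tl_ge0 ?tl_le0.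
Qed.

Lemma F_tl c r : 0 <= r -> Defs.F r (mkU c v) = ((if r == 0 then c else 0) + tl v r)%:E.
Proof. by move=> r0; rewrite /Defs.F EFinD tlE. Qed.

Definition v0 y := if 0 <= y then v y else 0.

Lemma v0_meas : measurable_fun setT v0.
Proof.
have -> : v0 = (v \_ (`[0, +oo[%classic : set R)).
  apply/funext => y; rewrite /v0 patchE; case: ifPn => y0.
    by rewrite mem_set//= in_itv/= y0.
  by rewrite memNset//= in_itv/= andbT; exact/negP.
by apply/measurable_restrict => //; rewrite setTI; exact: (ok_meas ok).
Qed.

Lemma v0_ge0 y : 0 <= v0 y.
Proof. by rewrite /v0; case: ifP => // y0; have /andP[] := ok_bd ok y0. Qed.

Lemma ox_tl x : (ox (tl v) x)%:E = (\int[mu]_y (v0 y * WW x y)%:E)%E.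
Proof.
have [x0|x0] := leP 0 x.
  rewrite ox_pos// tlE// integral_ge_if; apply: eq_integral => y _.
  rewrite /WW /v0; case: ifPn => xy.
    rewrite (le_trans x0 xy) (_ : x < - y = false) ?addr0 ?mulr1//.
    by apply/negbTE; rewrite -leNgt; have := le_trans x0 xy; lra.
  case: ifPn => y0; last by rewrite mul0r.
  by rewrite (_ : x < - y = false) ?addr0 ?mulr0//; apply/negbTE; rewrite -leNgt; lra.
rewrite ox_neg ?(ltW x0)//.
have nx : 0 <= - x by lra.
have -> : 2 * tl v 0 - tl v (- x) = tl v 0 + \int[mu]_(t in `[0, - x[) v t.
  by have := tl_split (lexx 0) nx; lra.
have sx : `[0, - x[%classic `<=` (`[0, +oo[%classic : set R).
  by move=> t /=; rewrite !in_itv/= andbT => /andP[].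
rewrite EFinD tlE// /Rintegral fineK; last first.
  by apply: integrable_fin_num => //; apply: integrableS (ok_int ok) => //.
rewrite integral_ge_if [X in (_ + X)%E]integral_mkcond -ge0_integralD//=.
- apply: eq_integral => y _; rewrite patchE /WW /v0; case: ifPn => y0; last first.
    rewrite memNset ?adde0 ?mul0r//= in_itv/= => /andP[h _]; by rewrite h in y0.
  rewrite (le_trans (ltW x0) y0); case: ifPn => yx.
    move: yx; rewrite inE/= in_itv/= => /andP[_ h].
    by rewrite (_ : x < - y) ?mulrDr ?mulr1 ?EFinD//; lra.
  rewrite (_ : x < - y = false) ?addr0 ?mulr1 ?adde0//.
  apply/negbTE; rewrite -leNgt; move: yx; rewrite notin_setE/= in_itv/= y0/= => /negP; rewrite -leNgt; lra.
- by move=> y _; case: ifP => // y0; rewrite lee_fin; have /andP[] := ok_bd ok y0.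
- have -> : (fun y => if 0 <= y then (v y)%:E else 0%E) = EFin \o v0.
    by apply/funext => y; rewrite /v0/=; case: ifP.
  by apply/measurable_EFinP; exact: v0_meas.
- move=> y _; apply: erestrict_ge0 => t /sx /=; rewrite in_itv/= andbT lee_fin => t0.
  by have /andP[] := ok_bd ok t0.
- apply/(measurable_restrictT _ _).1 => //.
  by apply/measurable_EFinP; exact: (measurable_funS _ sx (ok_meas ok)).
Qed.

Lemma WW_meas (dd : measure_display) (T : measurableType dd) (f g : T -> R) :
  measurable_fun setT f -> measurable_fun setT g -> measurable_fun setT (fun p => WW (f p) (g p)).
Proof.
move=> mf mg.
have nat_bool (b : T -> bool) : measurable_fun setT b -> measurable_fun setT (fun p => (b p)%:R : R).
  move=> mb; have -> : (fun p => (b p)%:R : R) = (fun p => if b p then 1 else 0 : R).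
    by apply/funext => p; case: (b p).
  exact: measurable_fun_ifT.
apply: measurable_funD; apply: nat_bool; first exact: measurable_fun_ler.
apply: measurable_fun_ltr => //.
by apply: (measurableT_comp (f := fun x : R => - x)); [exact: oppr_measurable|].
Qed.

Lemma WW_ge0 x y : 0 <= WW x y. Proof. by rewrite addr_ge0. Qed.

(** [ox (tl v)] is the superposition of the [WW x y] with weights v(y), and the Gaussian average of
    [WW x y] is [qq]; Tonelli exchanges the two integrals. *)
Lemma Gn_tl r : (Gn d (tl v) r)%:E = (\int[mu]_(y in `[0%R, +oo[) ((v y)%:E * qq r y))%E.
Proof.
have cf := cb_tl; have tf := tame_ox cf.
have gi := gauss_integrable r d0 tf.
have -> : (Gn d (tl v) r)%:E = (\int[mu]_x (gs r x * ox (tl v) x)%:E)%E.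
  by rewrite /Gn P_gauss// /Rintegral fineK//; exact: integrable_fin_num.
have m0 : measurable_fun setT (fun p : R * R => (v0 p.2 * (gs r p.1 * WW p.1 p.2))%:E).
  apply/measurable_EFinP; apply: measurable_funM.
    by apply: (measurableT_comp v0_meas); exact: measurable_snd.
  apply: measurable_funM; last exact: (WW_meas measurable_fst measurable_snd).
  by apply: (measurableT_comp (continuous_measurable_fun (@gauss_continuous _ d r))); exact: measurable_fst.
have p0 (p : R * R) : (0 <= (v0 p.2 * (gs r p.1 * WW p.1 p.2))%:E)%E.
  by rewrite lee_fin !mulr_ge0 ?v0_ge0 ?gs_ge0 ?WW_ge0.
have WW_mx x : measurable_fun setT (fun y => WW x y) by apply: WW_meas => //; exact: measurable_cst.
have WW_my y : measurable_fun setT (fun x => WW x y) by apply: WW_meas => //; exact: measurable_cst.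
transitivity (\int[mu]_x \int[mu]_y (v0 y * (gs r x * WW x y))%:E)%E.
  apply: eq_integral => x _.
  rewrite EFinM ox_tl -ge0_integralZl//=.
  - by apply: eq_integral => y _; rewrite -EFinM; congr EFin; ring.
  - by apply/measurable_EFinP; apply: measurable_funM; [exact: v0_meas|exact: WW_mx].
  - by move=> y _; rewrite lee_fin mulr_ge0 ?v0_ge0 ?WW_ge0.
  - by rewrite lee_fin gs_ge0.
transitivity (\int[mu]_y \int[mu]_x (v0 y * (gs r x * WW x y))%:E)%E.
  exact: (@fubini_tonelli _ _ (measurableTypeR R) (measurableTypeR R) R mu mu _ m0 p0).
rewrite integral_ge_if; apply: eq_integral => y _.
rewrite /v0; case: ifPn => y0; last first.
  by rewrite (eq_integral (cst 0%E)) ?integral0// => x _; rewrite mul0r.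
rewrite qqE -ge0_integralZl//=.
- by apply/measurable_EFinP; apply: measurable_funM; [exact: continuous_measurable_fun (@gauss_continuous _ d r)|exact: WW_my].
- by move=> x _; rewrite lee_fin mulr_ge0 ?gs_ge0 ?WW_ge0.
- by rewrite lee_fin; have /andP[] := ok_bd ok y0.
Qed.

Definition hh c : R -> R := dens (heat_neum d (mkU c v)).

Lemma gn_ge0 x y : 0 <= gauss_neum d x y. Proof. by rewrite addr_ge0 ?gs_ge0. Qed.

Lemma gn_le x y : gauss_neum d x y <= 2 * (Num.sqrt (2 * pi * d))^-1.
Proof. by rewrite /gauss_neum; have := gauss_le d0 x y; have := gauss_le d0 x (- y); lra. Qed.

Lemma gn_meas (dd : measure_display) (T : measurableType dd) (f g : T -> R) :
  measurable_fun setT f -> measurable_fun setT g -> measurable_fun setT (fun p => gauss_neum d (f p) (g p)).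
Proof.
move=> mf mg; apply: measurable_funD; first exact: gauss_measurable2.
apply: gauss_measurable2 => //.
by apply: (measurableT_comp (f := fun x : R => - x)); [exact: oppr_measurable|].
Qed.

Lemma gn_measx x (D : set R) : measurable_fun D (fun y => gauss_neum d x y).
Proof. by apply: measurable_funTS; apply: gn_meas => //; exact: measurable_cst. Qed.

Lemma hh_int x : mu.-integrable `[0, +oo[ (EFin \o (fun y => gauss_neum d x y * v y)).
Proof.
apply: (@le_integrable _ _ _ mu _ _ _ (fun y => (2 * (Num.sqrt (2 * pi * d))^-1)%:E * (v y)%:E)%E) => //.
- apply/measurable_EFinP; apply: measurable_funM; [exact: gn_measx|exact: (ok_meas ok)].
- move=> y /=; rewrite in_itv/= andbT => y0; rewrite lee_fin.
  have /andP[a1 _] := ok_bd ok y0; rewrite !ger0_norm ?mulr_ge0 ?gn_ge0 ?invr_ge0 ?sqrtr_ge0//.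
  by rewrite ler_wpM2r ?gn_le.
- by apply: integrableZl => //; exact: (ok_int ok).
Qed.

Lemma hh_EFin c x : (hh c x)%:E = ((c * gauss_neum d x 0)%:E + \int[mu]_(y in `[0%R, +oo[) (gauss_neum d x y * v y)%:E)%E.
Proof.
rewrite /hh /heat_neum/= EFinD; congr (_ + _)%E.
have fn : (\int[mu]_(y in `[0%R, +oo[) (gauss_neum d x y * v y)%:E)%E \is a fin_num.
  by apply: integrable_fin_num => //; exact: hh_int.
by rewrite -(fineK fn).
Qed.

End Density.
End Kernel.
End Tonelli.

(** * Identifying the barriers with their tails *)

Section BarrierTails.
Context {R : realType}.
Notation mu := (@lebesgue_measure R).
Implicit Types (r s t x y z e c m b k L : R) (f g h v : R -> R).

Lemma tl_vanish v B e : okd v B -> 0 < e -> exists2 b : R, 0 <= b & tl v b < e.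
Proof.
move=> ok e0.
have m0 := v0_meas ok; have p0 := v0_ge0 ok.
have I0 : (\int[mu]_x (v0 v x)%:E = (tl v 0)%:E)%E.
  rewrite (tlE ok)// integral_ge_if; apply: eq_integral => x _.
  by rewrite /v0; case: ifP.
have i0 : mu.-integrable setT (EFin \o v0 v).
  apply/integrableP; split; first exact/measurable_EFinP.
  under eq_integral => x _ do rewrite /= ger0_norm//.
  by rewrite I0 ltry.
have /cvgrPdist_lt /(_ _ e0) [N _ hN] := cvg_integral_symitv i0.
have := hN N (leqnn N); rewrite /= [X in `|X - _|]/Rintegral I0/=.
have N0 : 0 <= N%:R :> R by [].
have sN : `[- N%:R, N%:R]%classic `<=` ([set: R] : set R) by [].
have -> : \int[mu]_(x in `[- (N%:R : R), N%:R]) v0 v x = \int[mu]_(x in `[0, N%:R[) v x.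
  rewrite /Rintegral; congr fine.
  rewrite -integral_itv_bndo_bndc; last by apply/measurable_EFinP; exact: measurable_funTS.
  rewrite [LHS]integral_mkcond [RHS]integral_mkcond; apply: eq_integral => x _.
  rewrite !patchE; case: ifPn => h1; case: ifPn => h2 //.
  - move: h2; rewrite inE/= in_itv/= => /andP[x0 _].
    by rewrite /v0 x0.
  - move: h1; rewrite inE/= in_itv/= => /andP[_ xN].
    move: h2; rewrite notin_setE/= in_itv/= xN andbT => /negP; rewrite /v0.
    by case: (0 <= x).
  - move: h2; rewrite inE/= in_itv/= => /andP[x0 xN].
    move: h1; rewrite notin_setE/= in_itv/= xN andbT => h; exfalso; apply: h.
    by apply: le_trans x0; rewrite oppr_le0.
move=> h; exists N%:R => //.
move: h (tl_split ok (lexx 0) N0).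
move: (tl v 0) (tl v N%:R) (\int[mu]_(x in `[0, N%:R[) v x) => a b I.
by move=> h e1; have := ler_norm (a - I); lra.
Qed.

Section HeatStep.
Variables (d : R).
Hypothesis d0 : 0 < d.
Variables (v : R -> R) (B c : R).
Hypothesis ok : okd v B.
Hypothesis c0 : 0 <= c.

Let pk := (Num.sqrt (2 * pi * d))^-1.

Lemma hh_ge0 x : 0 <= hh d v c x.
Proof.
rewrite -lee_fin (hh_EFin d0 ok) adde_ge0//.
  by rewrite lee_fin mulr_ge0// gn_ge0.
apply: integral_ge0 => y /=; rewrite in_itv/= andbT => y0.
by rewrite lee_fin mulr_ge0 ?gn_ge0//; have /andP[] := ok_bd ok y0.
Qed.

Lemma hh_le x : hh d v c x <= 2 * pk * (c + tl v 0).
Proof.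
have -> : 2 * pk * (c + tl v 0) = c * (2 * pk) + 2 * pk * tl v 0 by ring.
rewrite -lee_fin (hh_EFin d0 ok) EFinD; apply: leeD.
  by rewrite lee_fin ler_wpM2l// gn_le.
rewrite EFinM (tlE ok)// -ge0_integralZl//=.
- apply: ge0_le_integral => //=.
  + move=> y; rewrite in_itv/= andbT => y0.
    by rewrite lee_fin mulr_ge0 ?gn_ge0//; have /andP[] := ok_bd ok y0.
  + by apply/measurable_EFinP; apply: measurable_funM; [exact: gn_measx|exact: (ok_meas ok)].
  + by apply: measurable_funeM; apply/measurable_EFinP; exact: (ok_meas ok).
  + move=> y; rewrite in_itv/= andbT => y0.
    by rewrite -EFinM lee_fin ler_wpM2r ?gn_le//; have /andP[] := ok_bd ok y0.
- by apply/measurable_EFinP; exact: (ok_meas ok).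
- by move=> y; rewrite in_itv/= andbT => y0; rewrite lee_fin; have /andP[] := ok_bd ok y0.
- by rewrite lee_fin mulr_ge0// invr_ge0 sqrtr_ge0.
Qed.

Let Kf (p : R * R) : \bar R := (gauss_neum d p.1 p.2 * v0 v p.2)%:E.

Let Kf_meas : measurable_fun setT Kf.
Proof.
apply/measurable_EFinP; apply: measurable_funM; first exact: (gn_meas d measurable_fst measurable_snd).
by apply: (measurableT_comp (v0_meas ok)); exact: measurable_snd.
Qed.

Let Kf_ge0 p : (0 <= Kf p)%E.
Proof. by rewrite lee_fin mulr_ge0 ?(gn_ge0 d0)// (v0_ge0 ok). Qed.

Let KfE x : (\int[mu]_(y in `[0%R, +oo[) (gauss_neum d x y * v y)%:E = \int[mu]_y Kf (x, y))%E.
Proof.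
rewrite integral_ge_if; apply: eq_integral => y _; rewrite /Kf /v0/=.
by case: ifP; rewrite ?mulr0.
Qed.

Let KF_meas : measurable_fun setT (fun x => (\int[mu]_y Kf (x, y))%E).
Proof. exact: (@measurable_fun_fubini_tonelli_F _ _ (measurableTypeR R) (measurableTypeR R) R mu _ Kf_meas Kf_ge0). Qed.

Lemma hh_meas : measurable_fun setT (hh d v c).
Proof.
apply/measurable_EFinP.
have -> : EFin \o hh d v c = (fun x => (c * gauss_neum d x 0)%:E + \int[mu]_y Kf (x, y))%E.
  by apply/funext => x /=; rewrite (hh_EFin d0 ok) KfE.
apply: emeasurable_funD => //; apply/measurable_EFinP; apply: measurable_funM => //.
by apply: gn_meas => //; exact: measurable_cst.
Qed.

(** The atom contributes c th by [th_qq], and the density contributes its reflected flow by [Gn_tl]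
    after an exchange of integrals. *)
Lemma hh_tail r : 0 <= r ->
  (\int[mu]_(x in `[r, +oo[) (hh d v c x)%:E = (Gn d (tl v) r + c * th d r)%:E)%E.
Proof.
move=> r0.
under eq_integral do rewrite (hh_EFin d0 ok) KfE.
rewrite ge0_integralD//=; first last.
- exact: measurable_funTS.
- by move=> x _; apply: integral_ge0 => y _; exact: Kf_ge0.
- apply: measurable_funTS; apply/measurable_EFinP; apply: measurable_funM => //.
  by apply: gn_meas => //; exact: measurable_cst.
- by move=> x _; rewrite lee_fin mulr_ge0// gn_ge0.
rewrite EFinD [RHS]addeC; congr (_ + _)%E.
  rewrite EFinM (th_qq d0 r0) /qq -ge0_integralZl//=.
  - by apply: measurable_funTS; apply/measurable_EFinP; apply: gn_meas => //; exact: measurable_cst.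
  - by move=> x _; rewrite lee_fin gn_ge0.
rewrite (Gn_tl d0 ok) !integral_ge_if.
have mS : measurable_fun setT (fun p : R * R => if r <= p.1 then Kf p else 0%E).
  apply: measurable_fun_ifT => //; apply: measurable_fun_ler; first exact: measurable_cst.
  exact: measurable_fst.
transitivity (\int[mu]_x \int[mu]_y (if (r <= x)%R then Kf (x, y) else 0))%E.
  by apply: eq_integral => x _; case: ifP => // _; rewrite integral0.
transitivity (\int[mu]_y \int[mu]_x (if (r <= x)%R then Kf (x, y) else 0))%E.
  apply: (@fubini_tonelli _ _ (measurableTypeR R) (measurableTypeR R) R mu mu _ mS) => p.
  by case: ifP => // _; exact: Kf_ge0.
apply: eq_integral => y _; rewrite -(integral_ge_if r (fun x => Kf (x, y))) /Kf/= /v0.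
case: ifPn => y0; last by rewrite (eq_integral (cst 0%E)) ?integral0// => x _; rewrite mulr0.
rewrite /qq -ge0_integralZl//=.
- by apply: eq_integral => x _; rewrite -EFinM mulrC.
- by apply: measurable_funTS; apply/measurable_EFinP; apply: gn_meas => //; exact: measurable_cst.
- by move=> x _; rewrite lee_fin gn_ge0.
- by rewrite lee_fin; have /andP[] := ok_bd ok y0.
Qed.

Lemma okd_hh : okd (hh d v c) (2 * pk * (c + tl v 0)).
Proof.
split.
- exact: measurable_funTS hh_meas.
- by move=> x _; rewrite hh_ge0 hh_le.
- apply/integrableP; split; first by apply/measurable_EFinP; exact: measurable_funTS hh_meas.
  under eq_integral => x _ do rewrite /= ger0_norm ?hh_ge0//.
  by rewrite hh_tail// ltry.
Qed.

Lemma tl_hh r : 0 <= r -> tl (hh d v c) r = Gn d (tl v) r + c * th d r.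
Proof. by move=> r0; apply: EFin_inj; rewrite (tlE okd_hh)// hh_tail. Qed.

End HeatStep.

Section CutStep.
Variables (j d : R) (h : R -> R) (B : R).
Hypothesis ok : okd h B.
Hypothesis jd0 : 0 < j * d.
Hypothesis jdh : j * d < tl h 0.

Let h' := dens (barrier_cut j d (of_fun h)).

(** The level j d is reached, by intermediate values between the total mass and a vanishing tail,
    and the Lipschitz tail still has this value at the infimum; so [level_inf] is real and the cut
    removes exactly the mass j d. *)
Lemma cut_level : exists2 rs, 0 <= rs & tl h rs = j * d /\ forall r, h' r = if r <= rs then h r else 0.
Proof.
pose S := [set r : R | 0 <= r /\ Defs.F r (of_fun h) = (j * d)%:E].
have SE r : S r <-> 0 <= r /\ tl h r = j * d.
  split=> [[r0]|[r0 e]].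
    by rewrite (F_tl ok 0 r0); case: eqP => _; rewrite add0r => -[].
  by split => //; rewrite (F_tl ok 0 r0) e; case: eqP => _; rewrite add0r.
have B0 : 0 <= B by have /andP[h1 h2] := ok_bd ok (lexx 0); exact: le_trans h2.
have ct : continuous (tl h) by apply: ucont_continuous; case: (cb_tl ok).
have S0 : S !=set0.
  have [b b0 hb] := tl_vanish ok jd0.
  have [|x + hx] := IVT b0 (continuous_subspaceT ct (A := _)) (v := j * d).
    by rewrite ge_min le_max (ltW jdh) (ltW hb) orbT.
  by rewrite in_itv/= => /andP[x0 _]; exists x; apply/SE.
have lb : has_lbound S by exists 0 => r [].
pose rs := inf S.
have rs0 : 0 <= rs by apply: lb_le_inf => // r [].
have lE : level_inf (j * d)%:E (of_fun h) = rs%:E by exact: ereal_inf_EFin.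
exists rs => //; split; last by move=> r; rewrite /h' /barrier_cut/= lE lee_fin.
apply/eqP; rewrite -subr_eq0 -normr_le0; apply/ler_addgt0Pl => e e0; rewrite addr0.
have q0 : 0 < e / (B + 1) by rewrite divr_gt0// ltr_wpDl.
have [r /SE[r0 hr] rlt] := inf_adherent q0 (conj S0 lb).
have rge : rs <= r by apply: ge_inf => //; apply/SE.
rewrite -hr; apply: (le_trans (tl_lip ok _ _)); rewrite distrC ger0_norm ?subr_ge0//.
apply: (@le_trans _ _ ((B + 1) * (e / (B + 1)))); last by rewrite mulrC divfK// gt_eqF// ltr_wpDl.
apply: ler_pM => //; first by rewrite subr_ge0.
- by rewrite lerDl.
- by rewrite lerBlDl ltW.
Qed.

Lemma okd_cut : okd h' B.
Proof.
have [rs rs0 [hrs hE]] := cut_level.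
have -> : h' = (fun r => if r <= rs then h r else 0) by apply/funext.
have m : measurable_fun (`[0, +oo[%classic : set R) (fun r => if r <= rs then h r else 0).
  apply: measurable_fun_if => //.
  - by apply: measurable_fun_ler => //; exact: measurable_cst.
  - apply: (measurable_funS _ _ (ok_meas ok)) => //; exact: subIsetl.
have /andP[b1 b2] := ok_bd ok (lexx 0).
have bd x : 0 <= x -> 0 <= (if x <= rs then h x else 0) <= B.
  by move=> x0; case: ifP => _; [exact: (ok_bd ok)|rewrite lexx (le_trans b1)].
split => //.
apply: (le_integrable _ _ _ (ok_int ok)) => //; first exact/measurable_EFinP.
move=> x /=; rewrite in_itv/= andbT => x0; rewrite lee_fin.
by case: ifP => // _; rewrite normr0.
Qed.

Lemma tl_cut r : 0 <= r -> tl h' r = cut j d (tl h) r.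
Proof.
move=> r0; have [rs rs0 [hrs hE]] := cut_level; have ok' := okd_cut.
have zero_after x : rs <= x -> tl h' x = 0.
  move=> rx; have x0 := le_trans rs0 rx.
  have := tlE ok' x0; rewrite -integral_itv_obnd_cbnd; last first.
    apply: (measurable_funS _ _ (ok_meas_from ok' x0)) => //.
    by move=> t /=; rewrite !in_itv/= !andbT; exact: ltW.
  rewrite (eq_integral (cst 0%E)) ?integral0; first by case.
  move=> t; rewrite inE/= in_itv/= andbT => xt; rewrite hE (_ : t <= rs = false)//.
  by apply/negbTE; rewrite -ltNge; exact: le_lt_trans xt.
have [rrs|/ltW rrs] := leP r rs; last first.
  by rewrite zero_after// /cut posp_0// subr_le0 -hrs; apply: (tl_mono ok).
have hh' : tl h rs <= tl h r by apply: (tl_mono ok).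
rewrite (tl_split ok' r0 rrs) (zero_after rs)// addr0 /cut posp_id; last by rewrite subr_ge0 -hrs.
rewrite (tl_split ok r0 rrs) hrs addrK; apply: eq_Rintegral => t.
by rewrite inE/= in_itv/= hE => /andP[_ /ltW ->].
Qed.

End CutStep.

Section Iterates.
Variables (j d : R) (v : R -> R) (B : R).
Hypothesis j0 : 0 < j.
Hypothesis d0 : 0 < d.
Hypothesis ok : okd v B.
Hypothesis big : j * d < tl v 0.

Lemma Gn_ext f g r : (forall x, 0 <= x -> f x = g x) -> Gn d f r = Gn d g r.
Proof.
move=> fg; congr (P d _ r); apply/funext => x.
by rewrite /ox !fg// posp_ge0.
Qed.

Lemma S_minus_heat n : exists B', okd (dens (heat_neum d (S_minus j d n v))) B' /\
  forall r, 0 <= r -> tl (dens (heat_neum d (S_minus j d n v))) r = Hn j d (tl v) n r.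
Proof.
have jd0 : 0 < j * d by rewrite mulr_gt0.
elim: n => [|n [B' [ok' tE]]].
  exists (2 * (Num.sqrt (2 * pi * d))^-1 * (0 + tl v 0)); split.
    exact: (okd_hh d0 ok (lexx 0)).
  by move=> r r0; rewrite -/(hh d v 0) (tl_hh d0 ok (lexx 0) r0) mul0r addr0.
set h := dens _ in ok' tE *.
have big' : j * d < tl h 0 by rewrite tE// (_ : Hn j d (tl v) n 0 = tl v 0)//; apply: Hn0 => //; [exact: cb_tl ok|exact: ltW].
have okc := okd_cut ok' jd0 big'.
set h' := dens (barrier_cut j d (of_fun h)) in okc *.
have SE : S_minus j d n.+1 v = mkU (j * d + 0) h' by [].
rewrite addr0 in SE.
rewrite SE; exists (2 * (Num.sqrt (2 * pi * d))^-1 * (j * d + tl h' 0)); split.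
  exact: (okd_hh d0 okc (ltW jd0)).
move=> r r0; rewrite -/(hh d h' (j * d)) (tl_hh d0 okc (ltW jd0) r0) /= /Tn.
congr (_ + _); apply: Gn_ext => x x0; rewrite (tl_cut ok' jd0 big' x0).
by rewrite /cut tE.
Qed.

(** n + 1 steps correspond to [Hn] at index n, because the first heat flow is not preceded by a cut.
    At r = 0 the convention for [F] counts the atom. *)
Lemma F_S_minus n r : 0 <= r ->
  Defs.F r (S_minus j d n.+1 v) = ((if r == 0 then j * d else 0) + cut j d (Hn j d (tl v) n) r)%:E.
Proof.
have jd0 : 0 < j * d by rewrite mulr_gt0.
move=> r0; have [B' [ok' tE]] := S_minus_heat n.
set h := dens _ in ok' tE *.
have big' : j * d < tl h 0 by rewrite tE// (_ : Hn j d (tl v) n 0 = tl v 0)//; apply: Hn0 => //; [exact: cb_tl ok|exact: ltW].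
have okc := okd_cut ok' jd0 big'.
set h' := dens (barrier_cut j d (of_fun h)) in okc *.
have SE : S_minus j d n.+1 v = mkU (j * d + 0) h' by [].
rewrite addr0 in SE.
rewrite SE (F_tl okc)//; congr (_ + _)%:E.
by rewrite (tl_cut ok' jd0 big' r0) /cut tE.
Qed.

End Iterates.
End BarrierTails.

(** * A smooth absolute value *)

Section SmoothAbs.
Context {R : realType}.
Implicit Types (r s t x y z e c m a b k : R) (f g h v : R -> R).

Lemma odd_part_cube x : posp (- x) ^+ 3 = posp x ^+ 3 - x ^+ 3.
Proof.
have [h|/ltW h] := leP 0 x; first by rewrite (posp_id h) posp_0 ?oppr_le0//; ring.
by rewrite (posp_0 h) posp_id ?oppr_ge0//; ring.
Qed.

Section Fixed.
Variable k : R.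
Hypothesis k0 : 0 < k.

(* The hat-kernel mollification of the absolute value, in closed form. *)
Definition sabs x := (posp (x + k) ^+ 3 - 2 * posp x ^+ 3 + posp (x - k) ^+ 3) / (3 * k ^+ 2) - x.
Definition sabs1 x := (posp (x + k) ^+ 2 - 2 * posp x ^+ 2 + posp (x - k) ^+ 2) / k ^+ 2 - 1.
Definition sabs2 x := 2 * (posp (x + k) - 2 * posp x + posp (x - k)) / k ^+ 2.

Let kn : k != 0. Proof. by rewrite gt_eqF. Qed.

Lemma sabs_even x : sabs (- x) = sabs x.
Proof.
rewrite /sabs (_ : - x + k = - (x - k)); last by ring.
rewrite (_ : - x - k = - (x + k)); last by ring.
rewrite !odd_part_cube; move: (posp (x - k)) (posp (x + k)) (posp x) => p q w.
by field; exact: kn.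
Qed.

Lemma sabs_pos x : 0 <= x -> sabs x = x + posp (k - x) ^+ 3 / (3 * k ^+ 2).
Proof.
move=> x0; have kk := k0; rewrite /sabs (posp_id x0) posp_id; last by rewrite addr_ge0// ltW.
rewrite -(opprB x k) odd_part_cube; move: (posp (x - k)) => p.
by field; exact: kn.
Qed.

Lemma sabs_near x : 0 <= x -> x <= sabs x <= x + k.
Proof.
move=> x0; rewrite sabs_pos// lerDl lerD2l.
have p0 := posp_ge0 (k - x); have kk := k0.
have pk : posp (k - x) <= k by rewrite -[leRHS](posp_id (ltW k0)); apply: posp_mono; lra.
rewrite divr_ge0 ?exprn_ge0 ?mulr_ge0 ?(ltW k0)//=.
rewrite ler_pdivrMr; last by rewrite mulr_gt0// exprn_gt0.
apply: (@le_trans _ _ (k ^+ 3)); first by rewrite lerXn2r// nnegrE ltW.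
have k3 : 0 < k ^+ 3 by rewrite exprn_gt0.
rewrite (_ : k * (3 * k ^+ 2) = 3 * k ^+ 3); last by ring.
lra.
Qed.

Lemma sabs_far x : k <= x -> sabs x = x /\ sabs1 x = 1.
Proof.
move=> kx; have kk := k0; have x0 : 0 <= x by lra.
rewrite sabs_pos// posp_0 ?subr_le0// expr0n/= mul0r addr0; split => //.
have p1 : posp (x + k) = x + k by rewrite posp_id//; lra.
have p2 : posp (x - k) = x - k by rewrite posp_id// subr_ge0.
by rewrite /sabs1 (posp_id x0) p1 p2; field; exact: kn.
Qed.

Lemma sabs_derive x : is_derive x 1 sabs (sabs1 x).
Proof.
have d1 := shift_derive k x posp_cube_derive; have d2 := shift_derive (- k) x posp_cube_derive.
have d3 := posp_cube_derive x; rewrite /sabs.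
apply: is_derive_eq; rewrite /GRing.scale/= /sabs1.
by move: (posp (x + k)) (posp x) (posp (x - k)) => p q w; field; exact: kn.
Qed.

Lemma sabs1_derive x : is_derive x 1 sabs1 (sabs2 x).
Proof.
have d1 := shift_derive k x posp_sqr_derive; have d2 := shift_derive (- k) x posp_sqr_derive.
have d3 := posp_sqr_derive x; rewrite /sabs1.
apply: is_derive_eq; rewrite /GRing.scale/= /sabs2.
by move: (posp (x + k)) (posp x) (posp (x - k)) => p q w; field; exact: kn.
Qed.

Lemma sabs2_continuous : continuous sabs2.
Proof.
have cs c : continuous (fun x => posp (x + c)).
  move=> x; apply: (@continuous_comp _ _ _ (fun x => x + c) posp); last exact: posp_continuous.
  by apply: cvgD; [exact: cvg_id|exact: cvg_cst].
move=> x; apply: cvgM; last exact: cvg_cst.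
apply: cvgM; first exact: cvg_cst.
apply: cvgD; last exact: cs.
apply: cvgB; first exact: cs.
by apply: cvgM; [exact: cvg_cst|exact: posp_continuous].
Qed.

End Fixed.
End SmoothAbs.

Lemma integral_if_itv (R : realType) (i k : interval R) (p : pred R) (f : R -> \bar R) :
  (forall x, (x \in k) = (x \in i) && p x) ->
  (\int[@lebesgue_measure R]_(x in [set` i]) (if p x then f x else 0) =
   \int[@lebesgue_measure R]_(x in [set` k]) f x)%E.
Proof.
move=> ikp; rewrite [LHS]integral_mkcond [RHS]integral_mkcond; apply: eq_integral => x _.
by rewrite !patchE !mem_setE ikp; case: (x \in i) => //=; case: (p x).
Qed.

(** * Approximating the initial datum *)

Section InitialDatum.
Context {R : realType}.
Notation mu := (@lebesgue_measure R).
Implicit Types (r s t x y z e c m a b k : R) (f g h v : R -> R).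
Variables (j B Z0 : R) (v : R -> R).
Hypothesis j0 : 0 < j.
Hypothesis Z00 : 0 <= Z0.
Hypothesis ok : okd v B.
Hypothesis vZ : forall x, Z0 < x -> v x = 0.

Let B0 : 0 <= B. Proof. by have /andP[h1 h2] := ok_bd ok (lexx 0); exact: le_trans h2. Qed.

(** Density of continuous functions in L^1 of [0, Z0], then clamping to [0, B], which does not
    increase the distance to v, and a linear cutoff over a length h0 with h0 B <= e / 2. Composition
    with |x| makes the result even. *)
Lemma continuous_approx e : 0 < e -> exists h, [/\ continuous h, forall x, h (- x) = h x,
  forall x, 0 <= h x <= B, forall x, Z0 + 1 / 2 <= `|x| -> h x = 0 &
  (\int[mu]_(x in `[0%R, +oo[) `|h x - v x|%:E <= e%:E)%E].
Proof.
move=> e0.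
have sZ : `[0, Z0]%classic `<=` (`[0, +oo[%classic : set R) by move=> x /=; rewrite !in_itv/= => /andP[->].
have iv : mu.-integrable `[0, Z0] (EFin \o v) by apply: integrableS (ok_int ok).
have mZ : (mu `[0%R, Z0] < +oo)%E by rewrite lebesgue_measure_itv/= lte_fin; case: ifP => _; rewrite ?ltry.
have [g_ [cg ig /fine_cvgP[fing gl]]] := approximation_continuous_integrable (measurable_itv `[0, Z0]) mZ iv.
have e2 : 0 < e / 2 by lra.
have [n hn] : exists n, (\int[mu]_(z in `[0%R, Z0]) `|(v z - g_ n z)%:E| <= (e / 2)%:E)%E.
  have /cvgrPdist_lt /(_ _ e2) h1 := gl.
  near \oo => n; exists n.
  have hf : (\int[mu]_(z in `[0%R, Z0]) `|(v z - g_ n z)%:E|)%E \is a fin_num by near: n.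
  rewrite -(fineK hf) lee_fin; apply: ltW; apply: le_lt_trans (ler_norm _) _.
  by rewrite -normrN -sub0r; near: n.
have {cg}cg := cg n; have {ig}ig := ig n; move: hn; set g := g_ n => hn.
pose h0 : R := Num.min (1 / 2) (e / (2 * (B + 1))).
have B1 : 0 < B + 1 by have := B0; lra.
have h00 : 0 < h0 by rewrite lt_min divr_gt0//= divr_gt0// mulr_gt0.
have h0h : h0 <= 1 / 2 by rewrite ge_min lexx.
have h0B : h0 * B <= e / 2.
  apply: (@le_trans _ _ (e / (2 * (B + 1)) * (B + 1))).
    by apply: ler_pM => //; [exact: ltW|rewrite ge_min lexx orbT|rewrite lerDl].
  by rewrite invfM mulrA divfK// gt_eqF.
pose cl y := Num.min (posp y) B.
pose ct x := posp (1 - posp (`|x| - Z0) / h0).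
pose h x := cl (g `|x|) * ct x.
have cl_bd y : 0 <= cl y <= B by rewrite le_min posp_ge0 B0 ge_min lexx orbT.
have ct_bd x : 0 <= ct x <= 1.
  rewrite posp_ge0 -[leRHS](posp_id ler01); apply: posp_mono.
  by rewrite gerBl divr_ge0 ?posp_ge0 ?(ltW h00).
have cl_lip y x : 0 <= x <= B -> `|cl y - x| <= `|y - x|.
  move=> /andP[x0 xB]; rewrite /cl /posp; have b0 := B0; clear -x0 xB b0.
  rewrite ler_norml; case: (leP y 0) => h1; case: (leP _ B) => h2; have := ler_norm (y - x);
    have := ler_norm (- (y - x)); rewrite normrN => H1 H2; apply/andP; split; lra.
have cl_c : continuous cl.
  by move=> y; apply: continuous_min; [exact: posp_continuous|exact: cvg_cst].
have ca : continuous (fun x : R => `|x|) by exact: norm_continuous.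
have ch : continuous h.
  move=> x; apply: cvgM.
    apply: (@continuous_comp _ _ _ (fun x => g `|x|) cl); last exact: cl_c.
    by apply: (@continuous_comp _ _ _ (fun x : R => `|x|) g); [exact: ca|exact: cg].
  apply: (@continuous_comp _ _ _ (fun x => 1 - posp (`|x| - Z0) / h0) posp); last exact: posp_continuous.
  apply: cvgB; first exact: cvg_cst.
  apply: cvgM; last exact: cvg_cst.
  apply: (@continuous_comp _ _ _ (fun x => `|x| - Z0) posp); last exact: posp_continuous.
  by apply: cvgB; [exact: ca|exact: cvg_cst].
have h_bd x : 0 <= h x <= B.
  have /andP[a1 a2] := cl_bd (g `|x|); have /andP[b1 b2] := ct_bd x.
  rewrite mulr_ge0//= -[leRHS]mulr1; exact: ler_pM.
have h_in x : 0 <= x -> x <= Z0 -> h x = cl (g x).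
  move=> x0 xZ; rewrite /h /ct ger0_norm// (posp_0 (x := x - Z0)) ?subr_le0// mul0r subr0.
  by rewrite posp_id// mulr1.
have h_out x : Z0 + h0 <= `|x| -> h x = 0.
  move=> hx; rewrite /h /ct (posp_0 (x := 1 - _)) ?mulr0// subr_le0 ler_pdivlMr// mul1r.
  by rewrite posp_id; have := h00; lra.
exists h; split => //.
- by move=> x; rewrite /h /ct normrN.
- by move=> x hx; apply: h_out; have := h0h; lra.
have mg : measurable_fun setT g by exact: continuous_measurable_fun.
pose Q x : \bar R := ((if x <= Z0 then `|v x - g x| else 0) + (if (Z0 <= x) && (x <= Z0 + h0) then B else 0))%:E.
apply: (@le_trans _ _ (\int[mu]_(x in `[0%R, +oo[) Q x)%E).
  apply: ge0_le_integral => //=.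
  - apply/measurable_EFinP; apply: measurableT_comp => //; apply: measurable_funB; last exact: ok_meas ok.
    by apply: measurable_funTS; exact: continuous_measurable_fun.
  - apply/measurable_EFinP; apply: measurable_funD.
      apply: measurable_fun_if => //.
      + by apply: measurable_fun_ler => //; exact: measurable_cst.
      + apply: measurableT_comp => //; apply: measurable_funB; last exact: measurable_funTS.
        by apply: (measurable_funS _ _ (ok_meas ok)) => //; exact: subIsetl.
    apply: measurable_fun_if => //; apply: measurable_and.
    + by apply: measurable_fun_ler => //; exact: measurable_cst.
    + by apply: measurable_fun_ler => //; exact: measurable_cst.
  - move=> x; rewrite in_itv/= andbT => x0; rewrite lee_fin.
    have q0 : 0 <= (if (Z0 <= x) && (x <= Z0 + h0) then B else 0) by case: ifP.
    have [xZ|xZ] := leP x Z0.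
      rewrite h_in//; have := cl_lip (g x) (v x) (ok_bd ok x0); rewrite (distrC (g x)) => H1.
      by apply: (le_trans H1); rewrite lerDl.
    rewrite (vZ xZ) subr0 add0r (ltW xZ)/=; have /andP[a1 a2] := h_bd x.
    rewrite ger0_norm//; case: (leP x (Z0 + h0)) => // /ltW hx; rewrite h_out// ger0_norm//.
rewrite (_ : e = e / 2 + e / 2); last by field.
rewrite /Q; under eq_integral do rewrite EFinD.
rewrite ge0_integralD//=.
- rewrite EFinD; apply: leeD.
    apply: le_trans hn; rewrite le_eqVlt -(@integral_if_itv _ `[0, +oo[ `[0, Z0] (fun x => x <= Z0)).
      by apply/orP; left; apply/eqP; apply: eq_integral => x _; case: ifP.
    by move=> x; rewrite !in_itv/= andbT.
  have -> : (\int[mu]_(x in `[0%R, +oo[) (if (Z0 <= x) && (x <= Z0 + h0) then B else 0)%:E =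
      \int[mu]_(x in `[Z0, (Z0 + h0)%R]) B%:E)%E.
    rewrite -(@integral_if_itv _ `[0, +oo[ `[Z0, (Z0 + h0)%R] (fun x => (Z0 <= x) && (x <= Z0 + h0))).
      by apply: eq_integral => x _; case: ifP.
    move=> x; rewrite !in_itv/= andbT; case: leP => //= h1; rewrite ?andbF//.
    by rewrite (le_trans Z00 h1).
  rewrite integral_cst//= lebesgue_measure_itv/= lte_fin ltrDl h00 -EFinD -EFinM lee_fin.
  by rewrite addrAC subrr add0r mulrC.
- by move=> x _; case: ifP => // _; rewrite lee_fin.
- apply/measurable_EFinP; apply: measurable_fun_if => //.
  + by apply: measurable_fun_ler => //; exact: measurable_cst.
  + apply: measurableT_comp => //; apply: measurable_funB; last exact: measurable_funTS.
    by apply: (measurable_funS _ _ (ok_meas ok)) => //; exact: subIsetl.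
- by move=> x _; case: ifP => // _; rewrite lee_fin.
- apply/measurable_EFinP; apply: measurable_fun_if => //; apply: measurable_and.
  + by apply: measurable_fun_ler => //; exact: measurable_cst.
  + by apply: measurable_fun_ler => //; exact: measurable_cst.
Unshelve. all: by end_near.
Qed.

Lemma initial_state e : 0 < e -> exists w w1 w2 W, [/\ state j w w1 w2 W (Z0 + 1),
  forall r, 0 <= r -> r <= Z0 + 1 -> 0 <= w r - 2 * j * r <= B + 2 * j + (Z0 + 1) ^+ 2 &
  (\int[mu]_(r in `[0%R, +oo[) `|(if r <= Z0 + 1 then w r - 2 * j * r else 0) - v r|%:E <= e%:E)%E].
Proof.
move=> e0; set Z := Z0 + 1; have Z1 : 1 <= Z by rewrite lerDr.
have Z_gt0 : 0 < Z by lra.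
have e2 : 0 < e / 2 by lra.
have [h [ch evh bdh outh inth]] := continuous_approx e2.
have outZ x : Z <= `|x| -> h x = 0 by move=> hx; apply: outh; rewrite /Z in hx; lra.
pose e' := e / (2 * Z); have e'0 : 0 < e' by rewrite divr_gt0// mulr_gt0.
have [M M0 hM] := csupp_ucont ch outZ (divr_gt0 e'0 (ltr0Sn _ 3)).
pose b := Num.min 1 (e' / (4 * Z ^+ 2)).
have b0 : 0 < b by rewrite lt_min ltr01 divr_gt0// mulr_gt0// exprn_gt0.
have b1 : b <= 1 by rewrite ge_min lexx.
have bZ : b * Z ^+ 2 <= e' / 4.
  apply: (@le_trans _ _ (e' / (4 * Z ^+ 2) * Z ^+ 2)).
    by rewrite ler_wpM2r ?sqr_ge0// ge_min lexx orbT.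
  rewrite le_eqVlt; apply/orP; left; apply/eqP; have zn : Z != 0 by rewrite gt_eqF.
  have aux (q z : R) : z != 0 -> q / (4 * z ^+ 2) * z ^+ 2 = q / 4 by move=> z0; field.
  exact: aux.
pose k := Num.min (1 / 2) (Num.min (e' / (4 * (2 * j))) (e' / (4 * (M + 1)))).
have M1 : 0 < M + 1 by lra.
have k0 : 0 < k by rewrite !lt_min !divr_gt0//= !mulr_gt0.
have k1 : k <= 1 / 2 by rewrite ge_min lexx.
have kj : 2 * j * k <= e' / 4.
  have : k <= e' / (4 * (2 * j)) by rewrite !ge_min lexx !orbT.
  by rewrite ler_pdivlMr ?mulr_gt0// => h1; rewrite ler_pdivlMr//; nra.
have kM : M * k ^+ 2 <= e' / 4.
  have h1 : k <= e' / (4 * (M + 1)) by rewrite !ge_min lexx !orbT.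
  move: h1; rewrite ler_pdivlMr ?mulr_gt0// => h1.
  have h2 : k ^+ 2 <= k by rewrite expr2 ger_pMr//; lra.
  have h3 : M * k ^+ 2 <= M * k by rewrite ler_wpM2l.
  rewrite ler_pdivlMr//; nra.
have [c [c1 [c2 mo]]] := mollifier_exists ch k0.
have c_ge0 x : 0 <= c x by apply: (mo_ge mo) => y _; have /andP[] := bdh y.
have c_leB x : c x <= B by apply: (mo_le mo) => y _; have /andP[] := bdh y.
have c_out x : Z <= `|x| -> c x = 0.
  move=> hx; apply: le_anti; rewrite c_ge0 andbT; apply: (mo_le mo) => y hy.
  rewrite outh//; rewrite /Z in hx; have := ler_normB y (y - x).
  by rewrite opprB addrCA subrr addr0; lra.
have c_close x : `|c x - h x| <= e' / 2.
  have H y : `|y - x| <= k -> h x - e' / 2 <= h y <= h x + e' / 2.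
    move=> hy; have := hM y x.
    have : (y - x) ^+ 2 <= k ^+ 2 by rewrite -[leLHS]real_normK ?num_real// lerXn2r// nnegrE ltW.
    move=> h1; have h2 : M * (y - x) ^+ 2 <= M * k ^+ 2 by rewrite ler_wpM2l.
    rewrite ler_norml => /andP[h3 h4]; apply/andP; split; lra.
  rewrite ler_norml; apply/andP; split.
    by rewrite lerBrDr addrC; apply: (mo_ge mo) => y /H /andP[].
  by rewrite lerBlDr addrC; apply: (mo_le mo) => y /H /andP[].
(* [c] is nonnegative and vanishes at Z, so Z is a minimum. *)
have c1Z : c1 Z = 0.
  have cZ : c Z = 0 by apply: c_out; rewrite gtr0_norm.
  apply/eqP; rewrite eq_le !leNgt; apply/andP; split; apply/negP => hc.
    have [|r' [_ _]] := left_descent (lo := Z - 1) (mo_d1 mo Z) hc; first by lra.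
    by rewrite cZ ltNge c_ge0.
  have [|r' [_ _]] := right_descent (hi := Z + 1) (mo_d1 mo Z) hc; first by lra.
  by rewrite cZ ltNge c_ge0.
(* [2 * j * sabs k] is even and equals 2 j x from k on: u = w - 2 j x has slope -2 j at 0, stays
   close to c and vanishes at Z. The term b (Z^2 - x^2) makes u positive before Z and its slope at Z
   negative. *)
pose w x := c x + 2 * j * sabs k x + b * (Z ^+ 2 - x ^+ 2).
pose w1 x := c1 x + 2 * j * sabs1 k x - 2 * b * x.
pose w2 x := c2 x + 2 * j * sabs2 k x - 2 * b.
have dw x : is_derive x 1 w (w1 x).
  have d1 := mo_d1 mo x; have d2 := sabs_derive k0 x; rewrite /w.
  by apply: is_derive_eq; rewrite /GRing.scale/= /w1; ring.
have dw1 x : is_derive x 1 w1 (w2 x).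
  have d1 := mo_d2 mo x; have d2 := sabs1_derive k0 x; rewrite /w1.
  by apply: is_derive_eq; rewrite /GRing.scale/= /w2; ring.
have ew x : w (- x) = w x.
  by rewrite /w (mo_even mo evh) sabs_even// sqrrN.
have [W [dW oW]] := odd_primitive (derive_continuous dw) ew.
have cw2 : continuous w2.
  have cc2 : continuous c2.
    have -> : c2 = (fun x => (h (x + k) - 2 * h x + h (x - k)) / k ^+ 2) by apply/funext => x; rewrite (mo_g2 mo).
    have cs m : continuous (fun x => h (x + m)).
      move=> x; apply: (@continuous_comp _ _ _ (fun x => x + m) h); last exact: ch.
      by apply: cvgD; [exact: cvg_id|exact: cvg_cst].
    move=> x; apply: cvgM; last exact: cvg_cst.
    apply: cvgD; last exact: cs.
    by apply: cvgB; [exact: cs|apply: cvgM; [exact: cvg_cst|exact: ch]].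
  move=> x; apply: cvgB; last exact: cvg_cst.
  apply: cvgD; first exact: cc2.
  by apply: cvgM; [exact: cvg_cst|exact: sabs2_continuous].
have kZ : k <= Z by lra.
have [fZ f1Z] := sabs_far k0 kZ.
have wE x : 0 <= x -> x <= Z -> c x + b * (Z ^+ 2 - x ^+ 2) <= w x - 2 * j * x <= c x + b * (Z ^+ 2 - x ^+ 2) + 2 * j * k.
  move=> x0 xZ; have /andP[s1 s2] := sabs_near k0 x0; rewrite /w.
  have jj := j0.
  have h1 : 2 * j * x <= 2 * j * sabs k x by rewrite ler_wpM2l//; lra.
  have h2 : 2 * j * sabs k x <= 2 * j * (x + k) by rewrite ler_wpM2l//; lra.
  by apply/andP; split; lra.
have sq x : 0 <= x -> x <= Z -> 0 <= b * (Z ^+ 2 - x ^+ 2) <= b * Z ^+ 2.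
  move=> x0 xZ; have h1 : x ^+ 2 <= Z ^+ 2 by rewrite lerXn2r// nnegrE ltW.
  by rewrite mulr_ge0 ?subr_ge0 ?(ltW b0)//= ler_wpM2l ?(ltW b0)// gerBl sqr_ge0.
exists w, w1, w2, W; split.
- split => //.
  + move=> x x0 xZ; have /andP[h1 _] := wE x x0 (ltW xZ); apply: lt_le_trans h1.
    apply: ltr_wpDl => //; rewrite mulr_gt0// subr_gt0 ltrXn2r//.
  + have -> : w Z = c Z + 2 * j * Z by rewrite /w fZ; ring.
    by rewrite c_out ?gtr0_norm//; ring.
  + by rewrite /w1 c1Z f1Z mulr1 add0r gtrBl mulr_gt0// mulr_gt0.
- move=> x x0 xZ; have /andP[h1 h2] := wE x x0 xZ; have /andP[h3 h4] := sq x x0 xZ.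
  have h5 := c_ge0 x; have h6 := c_leB x.
  have h7 : b * Z ^+ 2 <= Z ^+ 2 by rewrite ger_pMl ?exprn_gt0.
  have h8 : 2 * j * k <= 2 * j by rewrite ger_pMr ?mulr_gt0//; lra.
  by apply/andP; split; lra.
have key x : 0 <= x -> `|(if x <= Z then w x - 2 * j * x else 0) - v x| <= `|h x - v x| + (if x <= Z then e' else 0).
  move=> x0; case: (leP x Z) => [xZ|xZ]; last first.
    rewrite addr0 outZ//; rewrite ger0_norm//; exact: ltW.
  rewrite (_ : w x - _ - v x = (h x - v x) + (w x - 2 * j * x - h x)); last by ring.
  apply: (le_trans (ler_normD _ _)); rewrite lerD2l.
  have := c_close x; have /andP[h1 h2] := wE x x0 xZ; have /andP[h3 h4] := sq x x0 xZ.
  rewrite !ler_norml => /andP[h5 h6]; apply/andP; split; lra.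
have mQ : measurable_fun setT (fun x => if x <= Z then w x - 2 * j * x else 0).
  apply: measurable_fun_ifT => //.
  - by apply: measurable_fun_ler => //; exact: measurable_cst.
  - apply: measurable_funB; first exact: continuous_measurable_fun (derive_continuous dw).
    by apply: measurable_funM => //; exact: measurable_cst.
have mh : measurable_fun (`[0, +oo[ : set R) (fun x => `|h x - v x|).
  apply: measurableT_comp => //; apply: measurable_funB; last exact: ok_meas ok.
  by apply: measurable_funTS; exact: continuous_measurable_fun.
have mi : measurable_fun (`[0, +oo[ : set R) (fun x => if x <= Z then e' else 0).
  by apply: measurable_funTS; apply: measurable_fun_ifT => //; apply: measurable_fun_ler => //; exact: measurable_cst.
apply: (@le_trans _ _ (\int[mu]_(x in `[0%R, +oo[) (`|h x - v x| + (if x <= Z then e' else 0))%:E)%E).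
  apply: ge0_le_integral => //=.
  - apply/measurable_EFinP; apply: measurableT_comp => //; apply: measurable_funB; last exact: ok_meas ok.
    exact: measurable_funTS.
  - by apply/measurable_EFinP; apply: measurable_funD.
  - by move=> x; rewrite in_itv/= andbT => x0; rewrite lee_fin; exact: key.
under eq_integral do rewrite EFinD.
rewrite ge0_integralD//=.
- rewrite (_ : e = e / 2 + e / 2); last by field.
  rewrite EFinD; apply: leeD => //.
  have -> : (\int[mu]_(x in `[0%R, +oo[) (if x <= Z then e' else 0)%:E = \int[mu]_(x in `[0%R, Z]) e'%:E)%E.
    rewrite -(@integral_if_itv _ `[0, +oo[ `[0, Z] (fun x => x <= Z)).
      by apply: eq_integral => x _; case: ifP.
    by move=> x; rewrite !in_itv/= andbT.
  rewrite integral_cst//= lebesgue_measure_itv/= lte_fin Z_gt0 -EFinD -EFinM lee_fin subr0.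
  by rewrite /e' invfM mulrA divfK// gt_eqF.
- exact/measurable_EFinP.
- by move=> x _; case: ifP => // _; rewrite lee_fin ltW.
- exact/measurable_EFinP.
Qed.

End InitialDatum.

(** * A density from a Lipschitz tail *)

Section StieltjesDensity.
Context {R : realType}.
Notation mu := (@lebesgue_measure R).
Implicit Types (r s t x y z e c a b : R).

Lemma lebesgue_stieltjes_itv (f : cumulative R R) a b : a <= b ->
  lebesgue_stieltjes_measure f `]a, b] = (f b - f a)%:E.
Proof.
move=> ab; rewrite /lebesgue_stieltjes_measure/= /measure_extension measurable_mu_extE/=; last exact: is_ocitv.
by rewrite wlength_itv_bnd// EFinB.
Qed.

Variables (G : R -> R) (B m a : R).
Hypothesis G_mono : forall x y, x <= y -> G y <= G x.
Hypothesis G_lip : forall x y, `|G x - G y| <= B * `|x - y|.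
Hypothesis B0 : 0 <= B.
Hypothesis m0 : 0 < m.
Hypothesis G_neg : forall x, x <= 0 -> G x = m.
Hypothesis G_far : forall x, a <= x -> G x = 0.

Let F x := 1 - G x / m.
(** The Lipschitz bound makes H nondecreasing. The Stieltjes measures of F and H then add up to B /
    m times Lebesgue measure, so that of F is absolutely continuous and Radon-Nikodym applies. *)
Let H x := B / m * x - F x.
Let h x := B / m * x.

Let cG : continuous G.
Proof. by apply: ucont_continuous; exact: lip_ucont B0 G_lip. Qed.

Let cF : continuous F.
Proof. by move=> x; apply: cvgB; [exact: cvg_cst|apply: cvgM; [exact: cG|exact: cvg_cst]]. Qed.

Let ch : continuous h.
Proof. by move=> x; apply: cvgM; [exact: cvg_cst|exact: cvg_id]. Qed.

Let cH : continuous H.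
Proof. by move=> x; apply: cvgB; [exact: ch|exact: cF]. Qed.

Let F_nd : {homo F : x y / x <= y}.
Proof. by move=> x y xy; rewrite lerD2l lerN2 ler_pM2r ?invr_gt0//; exact: G_mono. Qed.

Let h_nd : {homo h : x y / x <= y}.
Proof. by move=> x y xy; rewrite ler_wpM2l// divr_ge0// ltW. Qed.

Let H_nd : {homo H : x y / x <= y}.
Proof.
move=> x y xy; rewrite -subr_ge0.
have -> : H y - H x = m^-1 * (B * (y - x) - (G x - G y)).
  by rewrite /H /F; field; rewrite gt_eqF.
rewrite mulr_ge0 ?invr_ge0 ?(ltW m0)// subr_ge0.
have := G_lip x y; rewrite ger0_norm ?subr_ge0 ?G_mono// => l.
by rewrite (le_trans l)// distrC ger0_norm// subr_ge0.
Qed.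

HB.instance Definition _ := isCumulative.Build R _ R F F_nd (right_continuousW cF).
HB.instance Definition _ := isCumulative.Build R _ R h h_nd (right_continuousW ch).
HB.instance Definition _ := isCumulative.Build R _ R H H_nd (right_continuousW cH).

Let F_neg x : x <= 0 -> F x = 0.
Proof. by move=> x0; rewrite /F G_neg// divff ?gt_eqF// subrr. Qed.

Let F_far x : a <= x -> F x = 1.
Proof. by move=> x0; rewrite /F G_far// mul0r subr0. Qed.

Let FNy : F @ -oo --> (0 : R).
Proof.
apply: cvg_near_cst; near=> x; apply: F_neg.
by near: x; apply: nbhs_ninfty_le; exact: num_real.
Unshelve. all: by end_near. Qed.

Let Fy : F @ +oo --> (1 : R).
Proof.
apply: cvg_near_cst; near=> x; apply: F_far.
by near: x; apply: nbhs_pinfty_ge; exact: num_real.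
Unshelve. all: by end_near. Qed.

HB.instance Definition _ := isCumulativeBounded.Build R 0 1 F FNy Fy.

Let nu : probability _ R := lebesgue_stieltjes_measure (F : cumulativeBounded (0 : R) (1 : R)).

Let unique2 (f : cumulative R R) (m' : {measure set (measurableTypeR R) -> \bar R}) :
  (forall x y, x <= y -> m' (`]x, y]%classic : set R) = (f y - f x)%:E) ->
  forall A, measurable A -> lebesgue_stieltjes_measure f A = m' A.
Proof.
move=> E; apply: lebesgue_stieltjes_measure_unique => X [[x y] _ <-]/=.
have [xy|yx] := leP x y; first by rewrite E// lebesgue_stieltjes_itv.
by rewrite set_itv_ge ?measure0// bnd_simp -leNgt ltW.
Qed.

Let hE A : measurable A -> lebesgue_stieltjes_measure (h : cumulative R R) A =
  (lebesgue_stieltjes_measure (F : cumulative R R) A + lebesgue_stieltjes_measure (H : cumulative R R) A)%E.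
Proof.
move=> mA; rewrite -(measure_addE (lebesgue_stieltjes_measure (F : cumulative R R)) (lebesgue_stieltjes_measure (H : cumulative R R))).
apply: (@unique2 h) => // x y xy.
transitivity (lebesgue_stieltjes_measure (F : cumulative R R) `]x, y] + lebesgue_stieltjes_measure (H : cumulative R R) `]x, y])%E.
  exact: measure_addE.
rewrite !lebesgue_stieltjes_itv// -EFinD; congr EFin.
change (F y - F x + (B / m * y - F y - (B / m * x - F x)) = B / m * y - B / m * x).
by move: (F y) (F x) => p q; ring.
Qed.

Let Bm0 : 0 <= B / m. Proof. by rewrite divr_ge0// ltW. Qed.

Let hmu A : measurable A -> lebesgue_stieltjes_measure (h : cumulative R R) A = ((B / m)%:E * mu A)%E.
Proof.
move=> mA; rewrite (_ : (_ * _)%E = mscale (NngNum Bm0) mu A)//.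
apply: (@unique2 h) => // x y xy.
transitivity ((B / m)%:E * lebesgue_stieltjes_measure idfun `]x, y])%E => //.
by rewrite lebesgue_stieltjes_itv// -EFinM mulrBr.
Qed.

Let nu_mu : nu `<< mu.
Proof.
apply/null_content_dominatesP => A mA A0.
apply/eqP; rewrite eq_le measure_ge0 andbT.
have := hE mA; rewrite hmu// A0 mule0 => /esym/eqP.
by rewrite padde_eq0 ?measure_ge0// => /andP[/eqP h' _]; suff -> : nu A = 0%E by []; exact: h'.
Qed.

Let nuE x y : x <= y -> nu (`]x, y]%classic : set R) = (F y - F x)%:E := @lebesgue_stieltjes_itv F x y.

Let nu_ray r : nu (`]r, +oo[%classic : set R) = (1 - F r)%:E.
Proof.
have mr : measurable (`]-oo, r]%classic : set R) by exact: measurable_itv.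
pose b := Num.max a r; pose c := Num.min 0 r.
have h1 : ((1 - F r)%:E <= nu (`]r, +oo[%classic : set R))%E.
  have -> : (1 - F r)%:E = nu (`]r, b]%classic : set R).
    by rewrite nuE ?le_max ?lexx ?orbT// (F_far (x := b))// le_max lexx.
  apply: le_measure; rewrite ?inE//= => x /=.
  by rewrite !in_itv/= andbT => /andP[].
have h2 : ((F r)%:E <= nu (`]-oo, r]%classic : set R))%E.
  have -> : (F r)%:E = nu (`]c, r]%classic : set R).
    by rewrite nuE ?ge_min ?lexx ?orbT// (F_neg (x := c)) ?subr0// ge_min lexx.
  apply: le_measure; rewrite ?inE//= => x /=.
  by rewrite !in_itv/= => /andP[].
apply/eqP; rewrite eq_le h1 andbT.
have -> : `]r, +oo[%classic = ~` (`]-oo, r]%classic : set R).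
  by apply/seteqP; split => x /=; rewrite !in_itv/= andbT => /= h'; [apply/negP; rewrite -ltNge|move/negP: h'; rewrite -ltNge].
rewrite probability_setC// EFinB; exact: leeB.
Qed.

Lemma density_of_tails : exists g : R -> R, [/\ forall x, 0 <= g x,
  mu.-integrable setT (EFin \o g) &
  forall r, (\int[mu]_(x in `[r, +oo[) (g x)%:E = (G r)%:E)%E].
Proof.
have [f [f0 ffin fint fE]] := @radon_nikodym_sigma_finite _ _ _ mu nu nu_mu.
have ff x : ((fine (f x))%:E = f x)%E by rewrite fineK.
have i1 : mu.-integrable setT (EFin \o (fine \o f)).
  by rewrite (_ : EFin \o _ = f)//; apply/funext => x /=.
exists (fun x => m * fine (f x)); split.
- by move=> x; rewrite mulr_ge0 ?(ltW m0)// fine_ge0.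
- have -> : EFin \o (fun x => m * fine (f x)) = (fun x => m%:E * (EFin \o (fine \o f)) x)%E.
    by apply/funext => x /=.
  exact: integrableZl.
- move=> r; under eq_integral do rewrite EFinM ff.
  have mr : measurable (`[r, +oo[%classic : set R) by exact: measurable_itv.
  have ir : mu.-integrable `[r, +oo[ f by exact: integrableS fint.
  rewrite integralZl//.
  rewrite -integral_itv_obnd_cbnd; last by apply: measurable_funTS; exact: measurable_int fint.
  rewrite -fE; last exact: measurable_itv.
  transitivity (m%:E * (1 - F r)%:E)%E; first by congr (_ * _)%E; exact: nu_ray.
  rewrite -EFinM; congr EFin; rewrite /F; field; by rewrite gt_eqF.
Qed.

End StieltjesDensity.

(** * Weak convergence from convergence of tails *)

Section WeakConvergence.
Context {R : realType}.
Notation mu := (@lebesgue_measure R).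
Implicit Types (r s t x y z e c a b M : R) (v f g phi : R -> R).

(** No upper bound as in [okd]: a Radon-Nikodym density need not satisfy one at every point. *)
Record tailed v : Prop := Tailed {
  ta_meas : measurable_fun (`[0, +oo[%classic : set R) v ;
  ta_ge0 : forall x, 0 <= x -> 0 <= v x ;
  ta_int : mu.-integrable `[0, +oo[ (EFin \o v) }.

Lemma okd_tailed v B : okd v B -> tailed v.
Proof.
by move=> ok; split; [exact: ok_meas ok|move=> x x0; have /andP[] := ok_bd ok x0|exact: ok_int ok].
Qed.

Section Piece.
Variables (v phi : R -> R) (M : R).
Hypothesis tv : tailed v.
Hypothesis mphi : measurable_fun (`[0, +oo[%classic : set R) phi.
Hypothesis phiM : forall x, 0 <= x -> `|phi x| <= M.

Let sub (i : interval R) : (forall x, x \in i -> 0 <= x) -> [set` i] `<=` (`[0, +oo[%classic : set R).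
Proof. by move=> hi x /hi; rewrite /= in_itv/= andbT. Qed.

Lemma tailed_intS (i : interval R) : (forall x, x \in i -> 0 <= x) -> mu.-integrable [set` i] (EFin \o v).
Proof. by move=> /sub hi; apply: integrableS (ta_int tv) => //. Qed.

Lemma tailed_mul : mu.-integrable `[0, +oo[ (EFin \o (fun x => phi x * v x)).
Proof.
apply: (@le_integrable _ _ _ mu _ _ _ (fun x => M%:E * (EFin \o v) x)%E) => //.
- by apply/measurable_EFinP; apply: measurable_funM => //; exact: (ta_meas tv).
- move=> x /=; rewrite in_itv/= andbT => x0; rewrite lee_fin.
  have v0 := ta_ge0 tv x0; have p := phiM x0; have M0 : 0 <= M by exact: le_trans p.
  by rewrite !normrM (ger0_norm v0) (ger0_norm M0) ler_wpM2r.
- by apply: integrableZl => //; exact: (ta_int tv).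
Qed.

Lemma tailed_mulS (i : interval R) : (forall x, x \in i -> 0 <= x) ->
  mu.-integrable [set` i] (EFin \o (fun x => phi x * v x)).
Proof. by move=> /sub hi; apply: integrableS tailed_mul => //. Qed.

Lemma Rintegral_halfline_split (w : R -> R) x y : 0 <= x -> x <= y ->
  mu.-integrable `[0, +oo[ (EFin \o w) ->
  \int[mu]_(t in `[x, +oo[) w t = \int[mu]_(t in `[x, y[) w t + \int[mu]_(t in `[y, +oo[) w t.
Proof.
move=> x0 xy iw; rewrite -Rintegral_setU//=.
- by rewrite -itv_bndbnd_setU// bnd_simp.
- rewrite -itv_bndbnd_setU// ?bnd_simp//; apply: integrableS iw => //.
  by apply: sub => z; rewrite in_itv/= andbT; exact: le_trans.
- rewrite disj_set2E; apply/eqP/seteqP; split => // t /= []; rewrite !in_itv/= andbT => /andP[_ h1] h2.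
  by rewrite ltNge h2 in h1.
Qed.

Lemma tailed_tl x : 0 <= x -> tl v x = \int[mu]_(t in `[x, +oo[) v t.
Proof. by move=> x0; rewrite /tl posp_id. Qed.

Lemma tailed_split x y : 0 <= x -> x <= y -> \int[mu]_(t in `[x, y[) v t = tl v x - tl v y.
Proof.
move=> x0 xy; have y0 := le_trans x0 xy.
rewrite !tailed_tl// (Rintegral_halfline_split x0 xy (ta_int tv)); lra.
Qed.

Lemma tailed_tail_bound x : 0 <= x -> `|\int[mu]_(t in `[x, +oo[) (phi t * v t)| <= M * tl v x.
Proof.
move=> x0; have hx z : z \in `[x, +oo[ -> 0 <= z by rewrite in_itv/= andbT; exact: le_trans.
apply: (le_trans (le_normr_Rintegral _ _)) => //; first exact: tailed_mulS.
rewrite tailed_tl// -RintegralZl//; last exact: tailed_intS.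
apply: le_Rintegral => //.
- exact: (integrable_norm (tailed_mulS hx)).
- by apply: (@integrableZl _ _ _ mu _ _ M (EFin \o v)) => //; exact: tailed_intS.
- move=> z /= zx; have z0 : 0 <= z := hx z zx.
  by rewrite normrM (ger0_norm (ta_ge0 tv z0)) ler_wpM2r ?phiM// (ta_ge0 tv).
Qed.

Lemma tailed_piece x y e : 0 <= x -> x <= y ->
  (forall z, x <= z -> z < y -> `|phi z - phi x| <= e) ->
  `|\int[mu]_(t in `[x, y[) (phi t * v t) - phi x * (tl v x - tl v y)| <= e * (tl v x - tl v y).
Proof.
move=> x0 xy he; have hx z : z \in `[x, y[ -> 0 <= z by rewrite in_itv/= => /andP[+ _]; exact: le_trans.
have iv := tailed_intS hx; have ip := tailed_mulS hx.
have ic c : mu.-integrable `[x, y[ (EFin \o (fun t => c * v t)).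
  by apply: (@integrableZl _ _ _ mu _ _ c (EFin \o v)) => //.
rewrite -tailed_split// -!RintegralZl// -RintegralB//.
have id : mu.-integrable `[x, y[ (EFin \o (fun t => phi t * v t - phi x * v t)).
  by apply: (@integrableB _ _ _ mu _ _ (EFin \o _) (EFin \o _)).
apply: (le_trans (le_normr_Rintegral _ _)) => //.
apply: le_Rintegral => //; first exact: (integrable_norm id).
move=> z /= zx; have z0 : 0 <= z := hx z zx; have v0 := ta_ge0 tv z0.
move: zx; rewrite in_itv/= => /andP[z1 z2].
by rewrite -mulrBl normrM (ger0_norm v0) ler_wpM2r// he.
Qed.

End Piece.

(** Extended evenly and cut off to compact support, phi falls under [csupp_ucont]. *)
Lemma within_halfline_uniform phi a : {within halfline R, continuous phi} -> 0 <= a ->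
  forall e, 0 < e -> exists2 d, 0 < d & forall x y, 0 <= x -> x <= a -> 0 <= y -> y <= a ->
    `|x - y| <= d -> `|phi x - phi y| <= e.
Proof.
move=> cphi a0 e e0.
pose f x := phi `|x| * posp (1 - posp (`|x| - a)).
have ca : continuous (fun x : R => `|x|) by exact: norm_continuous.
have cf : continuous f.
  move=> x; apply: cvgM.
    have hx : halfline R `|x| by rewrite /halfline/= in_itv/= andbT.
    have := (subspace_continuousP _ _).1 cphi _ hx.
    apply: cvg_comp => P hP.
    have hP' : \forall y \near x, halfline R `|y| -> P `|y| := ca x _ hP.
    suff : \forall y \near x, P `|y| by []; apply: filterS hP' => y; apply.
    by rewrite /halfline/= in_itv/= andbT.
  apply: (@continuous_comp _ _ _ (fun x => 1 - posp (`|x| - a)) posp); last exact: posp_continuous.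
  apply: cvgB; first exact: cvg_cst.
  apply: (@continuous_comp _ _ _ (fun x => `|x| - a) posp); last exact: posp_continuous.
  by apply: cvgB; [exact: ca|exact: cvg_cst].
have fZ x : a + 1 <= `|x| -> f x = 0.
  move=> hx; rewrite /f (posp_0 (x := 1 - _)) ?mulr0// subr_le0.
  by rewrite posp_id; lra.
have fE x : 0 <= x -> x <= a -> f x = phi x.
  by move=> x0 xa; rewrite /f ger0_norm// (posp_0 (x := x - a)) ?subr_le0// subr0 posp_id// mulr1.
have [K K0 hK] := csupp_ucont cf fZ (divr_gt0 e0 (ltr0Sn _ 1)).
have K1 : 0 < K + 1 by lra.
exists (Num.min 1 (e / (2 * (K + 1)))); first by rewrite lt_min ltr01 divr_gt0// mulr_gt0.
move=> x y x0 xa y0 ya; rewrite le_min => /andP[d1 d2].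
rewrite -!fE//; apply: (le_trans (hK x y)).
have h1 : (x - y) ^+ 2 <= `|x - y|.
  by rewrite -real_normK ?num_real// expr2 ler_piMl.
move: d2; rewrite ler_pdivlMr ?mulr_gt0// => d2.
have h2 : K * (x - y) ^+ 2 <= K * `|x - y| by rewrite ler_wpM2l.
have h3 : 0 <= `|x - y| by [].
move: d2 h2 h3; move: (K * (x - y) ^+ 2) `|x - y| => q p d2 h2 h3; lra.
Qed.

(** On a mesh of [0, a] where phi oscillates by at most e, each integral is a Stieltjes sum of tail
    values up to e times the mass. Convergence of the tails at the finitely many nodes suffices, and
    the limit has no mass beyond a. *)
Lemma weak_of_tails (f : nat -> R -> R) g a : 0 <= a -> (forall n, tailed (f n)) -> tailed g ->
  (forall r, 0 <= r -> tl (f n) r @[n --> \oo] --> tl g r) -> tl g a = 0 ->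
  weak_cvg f g.
Proof.
move=> a0 tf tg tt ga phi cphi [M0 hM0].
pose M := `|M0| + 1; have M_gt0 : 0 < M by rewrite /M; have := normr_ge0 M0; lra.
have hM x : 0 <= x -> `|phi x| <= M.
  by move=> x0; apply: (le_trans (hM0 x x0)); rewrite /M; have := ler_norm M0; lra.
have mphi : measurable_fun (`[0, +oo[%classic : set R) phi.
  by apply: subspace_continuous_measurable_fun.
have tail0 e : 0 < e -> forall r, 0 <= r -> \forall n \near \oo, `|tl (f n) r - tl g r| < e.
  move=> e0 r r0; have /cvgrPdist_lt /(_ _ e0) := tt r r0.
  by apply: filterS => n; rewrite distrC.
have tl0 v x : tailed v -> 0 <= x -> 0 <= tl v x.
  move=> tv x0; rewrite tailed_tl//; apply: Rintegral_ge0 => z /=; rewrite in_itv/= andbT => xz.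
  by apply: (ta_ge0 tv); exact: le_trans xz.
apply/cvgrPdist_le => eta eta0.
pose C := 2 * tl g 0 + 1; have C0 : 0 < C by rewrite /C; have := tl0 g 0 tg (lexx 0); lra.
pose e := eta / (4 * C); have e0 : 0 < e by rewrite divr_gt0// mulr_gt0.
have eC : e * C = eta / 4 by rewrite /e; field; rewrite gt_eqF.
have [d d0 hd] := within_halfline_uniform cphi a0 e0.
have [N hN] : exists N, a / N.+1%:R <= d.
  exists (Num.truncn (a / d)); rewrite ler_pdivrMr// mulrC -ler_pdivrMr//.
  by apply: ltW; exact: truncnS_gt.
pose q := a / N.+1%:R; have q0 : 0 <= q by rewrite divr_ge0.
pose X i : R := i%:R * q.
have X0 i : 0 <= X i by rewrite mulr_ge0.
have XS i : X i.+1 = X i + q by rewrite /X -natr1; ring.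
have XN : X N.+1 = a by rewrite /X /q mulrC divfK.
have Xa i : (i <= N.+1)%N -> X i <= a by move=> iN; rewrite -XN ler_wpM2r// ler_nat.
have step i : (i <= N.+1)%N -> forall h, 0 < h -> \forall n \near \oo,
    `|\int[mu]_(t in `[0, X i[) (phi t * f n t) - \int[mu]_(t in `[0, X i[) (phi t * g t)|
    <= e * (tl (f n) 0 - tl (f n) (X i) + (tl g 0 - tl g (X i))) + h.
  elim: i => [|i IH] iN h h0.
    near=> n; rewrite /X mul0r set_itvco0 !Rintegral_set0 subrr normr0 !subrr addr0 mulr0 add0r.
    exact: ltW.
  have iN' := ltnW iN; have h2 : 0 < h / 2 by lra.
  have h4 : 0 < h / (4 * M) by rewrite divr_gt0// mulr_gt0.
  have xx : X i <= X i.+1 by rewrite XS lerDl.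
  have split_ v : tailed v -> \int[mu]_(t in `[0, X i.+1[) (phi t * v t) =
      \int[mu]_(t in `[0, X i[) (phi t * v t) + \int[mu]_(t in `[X i, X i.+1[) (phi t * v t).
    move=> tv; have im := tailed_mul tv mphi hM.
    have e1 := Rintegral_halfline_split (lexx 0) (X0 i) im.
    have e2 := Rintegral_halfline_split (lexx 0) (X0 i.+1) im.
    have e3 := Rintegral_halfline_split (X0 i) xx im.
    by apply: (@addIr _ (\int[mu]_(t in `[X i.+1, +oo[) (phi t * v t))); rewrite -addrA -e3 -e1 e2.
  have near_phi z : X i <= z -> z < X i.+1 -> `|phi z - phi (X i)| <= e.
    move=> z1 z2; apply: hd => //; first exact: le_trans z1.
    - by apply: (le_trans (ltW z2)); exact: Xa.
    - exact: Xa.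
    - rewrite ger0_norm ?subr_ge0//; apply: le_trans hN; rewrite lerBlDl -XS; exact: ltW.
  near=> n.
  have t1 : `|tl (f n) (X i) - tl g (X i)| < h / (4 * M) by near: n; exact: tail0.
  have t2 : `|tl (f n) (X i.+1) - tl g (X i.+1)| < h / (4 * M) by near: n; exact: tail0.
  have t3 : `|\int[mu]_(t in `[0, X i[) (phi t * f n t) - \int[mu]_(t in `[0, X i[) (phi t * g t)|
    <= e * (tl (f n) 0 - tl (f n) (X i) + (tl g 0 - tl g (X i))) + h / 2 by near: n; exact: IH.
  have p1 := tailed_piece (tf n) mphi hM (X0 i) xx near_phi.
  have p2 := tailed_piece tg mphi hM (X0 i) xx near_phi.
  rewrite !split_//.
  have pM := hM _ (X0 i).
  have t12 : `|phi (X i) * ((tl (f n) (X i) - tl (f n) (X i.+1)) - (tl g (X i) - tl g (X i.+1)))| <= h / 2.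
    rewrite normrM; apply: (@le_trans _ _ (M * (h / (4 * M) + h / (4 * M)))).
      apply: ler_pM => //; move: t1 t2; rewrite !ltr_norml !ler_norml => /andP[a1 a2] /andP[a3 a4].
      by clear -a1 a2 a3 a4; apply/andP; split; lra.
    by rewrite le_eqVlt; apply/orP; left; apply/eqP; field; rewrite gt_eqF.
  move: t3 p1 p2 t12; rewrite [phi (X i) * (_ - (_ - _))]mulrBr.
  move: (\int[mu]_(t in `[0, X i[) (phi t * f n t)) (\int[mu]_(t in `[0, X i[) (phi t * g t)) => I1 I2.
  move: (\int[mu]_(t in `[X i, X i.+1[) (phi t * f n t)) (\int[mu]_(t in `[X i, X i.+1[) (phi t * g t)) => I3 I4.
  move: (phi (X i) * _) (phi (X i) * _) => I5 I6.
  move: (tl (f n) 0) (tl (f n) (X i)) (tl (f n) (X i.+1)) (tl g 0) (tl g (X i)) (tl g (X i.+1)) => b1 b2 b3 b4 b5 b6.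
  rewrite !ler_norml => /andP[c1 c2] /andP[c3 c4] /andP[c5 c6] /andP[c7 c8].
  move: c1 c2 c3 c4 c5 c6; rewrite !mulrDr !mulrN => c1 c2 c3 c4 c5 c6.
  by clear -c1 c2 c3 c4 c5 c6 c7 c8; apply/andP; split; lra.
have Ma : 0 < eta / (4 * M) by rewrite divr_gt0// mulr_gt0.
have eta4 : 0 < eta / 4 by lra.
near=> n.
have s1 : `|\int[mu]_(t in `[0, X N.+1[) (phi t * f n t) - \int[mu]_(t in `[0, X N.+1[) (phi t * g t)|
    <= e * (tl (f n) 0 - tl (f n) (X N.+1) + (tl g 0 - tl g (X N.+1))) + eta / 4.
  by near: n; exact: step.
have s2 : `|tl (f n) a - tl g a| < eta / (4 * M) by near: n; exact: tail0.
have s3 : `|tl (f n) 0 - tl g 0| < 1 by near: n; apply: tail0.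
rewrite XN in s1.
have e1 := Rintegral_halfline_split (lexx 0) a0 (tailed_mul (tf n) mphi hM).
have e2 := Rintegral_halfline_split (lexx 0) a0 (tailed_mul tg mphi hM).
have b1 := tailed_tail_bound (tf n) mphi hM a0.
have b2 := tailed_tail_bound tg mphi hM a0.
rewrite /halfline e1 e2; move: b2; rewrite ga mulr0 normr_le0 => /eqP ->; rewrite addr0.
have b3 : M * tl (f n) a <= eta / 4.
  move: s2; rewrite ga subr0 ger0_norm ?tl0// => s2.
  apply: (@le_trans _ _ (M * (eta / (4 * M)))); first by rewrite ler_wpM2l// ltW.
  by rewrite le_eqVlt; apply/orP; left; apply/eqP; field; rewrite gt_eqF.
have b4 : e * (tl (f n) 0 - tl (f n) a + (tl g 0 - tl g a)) <= eta / 4.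
  rewrite -eC ler_pM2l// /C; move: s3; rewrite ltr_norml => /andP[c1 c2].
  by have h := tl0 _ _ (tf n) a0; rewrite ga; clear -c2 h; lra.
move: s1 b1 b3 b4; clear e1 e2.
move: (\int[mu]_(t in `[0, a[) (phi t * f n t)) (\int[mu]_(t in `[0, a[) (phi t * g t)) => I1 I2.
move: (\int[mu]_(t in `[a, +oo[) (phi t * f n t)) => I3.
rewrite !ler_norml => /andP[c1 c2] /andP[c3 c4] c5 c6.
by clear -c1 c2 c3 c4 c5 c6; apply/andP; split; lra.
Unshelve. all: by end_near. Qed.

End WeakConvergence.

(** * From evolutions to quasi-solutions *)

Section QuasiSolutions.
Context {R : realType}.
Notation mu := (@lebesgue_measure R).
Implicit Types (r s t x y z e c a b : R).

Lemma derive1_is (f f1 : R -> R) : (forall x, is_derive x 1 f (f1 x)) -> (f^`())%classic = f1.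
Proof. by move=> df; apply/funext => x; rewrite derive1E; have d := df x; rewrite derive_val. Qed.

Lemma integral_of_derive (F f : R -> R) a b : a <= b -> (forall x, is_derive x 1 F (f x)) -> continuous f ->
  (\int[mu]_(x in `[a, b]) (f x)%:E = (F b - F a)%:E)%E.
Proof.
move=> + dF cf; rewrite le_eqVlt => /predU1P[<-|ab].
  by rewrite subrr set_itv1 integral_set1.
have cF := derive_continuous dF.
rewrite (@continuous_FTC2 R f F a b ab) ?EFinB//.
- exact: continuous_subspaceT.
- split; [|apply: cvg_at_right_filter; exact: cF|apply: cvg_at_left_filter; exact: cF].
  by move=> x _; have [] := dF x.
- by move=> x _; rewrite (derive1_is dF).
Qed.

Lemma tl_close (f v : R -> R) (B B' e : R) : okd f B -> okd v B' ->
  (\int[mu]_(x in `[0%R, +oo[) `|f x - v x|%:E <= e%:E)%E ->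
  forall r, 0 <= r -> `|tl f r - tl v r| <= e.
Proof.
move=> okf okv he r r0.
have sr : `[r, +oo[%classic `<=` (`[0, +oo[%classic : set R).
  by move=> x /=; rewrite !in_itv/= !andbT; exact: le_trans.
have i2 : mu.-integrable `[0, +oo[ (EFin \o (fun x => f x - v x)).
  by apply: (@integrableB _ _ _ mu _ _ (EFin \o f) (EFin \o v)) => //; [exact: (ok_int okf)|exact: (ok_int okv)].
have i3 : mu.-integrable `[r, +oo[ (EFin \o (fun x => f x - v x)) by apply: integrableS i2.
rewrite /tl posp_id// -RintegralB//.
- apply: (le_trans (le_normr_Rintegral _ i3)) => //.
  rewrite -lee_fin /Rintegral fineK; last first.
    by apply: integrable_fin_num => //; exact: (integrable_norm i3).
  apply: le_trans he; apply: ge0_subset_integral => //.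
  by apply: (measurable_int _ (integrable_norm i2)).
- exact: (ok_int_from okf).
- exact: (ok_int_from okv).
Qed.

Lemma int_trunc (F g : R -> R) X r : (forall x, is_derive x 1 F (g x)) -> continuous g -> r <= X ->
  (\int[mu]_(x in `[r, +oo[) (if x <= X then g x else 0)%:E = (F X - F r)%:E)%E.
Proof.
move=> dF cg rX; rewrite -(integral_of_derive rX dF cg).
rewrite -(@integral_if_itv _ `[r, +oo[ `[r, X] (fun x => x <= X)).
  by apply: eq_integral => x _; case: ifP.
by move=> x; rewrite !in_itv/= andbT.
Qed.

Lemma okd_trunc (g : R -> R) X B : continuous g -> 0 <= X -> 0 <= B ->
  (forall x, 0 <= x -> x <= X -> 0 <= g x <= B) -> okd (fun x => if x <= X then g x else 0) B.
Proof.
move=> cg X0 B0 hB; have [F dF] := primitive cg.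
have m : measurable_fun setT (fun x => if x <= X then g x else 0).
  apply: measurable_fun_ifT => //; last exact: continuous_measurable_fun.
  by apply: measurable_fun_ler => //; exact: measurable_cst.
have bd x : 0 <= x -> 0 <= (if x <= X then g x else 0) <= B.
  by move=> x0; case: ifP => xX; [exact: hB|rewrite lexx].
split => //; first exact: measurable_funTS.
apply/integrableP; split; first by apply/measurable_EFinP; exact: measurable_funTS.
suff -> : (\int[mu]_(x in `[0%R, +oo[) `|(EFin \o (fun x => if x <= X then g x else 0)%R) x| =
    \int[mu]_(x in `[0%R, +oo[) (if x <= X then g x else 0)%:E)%E.
  by rewrite (int_trunc dF)// ltry.
apply: eq_integral => x; rewrite inE/= in_itv/= andbT => x0; rewrite ger0_norm//.
by have /andP[] := bd x x0.
Qed.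

Section Convert.
Variables (j eps T : R) (X : R -> R) (u u1 u2 L : R -> R -> R).
Hypothesis j0 : 0 < j.
Hypothesis ev : evol j eps T X u u1 u2 L.

Section AtTime.
Variable s : R.
Hypothesis s0 : 0 <= s.
Hypothesis sT : s <= T.

Let cu : continuous (u s).
Proof. by apply: derive_continuous => r; exact: (ev_du ev r s0 sT). Qed.

Lemma int_ext0 r : 0 <= r -> (\int[mu]_(x in `[r, +oo[) (ext0 X u s x)%:E = (Phi X L s r)%:E)%E.
Proof.
move=> r0; have [rX|Xr] := leP r (X s).
  by rewrite (int_trunc (fun x => ev_dL ev x s0 sT) cu rX) (Phi_in _ r0 rX).
rewrite (Phi_out ev s0 sT (ltW Xr)) (eq_integral (cst 0%E)) ?integral0// => x.
rewrite inE/= in_itv/= andbT => rx; rewrite /ext0 ifF//.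
by apply/negbTE; rewrite -ltNge; exact: lt_le_trans rx.
Qed.

Lemma okd_ext0 (B : R) : 0 <= B -> (forall r, 0 <= r -> r <= X s -> u s r <= B) -> okd (ext0 X u s) B.
Proof.
move=> B0 hB; apply: okd_trunc => //; first exact: ltW (ev_pos ev s0 sT).
by move=> x x0 xX; rewrite (ev_ge0 ev)//= hB.
Qed.

Lemma tl_ext0 (B r : R) : okd (ext0 X u s) B -> 0 <= r -> tl (ext0 X u s) r = Phi X L s r.
Proof. by move=> ok r0; apply: EFin_inj; rewrite (tlE ok)// int_ext0. Qed.

End AtTime.

(** [ev_time] only concerns times s with r <= X s; for r strictly inside, the Lipschitz bound on X
    makes this true for all nearby times. *)
Lemma evol_time_derive t r : 0 < t -> t < T -> 0 < r -> r < X t ->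
  is_derive t 1 (fun s => u s r) (2^-1 * u2 t r).
Proof.
move=> t0 tT r0 rX.
suff c : h^-1 *: (u (h%:A + t) r - u t r) @[h --> 0^'] --> 2^-1 * u2 t r.
  by split; [apply: cvgP c|rewrite /derive; apply: cvg_lim => //].
apply/cvgrPdist_le => e e0.
have [d d0 hd] := ev_time ev (ltW t0) (ltW tT) (ltW r0) (ltW rX) e0.
have [k k0 lip] := ev_lip ev.
have gap : 0 < (X t - r) / (k + 1) by rewrite divr_gt0 ?subr_gt0//; lra.
exists (Num.min (Num.min d t) (Num.min (T - t) ((X t - r) / (k + 1)))) => /=.
  by rewrite !lt_min d0 t0 subr_gt0 tT gap.
move=> h; rewrite /= sub0r normrN !lt_min => /andP[/andP[hd' ht] /andP[hT hX]] hn0.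
rewrite /GRing.scale/= mulr1.
move: ht hT; rewrite !ltr_norml => /andP[h1 _] /andP[_ h2].
have s0 : 0 <= h + t by lra.
have sT : h + t <= T by lra.
have rXs : r <= X (h + t).
  have := lip (h + t) t s0 sT (ltW t0) (ltW tT); rewrite addrK.
  have : k * `|h| <= (k + 1) * ((X t - r) / (k + 1)).
    by apply: ler_pM => //; [lra|exact: ltW].
  rewrite [X in _ <= X -> _]mulrC divfK; last by rewrite gt_eqF//; lra.
  by rewrite ler_norml => h3 h4; move: h4 => /andP[h4 _]; lra.
have := hd _ s0 sT rXs; rewrite addrK => /(_ hd').
set q := _ - _ - _ => hq.
rewrite (_ : 2^-1 * u2 t r - h^-1 * (u (h + t) r - u t r) = - (h^-1 * q)); last by rewrite /q; field.
by rewrite normrN normrM normfV ler_pdivrMl ?normr_gt0// mulrC.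
Qed.

Lemma evol_quasi_solution (rho0 : R -> R) (e : R) : 0 < e -> eps <= e ->
  (\int[mu]_(r in halfline R) `|ext0 X u 0 r - rho0 r|%:E <= e%:E)%E ->
  quasi_solution j T rho0 X u e.
Proof.
move=> e0 epse init.
have D1 t : 0 <= t -> t <= T -> ((u t)^`())%classic = u1 t.
  by move=> t0 tT; apply: derive1_is => x; exact: (ev_du ev x t0 tT).
have D2 t : 0 <= t -> t <= T -> ((u t)^`(2))%classic = u2 t.
  move=> t0 tT; rewrite derive1nS derive1n1 D1//; apply: derive1_is => x; exact: (ev_du1 ev x t0 tT).
have c0 t : 0 <= t -> t <= T -> continuous (u t).
  by move=> t0 tT; apply: derive_continuous => x; exact: (ev_du ev x t0 tT).
have c1 t : 0 <= t -> t <= T -> continuous (u1 t).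
  by move=> t0 tT; apply: derive_continuous => x; exact: (ev_du1 ev x t0 tT).
split => //.
- by move=> t /andP[t0 /ltW tT]; exact: (ev_pos ev).
- have [k k0 lip] := ev_lip ev; exists k => -[s t] [] /=; rewrite !in_itv/=.
  by move=> /andP[s0 /ltW sT] /andP[t0 /ltW tT]; exact: lip.
- have [[D fD hD] [h1 h2]] := ev_C1 ev; split; [|split].
  + by exists D => // t /andP[t0 tT]; exact: hD.
  + by move=> t /andP[t0 tT]; exact: h1.
  + by move=> t /andP[t0 tT]; apply: h2 => //; exact: ltW.
- by move=> t r /andP[t0 /ltW tT] /andP[r0 rX]; exact: (ev_ge0 ev).
- move=> t /andP[t0 /ltW tT]; split.
  + move=> r _; rewrite D2//; split.
    * by have [] := ev_du ev r t0 tT.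
    * by rewrite D1//; have [] := ev_du1 ev r t0 tT.
    * exact: (ev_cu2 ev).
  + by apply: cvg_at_right_filter; exact: c0.
  + by apply: cvg_at_left_filter; exact: c0.
  + move=> k [->|->]; [rewrite derive1n1 D1//; exists (u1 t 0)|rewrite D2//; exists (u2 t 0)].
      by apply: cvg_at_right_filter; exact: c1.
    by apply: cvg_at_right_filter; exact: (ev_cu2 ev).
  + move=> k [->|->]; [rewrite derive1n1 D1//; exists (u1 t (X t))|rewrite D2//; exists (u2 t (X t))].
      by apply: cvg_at_left_filter; exact: c1.
    by apply: cvg_at_left_filter; exact: (ev_cu2 ev).
- move=> t r /andP[t0 /ltW tT] /andP[r0 rX]; exists (2^-1 * u2 t r).
  apply/cvgrPdist_le => e' e'0.
  have [d d0 hd] := ev_time ev t0 tT r0 rX e'0.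
  have nb : \forall s \near t, s != t -> (0 <= s < T /\ r <= X s) ->
      `|2^-1 * u2 t r - (u s r - u t r) / (s - t)| <= e'.
    exists d => // s /=; rewrite distrC => st sn [/andP[s0 /ltW sT] rXs].
    have := hd s s0 sT rXs st; set q := _ - _ - _ => hq.
    have sn' : s - t != 0 by rewrite subr_eq0.
    rewrite (_ : 2^-1 * u2 t r - (u s r - u t r) / (s - t) = - ((s - t)^-1 * q)); last by rewrite /q; field.
    by rewrite normrN normrM normfV ler_pdivrMl ?normr_gt0// mulrC.
  exact: nb.
- move=> t r /andP[t0 tT] /andP[r0 rX]; rewrite D2 ?ltW//; exact: evol_time_derive.
- move=> t /andP[/ltW t0 /ltW tT]; rewrite D1//.
  rewrite -(ev_neumann ev t0 tT); apply: cvg_at_right_filter; exact: c1.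
- by move=> t /andP[/ltW t0 /ltW tT]; exact: (ev_dir ev).
- move=> t /andP[t0 tT]; have T0 : 0 <= T by exact: le_trans (ltW tT).
  have E s : 0 <= s -> s <= T -> \int[mu]_(r in `[0, X s]) u s r = L s (X s).
    move=> s0 sT; rewrite /Rintegral (integral_of_derive (ltW (ev_pos ev s0 sT)) (fun x => ev_dL ev x s0 sT) (c0 _ s0 sT)).
    by rewrite (ev_L0 ev s0 sT) subr0.
  rewrite (E _ t0 (ltW tT)) (E _ (lexx 0) T0).
  apply: le_trans epse; apply: (ev_mass ev) => //; exact: ltW.
Qed.

End Convert.
End QuasiSolutions.

(** * Stationary profiles *)

Section Stationary.
Context {R : realType}.
Implicit Types (r s t x y z e c b d : R).
Variables (j a : R).
Hypothesis j0 : 0 < j.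
Hypothesis a0 : 0 < a.

Let Xs (t : R) : R := a.
Let us (t r : R) : R := 2 * j * a - 2 * j * r.
Let Ls (t r : R) : R := 2 * j * a * r - j * r ^+ 2.

Let s2 : smooth2 (fun x : R => 0 * x ^+ 2 + 2 * j * a * x + 0) (fun x => 0 * (2 * x) + 2 * j * a) (fun x => 0 * 2).
Proof.
apply: (@smooth2_affine R (fun x : R => x ^+ 2) (fun x => 2 * x) (fun _ => 2)); split.
- by move=> x; apply: is_derive_eq; rewrite /GRing.scale/=; ring.
- by move=> x; apply: is_derive_eq; rewrite /GRing.scale/=; ring.
- by exists 2 => // x; rewrite ger0_norm.
- by move=> e e0; exists 0 => // x y; rewrite subrr normr0 mul0r addr0 ltW.
Qed.

Let sF : smooth2 (fun x : R => 2 * j * a * x) (fun _ => 2 * j * a) (fun _ => 0).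
Proof.
have := s2; rewrite (_ : (fun x => _ + _ + _) = (fun x : R => 2 * j * a * x)); last by apply/funext => x; ring.
rewrite (_ : (fun x => _ + _) = (fun _ : R => 2 * j * a)); last by apply/funext => x; ring.
by rewrite (_ : (fun x : R => 0 * 2) = (fun _ : R => 0))//; apply/funext => x; ring.
Qed.

Let sf : smooth2 (fun _ : R => 2 * j * a) (fun _ => 0) (fun _ => 0).
Proof.
split.
- by move=> x; exact: is_derive_cst.
- by move=> x; exact: is_derive_cst.
- by exists 0 => // x; rewrite normr0.
- by move=> e e0; exists 0 => // x y; rewrite subrr normr0 mul0r addr0 ltW.
Qed.

Let uuE : uu j (fun _ => 2 * j * a) = us.
Proof. by apply/funext => s; apply/funext => r; rewrite /uu P_cst. Qed.

Let LamE : Lam j (fun x => 2 * j * a * x) = Ls.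
Proof.
apply/funext => s; apply/funext => r; rewrite /Lam /Ls.
have := P_affine s 0 (2 * j * a) 0 r (@tame_id R).
rewrite (_ : (fun x => _) = (fun x : R => 2 * j * a * x)); last by apply/funext => x /=; ring.
by move=> ->; ring.
Qed.

(** Seen as an evolution of accuracy 0, the profile 2 j (a - r) is subject to the one-step
    comparison, which makes its tail a subsolution of the barriers. *)
Lemma stationary_evol T : evol j 0 T Xs us (fun _ _ => - (2 * j)) (fun _ _ => 0) Ls.
Proof.
have cX : cont_on T Xs by move=> s s0 sT e e0; exists 1 => // s' _ _ _; rewrite subrr normr0 ltW.
have X0 s : 0 <= s -> s <= T -> 0 < Xs s by [].
have uX s : 0 <= s -> s <= T -> uu j (fun _ => 2 * j * a) s (Xs s) = 0.
  by rewrite uuE /us /Xs subrr.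
have D0 : (Xs^`())%classic = cst 0 by apply: derive1_is => x; exact: is_derive_cst.
split => //.
- by exists 0 => // s t *; rewrite subrr normr0 mul0r.
- split; [exists set0 => // t _ _ _|split => t _ _; exists 0].
  + by rewrite D0; split; [exact: derivable_cst|exact: cvg_cst].
  + by rewrite D0; exact: cvg_cst.
  + by rewrite D0; exact: cvg_cst.
- by move=> t r _ _; rewrite /us; apply: is_derive_eq; rewrite /GRing.scale/=; ring.
- by move=> t r _ _; exact: is_derive_cst.
- by move=> t _ _ x; exact: cvg_cst.
- by move=> t r _ _; rewrite /Ls; apply: is_derive_eq; rewrite /GRing.scale/= /us; ring.
- by move=> t _ _; rewrite /Ls; ring.
- by move=> t r _ _ r0 ra; rewrite /us -mulrBr mulr_ge0 ?subr_ge0// mulr_ge0// ltW.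
- by move=> t _ _; rewrite /us subrr.
- by move=> t r t0 tT r0 rX e e0; exists 1 => // s *; rewrite subrr mulr0 subrr normr0 mulr_ge0// ltW.
- by move=> t _ _; rewrite subrr normr0.
- move=> s t s0 st tT; rewrite -LamE; apply: (piece_up (ltW j0) sF _ cX X0 uX) => // x; ring.
- move=> s t s0 st tT; rewrite -LamE; apply: (piece_low sF _ cX X0) => // x; ring.
- by move=> s t s0 st tT; rewrite -uuE; apply: (piece_sup sf _ cX X0 uX).
Qed.

Definition parab : R -> R := Phi Xs Ls 0.

Lemma parab_in r : 0 <= r -> r <= a -> parab r = j * (a - r) ^+ 2.
Proof. by move=> r0 ra; rewrite /parab Phi_in// /Ls /Xs; ring. Qed.

Lemma parab_out r : a <= r -> parab r = 0.
Proof. by move=> ra; rewrite /parab (Phi_out (stationary_evol 0)). Qed.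

Lemma cb_parab : cb parab.
Proof. exact: (cb_Phi (stationary_evol 0)). Qed.

(** This is [step_up] for an evolution that does not move; d <= a^2 says that its mass j a^2 is at
    least j d. *)
Lemma parab_le_Tn d r : 0 < d -> d <= a ^+ 2 -> 0 <= r -> parab r <= Tn j d parab r.
Proof.
move=> d0 da r0; have := @step_up R j 0 d Xs us _ _ Ls j0 (lexx 0) (stationary_evol d) 0 d (lexx 0) d0 (lexx d) r.
rewrite subr0 mulr0 addr0; apply => //.
by rewrite -/parab parab_in ?(ltW a0)// subr0 ler_pM2l.
Qed.

Lemma parab_le_Hn d n r : 0 < d -> d <= a ^+ 2 -> 0 <= r -> parab r <= Hn j d parab n r.
Proof.
move=> d0 da; have cp := cb_parab.
have jd : j * d <= parab 0 by rewrite parab_in ?(ltW a0)// subr0 ler_pM2l.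
have p0 x : 0 <= x -> 0 <= parab x by move=> _; exact: (Phi_ge0 (stationary_evol 0)).
elim: n r => [|n IH] r r0.
  by apply: le_trans (parab_le_Tn d0 da r0) _; exact: Tn_le_Gn.
apply: le_trans (parab_le_Tn d0 da r0) _; apply: Tn_mono => //.
exact: cb_Hn.
Qed.

End Stationary.

(** * Approximate evolutions from the given datum *)

Section Approximation.
Context {R : realType}.
Notation mu := (@lebesgue_measure R).
Implicit Types (r s t x y z e c d : R).
Variables (j B Z0 : R) (v : R -> R).
Hypothesis j0 : 0 < j.
Hypothesis Z00 : 0 <= Z0.
Hypothesis ok : okd v B.
Hypothesis vZ : forall x, Z0 < x -> v x = 0.
Hypothesis mass : 0 < tl v 0.

Let B0 : 0 <= B. Proof. by have /andP[h1 h2] := ok_bd ok (lexx 0); exact: le_trans h2. Qed.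

Let K := B + 2 * j + (Z0 + 1) ^+ 2.
Let K0 : 0 <= K. Proof. by have b0 := B0; have jj := j0; have := sqr_ge0 (Z0 + 1); rewrite /K; lra. Qed.

(** The bound K on the initial profile does not depend on e, which makes the bound of [u_uniform]
    common to the whole sequence. *)
Definition approx T e (X : R -> R) (u L : R -> R -> R) : Prop := exists eps u1 u2,
  [/\ 0 <= eps, eps <= e, evol j eps T X u u1 u2 L,
      forall r, 0 <= r -> r <= X 0 -> u 0 r <= K &
      (\int[mu]_(r in `[0%R, +oo[) `|ext0 X u 0 r - v r|%:E <= e%:E)%E].

Lemma approx_exists T e : 0 < T -> 0 < e -> exists X u L, approx T e X u L.
Proof.
(* After an L^1 error of at most a third of the mass, two thirds are left, more than j tau <= e', as
   restarting requires. *)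
move=> T0 e0; pose e' := Num.min e (tl v 0 / 3).
have e'0 : 0 < e' by rewrite lt_min e0 divr_gt0.
have ee : e' <= e by rewrite ge_min lexx.
have em : e' <= tl v 0 / 3 by rewrite ge_min lexx orbT.
have [w [w1 [w2 [W [st bw iw]]]]] := initial_state j0 Z00 ok vZ e'0.
set X := Z0 + 1 in st bw iw; have X0 : 0 <= X by rewrite /X addr_ge0.
pose g r := w r - 2 * j * r; pose G r := W r - j * r ^+ 2.
have dg : forall r, is_derive r 1 g (w1 r - 2 * j).
  by move=> r; have d := st_d1 st r; rewrite /g; apply: is_derive_eq; rewrite /GRing.scale/=; ring.
have dG : forall r, is_derive r 1 G (g r).
  by move=> r; have d := st_dW st r; rewrite /G; apply: is_derive_eq; rewrite /GRing.scale/= /g; ring.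
have cg := derive_continuous dg.
have okg : okd (fun x => if x <= X then g x else 0) K by exact: okd_trunc.
have mG : tl (fun x => if x <= X then g x else 0) 0 = W X - j * X ^+ 2.
  apply: EFin_inj; rewrite (tlE okg)// (int_trunc dG cg X0) /G (odd_at0 (st_oW st)).
  by congr EFin; ring.
have := tl_close okg ok iw (lexx 0); rewrite mG => cl.
pose n := Num.truncn (j * T / e'); pose tau := T / n.+1%:R.
have tau0 : 0 < tau by rewrite divr_gt0.
have jtau : j * tau <= e'.
  rewrite /tau mulrA ler_pdivrMr// [leRHS]mulrC -ler_pdivrMr//; apply: ltW; exact: truncnS_gt.
have jm : j * tau < W X - j * X ^+ 2.
  have m := mass; move: cl; rewrite ler_norml => /andP[c1 c2].
  by move: m em jtau c1; move: (tl v 0) (j * tau) (W X - _) (e') => p q x y; lra.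
have [Y [u [u1 [u2 [L [ev en _]]]]]] := iterated_evol n j0 tau0 st jm.
have Tn : n.+1%:R * tau = T by rewrite /tau mulrC divfK.
rewrite Tn in ev; have YX := ea_X en; have uE := ea_u en.
exists Y, u, L, (j * tau), u1, u2; split => //.
- by rewrite mulr_ge0// ltW.
- exact: le_trans ee.
- by move=> r r0 rY; rewrite YX in rY; rewrite uE//; have /andP[] := bw r r0 rY.
- apply: (@le_trans _ _ e'%:E); last by rewrite lee_fin.
  apply: le_trans iw; rewrite le_eqVlt; apply/orP; left; apply/eqP; apply: eq_integral => r.
   rewrite inE/= in_itv/= andbT => r0; rewrite /ext0 YX; case: ifP => // rX.
  by rewrite uE.
Qed.

Definition height T := Num.max 0 (`|K| + 3 * j * (E1 * Num.sqrt T + 2) + 1).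

Lemma height_ge0 T : 0 <= height T. Proof. by rewrite le_max lexx. Qed.

Section One.
Variables (T e : R) (X : R -> R) (u L : R -> R -> R).
Hypothesis T0 : 0 <= T.
Hypothesis ap : approx T e X u L.

Lemma approx_e0 : 0 <= e.
Proof. by have [eps [_ [_ [h1 h2 _ _ _]]]] := ap; exact: le_trans h2. Qed.

Lemma approx_bound s r : 0 <= s -> s <= T -> 0 <= r -> r <= X s -> u s r <= height T.
Proof.
have [eps [u1 [u2 [h1 h2 ev hK _]]]] := ap.
by move=> s0 sT r0 rX; rewrite le_max (u_uniform j0 ev hK) ?orbT.
Qed.

Lemma approx_lip s x y : 0 <= s -> s <= T -> `|Phi X L s x - Phi X L s y| <= height T * `|x - y|.
Proof.
move=> s0 sT; have [eps [u1 [u2 [h1 h2 ev hK _]]]] := ap.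
by apply: (Phi_lip ev s0 sT) => r r0 rX; exact: approx_bound.
Qed.

Lemma approx_okd s : 0 <= s -> s <= T -> exists B', okd (ext0 X u s) B'.
Proof.
move=> s0 sT; have [eps [u1 [u2 [h1 h2 ev _ _]]]] := ap.
by exists (height T); apply: (okd_ext0 ev s0 sT (height_ge0 T)) => r r0 rX; exact: approx_bound.
Qed.

Lemma approx_tl s r : 0 <= s -> s <= T -> 0 <= r -> tl (ext0 X u s) r = Phi X L s r.
Proof.
move=> s0 sT r0; have [B' ok'] := approx_okd s0 sT; have [eps [u1 [u2 [h1 h2 ev _ _]]]] := ap.
exact: (tl_ext0 ev s0 sT ok').
Qed.

Lemma approx_close0 r : 0 <= r -> `|Phi X L 0 r - tl v r| <= e.
Proof.
move=> r0; have [B' ok'] := approx_okd (lexx 0) T0; rewrite -(approx_tl (lexx 0) T0 r0).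
by have [eps [u1 [u2 [h1 h2 ev _ i]]]] := ap; exact: (tl_close ok' ok).
Qed.

Lemma approx_mono s x y : 0 <= s -> s <= T -> x <= y -> Phi X L s y <= Phi X L s x.
Proof. by move=> s0 sT xy; have [eps [u1 [u2 [h1 h2 ev _ _]]]] := ap; exact: (Phi_mono ev). Qed.

Lemma approx_ge0 s r : 0 <= s -> s <= T -> 0 <= Phi X L s r.
Proof. by move=> s0 sT; have [eps [u1 [u2 [h1 h2 ev _ _]]]] := ap; exact: (Phi_ge0 ev). Qed.

Lemma approx_mass s : 0 <= s -> s <= T -> `|Phi X L s 0 - tl v 0| <= 2 * e.
Proof.
move=> s0 sT; have [eps [u1 [u2 [h1 h2 ev _ _]]]] := ap.
have := approx_close0 (lexx 0); have := ev_mass ev s0 sT.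
rewrite (Phi0 ev (lexx 0) T0) (Phi0 ev s0 sT) !ler_norml => /andP[a1 a2] /andP[a3 a4].
by apply/andP; split; lra.
Qed.

Lemma approx_sandwich d n r : 0 < d -> j * d + 2 * e <= tl v 0 -> n.+1%:R * d <= T -> 0 <= r ->
  cut j d (Hn j d (tl v) n) r - e * (1 + 4 * n.+1%:R) <= Phi X L (n.+1%:R * d) r /\
  Phi X L (n.+1%:R * d) r <= Hn j d (tl v) n r + e * (1 + 4 * n.+1%:R).
Proof.
move=> d0 jd nT r0; have [eps [u1 [u2 [h1 h2 ev _ _]]]] := ap.
have e0 := approx_e0.
have big : j * d + e + eps <= tl v 0 by lra.
have [k1 k2] := sandwich j0 h1 ev d0 e0 (cb_tl ok) approx_close0 big nT r0.
have h3 : 4 * eps * n.+1%:R <= 4 * e * n.+1%:R by rewrite ler_wpM2r// ler_wpM2l.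
have h4 : e * (1 + 4 * n.+1%:R) = e + 4 * e * n.+1%:R by ring.
by split; rewrite h4; lra.
Qed.

Lemma approx_upper a s : 0 <= a -> (forall r, 0 <= r -> tl v r <= j * (a - r) ^+ 2) -> 0 <= s -> s <= T ->
  Phi X L s a <= 3 * e.
Proof.
move=> a0 ha s0 sT; have [eps [u1 [u2 [h1 h2 ev _ _]]]] := ap.
have up r : 0 <= r -> Phi X L 0 r <= j * (a - r) ^+ 2 + e.
  move=> r0; have := approx_close0 r0; have := ha r r0; rewrite ler_norml => b1 /andP[b2 b3]; lra.
have := @upper_edge _ _ _ _ _ _ _ _ _ j0 h1 ev a e a0 h2 _ _ s s0 sT.
rewrite -(Phi0 ev (lexx 0) T0) => H; have := H _ _; rewrite -[a ^+ 2](_ : (a - 0) ^+ 2 = _) ?subr0//.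
move=> H'; apply: (le_trans (H' _ _)); [by have := up 0 (lexx 0); rewrite subr0|by move=> r r0 _; exact: up|lra].
Qed.

End One.

Lemma barrier_parabola : exists2 a, 0 < a & forall r, 0 <= r -> tl v r <= j * (a - r) ^+ 2.
Proof.
have m := mass; have jj := j0.
have q0 : 0 < tl v 0 / j by rewrite divr_gt0.
(* With q the mass divided by j, for r <= Z0 one has (a - r)^2 >= (1 + q)^2 >= q; beyond Z0 the tail
   vanishes. *)
exists (Z0 + 1 + tl v 0 / j); first by have z := Z00; move: q0; move: (tl v 0 / j) => q; lra.
move=> r r0; have [rZ|rZ] := leP r Z0; last first.
  have -> : tl v r = 0.
    apply: EFin_inj; rewrite (tlE ok)// (eq_integral (cst 0%E)) ?integral0// => x.
    rewrite inE/= in_itv/= andbT => rx; rewrite vZ//; exact: lt_le_trans rx.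
  by rewrite mulr_ge0 ?sqr_ge0// ltW.
apply: (le_trans (tl_mono ok (lexx 0) r0)).
have E : tl v 0 = j * (tl v 0 / j) by rewrite mulrC divfK// gt_eqF.
rewrite [leLHS]E ler_pM2l//; move: q0; move: (tl v 0 / j) => q q0.
have h : 1 + q <= Z0 + 1 + q - r by lra.
apply: (@le_trans _ _ ((1 + q) ^+ 2)).
  by rewrite expr2; nra.
by rewrite lerXn2r// nnegrE; lra.
Qed.

End Approximation.

(** * Passing to the limit *)

Section Limit.
Context {R : realType}.
Notation mu := (@lebesgue_measure R).
Implicit Types (r s t x y z e c d : R).

Lemma cvg_of_approx (x : nat -> R) :
  (forall e, 0 < e -> exists c, \forall n \near \oo, `|x n - c| <= e) -> cvg (x n @[n --> \oo]).
Proof.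
move=> H; apply/cauchy_cvgP; apply: cauchy_exP => e e0.
have [c hc] := H (e / 2) (divr_gt0 e0 (ltr0Sn _ 1)); exists c.
apply: filterS hc => n hn; rewrite /ball/= distrC; lra.
Qed.

Lemma cvg_le_of (x : nat -> R) l c : x n @[n --> \oo] --> l ->
  (forall e, 0 < e -> \forall n \near \oo, x n <= c + e) -> l <= c.
Proof.
move=> xl H; apply/ler_addgt0Pr => e e0.
rewrite -(cvg_lim _ xl)//; apply: limr_le; [by apply: cvgP xl|exact: H].
Qed.

Lemma inv_near e : 0 < e -> \forall n \near \oo, n.+1%:R^-1 <= e.
Proof.
move=> e0; have /cvgrPdist_le /(_ _ e0) := @cvg_harmonic R.
by apply: filterS => n; rewrite sub0r normrN ger0_norm// invr_ge0.
Qed.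

Variables (j B Z0 a T : R) (v rho0 : R -> R).
Hypothesis j0 : 0 < j.
Hypothesis Z00 : 0 <= Z0.
Hypothesis ok : okd v B.
Hypothesis vZ : forall x, Z0 < x -> v x = 0.
Hypothesis mass : 0 < tl v 0.
Hypothesis a0 : 0 < a.
Hypothesis ha : forall r, 0 <= r -> tl v r <= j * (a - r) ^+ 2.
Hypothesis T0 : 0 < T.

Let tla : tl v a = 0.
Proof. by apply: le_anti; rewrite (tl_ge0 ok) andbT; have := ha (ltW a0); rewrite subrr expr0n mulr0. Qed.

Section Sequence.
Variables (X : nat -> R -> R) (u L : nat -> R -> R -> R).
Hypothesis ap : forall n, approx j B Z0 v T n.+1%:R^-1 (X n) (u n) (L n).

Let ps n t r := Phi (X n) (L n) t r.

Lemma small_step t e : 0 < t -> 0 < e -> exists2 N : nat, j * (t / N.+1%:R) <= e & N.+1%:R * (t / N.+1%:R) = t.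
Proof.
move=> t0 e0; exists (Num.truncn (j * t / e)); last by rewrite mulrC divfK.
by rewrite mulrA ler_pdivrMr// [leRHS]mulrC -ler_pdivrMr//; apply: ltW; exact: truncnS_gt.
Qed.

(** For a fixed step d with j d <= e / 2, all terms with n large lie within e of one barrier value,
    the accuracy tending to 0 after the number of steps is fixed: the sequence is Cauchy and no
    compactness is involved. *)
Lemma sequence_cvg t r : 0 < t -> t <= T -> cvg (ps n t r @[n --> \oo]).
Proof.
move=> t0 tT; apply: cvg_of_approx => e e0; have m := mass.
pose q := Num.min (e / 2) (tl v 0 / 2).
have q0 : 0 < q by rewrite lt_min !divr_gt0.
have qe : q <= e / 2 by rewrite ge_min lexx.
have qm : q <= tl v 0 / 2 by rewrite ge_min lexx orbT.
have [N jd tE] := small_step t0 q0; set d := t / N.+1%:R in jd tE.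
have d0 : 0 < d by rewrite divr_gt0.
pose r' := posp r; have r0 : 0 <= r' := posp_ge0 r.
exists (Hn j d (tl v) N r').
have C0 : 0 < (1 + 4 * N.+1%:R : R) by rewrite ltr_wpDr// mulr_ge0.
have q2 : 0 < e / 2 / (1 + 4 * N.+1%:R) by rewrite !divr_gt0.
have m4 : 0 < tl v 0 / 4 by rewrite divr_gt0.
near=> n.
have e1 : n.+1%:R^-1 <= e / 2 / (1 + 4 * N.+1%:R) by near: n; exact: inv_near.
have e2 : n.+1%:R^-1 <= tl v 0 / 4 by near: n; exact: inv_near.
have big : j * d + 2 * n.+1%:R^-1 <= tl v 0.
  by move: jd e2; move: (j * d) (n.+1%:R^-1) => p w h1 h2; lra.
have ntT : N.+1%:R * d <= T by rewrite tE.
have [h1 h2] := approx_sandwich j0 ok (ltW T0) (ap n) d0 big ntT r0.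
have psE : ps n t r = Phi (X n) (L n) (N.+1%:R * d) r'.
  by rewrite tE /ps /Phi /r' (posp_id (posp_ge0 r)).
rewrite psE; have h3 : n.+1%:R^-1 * (1 + 4 * N.+1%:R) <= e / 2 by rewrite -ler_pdivlMr.
have h4 : Hn j d (tl v) N r' - j * d <= cut j d (Hn j d (tl v) N) r' by rewrite /cut le_max lexx.
rewrite ler_norml; move: h1 h2 h3 h4 jd.
move: (Phi _ _ _ _) (Hn _ _ _ _ _) (cut _ _ _ _) (j * d) (n.+1%:R^-1 * _) => p w y z k h1 h2 h3 h4 jd.
by apply/andP; split; lra.
Unshelve. all: by end_near. Qed.

Let psi t r : R := lim (ps n t r @[n --> \oo]).

Section AtTime.
Variable t : R.
Hypothesis t0 : 0 < t.
Hypothesis tT : t <= T.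

Let cv r : ps n t r @[n --> \oo] --> psi t r.
Proof. exact: sequence_cvg. Qed.

Let psi_mono x y : x <= y -> psi t y <= psi t x.
Proof.
move=> xy; apply: ler_lim; [exact: cvgP (@cv y)|exact: cvgP (@cv x)|].
by near=> n; apply: (approx_mono (ap n)) => //; exact: ltW.
Unshelve. all: by end_near. Qed.

Let psi_lip x y : `|psi t x - psi t y| <= height j B Z0 T * `|x - y|.
Proof.
have c : `|ps n t x - ps n t y| @[n --> \oo] --> `|psi t x - psi t y|.
  by apply: cvg_norm; apply: cvgB; exact: cv.
apply: (cvg_le_of c) => e e0; near=> n.
rewrite ler_wpDr ?(ltW e0)//; apply: (approx_lip j0 (ap n)) => //; exact: ltW.
Unshelve. all: by end_near. Qed.

Let psi_mass : psi t 0 = tl v 0.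
Proof.
apply/eqP; rewrite -subr_eq0 -normr_le0.
have c : `|ps n t 0 - tl v 0| @[n --> \oo] --> `|psi t 0 - tl v 0|.
  by apply: cvg_norm; apply: cvgB; [exact: cv|exact: cvg_cst].
apply: (cvg_le_of c) => e e0; have e2 : 0 < e / 2 by lra.
near=> n; rewrite add0r.
apply: (le_trans (approx_mass j0 ok (ltW T0) (ap n) (ltW t0) tT)).
rewrite mulrC -ler_pdivlMr//; near: n; exact: inv_near.
Unshelve. all: by end_near. Qed.

Lemma psi_far x : a <= x -> psi t x = 0.
Proof.
move=> ax; apply: le_anti; apply/andP; split; last first.
  apply: limr_ge; first exact: cvgP (@cv x).
  by near=> n; apply: (approx_ge0 (ap n)) => //; exact: ltW.
apply: le_trans (psi_mono ax) _; apply: (cvg_le_of (@cv a)) => e e0.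
have e3 : 0 < e / 3 by lra.
near=> n; rewrite add0r.
apply: (le_trans (approx_upper j0 ok (ltW T0) (ap n) (ltW a0) ha (ltW t0) tT)).
rewrite mulrC -ler_pdivlMr//; near: n; exact: inv_near.
Unshelve. all: by end_near. Qed.

Lemma psi_sandwich d n r : 0 < d -> t = n.+1%:R * d -> j * d < tl v 0 -> 0 <= r ->
  cut j d (Hn j d (tl v) n) r <= psi t r <= Hn j d (tl v) n r.
Proof.
move=> d0 tE jd r0.
have C0 : 0 < (1 + 4 * n.+1%:R : R) by rewrite ltr_wpDr// mulr_ge0.
have g0 : 0 < (tl v 0 - j * d) / 2 by rewrite divr_gt0// subr_gt0.
have S e : 0 < e -> \forall k \near \oo,
    cut j d (Hn j d (tl v) n) r - e <= ps k t r /\ ps k t r <= Hn j d (tl v) n r + e.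
  move=> e0; have e1 : 0 < e / (1 + 4 * n.+1%:R) by rewrite divr_gt0.
  near=> k.
  have e2 : k.+1%:R^-1 <= e / (1 + 4 * n.+1%:R) by near: k; exact: inv_near.
  have e3 : k.+1%:R^-1 <= (tl v 0 - j * d) / 2 by near: k; exact: inv_near.
  have big : j * d + 2 * k.+1%:R^-1 <= tl v 0.
    by move: e3; move: (j * d) (k.+1%:R^-1) (tl v 0) => p w q h1; lra.
  have ntT : n.+1%:R * d <= T by rewrite -tE.
  have := approx_sandwich j0 ok (ltW T0) (ap k) d0 big ntT r0; rewrite -tE -/(ps k t r) => -[h1 h2].
  have h3 : k.+1%:R^-1 * (1 + 4 * n.+1%:R) <= e by rewrite -ler_pdivlMr.
  split; [apply: le_trans h1; rewrite lerD2l lerN2|apply: le_trans h2 _; rewrite lerD2l]; exact: h3.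
apply/andP; split.
- rewrite -lerN2; apply: (cvg_le_of (cvgN (@cv r))) => e e0; near=> k.
  have [h1 _] : cut j d (Hn j d (tl v) n) r - e <= ps k t r /\ ps k t r <= Hn j d (tl v) n r + e by near: k; exact: S.
  lra.
- apply: (cvg_le_of (@cv r)) => e e0; near=> k.
  have [_ h1] : cut j d (Hn j d (tl v) n) r - e <= ps k t r /\ ps k t r <= Hn j d (tl v) n r + e by near: k; exact: S.
  exact: h1.
Unshelve. all: by end_near. Qed.

Lemma density_at : exists g, [/\ tailed g, mu.-integrable (halfline R) (EFin \o g) &
  forall r, 0 <= r -> tl g r = psi t r].
Proof.
have neg x : x <= 0 -> psi t x = tl v 0.
  move=> x0; rewrite -psi_mass /psi (_ : (fun n => ps n t x) = (fun n => ps n t 0))//.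
  by apply/funext => n; rewrite /ps /Phi (posp_0 x0) (posp_0 (lexx 0)).
have [g [g0 ig gE]] := density_of_tails psi_mono psi_lip (height_ge0 j B Z0 T) mass neg psi_far.
have ih : mu.-integrable (halfline R) (EFin \o g) by apply: integrableS ig => //; exact: measurable_itv.
exists g; split => //.
- split => //; apply: measurable_funTS; apply/measurable_EFinP; exact: measurable_int ig.
- by move=> r r0; rewrite /tl posp_id// /Rintegral gE.
Qed.

End AtTime.

Lemma tails_cvg0 r : 0 <= r -> tl (ext0 (X n) (u n) 0) r @[n --> \oo] --> tl v r.
Proof.
move=> r0; apply/cvgrPdist_le => e e0; near=> n.
rewrite (approx_tl j0 (ap n) (lexx 0) (ltW T0) r0) distrC.
apply: (le_trans (approx_close0 j0 ok (ltW T0) (ap n) r0)); near: n; exact: inv_near.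
Unshelve. all: by end_near. Qed.

Hypothesis rho0_meas : measurable_fun (`[0, +oo[%classic : set R) rho0.
Hypothesis rho0_v : eq_ae_halfline rho0 v.

Lemma approx_quasi n : quasi_solution j T rho0 (X n) (u n) n.+1%:R^-1.
Proof.
have [eps [u1 [u2 [h1 h2 ev hK i]]]] := ap n.
apply: (evol_quasi_solution ev) => //.
apply: le_trans i; rewrite le_eqVlt; apply/orP; left; apply/eqP.
have [B' ok'] := approx_okd j0 (ap n) (lexx 0) (ltW T0).
apply: ae_eq_integral => //.
- exact: measurable_itv.
- by apply/measurable_EFinP; apply: measurableT_comp => //; apply: measurable_funB => //; exact: ok_meas ok'.
- by apply/measurable_EFinP; apply: measurableT_comp => //; apply: measurable_funB => //; [exact: ok_meas ok'|exact: ok_meas ok].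
- have Fae := ae_filter_ringOfSetsType mu; apply: filterS rho0_v => x hx; rewrite /halfline/= in_itv/= andbT => x0.
  by rewrite hx.
Qed.

Lemma limit_of_sequence : exists rho, generalized_solution j T rho0 rho /\
  forall t, 0 <= t -> t < T -> [/\ tailed (rho t), tl (rho t) a = 0, (t = 0 -> rho t = v) &
    forall d n r, 0 < d -> t = n.+1%:R * d -> j * d < tl v 0 -> 0 <= r ->
      cut j d (Hn j d (tl v) n) r <= tl (rho t) r <= Hn j d (tl v) n r].
Proof.
have G t : exists g, 0 < t -> t <= T -> [/\ tailed g, mu.-integrable (halfline R) (EFin \o g) &
  forall r, 0 <= r -> tl g r = psi t r].
  have [t0|t0] := ltP 0 t; last by exists (cst 0).
  have [tT|tT] := leP t T; last by exists (cst 0).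
  by have [g hg] := density_at t0 tT; exists g.
have [g hg] := choice G.
(* The barriers identify the limit at positive times only; at time 0 the tails converge to that of v
   by the initial L^1 bound. *)
pose rho t := if t == 0 then v else g t.
have P t : 0 <= t -> t < T -> [/\ tailed (rho t), mu.-integrable (halfline R) (EFin \o rho t),
    tl (rho t) a = 0 & forall r, 0 <= r -> tl (ext0 (X n) (u n) t) r @[n --> \oo] --> tl (rho t) r].
  move=> t0 tT; rewrite /rho; case: eqP => [->|/eqP tn].
    by split => //; [exact: okd_tailed ok|exact: ok_int ok|exact: tails_cvg0].
  have tp : 0 < t by rewrite lt_neqAle eq_sym tn.
  have [h1 h2 h3] := hg t tp (ltW tT); split => //.
  - rewrite h3 ?ltW//; exact: (psi_far tp (ltW tT)).
  - move=> r r0; rewrite h3//.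
    rewrite (_ : (fun n => tl _ r) = (fun n => ps n t r)); first exact: (sequence_cvg (r := r) tp (ltW tT)).
    by apply/funext => n; exact: (approx_tl j0 (ap n) t0 (ltW tT) r0).
exists rho; split; [split|].
- by move=> t /andP[t0 tT]; have [] := P t t0 tT.
- exists X, u, (fun n => n.+1%:R^-1); split; first by split; [exact: approx_quasi|exact: cvg_harmonic].
  move=> t /andP[t0 tT]; have [h1 h2 h3 h4] := P t t0 tT.
  apply: (weak_of_tails (ltW a0)) => // n.
  by have [B' ok'] := approx_okd j0 (ap n) t0 (ltW tT); exact: okd_tailed ok'.
- move=> t t0 tT; have [h1 h2 h3 h4] := P t t0 tT; split => //.
  + by rewrite /rho => ->; rewrite eqxx.
  + move=> d n r d0 tE jd r0; have tp : 0 < t by rewrite tE mulr_gt0.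
    rewrite /rho gt_eqF//; have [_ _ ->] := hg t tp (ltW tT) => //.
    exact: (psi_sandwich tp (ltW tT) d0 tE jd r0).
Qed.

End Sequence.

Lemma limit_solution : measurable_fun (`[0, +oo[%classic : set R) rho0 -> eq_ae_halfline rho0 v ->
  exists rho, generalized_solution j T rho0 rho /\
  forall t, 0 <= t -> t < T -> [/\ tailed (rho t), tl (rho t) a = 0, (t = 0 -> rho t = v) &
    forall d n r, 0 < d -> t = n.+1%:R * d -> j * d < tl v 0 -> 0 <= r ->
      cut j d (Hn j d (tl v) n) r <= tl (rho t) r <= Hn j d (tl v) n r].
Proof.
move=> mr ae.
have H n : exists p : (R -> R) * (R -> R -> R) * (R -> R -> R), approx j B Z0 v T n.+1%:R^-1 p.1.1 p.1.2 p.2.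
  have [|X [u [L h]]] := approx_exists j0 Z00 ok vZ mass T0 (e := n.+1%:R^-1); first by rewrite invr_gt0.
  by exists (X, u, L).
have [p hp] := choice H.
exact: (@limit_of_sequence (fun n => (p n).1.1) (fun n => (p n).1.2) (fun n => (p n).2)).
Qed.

End Limit.

(** * Almost everywhere equality *)

Section AlmostEverywhere.
Context {R : realType}.
Notation mu := (@lebesgue_measure R).
Implicit Types (r s t x y z e c d : R) (f g : R -> R).

Lemma F_ext_ae f g r : 0 <= r -> measurable_fun (`[0, +oo[%classic : set R) f ->
  measurable_fun (`[0, +oo[%classic : set R) g -> eq_ae_halfline f g ->
  Defs.F r (of_fun f) = Defs.F r (of_fun g).
Proof.
move=> r0 mf mg fg; have Fae := ae_filter_ringOfSetsType mu; rewrite /Defs.F/=; congr (_ + _)%E.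
have sr : `[r, +oo[%classic `<=` (`[0, +oo[%classic : set R).
  by move=> x /=; rewrite !in_itv/= !andbT; exact: le_trans.
apply: ae_eq_integral => //.
- by apply/measurable_EFinP; exact: measurable_funS mf.
- by apply/measurable_EFinP; exact: measurable_funS mg.
- by apply: filterS fg => x hx /= /sr; rewrite /= in_itv/= andbT => x0; rewrite hx.
Qed.

(** A nonnegative function with zero integral past z vanishes there almost everywhere, so cutting at
    z and clamping to [0, B] changes f on a null set only. *)
Lemma Linfty_L1_representative f z : Linfty_L1_nonneg f -> 0 <= z -> Defs.F z (of_fun f) = 0%E ->
  exists B v, [/\ okd v B, forall x, z < x -> v x = 0 & eq_ae_halfline f v].
Proof.
move=> [fi [M fM]] z0; have Fae := ae_filter_ringOfSetsType mu; rewrite /Defs.F/= if_same add0e => Fz.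
have mf : measurable_fun (`[0, +oo[%classic : set R) f by apply/measurable_EFinP; exact: measurable_int fi.
have sz : `[z, +oo[%classic `<=` (`[0, +oo[%classic : set R).
  by move=> x /=; rewrite !in_itv/= !andbT; exact: le_trans.
have mfz : measurable_fun (`[z, +oo[%classic : set R) (EFin \o f).
  by apply/measurable_EFinP; exact: measurable_funS mf.
have far : {ae mu, forall x, z <= x -> f x = 0}.
  have H : (\int[mu]_(x in `[z, +oo[) `|(EFin \o f) x| = 0)%E.
    rewrite -Fz; apply: ae_eq_integral => //.
    - exact: measurableT_comp.
    - apply: filterS fM => x hx /=; rewrite in_itv/= andbT => zx.
      by have /andP[f0 _] := hx (le_trans z0 zx); rewrite ger0_norm.
  have : ae_eq mu (`[z, +oo[%classic : set R) (EFin \o f) (cst 0%E) by apply/ae_eq_integral_abs.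
  by apply: filterS => x /= hx zx; have := hx; rewrite /= in_itv/= andbT => /(_ zx) [].
pose B := Num.max M 0.
pose v x := if x <= z then Num.min (Num.max (f x) 0) B else 0.
have bd x : 0 <= v x <= B.
  have B0 : 0 <= B by rewrite le_max lexx orbT.
  by rewrite /v; case: ifP => _; rewrite ?lexx// le_min ge_min (lexx B) orbT B0 le_max lexx orbT.
have mv : measurable_fun (`[0, +oo[%classic : set R) v.
  apply: measurable_fun_if => //.
    by apply: measurable_fun_ler => //; exact: measurable_cst.
  suff h : measurable_fun (`[0, +oo[%classic : set R) (fun t => Num.min (Num.max (f t) 0) B).
    by apply: (measurable_funS _ _ h) => //; exact: subIsetl.
  apply: measurable_minr => //; exact: measurable_maxr.
exists B, v; split.
- split => //.
  apply: (@le_integrable _ _ _ mu _ _ _ (EFin \o f)) => //; first exact/measurable_EFinP.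
  move=> x /=; rewrite in_itv/= andbT => x0; rewrite lee_fin.
  have /andP[v0 _] := bd x; rewrite ger0_norm// /v; case: ifP => // _.
  rewrite ge_min; apply/orP; left.
  by rewrite ge_max ler_norm normr_ge0.
- by move=> x zx; rewrite /v leNgt zx.
- apply: filterS2 far fM => x h1 h2 x0; rewrite /v; have [xz|/ltW zx] := leP x z; last exact: h1.
  have /andP[f0 fB] := h2 x0; rewrite max_l// min_l// le_max fB//.
Qed.

(** The first heat flow only sees the class of the datum; with no step at all the two functions
    themselves could differ. *)
Lemma S_minus_ext_ae j d n f g : measurable_fun (`[0, +oo[%classic : set R) f ->
  measurable_fun (`[0, +oo[%classic : set R) g -> eq_ae_halfline f g ->
  S_minus j d n.+1 f = S_minus j d n.+1 g.
Proof.
move=> mf mg fg; have Fae := ae_filter_ringOfSetsType mu; rewrite /S_minus !iterSr; congr (iter n _ (barrier_cut j d _)).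
rewrite /heat_neum/=; congr of_fun; apply/funext => r; rewrite !mul0r !add0r.
congr fine; apply: ae_eq_integral.
- exact: measurable_itv.
- by apply/measurable_EFinP; apply: measurable_funM => //; exact: gn_measx.
- by apply/measurable_EFinP; apply: measurable_funM => //; exact: gn_measx.
- apply: filterS fg => x hx; rewrite /halfline/= in_itv/= andbT => x0; by rewrite hx.
Qed.

(** The difference, extended by 0, has zero integral over every half-line up to x, so it vanishes
    almost everywhere by Lebesgue's differentiation theorem. *)
Lemma ae_of_tails f g : mu.-integrable (halfline R) (EFin \o f) ->
  {within halfline R, continuous g} ->
  (forall r, 0 <= r -> Defs.F r (of_fun g) = Defs.F r (of_fun f)) -> eq_ae_halfline f g.
Proof.
move=> fi cg E; have Fae := ae_filter_ringOfSetsType mu.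
have mH : measurable (halfline R) by exact: measurable_itv.
have E' r : 0 <= r -> (\int[mu]_(x in `[r, +oo[) (g x)%:E = \int[mu]_(x in `[r, +oo[) (f x)%:E)%E.
  by move=> /E; rewrite /Defs.F/= !if_same !add0e.
have mg : measurable_fun (halfline R) (EFin \o g).
  by apply/measurable_EFinP; apply: subspace_continuous_measurable_fun.
have gi : mu.-integrable (halfline R) (EFin \o g).
  (* Integrability of g is not given; a finite extended integral forces the integrals of both its
     positive and negative parts to be finite. *)
  have fin : (\int[mu]_(x in halfline R) (EFin \o g) x)%E \is a fin_num.
    have -> : (\int[mu]_(x in halfline R) (EFin \o g) x = \int[mu]_(x in halfline R) (f x)%:E)%E := E' 0 (lexx 0).
    exact: integrable_fin_num fi.
  apply/integrableP; split => //.
  move: fin; rewrite integralE fin_numB => /andP[p1 p2].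
  rewrite (_ : (fun x => `|(EFin \o g) x|)%E = ((EFin \o g)^\+ \+ (EFin \o g)^\-)%E); last by rewrite -fune_abse.
  rewrite ge0_integralD//; first by rewrite lte_add_pinfty// ltey_eq ?p1 ?p2.
  - exact: measurable_funepos.
  - exact: measurable_funeneg.
have wi : mu.-integrable (halfline R) (EFin \o (fun x => f x - g x)).
  by apply: (@integrableB _ _ _ mu _ _ (EFin \o f) (EFin \o g)).
pose w := (fun x => f x - g x) \_ (halfline R).
have wR : mu.-integrable setT (EFin \o w).
  have := (@integrable_mkcond _ _ _ mu _ (EFin \o (fun x => f x - g x)) mH).1 wi.
  by rewrite (_ : _ \_ _ = EFin \o w)//; apply/funext => x /=; rewrite /w !patchE; case: ifP.
have W0 x : \int[mu]_(t in `]-oo, x]) w t = 0.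
  rewrite /w -Rintegral_mkcondr.
  have [x0|x0] := leP 0 x; last first.
    rewrite (_ : _ `&` _ = set0) ?Rintegral_set0//; apply/seteqP; split => // t /=.
    by rewrite /halfline/= !in_itv/= andbT => -[h1 h2]; have := le_trans h2 h1; rewrite leNgt x0.
  have -> : `]-oo, x]%classic `&` halfline R = `[0, x]%classic.
    by apply/seteqP; split => t /=; rewrite /halfline/= !in_itv/= andbT; [case=> -> ->|case/andP => -> ->].
  have T0 r : 0 <= r -> \int[mu]_(t in `[r, +oo[) (f t - g t) = 0.
    move=> r0; have sr : `[r, +oo[%classic `<=` halfline R.
      by move=> t /=; rewrite /halfline/= !in_itv/= !andbT; exact: le_trans.
    rewrite RintegralB//; [|by apply: integrableS fi|by apply: integrableS gi].
    by rewrite {2}/Rintegral E'// subrr.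
  have sp := Rintegral_halfline_split (lexx 0) x0 wi.
  move: sp; rewrite !T0// addr0 => sp; rewrite -Rintegral_itv_bndo_bndc//.
  apply: integrableS wi => // t /=; rewrite /halfline/= !in_itv/= andbT; by case/andP.
have := FTC1Ny (f := w) _ _.
have -> : (fun x => \int[mu]_(t in `]-oo, x]) w t) = cst 0 by apply/funext => x; exact: W0.
move=> H; have H' := H _ _; apply: filterS (H' _ _).
- by move=> x /= [_]; rewrite derive1_cst => h x0; move: h; rewrite /w patchE mem_set; [move/eqP; rewrite eq_sym subr_eq0 => /eqP|rewrite /halfline/= in_itv/= x0].
- by move=> y; apply: integrableS wR => //.
- by apply: open_integrable_locally => //; exact: openT.
Qed.

End AlmostEverywhere.

(** * The generalized solution: identification and edge bounds *)

Section GeneralizedSolution.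
Context {R : realType}.
Notation mu := (@lebesgue_measure R).
Implicit Types (r s t x y z e c d : R).
Variables (j : R) (rho0 : R -> R) (rhobar : R -> R -> R).
Hypothesis j0 : 0 < j.
Hypothesis reg : Linfty_L1_nonneg rho0.
Hypothesis edge0 : (0 < edge (of_fun rho0) < +oo)%E.
Hypothesis sol : the_generalized_solution j rho0 rhobar.

Let meas0 : measurable_fun (`[0, +oo[%classic : set R) rho0.
Proof. by have [fi _] := reg; apply/measurable_EFinP; exact: measurable_int fi. Qed.

(** A finite edge provides a point Z with zero tail, a positive edge a point x0 > 0 with positive
    tail. *)
Lemma datum_exists : exists B v Z x0, [/\ okd v B, 0 <= Z /\ (forall x, Z < x -> v x = 0),
  eq_ae_halfline rho0 v & 0 < x0 /\ 0 < tl v x0].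
Proof.
have /andP[e0 eoo] := edge0.
have [z z0 Fz] : exists2 z, 0 <= z & Defs.F z (of_fun rho0) = 0%E.
  apply: contrapT => H; move: eoo; rewrite ltNge => /negP; apply.
  by apply/ereal_infP => y [r [r0 Fr] _]; exfalso; apply: H; exists r.
have [B [v [ok vz ae]]] := Linfty_L1_representative reg z0 Fz.
have [x0 x00 xe] : exists2 x0, 0 < x0 & (x0%:E < edge (of_fun rho0))%E.
  move: e0; case: (edge (of_fun rho0)) => [q||] //=.
  - by rewrite lte_fin => q0; exists (q / 2); [rewrite divr_gt0|rewrite lte_fin; lra].
  - by move=> _; exists 1 => //; rewrite ltry.
exists B, v, z, x0; split => //; split => //.
rewrite lt_neqAle (tl_ge0 ok) andbT eq_sym; apply/negP => /eqP tx0.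
move: xe; rewrite ltNge => /negP; apply; apply: ge_ereal_inf.
exists x0%:E => //; exists x0 => //; split; first exact: ltW.
rewrite (F_ext_ae (ltW x00) meas0 (ok_meas ok) ae) (F_tl ok 0 (ltW x00)) tx0 addr0.
by case: ifP.
Qed.

Section WithDatum.
Variables (B : R) (v : R -> R) (Z x0 : R).
Hypothesis ok : okd v B.
Hypothesis Z0 : 0 <= Z.
Hypothesis vZ : forall x, Z < x -> v x = 0.
Hypothesis ae : eq_ae_halfline rho0 v.
Hypothesis x00 : 0 < x0.
Hypothesis tx0 : 0 < tl v x0.

Lemma mass_gt0 : 0 < tl v 0.
Proof. by apply: lt_le_trans tx0 _; exact: (tl_le0 ok). Qed.

(** By uniqueness on [0, t + 1), [rhobar t] is the limit constructed there, and its tail inherits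
    the sandwich between barriers. *)
Lemma solution_tail a t : 0 < a -> (forall r, 0 <= r -> tl v r <= j * (a - r) ^+ 2) -> 0 <= t ->
  exists G : R -> R, [/\ forall r, 0 <= r -> Defs.F r (of_fun (rhobar t)) = (G r)%:E,
    G a = 0, (t = 0 -> forall r, 0 <= r -> G r = tl v r) &
    forall d n r, 0 < d -> t = n.+1%:R * d -> j * d < tl v 0 -> 0 <= r ->
      cut j d (Hn j d (tl v) n) r <= G r <= Hn j d (tl v) n r].
Proof.
move=> a0 ha t0; have T0 : 0 < t + 1 by lra.
have [rho [gs hrho]] := limit_solution j0 Z0 ok vZ mass_gt0 a0 ha T0 meas0 ae.
have [[ibar _] uniq] := sol T0.
have tT : t < t + 1 by lra.
have tt : 0 <= t < t + 1 by rewrite t0 tT.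
have eqt := uniq rho gs t tt; have [ta tla r0E sw] := hrho t t0 tT.
have mb : measurable_fun (`[0, +oo[%classic : set R) (rhobar t).
  by apply/measurable_EFinP; exact: measurable_int (ibar t tt).
exists (tl (rho t)); split => //; last by move=> /r0E ->.
move=> r r0; rewrite -(F_ext_ae r0 (ta_meas ta) mb eqt) /Defs.F/= if_same add0e.
rewrite (tailed_tl _ r0)/= /Rintegral fineK//.
apply: integrable_fin_num => //; apply: integrableS (ta_int ta) => //.
by move=> x /=; rewrite !in_itv/= !andbT; exact: le_trans.
Qed.

Lemma edge_upper : exists a2 : R, forall t : R, 0 <= t -> (edge (of_fun (rhobar t)) < a2%:E)%E.
Proof.
have [a a0 ha] := barrier_parabola j0 Z0 ok vZ mass_gt0.
exists (a + 1) => t t0; have [G [GE Ga _ _]] := solution_tail a0 ha t0.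
apply: (@le_lt_trans _ _ a%:E); last by rewrite lte_fin; lra.
apply: ge_ereal_inf; exists a%:E => //; exists a => //; split; first exact: ltW.
by rewrite GE ?ltW// Ga.
Qed.

(** A tail j ((b - r)^+)^2 lying below the initial one stays below the barriers, hence below the
    solution. It is enough that b <= x0 and j b^2 <= tl v x0, because the initial tail is at least
    tl v x0 on [0, x0]. *)
Lemma edge_lower : exists2 a1 : R, 0 < a1 & forall t : R, 0 <= t -> (a1%:E < edge (of_fun (rhobar t)))%E.
Proof.
have [a a0 ha] := barrier_parabola j0 Z0 ok vZ mass_gt0.
pose b := Num.min x0 (Num.min 1 (tl v x0 / j)).
have b0 : 0 < b by rewrite !lt_min x00 ltr01 divr_gt0.
have bx : b <= x0 by rewrite ge_min lexx.
have b1 : b <= 1 by rewrite !ge_min lexx orbT.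
have bj : j * b <= tl v x0 by rewrite mulrC -ler_pdivlMr// !ge_min lexx !orbT.
have jb : j * b ^+ 2 <= tl v x0.
  by apply: le_trans bj; rewrite ler_pM2l// expr2 ger_pMl.
have pv r : 0 <= r -> parab j b r <= tl v r.
  move=> r0; have [rb|br] := leP r b; last by rewrite (parab_out j0 b0 (ltW br)) (tl_ge0 ok).
  rewrite parab_in//; apply: (@le_trans _ _ (tl v x0)).
    apply: le_trans jb; rewrite ler_pM2l// lerXn2r// ?nnegrE ?subr_ge0 ?(ltW b0)//.
    by rewrite gerBl.
  by apply: (tl_mono ok) => //; exact: le_trans bx.
exists (b / 2); first by rewrite divr_gt0.
move=> t t0; have [G [GE Ga G0 sw]] := solution_tail a0 ha t0.
have Gp r : 0 <= r -> parab j b r <= G r.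
  move=> r0; move: t0; rewrite le_eqVlt => /predU1P[t0|t0]; first by rewrite G0// pv.
  apply/ler_addgt0Pr => e e0.
  (* Three demands on the step d: j d <= e makes the cut harmless, j d below the mass is needed for
     the sandwich, and d <= b^2 makes the parabola a subsolution. *)
  pose q := Num.min e (Num.min (tl v 0 / 2) (j * b ^+ 2)).
  have m0 := mass_gt0.
  have q0 : 0 < q by rewrite !lt_min e0 divr_gt0//= mulr_gt0// exprn_gt0.
  have [N jd tE] := small_step j t0 q0; set d := t / N.+1%:R in jd tE.
  have d0 : 0 < d by rewrite divr_gt0.
  have jd1 : j * d <= e by apply: le_trans jd _; rewrite ge_min lexx.
  have jd2 : j * d <= tl v 0 / 2 by apply: le_trans jd _; rewrite !ge_min lexx orbT.
  have jd3 : d <= b ^+ 2.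
    by rewrite -(ler_pM2l j0); apply: le_trans jd _; rewrite !ge_min lexx !orbT.
  have jd4 : j * d < tl v 0 by apply: le_lt_trans jd2 _; lra.
  have /andP[h1 _] := sw d N r d0 (esym tE) jd4 r0.
  have h2 := parab_le_Hn j0 b0 N d0 jd3 r0.
  have h3 := Hn_mono j d0 N (cb_parab j0 b0) (cb_tl ok) pv r0.
  have h4 : Hn j d (tl v) N r - j * d <= cut j d (Hn j d (tl v) N) r by rewrite /cut le_max lexx.
  move: h1 h2 h3 h4 jd1; move: (Hn _ _ _ _ _) (Hn _ _ _ _ _) (cut _ _ _ _) (j * d) (parab _ _ _) => p1 p2 p3 p4 p5.
  by move=> *; lra.
apply: (@lt_le_trans _ _ b%:E); first by rewrite lte_fin; lra.
apply/ereal_infP => _ [r [r0 Fr] <-]; rewrite lee_fin leNgt; apply/negP => rb.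
move: Fr; rewrite GE// => -[Gr]; have := Gp r r0; rewrite Gr (parab_in j r0 (ltW rb)).
by apply/negP; rewrite -ltNge mulr_gt0// exprn_gt0// subr_gt0.
Qed.

Lemma separating_tail S t r : separating_element j rho0 S -> 0 < t -> 0 <= r ->
  Defs.F r (of_fun (S t)) = Defs.F r (of_fun (rhobar t)).
Proof.
move=> [_ sep] t0 r0; have [a a0 ha] := barrier_parabola j0 Z0 ok vZ mass_gt0.
have [G [GE Ga _ sw]] := solution_tail a0 ha (ltW t0).
have [lim_minus _ _ _] := sep t r t0 r0; rewrite GE//.
have m0 := mass_gt0.
(* [2 ^ l] steps correspond to [Hn] at index [(2 ^ l).-1]; the first summand is the atom seen by [F]
   at r = 0, which tends to 0. *)
pose y l := (if r == 0 then j * (t / 2 ^+ l) else 0) + cut j (t / 2 ^+ l) (Hn j (t / 2 ^+ l) (tl v) (2 ^ l).-1) r.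
have small e : 0 < e -> \forall l \near \oo, j * (t / 2 ^+ l) <= e.
  move=> e0; near=> l.
  have h : l.+1%:R^-1 <= e / (j * t) by near: l; apply: inv_near; rewrite divr_gt0// mulr_gt0.
  apply: (@le_trans _ _ (j * (t / l.+1%:R))).
    rewrite ler_pM2l// ler_pM2l// lef_pV2 ?posrE ?exprn_gt0//.
    by rewrite -natrX ler_nat ltn_expl.
  by rewrite mulrA mulrC -ler_pdivlMr// mulr_gt0.
have d0 l : 0 < t / 2 ^+ l by rewrite divr_gt0// exprn_gt0.
have pE l : (2 ^ l = (2 ^ l).-1.+1)%N by rewrite prednK// expn_gt0.
have tE l : t = ((2 ^ l).-1.+1)%:R * (t / 2 ^+ l).
  by rewrite -pE natrX mulrC divfK// gt_eqF// exprn_gt0.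
have m2 : 0 < tl v 0 / 2 by rewrite divr_gt0.
have yE : \forall l \near \oo, (y l)%:E = Defs.F r (S_minus j (t / 2 ^+ l) (2 ^ l)%N rho0).
  near=> l; have jd : j * (t / 2 ^+ l) <= tl v 0 / 2 by near: l; exact: small.
  rewrite pE (S_minus_ext_ae j _ _ meas0 (ok_meas ok) ae) (F_S_minus j0 (d0 l) ok _ _ r0) ?prednK ?expn_gt0//.
  by apply: le_lt_trans jd _; lra.
have yG : y l @[l --> \oo] --> G r.
  apply/cvgrPdist_le => e e0; have e2 : 0 < e / 2 by lra.
  near=> l; have jd : j * (t / 2 ^+ l) <= tl v 0 / 2 by near: l; exact: small.
  have je : j * (t / 2 ^+ l) <= e / 2 by near: l; exact: small.
  have jd' : j * (t / 2 ^+ l) < tl v 0 by apply: le_lt_trans jd _; lra.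
  have /andP[h1 h2] := sw _ _ r (d0 l) (tE l) jd' r0.
  have h4 : Hn j (t / 2 ^+ l) (tl v) (2 ^ l).-1 r - j * (t / 2 ^+ l) <= cut j (t / 2 ^+ l) (Hn j (t / 2 ^+ l) (tl v) (2 ^ l).-1) r.
    by rewrite /cut le_max lexx.
  pose i := if r == 0 then j * (t / 2 ^+ l) else 0.
  have h5 : 0 <= i <= j * (t / 2 ^+ l).
    have h : 0 <= j * (t / 2 ^+ l) by rewrite mulr_ge0// ltW.
    by rewrite /i; case: ifP => _; rewrite ?lexx h.
  rewrite /y -/i; move: h5 h1 h2 h4 je; move: (i) (j * _) (cut _ _ _ _) (Hn _ _ _ _ _) => w k p q.
  by move=> /andP[i1 i2] h1 h2 h4 je; rewrite ler_norml; apply/andP; split; lra.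
have yG' : (y l)%:E @[l --> \oo] --> (G r)%:E by apply: cvg_EFin => //; near=> l.
have lm : (y l)%:E @[l --> \oo] --> Defs.F r (of_fun (S t)).
  by apply: cvg_trans lim_minus; apply: near_eq_cvg; apply: filterS yE.
exact: (cvg_unique _ lm yG').
Unshelve. all: by end_near. Qed.

Lemma separating_eq S t : separating_element j rho0 S -> 0 < t -> eq_ae_halfline (rhobar t) (S t).
Proof.
move=> sep t0; have T0 : 0 < t + 1 by lra.
have [[ibar _] _] := sol T0.
apply: ae_of_tails; [by apply: ibar; rewrite (ltW t0)/=; lra| |by move=> r r0; exact: separating_tail].
have [cS _] := sep; apply/subspace_continuousP => r; rewrite /halfline/= in_itv/= andbT => r0.
have := (subspace_continuousP _ _).1 cS (t, r) (conj t0 r0) => H.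
apply: (cvg_comp (fun r => (t, r)) (fun p : R * R => S p.1 p.2) _ H).
move=> P [[P1 P2] /= [h1 h2] hP].
have : \forall s \near r, P2 s by exact: h2.
apply: filterS => s Ps; rewrite /halfline/= in_itv/= andbT => s0.
by apply: (hP (t, s)) => /=; [split => //; exact: nbhs_singleton h1|split].
Qed.

End WithDatum.
End GeneralizedSolution.

Theorem theorem1p4 (R : realType) (j : R) (rho0 : R -> R) (rhobar : R -> R -> R)
  (j_gt0 : 0 < j)
  (rho0_reg : Linfty_L1_nonneg rho0)
  (rho0_edge : (0 < edge (of_fun rho0) < +oo)%E)
  (rhobar_sol : the_generalized_solution j rho0 rhobar) :
  [/\ forall S : R -> R -> R, separating_element j rho0 S ->
        forall t : R, 0 < t -> eq_ae_halfline (rhobar t) (S t),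
      exists a2 : R, forall t : R, 0 <= t ->
        (edge (of_fun (rhobar t)) < a2%:E)%E &
      pos_near_origin rho0 ->
        exists2 a1 : R, 0 < a1 & forall t : R, 0 <= t ->
          (a1%:E < edge (of_fun (rhobar t)))%E].
Proof.
have [B [v [Z [x0 [ok [Z0 vZ] ae [x00 tx0]]]]]] := datum_exists rho0_reg rho0_edge.
split.
- by move=> S sep t t0; exact: (separating_eq j_gt0 rho0_reg rhobar_sol ok Z0 vZ ae tx0 sep t0).
- exact: (edge_upper j_gt0 rho0_reg rhobar_sol ok Z0 vZ ae tx0).
- by move=> _; exact: (edge_lower j_gt0 rho0_reg rhobar_sol ok Z0 vZ ae x00 tx0).
Qed.
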